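(* Let $n\in\mathbb{N}$, $\frac{2n+2}{n+3}\le p\le 2$, $q\ge1$ and $\sigma>0$. There exists a constant $C>0$, independent of $\delta\ge0$ and of $t>0$, such that for all $\delta\ge0$ and all $t>0$, $$\big\|e^{\delta t\Delta}\Lambda_\delta^{-1}\sinh(t\Lambda_\delta)\,v\big\|_{B^\sigma_{p'q}}\le C\,t^{1-2n(\frac1p-\frac12)}\max(t^{\sigma},t^{-\sigma})\,\|v\|_{B^\sigma_{pq}}\quad\text{for all } v\in B^\sigma_{pq}.$$
   Context: $\hat v$ is the Fourier transform, $\mathfrak{F}^{-1}$ its inverse, $\mathfrak{F}^{-1}g(x)=\int e^{2\pi i x\cdot\xi}g(\xi)\,d\xi$; $p'$ is the conjugate exponent, $\frac1p+\frac1{p'}=1$. Operators are Fourier multipliers, with $\Delta$ having symbol $-|\xi|^2$ and $\Lambda_\delta:=\sqrt{\delta^2\Delta^2+\Delta}$; thus $e^{\delta t\Delta}\Lambda_\delta^{-1}\sinh(t\Lambda_\delta)v=\mathfrak{F}^{-1}(m_{\delta,t}\hat v)$ with $m_{\delta,t}(\xi)=e^{-\delta t|\xi|^2}\frac{\sinh(t\beta_\delta(|\xi|))}{\beta_\delta(|\xi|)}$, $\beta_\delta(r)=r\sqrt{\delta^2r^2-1}$, understood as $\frac{\sin(t\,r\sqrt{1-\delta^2r^2})}{r\sqrt{1-\delta^2r^2}}$ when $\delta r<1$ and as $t$ when $\beta_\delta=0$. This is the $(1,2)$ entry of the semigroup generated by the linear part of $\partial_t^2\psi-\delta\Delta\partial_t\psi-\Delta\psi=0$.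 Besov spaces: fix $\varphi\in C_c^\infty(\mathbb{R}^n)$ with $\operatorname{supp}\varphi\subseteq\{\tfrac12<|x|<2\}$, $\varphi_j(x)=\varphi(2^{-j}x)$ for $j\ge1$, $\varphi_0=1-\sum_{j\ge1}\varphi_j$; $B^\sigma_{pq}$ is the set of tempered distributions with $\|v\|_{B^\sigma_{pq}}:=\big(\sum_{j\ge0}2^{j\sigma q}\|\mathfrak{F}^{-1}(\varphi_j\hat v)\|_{L^p}^q\big)^{1/q}<\infty$. *)

(* Defs.v *)
From HB Require Import structures.
From mathcomp Require Import all_boot all_order all_algebra.
From mathcomp Require Import all_classical all_reals all_analysis.
From mathcomp Require Import complex.

Set Implicit Arguments.
Unset Strict Implicit.
Unset Printing Implicit Defensive.

Import Order.TTheory GRing.Theory Num.Theory.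
Import numFieldNormedType.Exports.
Local Open Scope classical_set_scope.
Local Open Scope ring_scope.

Section Defs.
Variable R : realType.
Variable n : nat.

Local Notation pt := 'rV[R]_n.

Definition dotp (x y : pt) : R := \sum_(i < n) x 0 i * y 0 i.
Definition enorm (x : pt) : R := Num.sqrt (dotp x x).

Definition cre (z : R[i]) : R := match z with Complex a _ => a end.
Definition cim (z : R[i]) : R := match z with Complex _ b => b end.

Definition cabs (z : R[i]) : R := Num.sqrt (cre z ^+ 2 + cim z ^+ 2).
Definition expi (th : R) : R[i] := Complex (cos th) (sin th).

(* R^n is identified with n.-tuple R, which carries the product (Borel)
   sigma-algebra of the library; the integral over R^n of a non-negative
   function is the iterated Lebesgue integral (= n-dimensional Lebesgue
   integral by Tonelli for measurable integrands). *)
Fixpoint iint (m : nat) : (m.-tuple R -> \bar R) -> \bar R :=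
  match m return (m.-tuple R -> \bar R) -> \bar R with
  | 0 => fun f => f [tuple]
  | m'.+1 => fun f =>
      integral (@lebesgue_measure R) [set: R]
        (fun y : R => iint (fun t : m'.-tuple R => f (cons_tuple y t)))
  end.

Definition row_of_tuple (t : n.-tuple R) : pt := \row_(i < n) tnth t i.

Definition intRn (f : pt -> \bar R) : \bar R := iint (fun t => f (row_of_tuple t)).

Definition rint (f : pt -> R) : R :=
  fine (intRn (fun x => (Num.max (f x) 0)%:E)) -
  fine (intRn (fun x => (Num.max (- f x) 0)%:E)).

Definition cint (f : pt -> R[i]) : R[i] :=
  Complex (rint (fun x => cre (f x))) (rint (fun x => cim (f x))).

Definition meas_n (A : set pt) : \bar R := intRn (fun x => (\1_A x)%:E).

Definition FT (f : pt -> R[i]) : pt -> R[i] :=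
  fun xi => cint (fun x => expi (- (2 * pi * dotp x xi)) * f x).
Definition IFT (g : pt -> R[i]) : pt -> R[i] :=
  fun x => cint (fun xi => expi (2 * pi * dotp x xi) * g xi).

Definition dpart (s : seq 'I_n) (h : pt -> R) : pt -> R :=
  foldr (fun i g => fun x => derive g x (delta_mx 0 i)) h s.

Definition smooth (h : pt -> R) : Prop :=
  forall s : seq 'I_n, continuous (dpart s h) /\
    forall (x : pt) (i : 'I_n), derivable (dpart s h) x (delta_mx 0 i).

Definition cpart (s : seq 'I_n) (f : pt -> R[i]) : pt -> R[i] :=
  fun x => Complex (dpart s (fun y => cre (f y)) x) (dpart s (fun y => cim (f y)) x).

Definition schwartz (f : pt -> R[i]) : Prop :=
  smooth (fun x => cre (f x)) /\ smooth (fun x => cim (f x)) /\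
  forall (s : seq 'I_n) (k : nat), exists C : R,
    forall x, (1 + enorm x) ^+ k * cabs (cpart s f x) <= C.

Definition distr := (pt -> R[i]) -> R[i].

Definition tempered (u : distr) : Prop :=
  (forall (a : R[i]) f g, schwartz f -> schwartz g ->
     u (fun x => a * f x + g x) = a * u f + u g) /\
  exists (C : R) (k N : nat), forall f, schwartz f ->
    forall M : R, (forall x (s : seq 'I_n), (size s <= N)%N ->
                     (1 + enorm x) ^+ k * cabs (cpart s f x) <= M) ->
    cabs (u f) <= C * M.

Definition Lpn (p : \bar R) (g : pt -> R[i]) : \bar R :=
  match p with
  | r%:E => poweR (intRn (fun x => (powR (cabs (g x)) r)%:E)) r^-1
  | +oo%E => ereal_inf [set M%:E | M in [set M : R | meas_n [set x | M < cabs (g x)] = 0%E]]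
  | -oo%E => +oo%E
  end.

Definition represents (w : distr) (g : pt -> R[i]) : Prop :=
  measurable_fun [set: n.-tuple R] (fun t => cre (g (row_of_tuple t))) /\
  measurable_fun [set: n.-tuple R] (fun t => cim (g (row_of_tuple t))) /\
  forall f, schwartz f -> w f = cint (fun x => g x * f x).

(* ||w||_{L^p}; +oo if w is not given by an L^p function *)
Definition dnorm (p : \bar R) (w : distr) : \bar R :=
  ereal_inf [set Lpn p g | g in represents w].

(* F^{-1}(h \hat w) : f |-> w (F (h * F^{-1} f)) *)
Definition fmult (h : pt -> R) (w : distr) : distr :=
  fun f => w (FT (fun xi => Complex (h xi) 0 * IFT f xi)).

Definition phi0 (phi : pt -> R) (xi : pt) : R :=
  1 - limn (fun N => \sum_(1 <= j < N) phi ((2%:R ^- j) *: xi)).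

Definition phij (phi : pt -> R) (j : nat) : pt -> R :=
  if j is 0 then phi0 phi else fun xi => phi ((2%:R ^- j) *: xi).

(* admissible phi: C_c^infty with support in {1/2 < |x| < 2}, and such that
   phi_0 = 1 - sum_{j>=1} phi_j vanishes for |xi| >= 2 (equivalently
   sum_{j in Z} phi(2^-j xi) = 1 for xi <> 0) *)
Definition LP_admissible (phi : pt -> R) : Prop :=
  smooth phi /\
  closure [set x | phi x != 0] `<=` [set x | 2^-1 < enorm x < 2] /\
  forall xi, 2 <= enorm xi -> phi0 phi xi = 0.

Definition besov (phi : pt -> R) (sigma : R) (p : \bar R) (q : R) (w : distr) : \bar R :=
  poweR (\sum_(0 <= j <oo)
           ((powR 2 (j%:R * sigma * q))%:E * poweR (dnorm p (fmult (phij phi j) w)) q))%E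
        q^-1.

Definition sinh (x : R) : R := (expR x - expR (- x)) / 2.

Definition msym (delta t r : R) : R :=
  let a := r * Num.sqrt (1 - delta ^+ 2 * r ^+ 2) in
  let b := r * Num.sqrt (delta ^+ 2 * r ^+ 2 - 1) in
  expR (- (delta * t * r ^+ 2)) *
  (if delta * r < 1 then (if a == 0 then t else sin (t * a) / a)
   else (if b == 0 then t else sinh (t * b) / b)).

Definition Top (delta t : R) (w : distr) : distr :=
  fmult (fun xi => msym delta t (enorm xi)) w.

End Defs.

Definition pconj {R : realType} (p : R) : \bar R :=
  if p == 1 then +oo%E else (p / (p - 1))%:E.

(* Main.v *)
(* Split the symbol into dyadic pieces.  The L^2 bound of a piece is the supremum of
   the symbol (Plancherel).  For the L^1 -> L^oo bound, the piece at frequency lam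
   is a function h of |xi|^2; writing h as a superposition of the chirps
   exp (2 i pi tau |xi|^2) and integrating by parts against the van der Corput
   primitive in each coordinate gives the factor |tau|^(-n/2), while repeated
   integration by parts shows that the transform of h concentrates at |tau| of
   order t / lam.  This yields lam^(n-1) (t lam)^(-(n-1)/2), uniformly in delta
   as long as delta lam is small; for larger delta lam the damping makes the piece
   of size 1 / t.  Interpolating (Marcinkiewicz) gives t^(1 - 2n(1/p - 1/2)) for
   each piece, the condition on p making the power of t lam that is left over
   nonpositive.  The low-frequency Littlewood-Paley block is cut further into about
   1 + log t pieces, and this loss is absorbed by max (t^sigma, t^-sigma). *)
Require Import Defs.
From HB Require Import structures.
From mathcomp Require Import all_boot all_order all_algebra.
From mathcomp Require Import all_classical all_reals all_analysis.
From mathcomp Require Import measurable_realfun.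
From mathcomp Require Import complex ring lra.
Import Order.TTheory GRing.Theory Num.Theory.
Import numFieldNormedType.Exports.
Set Implicit Arguments.
Unset Strict Implicit.
Unset Printing Implicit Defensive.
Local Open Scope classical_set_scope.
Local Open Scope ring_scope.

(** * One-variable calculus *)

(** A chirp in [|xi|^2] is a product over the coordinates, so decay in R^n follows from
    one-dimensional estimates, without stationary phase on spheres. Uniformity in [delta] rests on
    one identity. After rescaling to [|xi|] of size 1 and with [u = |xi|^2], the symbol is built
    from [exp (T z)], where [z = - del u + i th] and [th^2 = u - del^2 u^2]; then
    [|dz/du| = 1 / (2 th)] exactly. Hence an integration by parts in [u] gains [1 / T] whatever the
    balance between damping and oscillation. The amplitudes involve [1 / th], and the threshold 1/8
    on [delta lam] keeps [th] away from 0. Past the threshold oscillation is given up and only the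
    size of the symbol counts: for large [delta] the slow mode decays merely like
    [exp (- t / (2 delta))], but the division by [beta] supplies the missing [1 / delta]. On the
    distribution side, L^p norms are infima over representing functions, so each block of [v] is
    replaced by a nearly optimal function, on which the pieces act by convolution. Complex integrals
    are estimated through real and imaginary parts, at the price of a factor 2 each time. *)

Section Calc.
Variable R : realType.
Implicit Types (f g : R -> R) (x : R).
(* A plain predicate: [is_derive] is a type class and would be solved by instance search. *)
Definition der f x (a : R) : Prop := is_derive x 1 f a.
Lemma dC (c : R) x : der (fun _ : R => c) x 0.
Proof. exact: is_derive_cst. Qed.
Lemma dId x : der (fun y : R => y) x 1.
Proof. exact: is_derive_id. Qed.
Lemma dD f g x a b : der f x a -> der g x b -> der (fun y => f y + g y) x (a + b).
Proof. move=> ? ?; exact: is_deriveD. Qed.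
Lemma dN f x a : der f x a -> der (fun y => - f y) x (- a).
Proof. move=> ?; exact: is_deriveN. Qed.
Lemma dM f g x a b : der f x a -> der g x b ->
  der (fun y => f y * g y) x (a * g x + f x * b).
Proof.
move=> hf hg; apply: is_derive_eq (is_deriveM hf hg) _.
by rewrite /GRing.scale /= addrC mulrC.
Qed.
Lemma dchain f g x a b : der g (f x) b -> der f x a -> der (fun y => g (f y)) x (b * a).
Proof. by move=> hg hf; apply: is_derive1_comp. Qed.
Lemma dcos f x a : der f x a -> der (fun y => cos (f y)) x (- sin (f x) * a).
Proof. by move=> h; apply: dchain h; exact: is_derive_cos. Qed.
Lemma dsin f x a : der f x a -> der (fun y => sin (f y)) x (cos (f x) * a).
Proof. by move=> h; apply: dchain h; exact: is_derive_sin. Qed.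
Lemma dexp f x a : der f x a -> der (fun y => expR (f y)) x (expR (f x) * a).
Proof. by move=> h; apply: dchain h; exact: is_derive_expR. Qed.
Lemma datan f x a : der f x a ->
  der (fun y => atan (f y)) x ((1 + f x ^+ 2)^-1 * a).
Proof. by move=> h; apply: dchain h; exact: is_derive1_atan. Qed.
Lemma dV f x a : f x != 0 -> der f x a ->
  der (fun y => (f y)^-1) x (- (f x) ^- 2 * a).
Proof. by move=> f0 h; apply: is_derive_eq (is_deriveV f0 h) _. Qed.
Lemma deq f x a b : der f x a -> a = b -> der f x b.
Proof. by move=> ? <-. Qed.
Lemma dX f x a n : der f x a ->
  der (fun y => f y ^+ n.+1) x (n.+1%:R * f x ^+ n * a).
Proof.
move=> h; elim: n => [|n IH].
  by apply: (deq h); rewrite expr0 !mul1r.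
rewrite (_ : (fun y => _) = (fun y => f y * f y ^+ n.+1)); last first.
  by apply/funext => y; rewrite exprS.
apply: (deq (dM h IH)); rewrite -[n.+2%:R]natr1 exprS; ring.
Qed.
Lemma dMl (a x : R) : der ( *%R a) x a.
Proof. by have := dM (dC a x) (dId x); rewrite mul0r add0r mulr1. Qed.
Lemma dDl (a x : R) : der (+%R a) x 1.
Proof. by have := dD (dC a x) (dId x); rewrite add0r. Qed.
Lemma dOpp (x : R) : der -%R x (-1).
Proof. exact: (dN (dId x)). Qed.
Lemma dSin (x : R) : der sin x (cos x).
Proof. exact: is_derive_sin. Qed.
Lemma dCos (x : R) : der cos x (- sin x).
Proof. exact: is_derive_cos. Qed.
Lemma dExp (x : R) : der expR x (expR x).
Proof. exact: is_derive_expR. Qed.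
Lemma d_cont f x a : der f x a -> {for x, continuous f}.
Proof. by case=> h _; exact/differentiable_continuous/derivable1_diffP. Qed.
Lemma d_near f g x a : der f x a -> (\forall y \near x, f y = g y) -> der g x a.
Proof.
move=> [h1 h2] fg; have fg1 : {near x, f =1 g} by [].
split.
- exact: (near_eq_derivable fg1 h1).
- by rewrite -(near_eq_derive _ fg1).
Qed.
Lemma cont_mul f g : continuous f -> continuous g -> continuous (fun y => f y * g y).
Proof. by move=> cf cg y; apply: continuousM; [exact: cf|exact: cg]. Qed.
(** The mean value theorem for [g - f]. Estimates on primitives below are obtained by comparing
    derivatives rather than by estimating integrals. *)
Lemma der_le f g (f' g' : R -> R) a b : a <= b ->
  (forall x, a <= x <= b -> der f x (f' x)) -> (forall x, a <= x <= b -> der g x (g' x)) ->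
  (forall x, a <= x <= b -> f' x <= g' x) -> f b - f a <= g b - g a.
Proof.
move=> ab df dg fg.
have h : (g a - f a) <= (g b - f b).
  have dgf x : a <= x <= b -> der (fun x => g x - f x) x (g' x - f' x).
    by move=> xab; apply: dD; [exact: dg|apply: dN; exact: df].
  move: ab; rewrite le_eqVlt => /predU1P[->//|ab].
  have [||c cab] := @MVT _ (fun x => g x - f x) (fun x => g' x - f' x) _ _ ab.
  - by move=> x /[!in_itv]/= /andP[h1 h2]; apply: dgf; rewrite !ltW.
  - apply: derivable_within_continuous => x /[!in_itv]/= xab.
    by have [] := dgf x xab.
  move=> E; rewrite -subr_ge0 E mulr_ge0 ?subr_ge0 ?(ltW ab)//.
  by apply: fg; move: cab; rewrite in_itv/= => /andP[h1 h2]; rewrite !ltW.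
lra.
Qed.
End Calc.

Ltac drv1 :=
  lazymatch goal with
  | |- der (fun y => y) _ _ => exact: dId
  | |- der (GRing.mul _) _ _ => exact: dMl
  | |- der (GRing.add _) _ _ => exact: dDl
  | |- der GRing.opp _ _ => exact: dOpp
  | |- der sin _ _ => exact: dSin
  | |- der cos _ _ => exact: dCos
  | |- der expR _ _ => exact: dExp
  | |- der (fun y => cos _) _ _ => apply: dcos
  | |- der (fun y => sin _) _ _ => apply: dsin
  | |- der (fun y => expR _) _ _ => apply: dexp
  | |- der (fun y => atan _) _ _ => apply: datan
  | |- der (fun y => (_ + _)%R) _ _ => apply: dD
  | |- der (fun y => (- _)%R) _ _ => apply: dN
  | |- der (fun y => (_ * _)%R) _ _ => apply: dM
  | |- der (fun y => (_ ^+ _)%R) _ _ => apply: dX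
  end.
Ltac drv := repeat first [eassumption | drv1 | exact: dC].

(** * Lebesgue measure on tuples *)

Section TupleMeasure.
Variable R : realType.

Definition consp (m : nat) (p : R * m.-tuple R) : m.+1.-tuple R :=
  cons_tuple p.1 p.2.

Lemma measurable_consp m : measurable_fun setT (@consp m).
Proof.
have := @measurable_cons _ _ (R * m.-tuple R)%type R fst m snd
  measurable_fst measurable_snd.
by apply: eq_measurable_fun => x _; apply/val_inj.
Qed.

(** With this pushforward, one step of the recursion in [iint] is one application of Tonelli's
    theorem. *)
Definition mucons (m : nat) (nu : {sigma_finite_measure set (m.-tuple R) -> \bar R}) :=
  pushforward (@lebesgue_measure R \x nu)%E (@consp m).

Section mucons_inst.
Variables (m : nat) (nu : {sigma_finite_measure set (m.-tuple R) -> \bar R}).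

Let mc0 : mucons nu set0 = 0%E.
Proof. by rewrite /mucons /pushforward preimage_set0 measure0. Qed.
Let mc_ge0 A : (0 <= mucons nu A)%E.
Proof. exact: (measure_ge0 (@lebesgue_measure R \x nu)%E). Qed.
Let mc_sa : semi_sigma_additive (mucons nu).
Proof.
move=> F mF tF mUF; rewrite /mucons /pushforward preimage_bigcup.
apply: measure_semi_sigma_additive.
- by move=> n; rewrite -[X in measurable X]setTI; apply: measurable_consp.
- apply/trivIsetP => /= i j _ _ ij; rewrite -preimage_setI.
  by move/trivIsetP : tF => /(_ _ _ _ _ ij) ->//; rewrite preimage_set0.
- by rewrite -preimage_bigcup -[X in measurable X]setTI; apply: measurable_consp.
Qed.
HB.instance Definition _ := isMeasure.Build _ _ _ (mucons nu) mc0 mc_ge0 mc_sa.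

Let mc_sf : sigma_finite setT (mucons nu).
Proof.
have [F FT Ffin] : sigma_finite setT (@lebesgue_measure R \x nu)%E.
  have /sigma_finiteP[F [TF ndF Foo]] := sigma_finiteT (@lebesgue_measure R).
  have /sigma_finiteP[G [TG ndG Goo]] := sigma_finiteT nu.
  exists (fun k => F k `*` G k).
    rewrite -setXTT TF TG predeqE => -[x y]; split.
      move=> [/= [n _ Fnx] [k _ Gky]]; exists (maxn n k) => //; split.
      - by move: x Fnx; exact/subsetPset/ndF/leq_maxl.
      - by move: y Gky; exact/subsetPset/ndG/leq_maxr.
    by move=> [n _ []/= ? ?]; split; exists n.
  move=> k; have [mF fF] := Foo k; have [mG fG] := Goo k.
  split; first exact: measurableX.
  by rewrite product_measure1E// lte_mul_pinfty// ge0_fin_numE.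
(* [un] inverts [consp]; pulling back along it turns an exhaustion of the product into one of the
   tuples. *)
pose un (t : m.+1.-tuple R) := (thead t, [tuple of behead t]).
have mun : measurable_fun setT un.
  by apply: measurable_fun_pair; [exact: measurable_tnth|exact: measurable_behead].
have unK : cancel (@consp m) un.
  by case=> y t; rewrite /un /consp /= theadE; congr pair; apply/val_inj.
exists (fun i => un @^-1` F i).
  by rewrite -preimage_bigcup -FT preimage_setT.
move=> i; have [mFi fFi] := Ffin i; split.
  by rewrite -[X in measurable X]setTI; apply: mun.
rewrite /mucons /pushforward; have -> : @consp m @^-1` (un @^-1` F i) = F i => //.
by rewrite -comp_preimage (_ : un \o _ = id) //; apply/funext => p; rewrite /= unK.
Qed.
HB.instance Definition _ := Measure_isSigmaFinite.Build _ _ _ (mucons nu) mc_sf.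
End mucons_inst.

Definition mu0 : set (0.-tuple R) -> \bar R := dirac [tuple].
HB.instance Definition _ := Measure.on mu0.
Lemma mu0_sf : sigma_finite setT mu0.
Proof.
apply: fin_num_fun_sigma_finite; first by rewrite measure0.
by move=> A mA; rewrite /mu0 /= diracE.
Qed.
HB.instance Definition _ := Measure_isSigmaFinite.Build _ _ _ mu0 mu0_sf.

Fixpoint mu (m : nat) : {sigma_finite_measure set (m.-tuple R) -> \bar R} :=
  match m return {sigma_finite_measure set (m.-tuple R) -> \bar R} with
  | 0 => mu0
  | m'.+1 => mucons (mu m')
  end.

Lemma ge0_integral_muS m (f : m.+1.-tuple R -> \bar R) :
  measurable_fun setT f -> (forall x, 0 <= f x)%E ->
  (\int[mu m.+1]_t f t =
   \int[@lebesgue_measure R]_y \int[mu m]_t f (cons_tuple y t))%E.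
Proof.
move=> mf f0.
rewrite /= /mucons ge0_integral_pushforward//; last exact: measurable_consp.
rewrite preimage_setT fubini_tonelli1//.
  by apply: measurableT_comp => //; exact: measurable_consp.
by move=> x; exact: f0.
Qed.

Lemma measurable_consl m y : measurable_fun setT (@cons_tuple m R y).
Proof.
rewrite (_ : cons_tuple _ = @consp m \o pair y)//.
by apply: measurableT_comp; [exact: measurable_consp|].
Qed.

(** The iterated integrals of the statement become integrals against a single measure, where
    convergence theorems and Fubini apply. *)
Lemma iintE m (f : m.-tuple R -> \bar R) :
  measurable_fun setT f -> (forall x, 0 <= f x)%E ->
  iint f = (\int[mu m]_t f t)%E.
Proof.
elim: m f => [|m IH] f mf f0.
  by rewrite /= /mu0 integral_dirac// diracE in_setT mul1e.
rewrite ge0_integral_muS//=; apply: eq_integral => y _.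
by rewrite IH//; apply: measurableT_comp => //; exact: measurable_consl.
Qed.

End TupleMeasure.

(** * Integrals of complex-valued functions *)

Section ComplexFun.
Variable R : realType.
Implicit Types z w : R[i].

Lemma creD z w : cre (z + w) = cre z + cre w. Proof. by case: z; case: w. Qed.
Lemma cimD z w : cim (z + w) = cim z + cim w. Proof. by case: z; case: w. Qed.
Lemma creM z w : cre (z * w) = cre z * cre w - cim z * cim w.
Proof. by case: z; case: w. Qed.
Lemma cimM z w : cim (z * w) = cre z * cim w + cim z * cre w.
Proof. by case: z => a b; case: w => c d. Qed.
Lemma cE z : z = Complex (cre z) (cim z). Proof. by case: z. Qed.
Lemma c_ext z w : cre z = cre w -> cim z = cim w -> z = w.
Proof. by rewrite (cE z) (cE w) /= => -> ->. Qed.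
Lemma cabs_ge0 z : 0 <= cabs z. Proof. exact: sqrtr_ge0. Qed.
Lemma cabs_sqr z : cabs z ^+ 2 = cre z ^+ 2 + cim z ^+ 2.
Proof. by rewrite sqr_sqrtr// addr_ge0// sqr_ge0. Qed.
Lemma cabsM z w : cabs (z * w) = cabs z * cabs w.
Proof.
rewrite /cabs -sqrtrM ?addr_ge0 ?sqr_ge0// creM cimM; congr Num.sqrt; ring.
Qed.
Lemma cabs0 : cabs (0 : R[i]) = 0.
Proof. by rewrite /cabs /= expr0n /= addr0 sqrtr0. Qed.
Lemma cre_le z : `|cre z| <= cabs z.
Proof. by rewrite -sqrtr_sqr ler_wsqrtr// lerDl sqr_ge0. Qed.
Lemma cim_le z : `|cim z| <= cabs z.
Proof. by rewrite -sqrtr_sqr ler_wsqrtr// lerDr sqr_ge0. Qed.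
Lemma cabs_le z : cabs z <= `|cre z| + `|cim z|.
Proof.
rewrite -(@ler_pXn2r _ 2) ?nnegrE ?addr_ge0 ?sqrtr_ge0//.
rewrite cabs_sqr sqrrD !real_normK ?num_real//.
by rewrite -addrA [_ *+ 2 + _]addrC addrA lerDl mulrn_wge0// mulr_ge0.
Qed.
Lemma cabsD z w : cabs (z + w) <= cabs z + cabs w.
Proof.
have h : cre z * cre w + cim z * cim w <= cabs z * cabs w.
  apply: (le_trans (ler_norm _)); rewrite -cabsM.
  have -> : cabs (z * w) = cabs (z * Complex (cre w) (- cim w)).
    by rewrite !cabsM; congr (_ * _); rewrite /cabs /= sqrrN.
  by apply: le_trans (cre_le _); rewrite creM /= mulrN opprK.
rewrite -(@ler_pXn2r _ 2) ?nnegrE ?addr_ge0 ?sqrtr_ge0//.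
rewrite sqrrD !cabs_sqr creD cimD; nra.
Qed.
Lemma cabsN z : cabs (- z) = cabs z.
Proof. by case: z => a b; rewrite /cabs /= !sqrrN. Qed.
Lemma cabs_real (a : R) : cabs (Complex a 0) = `|a|.
Proof. by rewrite /cabs /= expr0n /= addr0 sqrtr_sqr. Qed.
Lemma cabs_expi (a : R) : cabs (expi a) = 1.
Proof. by rewrite /cabs /= cos2Dsin2 sqrtr1. Qed.
Lemma expiD (a b : R) : expi (a + b) = expi a * expi b.
Proof. by apply: c_ext; rewrite ?creM ?cimM /= ?cosD ?sinD//; ring. Qed.
Lemma expi0 : expi 0 = 1 :> R[i].
Proof. by rewrite /expi cos0 sin0. Qed.
Definition cconj z := Complex (cre z) (- cim z).
Lemma cabs_conj z : cabs (cconj z) = cabs z.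
Proof. by rewrite /cabs /= sqrrN. Qed.
Lemma cconjM z w : cconj (z * w) = cconj z * cconj w.
Proof. by apply: c_ext; rewrite /cconj ?creM ?cimM /=; ring. Qed.
Lemma cconj_expi (a : R) : cconj (expi a) = expi (- a).
Proof. by rewrite /cconj /expi /= cosN sinN. Qed.
Lemma mul_cconj z : z * cconj z = Complex (cabs z ^+ 2) 0.
Proof. by apply: c_ext; rewrite ?creM ?cimM /= ?cabs_sqr; ring. Qed.
Definition rc (a : R) : R[i] := Complex a 0.
Lemma rcD a b : rc (a + b) = rc a + rc b.
Proof. by apply: c_ext; rewrite ?creD ?cimD /=; ring. Qed.
Lemma rcM a b : rc (a * b) = rc a * rc b.
Proof. by apply: c_ext; rewrite ?creM ?cimM /=; ring. Qed.
Lemma cre_rcM a z : cre (rc a * z) = a * cre z.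
Proof. by rewrite creM /=; ring. Qed.
Lemma cim_rcM a z : cim (rc a * z) = a * cim z.
Proof. by rewrite cimM /=; ring. Qed.

Section meas.
Context d (T : measurableType d).
Implicit Types f g : T -> R[i].
Definition mC f := measurable_fun setT (fun x => cre (f x)) /\
                   measurable_fun setT (fun x => cim (f x)).
Lemma mC_cst z : mC (fun=> z). Proof. by split; exact: measurable_cst. Qed.
Lemma mCD f g : mC f -> mC g -> mC (fun x => f x + g x).
Proof.
move=> [f1 f2] [g1 g2]; split.
- under eq_fun do rewrite creD; exact: measurable_funD.
- under eq_fun do rewrite cimD; exact: measurable_funD.
Qed.
Lemma mCM f g : mC f -> mC g -> mC (fun x => f x * g x).
Proof.
move=> [f1 f2] [g1 g2]; split.
- by under eq_fun do rewrite creM; apply: measurable_funB; apply: measurable_funM.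
- by under eq_fun do rewrite cimM; apply: measurable_funD; apply: measurable_funM.
Qed.
Lemma mC_rc (h : T -> R) : measurable_fun setT h -> mC (fun x => rc (h x)).
Proof. by move=> mh; split => //=; exact: measurable_cst. Qed.
Lemma mC_expi (h : T -> R) : measurable_fun setT h -> mC (fun x => expi (h x)).
Proof.
move=> mh; split => /=; apply: measurableT_comp => //.
- by apply: continuous_measurable_fun; exact: continuous_cos.
- by apply: continuous_measurable_fun; exact: continuous_sin.
Qed.
Lemma mC_conj f : mC f -> mC (fun x => cconj (f x)).
Proof. by move=> [f1 f2]; split => //=; exact: measurableT_comp. Qed.

Lemma m_cabs f : mC f -> measurable_fun setT (fun x => cabs (f x)).
Proof.
move=> [f1 f2]; rewrite /cabs; apply: measurableT_comp => /=.
  by apply: continuous_measurable_fun; exact: sqrt_continuous.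
by apply: measurable_funD; apply: measurable_funX.
Qed.
Lemma m_cabsE f : mC f -> measurable_fun setT (fun x => (cabs (f x))%:E).
Proof. by move=> /m_cabs ?; apply/measurable_EFinP. Qed.
Lemma mC_sum (I : Type) (s : seq I) (F : I -> T -> R[i]) :
  (forall i, mC (F i)) -> mC (fun x => \sum_(i <- s) F i x).
Proof.
move=> mF; elim: s => [|i s IH].
  by under eq_fun do rewrite big_nil; exact: mC_cst.
by under eq_fun do rewrite big_cons; exact: mCD.
Qed.
Lemma mC_prod (I : Type) (s : seq I) (F : I -> T -> R[i]) :
  (forall i, mC (F i)) -> mC (fun x => \prod_(i <- s) F i x).
Proof.
move=> mF; elim: s => [|i s IH].
  by under eq_fun do rewrite big_nil; exact: mC_cst.
by under eq_fun do rewrite big_cons; exact: mCM.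
Qed.
End meas.

Lemma mC_comp d d' (T : measurableType d) (T' : measurableType d') (g : T' -> T)
    (f : T -> R[i]) :
  measurable_fun setT g -> mC f -> mC (fun x => f (g x)).
Proof.
move=> mg [f1 f2]; split.
- exact: (measurableT_comp f1 mg).
- exact: (measurableT_comp f2 mg).
Qed.

Section integ.
Context d (T : measurableType d) (mu : {measure set T -> \bar R}).
Implicit Types f g : T -> R[i].
Definition iC f := mu.-integrable setT (fun x => (cre (f x))%:E) /\
                   mu.-integrable setT (fun x => (cim (f x))%:E).
Definition cI f : R[i] := Complex (\int[mu]_x cre (f x)) (\int[mu]_x cim (f x)).
Lemma iC_mC f : iC f -> mC f.
Proof.
by move=> [/integrableP[/measurable_EFinP ? _] /integrableP[/measurable_EFinP ? _]].
Qed.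
Lemma iC_dom f (g : T -> R) : mC f -> mu.-integrable setT (EFin \o g) ->
  (forall x, cabs (f x) <= g x) -> iC f.
Proof.
move=> [f1 f2] ig fg; split; apply: le_integrable ig => //.
- exact/measurable_EFinP.
- move=> x _ /=; rewrite lee_fin (le_trans (cre_le _))// (le_trans (fg _))//.
  exact: ler_norm.
- exact/measurable_EFinP.
- move=> x _ /=; rewrite lee_fin (le_trans (cim_le _))// (le_trans (fg _))//.
  exact: ler_norm.
Qed.
Lemma i_cabs f : iC f -> mu.-integrable setT (EFin \o (fun x => cabs (f x))).
Proof.
move=> h; have mf := iC_mC h; case: h => i1 i2.
have i3 : mu.-integrable setT (EFin \o (fun x => `|cre (f x)| + `|cim (f x)|)).
  rewrite (_ : _ \o _ = (fun x => `|(cre (f x))%:E| + `|(cim (f x))%:E|)%E)//.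
  by apply: integrableD => //; exact: integrable_abse.
apply: le_integrable i3 => //; first exact: m_cabsE.
by move=> x _ /=; rewrite lee_fin ger0_norm ?cabs_ge0// ger0_norm ?addr_ge0// cabs_le.
Qed.
Lemma iCP f : mC f -> iC f <-> (\int[mu]_x (cabs (f x))%:E < +oo)%E.
Proof.
move=> mf; split => [/i_cabs/integrableP[_]|h].
  by under eq_integral do rewrite /= ger0_norm ?cabs_ge0//.
apply: (@iC_dom _ (fun x => cabs (f x))) => //.
apply/integrableP; split; first exact: m_cabsE.
by under eq_integral do rewrite /= ger0_norm ?cabs_ge0//.
Qed.
Lemma iC_cabs_lty f : iC f -> (\int[mu]_x (cabs (f x))%:E < +oo)%E.
Proof. by move=> h; apply/iCP => //; exact: iC_mC. Qed.
Lemma iC_domC f g : mC f -> iC g -> (forall x, cabs (f x) <= cabs (g x)) -> iC f.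
Proof. by move=> mf /i_cabs ig fg; apply: iC_dom ig _. Qed.
Lemma iCD f g : iC f -> iC g -> iC (fun x => f x + g x).
Proof.
move=> [f1 f2] [g1 g2]; split.
- under eq_fun do rewrite creD EFinD; exact: integrableD.
- under eq_fun do rewrite cimD EFinD; exact: integrableD.
Qed.
Lemma iCZ z f : iC f -> iC (fun x => z * f x).
Proof.
move=> h; have mf := iC_mC h.
apply: (@iC_dom _ (fun x => cabs z * cabs (f x))).
- by apply: mCM => //; exact: mC_cst.
- rewrite (_ : _ \o _ = (fun x => (cabs z)%:E * (cabs (f x))%:E)%E)//.
  by apply: integrableZl => //; exact: i_cabs.
- by move=> x; rewrite cabsM.
Qed.
Lemma iCMb f g (B : R) : mC g -> iC f -> (forall x, cabs (g x) <= B) ->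
  iC (fun x => g x * f x).
Proof.
move=> mg h gB; have mf := iC_mC h.
apply: (@iC_domC _ (fun x => rc `|B| * f x)); [exact: mCM|exact: iCZ|].
move=> x; rewrite !cabsM cabs_real normr_id ler_wpM2r ?cabs_ge0//.
by rewrite (le_trans (gB x))// ler_norm.
Qed.
Lemma cI_add f g : iC f -> iC g -> cI (fun x => f x + g x) = cI f + cI g.
Proof.
move=> [f1 f2] [g1 g2]; apply: c_ext; rewrite ?creD ?cimD /=.
- by under eq_Rintegral do rewrite creD; rewrite RintegralD.
- by under eq_Rintegral do rewrite cimD; rewrite RintegralD.
Qed.
Lemma cIZ z f : iC f -> cI (fun x => z * f x) = z * cI f.
Proof.
move=> [f1 f2].
have Z (a : R) (h : T -> R) : mu.-integrable setT (fun x => (h x)%:E) ->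
    mu.-integrable setT (fun x => (a * h x)%:E).
  move=> ih; rewrite (_ : (fun x => _) = (fun x => a%:E * (h x)%:E)%E)//.
  exact: integrableZl.
apply: c_ext; rewrite ?creM ?cimM /=.
- under eq_Rintegral do rewrite creM.
  by rewrite RintegralB ?RintegralZl//; exact: Z.
- under eq_Rintegral do rewrite cimM.
  by rewrite RintegralD ?RintegralZl//; exact: Z.
Qed.
Lemma cIZr z f : iC f -> cI (fun x => f x * z) = cI f * z.
Proof. by move=> h; under eq_fun do rewrite mulrC; rewrite cIZ// mulrC. Qed.
Lemma eq_cI f g : f =1 g -> cI f = cI g.
Proof. by move=> fg; congr cI; apply/funext. Qed.
Lemma cI_sum (I : Type) (s : seq I) (F : I -> T -> R[i]) :
  (forall i, iC (F i)) ->
  iC (fun x => \sum_(i <- s) F i x) /\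
  cI (fun x => \sum_(i <- s) F i x) = \sum_(i <- s) cI (F i).
Proof.
move=> iF; elim: s => [|i s [IH1 IH2]].
  under eq_fun do rewrite big_nil; rewrite big_nil; split.
    by split; exact: integrable0.
  by apply: c_ext => /=; rewrite Rintegral_cst ?mul0r.
under eq_fun do rewrite big_cons; rewrite big_cons; split; first exact: iCD.
by rewrite cI_add// IH2.
Qed.
Lemma cI_rc (h : T -> R) : cI (fun x => rc (h x)) = rc (\int[mu]_x h x).
Proof. by apply: c_ext => //=; rewrite Rintegral_cst// mul0r. Qed.
(** Real and imaginary parts are bounded separately, whence the 2. Integrability is not assumed: an
    infinite right-hand side makes the claim trivial. *)
Lemma cI_norm f : mC f ->
  ((cabs (cI f))%:E <= 2%:E * \int[mu]_x (cabs (f x))%:E)%E.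
Proof.
move=> mf.
have [/(iCP mf) h|] := ltP (\int[mu]_x (cabs (f x))%:E)%E +oo%E; last first.
  by rewrite leye_eq => /eqP ->; rewrite gt0_muley// leey.
have ic := i_cabs h; case: h => f1 f2.
have E : (\int[mu]_x (cabs (f x))%:E)%E = (\int[mu]_x cabs (f x))%:E.
  by rewrite fineK//; exact: integrable_fin_num.
have N (k : T -> R) : mu.-integrable setT (fun x => (k x)%:E) ->
    (forall x, `|k x| <= cabs (f x)) -> `|\int[mu]_x k x| <= \int[mu]_x cabs (f x).
  move=> ik kf; apply: (le_trans (le_normr_Rintegral _ ik)) => //.
  by apply: le_Rintegral => //; exact: integrable_abse ik.
rewrite E -EFinM lee_fin (le_trans (cabs_le _))//= mulr2n mulrDl !mul1r.
by apply: lerD; apply: N => // x; [exact: cre_le|exact: cim_le].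
Qed.
Lemma cI_norm_le f (g : T -> R) : mC f -> (forall x, cabs (f x) <= g x) ->
  mu.-integrable setT (EFin \o g) -> cabs (cI f) <= 2 * \int[mu]_x g x.
Proof.
move=> mf fg ig; rewrite -lee_fin (le_trans (cI_norm mf))// EFinM lee_wpmul2l//.
rewrite fineK; last exact: integrable_fin_num.
apply: ge0_le_integral => //.
- by move=> x _; rewrite lee_fin cabs_ge0.
- exact: m_cabsE.
- by have /integrableP[] := ig.
- by move=> x _; rewrite lee_fin.
Qed.
Lemma cI_dct (F : nat -> T -> R[i]) f (g : T -> R) :
  (forall k, mC (F k)) -> mC f -> mu.-integrable setT (EFin \o g) ->
  (forall k x, cabs (F k x) <= g x) ->
  (forall x, cre (F k x) @[k --> \oo] --> cre (f x)) ->
  (forall x, cim (F k x) @[k --> \oo] --> cim (f x)) ->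
  cre (cI (F k)) @[k --> \oo] --> cre (cI f) /\
  cim (cI (F k)) @[k --> \oo] --> cim (cI f).
Proof.
move=> mF mf ig Fg c1 c2.
have D (h : nat -> T -> R) (l : T -> R) :
    (forall k, measurable_fun setT (h k)) -> measurable_fun setT l ->
    (forall k x, `|h k x| <= g x) ->
    (forall x, h k x @[k --> \oo] --> l x) ->
    \int[mu]_x h k x @[k --> \oo] --> \int[mu]_x l x.
  move=> mh ml hg hl.
  have hlE x : (h k x)%:E @[k --> \oo] --> (l x)%:E.
    by apply/cvg_EFin; [exact: nearW|exact: hl].
  have [il _ cv] := @dominated_convergence _ _ _ mu setT measurableT
    (fun k x => (h k x)%:E) (fun x => (l x)%:E) (EFin \o g)
    (fun k => (measurable_EFinP _ _).2 (mh k)) ((measurable_EFinP _ _).2 ml)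
    (aeW _ (fun x _ => (hlE x)))
    ig (aeW _ (fun x k _ => hg k x)).
  by apply: fine_cvg; rewrite fineK//; exact: integrable_fin_num.
split.
- apply: D => //; [by move=> k; case: (mF k)|by case: mf|].
  by move=> k x; rewrite (le_trans (cre_le _)).
- apply: D => //; [by move=> k; case: (mF k)|by case: mf|].
  by move=> k x; rewrite (le_trans (cim_le _)).
Qed.
End integ.

(** * Parameter integrals and Fubini's theorem for complex integrands *)

Section fub.
Context d1 d2 (T1 : measurableType d1) (T2 : measurableType d2).
Variable m1 : {sigma_finite_measure set T1 -> \bar R}.
Variable m2 : {sigma_finite_measure set T2 -> \bar R}.

(** Sections may fail to be integrable: Tonelli handles the positive and negative parts, and [fine]
    is measurable. *)
Lemma measurable_RintegralF (f : T1 * T2 -> R) : measurable_fun setT f ->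
  measurable_fun setT (fun x => \int[m2]_y f (x, y)).
Proof.
move=> mf; rewrite /Rintegral; apply: (measurableT_comp (fine_measurable measurableT)) => //.
have me : measurable_fun setT (EFin \o f) by exact/measurable_EFinP.
rewrite (_ : (fun x => _) = ((fun x => \int[m2]_y (EFin \o f)^\+ (x, y)) \-
   (fun x => \int[m2]_y (EFin \o f)^\- (x, y)))%E).
  apply: emeasurable_funB; apply: measurable_fun_fubini_tonelli_F => //.
  - exact: measurable_funepos.
  - exact: measurable_funeneg.
apply/funext => x; rewrite [LHS]integralE.
by congr (_ - _)%E; apply: eq_integral => y _; rewrite ?funeposE ?funenegE.
Qed.
Lemma mC_cI (F : T1 * T2 -> R[i]) : mC F -> mC (fun x => cI m2 (fun y => F (x, y))).
Proof.
move=> [F1 F2]; split => /=.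
- exact: (measurable_RintegralF (f := fun p => cre (F p))).
- exact: (measurable_RintegralF (f := fun p => cim (F p))).
Qed.
End fub.

Section fub2.
Context d1 d2 (T1 : measurableType d1) (T2 : measurableType d2).
Variable m1 : {sigma_finite_measure set T1 -> \bar R}.
Variable m2 : {sigma_finite_measure set T2 -> \bar R}.
(** The inner integral is finite only almost everywhere, so [fine] may change it on a null set;
    equality almost everywhere absorbs the change. *)
Lemma RFubini_half (f : T1 * T2 -> R) :
  (m1 \x m2)%E.-integrable setT (EFin \o f) ->
  (\int[m1]_x \int[m2]_y f (x, y))%R = fine (\int[m1 \x m2]_z (f z)%:E)%E.
Proof.
move=> iff.
rewrite /Rintegral -(integral12_prod_meas1 iff); congr fine.
have mf : measurable_fun setT f by apply/measurable_EFinP; case/integrableP: iff.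
apply: ae_eq_integral => //.
- by apply/measurable_EFinP; exact: (measurable_RintegralF m2 mf).
- exact: (measurable_fubini_F iff).
- have := ae_integrable1 iff; apply: filterS => x ix _ /=.
  by rewrite fineK//; exact: integrable_fin_num.
Qed.
Lemma RFubini_half2 (f : T1 * T2 -> R) :
  (m1 \x m2)%E.-integrable setT (EFin \o f) ->
  (\int[m2]_y \int[m1]_x f (x, y))%R = fine (\int[m1 \x m2]_z (f z)%:E)%E.
Proof.
move=> iff.
rewrite /Rintegral -(integral21_prod_meas1 iff); congr fine.
have mf : measurable_fun setT f by apply/measurable_EFinP; case/integrableP: iff.
apply: ae_eq_integral => //.
- apply/measurable_EFinP.
  apply: (@measurable_RintegralF _ _ _ _ m1 (fun p => f (p.2, p.1))).
  by apply: measurableT_comp => //; exact: measurable_swap.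
- exact: (measurable_fubini_G iff).
- have := ae_integrable2 iff; apply: filterS => x ix _ /=.
  by rewrite fineK//; exact: integrable_fin_num.
Qed.
Lemma cI_fubini (F : T1 * T2 -> R[i]) : mC F ->
  (\int[m1]_x \int[m2]_y (cabs (F (x, y)))%:E < +oo)%E ->
  cI m1 (fun x => cI m2 (fun y => F (x, y))) =
  cI m2 (fun y => cI m1 (fun x => F (x, y))).
Proof.
move=> mF Foo.
have [i1 i2] : iC (m1 \x m2)%E F.
  apply/iCP => //; rewrite fubini_tonelli1//; first exact: m_cabsE.
  by move=> x; rewrite lee_fin cabs_ge0.
apply: c_ext => /=.
- by rewrite (RFubini_half i1) -(RFubini_half2 i1).
- by rewrite (RFubini_half i2) -(RFubini_half2 i2).
Qed.
Lemma iC_cI (F : T1 * T2 -> R[i]) : mC F ->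
  (\int[m1]_x \int[m2]_y (cabs (F (x, y)))%:E < +oo)%E ->
  iC m1 (fun x => cI m2 (fun y => F (x, y))).
Proof.
move=> mF Foo; apply/iCP; first exact: mC_cI.
have mt : measurable_fun setT (fun x => \int[m2]_y (cabs (F (x, y)))%:E)%E.
  apply: (measurable_fun_fubini_tonelli_F (fun p => (cabs (F p))%:E)).
    exact: m_cabsE.
  by move=> p; rewrite lee_fin cabs_ge0.
apply: (@le_lt_trans _ _ (2%:E * \int[m1]_x \int[m2]_y (cabs (F (x, y)))%:E)%E).
  rewrite -ge0_integralZl//; last first.
    by move=> x _; apply: integral_ge0 => y _; rewrite lee_fin cabs_ge0.
  apply: ge0_le_integral => //.
  - by move=> x _; rewrite lee_fin cabs_ge0.
  - by apply: m_cabsE; exact: mC_cI.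
  - exact: measurable_funeM.
  - move=> x _; apply: cI_norm.
    by apply: (mC_comp _ mF); exact: pair1_measurable.
by rewrite lte_mul_pinfty.
Qed.
End fub2.
End ComplexFun.

(** * Integration over R^n *)

Section RnMeas.
Variables (R : realType).
Notation leb := (@lebesgue_measure R).

(** The sigma-algebra is the product one, so the open preimage has to be written as a countable
    union of boxes. Boxes with rational centres and half-widths [1/(j+1)] suffice; a point is only
    that close to its centre, so twice the half-width must fit inside the open set. *)
Lemma continuous_measurable_tuple n (f : 'rV[R]_n -> R) : continuous f ->
  measurable_fun setT (fun t : n.-tuple R => f (row_of_tuple t)).
Proof.
move=> cf; apply: (measurability _ (RGenOInfty.measurableE R)).
move=> /= _ [_ [a ->]] <-; rewrite setTI.
pose U := f @^-1` [set` `]a, +oo[].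
have oU : open U.
  by apply: open_comp => [x _|]; [exact: cf|exact: interval_open].
pose box (k : {ffun 'I_n -> rat} * nat) := [set t : n.-tuple R |
  forall i, `|ratr (k.1 i) - tnth t i| < k.2.+1%:R^-1].
pose good k := forall t, box k t -> U (row_of_tuple t).
have -> : (fun t : n.-tuple R => f (row_of_tuple t)) @^-1` [set` `]a, +oo[] =
    \bigcup_k (if `[< good k >] then box k else set0).
  apply/seteqP; split => [t Ut|t [k _]]; last first.
    by case: asboolP => // gk bt; exact: (gk t bt).
  have /nbhs_ballP[e /= e0 eU] : nbhs (row_of_tuple t) U.
    by apply: open_nbhs_nbhs; split.
  have [j je] : exists j : nat, 2 * j.+1%:R^-1 < e.
    have := @near_infty_natSinv_lt R (PosNum (divr_gt0 e0 (ltr0n R 2))).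
    case=> N _ /(_ N (leqnn _)) /= h; exists N.
    by rewrite mulrC -ltr_pdivlMr.
  have j0 : 0 < (j.+1%:R^-1 : R) by rewrite invr_gt0.
  have ex i : exists q : rat, `|ratr q - tnth t i| < (j.+1%:R^-1 : R).
    move: (j.+1%:R^-1) j0 => w w0.
    have : tnth t i - w < tnth t i + w by rewrite ltrD2l gtrN.
    move=> /rat_in_itvoo[q]; rewrite inE /= => /andP[h1 h2].
    exists q; rewrite ltr_norml; apply/andP; split.
    - by rewrite ltrBrDl.
    - by rewrite ltrBlDl.
  have /choice[c cP] := ex.
  exists ([ffun i => c i], j) => //.
  have bt : box ([ffun i => c i], j) t by move=> i /=; rewrite ffunE.
  case: asboolP => // -[] s bs; apply: eU; split => // i0 i.
  rewrite /ball /= !mxE; have := bs i; have := bt i => /=; rewrite ffunE.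
  move=> h1 h2; apply: le_lt_trans je.
  rewrite (_ : _ - _ = (ratr (c i) - tnth s i) - (ratr (c i) - tnth t i)); last ring.
  by rewrite (le_trans (ler_normB _ _))// mulr2n mulrDl !mul1r lerD// ltW.
apply: countable_bigcupT_measurable => [|k]; first exact: countableP.
case: ifP => // _.
rewrite (_ : box k = \bigcap_(i in [set: 'I_n]) [set t | `|ratr (k.1 i) - tnth t i| < k.2.+1%:R^-1]).
  rewrite bigcap_mkcond; apply: fin_bigcap_measurable => // i _.
  case: ifP => // _.
  rewrite (_ : [set t | _] = (fun t : n.-tuple R => `|ratr (k.1 i) - tnth t i|) @^-1` `]-oo, k.2.+1%:R^-1[).
    rewrite -[X in measurable X]setTI; have : measurable_fun setT
      (fun t : n.-tuple R => `|ratr (k.1 i) - tnth t i|); last exact.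
    apply: measurableT_comp => //; apply: measurable_funB => //.
    exact: measurable_tnth.
  by apply/seteqP; split => t /=; rewrite in_itv.
by apply/seteqP; split => t /= h i; [move=> _; exact: h|exact: (h i Logic.I)].
Qed.

Definition mR n (f : 'rV[R]_n -> R) :=
  measurable_fun setT (fun t : n.-tuple R => f (row_of_tuple t)).
Definition mCn n (f : 'rV[R]_n -> R[i]) := mC (fun t : n.-tuple R => f (row_of_tuple t)).
Definition iCn n (f : 'rV[R]_n -> R[i]) :=
  iC (mu R n) (fun t : n.-tuple R => f (row_of_tuple t)).
Definition cIn n (f : 'rV[R]_n -> R[i]) :=
  cI (mu R n) (fun t : n.-tuple R => f (row_of_tuple t)).
Definition In n (f : 'rV[R]_n -> \bar R) : \bar R :=
  (\int[mu R n]_t f (row_of_tuple t))%E.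

Lemma intRnE n (f : 'rV[R]_n -> \bar R) :
  measurable_fun setT (fun t : n.-tuple R => f (row_of_tuple t)) ->
  (forall x, 0 <= f x)%E -> intRn f = In f.
Proof. by move=> mf f0; rewrite /intRn iintE. Qed.

Lemma cintE n (f : 'rV[R]_n -> R[i]) : iCn f -> cint f = cIn f.
Proof.
move=> [i1 i2].
have E (g : 'rV[R]_n -> R) : (mu R n).-integrable setT (fun t => (g (row_of_tuple t))%:E) ->
    rint g = (\int[mu R n]_t g (row_of_tuple t))%R.
  move=> ig; have mg : mR g by case/integrableP: ig => /measurable_EFinP.
  rewrite /rint /Rintegral integralE fineB; last 2 first.
  - by rewrite integrable_pos_fin_num.
  - by rewrite integrable_neg_fin_num.
  rewrite !intRnE ?/In; last 4 first.
  - apply/measurable_EFinP; apply: measurable_maxr => //.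
    exact: measurableT_comp.
  - by move=> x; rewrite lee_fin le_max lexx orbT.
  - by apply/measurable_EFinP; exact: measurable_maxr.
  - by move=> x; rewrite lee_fin le_max lexx orbT.
  congr (fine _ - fine _); apply: eq_integral => t _.
  - by rewrite funeposE EFin_max.
  - by rewrite funenegE EFin_max.
by rewrite /cint /cIn /cI; congr Complex; apply: E.
Qed.

Lemma integrable_muS m (f : m.+1.-tuple R -> \bar R) :
  (mu R m.+1).-integrable setT f -> (leb \x mu R m)%E.-integrable setT (f \o @consp R m).
Proof.
move=> /integrableP[mf foo]; apply/integrableP; split.
  by apply: measurableT_comp => //; exact: measurable_consp.
rewrite /= /mucons ge0_integral_pushforward// in foo; last 2 first.
- exact: measurable_consp.
- exact: measurableT_comp.
Qed.

Lemma Rintegral_muS m (f : m.+1.-tuple R -> R) :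
  (mu R m.+1).-integrable setT (EFin \o f) ->
  (\int[mu R m.+1]_t f t = \int[leb]_y \int[mu R m]_t f (cons_tuple y t))%R.
Proof.
move=> itf; have i2 := integrable_muS itf.
rewrite (@RFubini_half _ _ _ _ _ leb (mu R m) (fun p => f (consp p)) i2) /Rintegral.
rewrite [in LHS]/= /mucons integral_pushforward//.
- exact: measurable_consp.
- by case/integrableP: itf.
Qed.
Lemma Rintegral_muS2 m (f : m.+1.-tuple R -> R) :
  (mu R m.+1).-integrable setT (EFin \o f) ->
  (\int[mu R m.+1]_t f t = \int[mu R m]_t \int[leb]_y f (cons_tuple y t))%R.
Proof.
move=> itf; have i2 := integrable_muS itf.
rewrite Rintegral_muS//.
rewrite (@RFubini_half _ _ _ _ _ leb (mu R m) (fun p => f (consp p)) i2).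
by rewrite (@RFubini_half2 _ _ _ _ _ leb (mu R m) (fun p => f (consp p)) i2).
Qed.
Lemma cI_muS m (F : m.+1.-tuple R -> R[i]) : iC (mu R m.+1) F ->
  cI (mu R m.+1) F = cI leb (fun y => cI (mu R m) (fun t => F (cons_tuple y t))).
Proof. by move=> [i1 i2]; rewrite /cI !Rintegral_muS. Qed.

Lemma tnth_consS m (y : R) (t : m.-tuple R) i : tnth (cons_tuple y t) (lift ord0 i) = tnth t i.
Proof. by rewrite tnthS. Qed.

Lemma ge0_integral_prod m (f : 'I_m -> R -> R) :
  (forall i, measurable_fun setT (f i)) -> (forall i x, 0 <= f i x) ->
  (forall i, leb.-integrable setT (EFin \o f i)) ->
  (\int[mu R m]_t (\prod_i f i (tnth t i))%:E)%E = (\prod_i \int[leb]_x f i x)%:E.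
Proof.
elim: m f => [|m IH] f mf f0 itf.
  rewrite big_ord0; under eq_integral do rewrite big_ord0.
  by rewrite /= /mu0 integral_dirac// diracE in_setT mule1.
have mp : forall k (g : 'I_k -> R -> R), (forall i, measurable_fun setT (g i)) ->
    measurable_fun setT (fun t : k.-tuple R => (\prod_i g i (tnth t i))%:E).
  move=> k g mg; apply/measurable_EFinP; apply: measurable_prod => i _.
  by apply: (measurableT_comp (mg i)); exact: measurable_tnth.
rewrite ge0_integral_muS//; last 2 first.
- exact: mp.
- by move=> t; rewrite lee_fin prodr_ge0.
have E y : (\int[mu R m]_t (\prod_i f i (tnth (cons_tuple y t) i))%:E =
    (f ord0 y)%:E * (\prod_(i < m) \int[leb]_x f (lift ord0 i) x)%:E)%E.
  rewrite (eq_integral (fun t => (f ord0 y)%:E *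
      (\prod_(i < m) f (lift ord0 i) (tnth t i))%:E)%E); last first.
    move=> t _; rewrite big_ord_recl EFinM; congr (_ * _%:E)%E.
    by apply: eq_bigr => i _; rewrite tnth_consS.
  rewrite ge0_integralZl//; last 3 first.
  - exact: (mp m (fun i => f (lift ord0 i))).
  - by move=> t _; rewrite lee_fin prodr_ge0.
  - by rewrite lee_fin.
  by rewrite (IH (fun i => f (lift ord0 i))).
under eq_integral do rewrite E.
rewrite ge0_integralZr//; last 3 first.
- by apply/measurable_EFinP; exact (mf ord0).
- by move=> y _; rewrite lee_fin.
- by rewrite lee_fin prodr_ge0// => i _; exact: Rintegral_ge0.
rewrite big_ord_recl EFinM; congr (_ * _)%E.
by rewrite /Rintegral fineK//; exact (integrable_fin_num measurableT (itf ord0)).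
Qed.

Lemma integrable_prod m (f : 'I_m -> R -> R) :
  (forall i, measurable_fun setT (f i)) -> (forall i x, 0 <= f i x) ->
  (forall i, leb.-integrable setT (EFin \o f i)) ->
  (mu R m).-integrable setT (fun t => (\prod_i f i (tnth t i))%:E).
Proof.
move=> mf f0 itf; apply/integrableP; split.
  apply/measurable_EFinP; apply: measurable_prod => i _.
  by apply: (measurableT_comp (mf i)); exact: measurable_tnth.
under eq_integral do rewrite gee0_abs ?lee_fin ?prodr_ge0//.
by rewrite ge0_integral_prod// ltry.
Qed.

(** This is what reduces the transform of [Qk] to a one-dimensional computation. *)
Lemma cI_prod m (G : 'I_m -> R -> R[i]) : (forall i, iC leb (G i)) ->
  iC (mu R m) (fun t => \prod_i G i (tnth t i)) /\
  cI (mu R m) (fun t => \prod_i G i (tnth t i)) = \prod_i cI leb (G i).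
Proof.
have I m' (G' : 'I_m' -> R -> R[i]) : (forall i, iC leb (G' i)) ->
    iC (mu R m') (fun t => \prod_i G' i (tnth t i)).
  move=> iG; have mG i := iC_mC (iG i).
  apply: (@iC_dom _ _ _ _ _ (fun t => \prod_i cabs (G' i (tnth t i)))).
  - by apply: mC_prod => i; apply: mC_comp (mG i); exact: measurable_tnth.
  - apply: (@integrable_prod _ (fun i x => cabs (G' i x))).
    + by move=> i; exact (m_cabs (mG i)).
    + by move=> i x; exact: cabs_ge0.
    + by move=> i; exact: i_cabs.
  - move=> t; rewrite le_eqVlt; apply/orP; left; apply/eqP.
    apply: (big_morph (@cabs R)); first exact: cabsM.
    by rewrite (cabs_real 1) normr1.
move=> iG; split; first exact: I.
elim: m G iG => [|m IH] G iG.
  rewrite big_ord0; under eq_cI do rewrite big_ord0.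
  apply: c_ext => /=; rewrite /Rintegral /mu0 integral_dirac// diracE in_setT mul1e//.
rewrite cI_muS; last exact: I.
rewrite big_ord_recl -(IH (fun i => G (lift ord0 i)))// -cIZr; last exact: iG.
congr cI; apply/funext => y.
rewrite -cIZ; last exact: (I _ (fun i => G (lift ord0 i))).
congr cI; apply/funext => t; rewrite big_ord_recl; congr (_ * _).
by apply: eq_bigr => i _; rewrite tnth_consS.
Qed.

Lemma integrable_bdd_supp m (f : m.-tuple R -> R) (B r : R) :
  measurable_fun setT f -> (forall t, `|f t| <= B) ->
  (forall t i, r < `|tnth t i| -> f t = 0) ->
  (mu R m).-integrable setT (EFin \o f).
Proof.
move=> mf fB fr.
have B0 : 0 <= B by rewrite (le_trans _ (fB [tuple of nseq m 0])).
pose g (i : 'I_m) (x : R) : R := \1_`[-r, r] x.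
have ig : (mu R m).-integrable setT (fun t => (\prod_i g i (tnth t i))%:E).
  apply: integrable_prod => i.
  - exact: measurable_indic.
  - by move=> x; rewrite /g indicE.
  - apply/integrableP; split; first by apply/measurable_EFinP; exact: measurable_indic.
    under eq_integral do rewrite /= ger0_norm//.
    by rewrite integral_indic//= setIT lebesgue_measure_itv/=; case: ifP => // _; rewrite -EFinB ltry.
have igB := integrableZl measurableT B ig.
apply: le_integrable igB => //; first exact/measurable_EFinP.
move=> t _ /=; rewrite lee_fin.
have [/existsP[i hi]|/existsPn h] := boolP [exists i, r < `|tnth t i|].
  by rewrite (fr t i hi) normr0.
rewrite big1 ?mulr1; first by rewrite (le_trans (fB t))// ler_norm.
move=> i _; rewrite /g indicE mem_set//= in_itv/= -ler_norml leNgt; exact: h.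
Qed.

Definition upd m (t : m.-tuple R) (i : 'I_m) (y : R) : m.-tuple R :=
  [tuple if j == i then y else tnth t j | j < m].
Lemma tnth_upd m (t : m.-tuple R) i y j :
  tnth (upd t i y) j = if j == i then y else tnth t j.
Proof. by rewrite tnth_mktuple. Qed.
Lemma upd_cons0 m (t : m.-tuple R) x y : upd (cons_tuple x t) ord0 y = cons_tuple y t.
Proof.
apply: eq_from_tnth => j; rewrite tnth_upd.
case: (unliftP ord0 j) => [k ->|->]; last by rewrite eqxx.
by rewrite eq_sym (negbTE (neq_lift ord0 k)) !tnth_consS.
Qed.
Lemma upd_consS m (t : m.-tuple R) x i y :
  upd (cons_tuple x t) (lift ord0 i) y = cons_tuple x (upd t i y).
Proof.
apply: eq_from_tnth => j; rewrite tnth_upd.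
case: (unliftP ord0 j) => [k ->|->].
  by rewrite (inj_eq lift_inj) !tnth_consS tnth_upd.
by rewrite (negbTE (neq_lift ord0 i)).
Qed.

Lemma integral_line_derive (F G : R -> R) (r : R) :
  (forall y : R, is_derive y 1 F (G y)) -> continuous G ->
  (forall y, r < `|y| -> F y = 0) -> (forall y, r < `|y| -> G y = 0) ->
  (\int[leb]_y G y = 0)%R.
Proof.
move=> dF cG F0 G0.
pose s := `|r| + 1.
have rs : r < s by rewrite (le_lt_trans (ler_norm r))// ltrDl.
have s0 : 0 < s by rewrite ltr_wpDl.
have cF : continuous F by move=> y; exact/differentiable_continuous/derivable1_diffP.
have -> : (\int[leb]_y G y = \int[leb]_(y in `[-s, s]) G y)%R.
  rewrite [RHS]Rintegral_mkcond; apply: eq_Rintegral => y _.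
  rewrite patchE; case: ifPn => // /negP h; apply: G0; rewrite ltNge.
  apply/negP => yr; apply: h; apply/mem_set => /=.
  by rewrite in_itv/= -ler_norml (le_trans yr)// ltW.
rewrite /Rintegral (@continuous_FTC2 _ G F)//.
- by rewrite !F0 ?subee// ?normrN gtr0_norm.
- lra.
- exact: continuous_subspaceT.
- split => [x _| |].
  + by have [] := dF x.
  + exact/cvg_at_right_filter/cF.
  + exact/cvg_at_left_filter/cF.
- by move=> x _; rewrite derive1E; have [_ ->] := dF x.
Qed.

(** Induction on the dimension: if [i] is the first coordinate, the inner line integral vanishes;
    otherwise the first coordinate is frozen and the induction hypothesis treats the rest. *)
Lemma integral_coord_derive m (i : 'I_m) (F G : m.-tuple R -> R) (B r : R) :
  measurable_fun setT G -> (forall t, `|G t| <= B) ->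
  (forall t j, r < `|tnth t j| -> G t = 0) ->
  (forall t j, r < `|tnth t j| -> F t = 0) ->
  (forall t (y : R), is_derive y 1 (fun y => F (upd t i y)) (G (upd t i y))) ->
  (forall t, continuous (fun y : R => G (upd t i y))) ->
  (\int[mu R m]_t G t = 0)%R.
Proof.
elim: m i F G => [[]//|m IH] i F G mG GB G0 F0 dF cG.
have iG := integrable_bdd_supp mG GB G0.
case: (unliftP ord0 i) => [k ik|ik]; rewrite {}ik in dF cG.
  rewrite Rintegral_muS//.
  rewrite (_ : (fun y => _) = cst 0); first by rewrite Rintegral_cst// mul0r.
  apply/funext => y; apply: (IH k (fun t => F (cons_tuple y t))).
  - by apply: (measurableT_comp mG); exact: measurable_consl.
  - by move=> t; exact: GB.
  - by move=> t j h; apply: (G0 _ (lift ord0 j)); rewrite tnth_consS.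
  - by move=> t j h; apply: (F0 _ (lift ord0 j)); rewrite tnth_consS.
  - by move=> t z; have := dF (cons_tuple y t) z; under eq_fun do rewrite upd_consS; rewrite upd_consS.
  - by move=> t; have := cG (cons_tuple y t); under eq_fun do rewrite upd_consS.
rewrite Rintegral_muS2//.
rewrite (_ : (fun y => _) = cst 0); first by rewrite Rintegral_cst// mul0r.
apply/funext => t.
apply: (@integral_line_derive (fun y => F (cons_tuple y t)) _ r).
- by move=> z; have := dF (cons_tuple 0 t) z; under eq_fun do rewrite upd_cons0; rewrite upd_cons0.
- by have := cG (cons_tuple 0 t); under eq_fun do rewrite upd_cons0.
- by move=> y h; apply: (F0 _ ord0).
- by move=> y h; apply: (G0 _ ord0).
Qed.

End RnMeas.

(** * The Poisson kernel on the line *)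

Section Poisson1.
Variable R : realType.
Notation leb := (@lebesgue_measure R).

(** Reduces to half-lines, where the fundamental theorem for non-negative integrands with a limit at
    infinity applies. *)
Lemma ge0_integralT_split (f : R -> R) (x : R) : (forall y, 0 <= f y) ->
  continuous f ->
  (\int[leb]_y (f y)%:E = \int[leb]_(y in `[x, +oo[) (f y)%:E +
     \int[leb]_(y in `[(- x)%R, +oo[) (f (- y)%R)%:E)%E.
Proof.
move=> f0 cf; have mf : measurable_fun setT f by exact: continuous_measurable_fun.
have mI : measurable (`[x, +oo[%classic : set R) by exact: measurable_itv.
rewrite -(setUv `[x, +oo[%classic) ge0_integral_setU//=; last 4 first.
- exact: measurableC.
- by apply/measurable_EFinP; rewrite setUv.
- by move=> y _; rewrite lee_fin.
- exact/disj_setPCl.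
congr (_ + _)%E; rewrite setCitvr.
rewrite integral_itv_bndo_bndc; last exact/measurable_EFinP/measurable_funTS.
rewrite -{1}(opprK x) ge0_integration_by_substitutionNy//.
exact: continuous_subspaceT.
Qed.

Lemma cauchy_cont (e x : R) : 0 < e ->
  continuous (fun y : R => e / pi / (e ^+ 2 + (y - x) ^+ 2)).
Proof.
move=> e0 y; apply: (@d_cont _ (fun y => e / pi / (e ^+ 2 + (y - x) ^+ 2)) _ _).
apply: dM; first exact: dC.
apply: dV; last by drv.
by rewrite gt_eqF// ltr_pwDl ?exprn_gt0 ?sqr_ge0.
Qed.
Lemma cauchy_ge0 (e x y : R) : 0 < e -> 0 <= e / pi / (e ^+ 2 + (y - x) ^+ 2).
Proof.
move=> e0; have p0 := pi_gt0 R.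
by apply: divr_ge0; [apply: divr_ge0; apply: ltW|rewrite addr_ge0 ?sqr_ge0].
Qed.

Lemma cauchy_half (e x : R) : 0 < e ->
  (\int[leb]_(y in `[x, +oo[) (e / pi / (e ^+ 2 + (y - x) ^+ 2))%:E = (2^-1)%:E)%E.
Proof.
move=> e0; have p0 := pi_gt0 R.
have d (y : R) : der (fun y => pi^-1 * atan ((y - x) * e^-1)) y
    (e / pi / (e ^+ 2 + (y - x) ^+ 2)).
  apply: deq; first drv.
  have : e ^+ 2 + (y - x) ^+ 2 != 0 by rewrite gt_eqF// ltr_pwDl ?exprn_gt0 ?sqr_ge0.
  have : 1 + ((y - x) / e) ^+ 2 != 0 by rewrite gt_eqF// ltr_pwDl ?sqr_ge0.
  move: (pi : R) p0 => P P0 h1 h2; field; rewrite !gt_eqF//.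
  by rewrite ltr_pwDl ?exprn_gt0 ?sqr_ge0.
rewrite (@ge0_continuous_FTC2y _ _ (fun y => pi^-1 * atan ((y - x) * e^-1)) _ (2^-1)).
- by rewrite subrr mul0r atan0 mulr0 sube0.
- by move=> y _; exact: cauchy_ge0.
- by apply: continuous_subspaceT; exact: cauchy_cont.
- rewrite [X in _ --> X](_ : _ = pi^-1 * (pi / 2)); last by rewrite mulrA mulVf ?gt_eqF// mul1r.
  apply: cvgZr; apply: (cvg_comp (fun y => (y - x) * e^-1) atan); last exact: cvgy_atan.
  apply/cvgryPge => A; near=> y.
  rewrite ler_pdivlMr// lerBrDr; near: y; apply: nbhs_pinfty_ge; exact: num_real.
- by move=> y _; have [] := d y.
- by apply: cvg_at_right_filter; apply: (d_cont (d x)).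
- by move=> y _; rewrite derive1E; have [_ ->] := d y.
Unshelve. all: by end_near. Qed.

Lemma cauchy_int (e x : R) : 0 < e ->
  (\int[leb]_y (e / pi / (e ^+ 2 + (y - x) ^+ 2))%:E = 1%:E)%E.
Proof.
move=> e0; have p0 := pi_gt0 R.
rewrite (@ge0_integralT_split _ x).
- rewrite cauchy_half// [X in (_ + X)%E](_ : _ = (2^-1)%:E).
    by rewrite -EFinD; congr EFin; field.
  rewrite -(cauchy_half (- x) e0); apply: eq_integral => y _; congr (EFin (_ / (_ + _))).
  by ring.
- by move=> y; exact: cauchy_ge0.
- exact (@cauchy_cont e x e0).
Qed.

Lemma cauchy_meas (e x : R) : 0 < e ->
  measurable_fun setT (fun y : R => e / pi / (e ^+ 2 + (y - x) ^+ 2)).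
Proof. by move=> e0; apply: continuous_measurable_fun; exact: cauchy_cont. Qed.
Lemma cauchy_integrable (e x : R) : 0 < e ->
  leb.-integrable setT (EFin \o (fun y : R => e / pi / (e ^+ 2 + (y - x) ^+ 2))).
Proof.
move=> e0; apply/integrableP; split; first by apply/measurable_EFinP; exact (@cauchy_meas e x e0).
rewrite (_ : (\int[leb]_y _)%E = 1%:E) ?ltry// -(cauchy_int x e0).
by apply: eq_integral => y _; rewrite /= ger0_norm// cauchy_ge0.
Qed.

(** The summand 1, together with [|p| + |q| <= 1], makes the integrand non-negative, as the improper
    fundamental theorem requires. Its contribution is subtracted afterwards. *)
Lemma exp_trig_half (a b p q : R) : 0 < a -> `|p| + `|q| <= 1 ->
  (\int[leb]_(y in `[0%R, +oo[) (expR (- (a * y)) * (1 + (p * cos (b * y) + q * sin (b * y))))%:E =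
   (a^-1 + (p * a + q * b) / (a ^+ 2 + b ^+ 2))%:E)%E.
Proof.
move=> a0 pq.
have ab : 0 < a ^+ 2 + b ^+ 2 by rewrite ltr_pwDl ?exprn_gt0 ?sqr_ge0.
pose F y := expR (- (a * y)) * (- a^-1 + (a ^+ 2 + b ^+ 2)^-1 *
  ((p * b - q * a) * sin (b * y) - (p * a + q * b) * cos (b * y))).
have d (y : R) : der F y
    (expR (- (a * y)) * (1 + (p * cos (b * y) + q * sin (b * y)))).
  apply: deq; first by rewrite /F; drv.
  cbv beta; by move: (expR _) (sin _) (cos _) => X S C; field; rewrite !gt_eqF.
have d2 (y : R) : {for y, continuous (fun y =>
    expR (- (a * y)) * (1 + (p * cos (b * y) + q * sin (b * y))))}.
  by apply: d_cont; drv.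
rewrite (@ge0_continuous_FTC2y _ _ F _ 0).
- rewrite /F !mulr0 oppr0 expR0 sin0 cos0 -EFinB; congr EFin; field; rewrite !gt_eqF//.
- move=> y _; rewrite mulr_ge0 ?expR_ge0//.
  suff : `|p * cos (b * y) + q * sin (b * y)| <= 1 by rewrite ler_norml => /andP[]; lra.
  rewrite (le_trans (ler_normD _ _))// (le_trans _ pq)// !normrM lerD//.
  + by rewrite ler_piMr// ler_norml cos_geN1 cos_le1.
  + by rewrite ler_piMr// ler_norml sin_geN1 sin_le1.
- by apply: continuous_subspaceT => y; exact: d2.
- pose C := a^-1 + (a ^+ 2 + b ^+ 2)^-1 * (`|p * b - q * a| + `|p * a + q * b|).
  apply: (@squeeze_cvgr _ _ _ _ (fun y => - (expR (- (a * y)) * C)) (fun y => expR (- (a * y)) * C)).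
  + near=> y; rewrite -ler_norml /F normrM ger0_norm ?expR_ge0// ler_wpM2l ?expR_ge0//.
    rewrite (le_trans (ler_normD _ _))// normrN gtr0_norm ?invr_gt0// lerD2l.
    rewrite normrM gtr0_norm ?invr_gt0//; apply: ler_wpM2l; first by rewrite invr_ge0 ltW.
    rewrite (le_trans (ler_normB _ _))// !normrM lerD//.
    * by rewrite ler_piMr// ler_norml sin_geN1 sin_le1.
    * by rewrite ler_piMr// ler_norml cos_geN1 cos_le1.
  + have E : expR (- (a * y)) @[y --> +oo] --> (0 : R).
      apply: (cvg_comp (fun y => a * y) (fun z => expR (- z))); last exact: cvgr_expR.
      by apply/cvgryPge => A; near=> y; rewrite mulrC -ler_pdivrMr//; near: y; apply: nbhs_pinfty_ge; exact: num_real.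
    by rewrite -oppr0 -(mul0r C); apply: cvgN; apply: cvgZl.
  + have E : expR (- (a * y)) @[y --> +oo] --> (0 : R).
      apply: (cvg_comp (fun y => a * y) (fun z => expR (- z))); last exact: cvgr_expR.
      by apply/cvgryPge => A; near=> y; rewrite mulrC -ler_pdivrMr//; near: y; apply: nbhs_pinfty_ge; exact: num_real.
    by rewrite -(mul0r C); apply: cvgZl.
- by move=> y _; have [] := d y.
- by apply: cvg_at_right_filter; apply: (d_cont (d 0)).
- by move=> y _; rewrite derive1E; have [_ ->] := d y.
Unshelve. all: by end_near. Qed.

Lemma exp_abs_cont (a : R) : continuous (fun y : R => expR (- (a * `|y|))).
Proof.
move=> y; apply: (@continuous_comp _ _ _ (fun y : R => - (a * `|y|)) expR); last exact: continuous_expR.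
apply: cvgN; apply: cvgZr; exact: norm_continuous.
Qed.
Lemma exp_trig_cont (a b p q : R) : continuous (fun y : R => expR (- (a * `|y|)) * (1 + (p * cos (b * y) + q * sin (b * y)))).
Proof.
apply: cont_mul => y; first exact: exp_abs_cont.
by apply: (@d_cont _ (fun y => 1 + (p * cos (b * y) + q * sin (b * y)))); drv.
Qed.

Lemma exp_trig_T (a b p q : R) : 0 < a -> `|p| + `|q| <= 1 ->
  (\int[leb]_y (expR (- (a * `|y|)) * (1 + (p * cos (b * y) + q * sin (b * y))))%:E =
   (2 * a^-1 + 2 * p * a / (a ^+ 2 + b ^+ 2))%:E)%E.
Proof.
move=> a0 pq.
have ab : 0 < a ^+ 2 + b ^+ 2 by rewrite ltr_pwDl ?exprn_gt0 ?sqr_ge0.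
rewrite (@ge0_integralT_split _ 0).
- rewrite (_ : (\int[leb]_(y in `[0%R, +oo[) _)%E = (a^-1 + (p * a + q * b) / (a ^+ 2 + b ^+ 2))%:E); last first.
    rewrite -exp_trig_half//; apply: eq_integral => y.
    by rewrite inE/= in_itv/= andbT => y0; rewrite ger0_norm.
  rewrite oppr0.
  rewrite (_ : (\int[leb]_(y in `[0%R, +oo[) _)%E = (a^-1 + (p * a + (- q) * b) / (a ^+ 2 + b ^+ 2))%:E); last first.
    rewrite -exp_trig_half//; last by rewrite normrN.
    apply: eq_integral => y.
    rewrite inE/= in_itv/= andbT => y0; rewrite normrN ger0_norm// mulrN cosN sinN.
    by rewrite mulNr mulrN.
  by rewrite -EFinD; congr EFin; field; rewrite !gt_eqF.
- move=> y; rewrite mulr_ge0 ?expR_ge0//.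
  suff : `|p * cos (b * y) + q * sin (b * y)| <= 1 by rewrite ler_norml => /andP[]; lra.
  rewrite (le_trans (ler_normD _ _))// (le_trans _ pq)// !normrM lerD//.
  + by rewrite ler_piMr// ler_norml cos_geN1 cos_le1.
  + by rewrite ler_piMr// ler_norml sin_geN1 sin_le1.
- exact (@exp_trig_cont a b p q).
Qed.

Lemma exp_abs_int (a : R) : 0 < a ->
  leb.-integrable setT (EFin \o (fun y : R => expR (- (a * `|y|)))).
Proof.
move=> a0; apply/integrableP; split.
  by apply/measurable_EFinP; apply: continuous_measurable_fun; exact: exp_abs_cont.
have := @exp_trig_T a 0 0 0 a0; rewrite normr0 addr0 => /(_ ler01) E.
move: E; set I := (X in X = _) => E.
suff -> : (\int[leb]_y `|(EFin \o (fun y : R => expR (- (a * `|y|)))) y|)%E = I by rewrite E ltry.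
by apply: eq_integral => y _; rewrite /= ger0_norm ?expR_ge0// !mul0r !addr0 mulr1.
Qed.

Lemma exp_abs_fourier (a b : R) : 0 < a ->
  iC leb (fun y : R => rc (expR (- (a * `|y|))) * expi (b * y)) /\
  cI leb (fun y : R => rc (expR (- (a * `|y|))) * expi (b * y)) =
  rc (2 * a / (a ^+ 2 + b ^+ 2)).
Proof.
move=> a0; have ie := exp_abs_int a0.
have mby : measurable_fun setT (fun y : R => b * y).
  by apply: continuous_measurable_fun => y; apply: d_cont; drv.
have i : iC leb (fun y : R => rc (expR (- (a * `|y|))) * expi (b * y)).
  apply: iC_dom ie _.
  - have h1 : mC (fun y : R => rc (expR (- (a * `|y|)))).
      by apply: mC_rc; apply: continuous_measurable_fun; exact: exp_abs_cont.
    exact (mCM h1 (mC_expi mby)).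
  - by move=> y; rewrite cabsM cabs_expi mulr1 cabs_real ger0_norm ?expR_ge0.
split => //.
have E0 : (\int[leb]_y expR (- (a * `|y|)) = 2 / a)%R.
  have := @exp_trig_T a 0 0 0 a0; rewrite normr0 addr0 => /(_ ler01) E.
  move: E; set I := (X in X = _) => E.
  suff EI : (\int[leb]_y (expR (- (a * `|y|)))%:E)%E = I.
    by rewrite /Rintegral EI E /= mulr0 !mul0r addr0.
  by apply: eq_integral => y _; rewrite /= !mul0r !addr0 mulr1.
(* Subtracts the integral of [exp (- a |y|)] from the non-negative combination; [(p, q) = (1, 0)]
   then gives the real part and [(0, 1)] the imaginary part. *)
have S (t : R -> R) p q : `|p| + `|q| <= 1 ->
    (forall y, t y = expR (- (a * `|y|)) * (p * cos (b * y) + q * sin (b * y))) ->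
    leb.-integrable setT (fun y => (t y)%:E) ->
    (\int[leb]_y t y)%R = 2 * p * a / (a ^+ 2 + b ^+ 2).
  move=> pq tE it.
  have H := RintegralD measurableT ie it.
  have := @exp_trig_T a b p q a0 pq; set I := (X in X = _) => E.
  have EI : (\int[leb]_y (expR (- (a * `|y|)) + t y)%:E)%E = I.
    by apply: eq_integral => y _; rewrite tE [in RHS]mulrDr mulr1.
  move: H; rewrite {1}/Rintegral EI E E0 /= => /addrI <-//.
case: i => i1 i2.
apply: c_ext => /=.
- rewrite (S _ 1 0) ?mulr1 ?normr1 ?normr0 ?addr0// => y.
  by rewrite !mul0r subr0 mul1r addr0.
- rewrite (S _ 0 1) ?mulr0 ?mul0r ?normr1 ?normr0 ?add0r// => y.
  by rewrite !mul0r addr0 mul1r add0r.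
Qed.
End Poisson1.

(** * Fourier inversion and Plancherel *)

Lemma fatou_le d (T : measurableType d) (R : realType) (mu : {measure set T -> \bar R})
    (f_ : nat -> T -> R) (f : T -> R) (B : \bar R) :
  (forall k, measurable_fun setT (f_ k)) -> (forall k x, 0 <= f_ k x) ->
  (forall x, f_ k x @[k --> \oo] --> f x) ->
  (forall k, (\int[mu]_x (f_ k x)%:E <= B)%E) -> (\int[mu]_x (f x)%:E <= B)%E.
Proof.
move=> mf f0 ff fB.
have := @fatou _ _ _ mu setT measurableT (fun k x => (f_ k x)%:E)
  (fun k => (measurable_EFinP _ _).2 (mf k)) (fun k x _ => f0 k x).
rewrite (eq_integral (fun x => (f x)%:E)); last first.
  move=> x _; apply/esym; apply/esym.
  have c : (f_ k x)%:E @[k --> \oo] --> (f x)%:E.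
    by apply/cvg_EFin; [exact: nearW|exact: ff].
  by rewrite is_cvg_limn_einfE; [exact/cvg_lim|apply/cvg_ex; eexists; exact: c].
move=> /le_trans; apply.
rewrite limn_einf_lim; apply: lime_le; first exact: is_cvg_einfs.
apply: nearW => k; apply: (le_trans _ (fB k)); apply: ereal_inf_lbound.
by exists k => //=.
Qed.

Section Fourier.
Variables (R : realType) (n : nat).
Notation pt := 'rV[R]_n.
Notation leb := (@lebesgue_measure R).
Notation rt := (@row_of_tuple R n).
Notation tup := (n.-tuple R).

Definition tuple_of_row (x : pt) : tup := [tuple x 0 i | i < n].
Lemma rtK (x : pt) : rt (tuple_of_row x) = x.
Proof. by apply/rowP => i; rewrite mxE tnth_mktuple. Qed.
Lemma rtE (t : tup) i : rt t 0 i = tnth t i. Proof. by rewrite mxE. Qed.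

Lemma dotpC (x y : pt) : dotp x y = dotp y x.
Proof. by apply: eq_bigr => i _; rewrite mulrC. Qed.

Lemma m_dotp2 : measurable_fun setT (fun p : tup * tup => dotp (rt p.1) (rt p.2)).
Proof.
rewrite /dotp; apply: measurable_sum => i; apply: measurable_funM.
- under eq_fun do rewrite rtE.
  apply: (measurableT_comp (measurable_tnth i)); exact: measurable_fst.
- under eq_fun do rewrite rtE.
  apply: (measurableT_comp (measurable_tnth i)); exact: measurable_snd.
Qed.
Lemma m_dotp (x : pt) : measurable_fun setT (fun t : tup => dotp (rt t) x).
Proof.
have := measurableT_comp m_dotp2 (pair2_measurable (tuple_of_row x)).
by rewrite /comp/=; under eq_fun do rewrite rtK.
Qed.

Definition ph (s : R) (x y : pt) : R[i] := expi (s * (2 * pi * dotp x y)).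
Lemma cabs_ph s x y : cabs (ph s x y) = 1. Proof. exact: cabs_expi. Qed.
Lemma phC s x y : ph s x y = ph s y x. Proof. by rewrite /ph dotpC. Qed.
Lemma conj_ph s x y : cconj (ph s x y) = ph (- s) x y.
Proof. by rewrite /ph cconj_expi mulNr. Qed.
Lemma mC_ph s (x : pt) : mC (fun t : tup => ph s (rt t) x).
Proof.
apply: mC_expi; apply: measurable_funM => //; apply: measurable_funM => //.
exact: m_dotp.
Qed.
Lemma mC_ph2 s : mC (fun p : tup * tup => ph s (rt p.1) (rt p.2)).
Proof.
apply: mC_expi; apply: measurable_funM => //; apply: measurable_funM => //.
exact: m_dotp2.
Qed.
Lemma mC_ph2' s : mC (fun p : tup * tup => ph s (rt p.2) (rt p.1)).
Proof. under eq_fun do rewrite phC; exact: mC_ph2. Qed.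
Lemma mC_fst (f : pt -> R[i]) : mCn f -> mC (fun p : tup * tup => f (rt p.1)).
Proof. by move=> mf; apply: (mC_comp measurable_fst mf). Qed.
Lemma mC_snd (f : pt -> R[i]) : mCn f -> mC (fun p : tup * tup => f (rt p.2)).
Proof. by move=> mf; apply: (mC_comp measurable_snd mf). Qed.

(* s = 1 is the inverse transform and s = -1 the direct one. *)
Definition Fr (s : R) (f : pt -> R[i]) (xi : pt) : R[i] :=
  cIn (fun x => ph s x xi * f x).

Lemma iCn_ph s f xi : iCn f -> iCn (fun x => ph s x xi * f x).
Proof.
move=> h; apply: (@iCMb _ _ _ _ _ _ 1); [exact: mC_ph|exact: h|].
by move=> t; rewrite cabs_ph.
Qed.
Lemma FTE f : iCn f -> FT f = Fr (-1) f.
Proof.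
move=> h; apply/funext => xi; rewrite /FT /Fr -cintE; last exact: iCn_ph.
by congr cint; apply/funext => x; rewrite /ph mulN1r.
Qed.
Lemma IFTE f : iCn f -> IFT f = Fr 1 f.
Proof.
move=> h; apply/funext => xi; rewrite /IFT /Fr -cintE; last exact: iCn_ph.
by congr cint; apply/funext => x; rewrite /ph mul1r dotpC.
Qed.
Lemma mCn_Fr s f : mCn f -> mCn (Fr s f).
Proof.
move=> mf; apply: (@mC_cI _ _ _ _ _ (mu R n) (fun p : tup * tup => ph s (rt p.2) (rt p.1) * f (rt p.2))).
by apply: mCM; [exact: mC_ph2'|exact: mC_snd].
Qed.
Lemma Fr_bound s f : iCn f -> exists B, forall xi, cabs (Fr s f xi) <= B.
Proof.
move=> h; have ic := i_cabs h.
exists (2 * \int[mu R n]_t cabs (f (rt t)))%R => xi.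
apply: cI_norm_le => //.
- by apply: mCM; [exact: mC_ph|exact: iC_mC h].
- by move=> t; rewrite cabsM cabs_ph mul1r.
Qed.
Lemma conj_Fr s f xi : iCn f -> cconj (Fr s f xi) = Fr (- s) (fun x => cconj (f x)) xi.
Proof.
move=> /(iCn_ph s xi) [_ i2].
rewrite /Fr /cIn; rewrite (_ : (fun t : tup => ph (- s) _ _ * _) =
  (fun t : tup => cconj (ph s (rt t) xi * f (rt t)))); last first.
  by apply/funext => t; rewrite cconjM conj_ph.
rewrite /cconj /cI /=; congr Complex.
rewrite -mulN1r -RintegralZl//.
by apply: eq_Rintegral => t _; rewrite mulN1r.
Qed.

(* Pk is the inverse transform of Qk; letting e tend to 0 gives inversion by
   Abel summation, and Pk factors over the coordinates. *)
Definition Qk (e : R) (xi : pt) : R := expR (- (e * (2 * pi * \sum_i `|xi 0 i|))).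
Definition Pk (e : R) (x y : pt) : R :=
  \prod_i (e / pi / (e ^+ 2 + (y 0 i - x 0 i) ^+ 2)).

Lemma expi_sum (I : Type) (s : seq I) (F : I -> R) :
  expi (\sum_(i <- s) F i) = \prod_(i <- s) expi (F i).
Proof.
elim: s => [|i s IH]; first by rewrite !big_nil expi0.
by rewrite !big_cons expiD IH.
Qed.
Lemma rc_prod (I : Type) (s : seq I) (F : I -> R) :
  rc (\prod_(i <- s) F i) = \prod_(i <- s) rc (F i).
Proof.
elim: s => [|i s IH]; first by rewrite !big_nil.
by rewrite !big_cons rcM IH.
Qed.

Lemma Qk_fourier e s x y : 0 < e -> s ^+ 2 = 1 ->
  iCn (fun xi => rc (Qk e xi) * (ph s xi x * ph (- s) y xi)) /\
  cIn (fun xi => rc (Qk e xi) * (ph s xi x * ph (- s) y xi)) = rc (Pk e x y).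
Proof.
move=> e0 s1; have p0 := pi_gt0 R.
pose G (i : 'I_n) (z : R) : R[i] := rc (expR (- (2 * pi * e * `|z|))) *
   expi ((s * (2 * pi * (x 0 i - y 0 i))) * z).
have a0 : 0 < 2 * pi * e by rewrite !mulr_gt0.
have E : (fun t : tup => rc (Qk e (rt t)) * (ph s (rt t) x * ph (- s) y (rt t))) =
    (fun t => \prod_i G i (tnth t i)).
  apply/funext => t; rewrite /G big_split/= -rc_prod -expi_sum -expiD; congr (rc _ * expi _).
    rewrite /Qk -expR_sum; congr expR; rewrite sumrN; congr (- _).
    by rewrite !mulr_sumr; apply: eq_bigr => i _; rewrite rtE; ring.
  rewrite /dotp !mulr_sumr -big_split/=; apply: eq_bigr => i _; rewrite rtE; ring.
have [h1 h2] := @cI_prod _ n G (fun i => (exp_abs_fourier _ a0).1).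
rewrite /iCn /cIn E; split => //; rewrite h2 /Pk rc_prod; apply: eq_bigr => i _.
rewrite /G (exp_abs_fourier _ a0).2; congr rc.
have h : e ^+ 2 + (y 0 i - x 0 i) ^+ 2 != 0.
  by rewrite gt_eqF// ltr_pwDl ?exprn_gt0 ?sqr_ge0.
rewrite !exprMn s1 mul1r; move: (pi : R) p0 {a0 E h1 h2 G} => P P0.
have -> : (2 * P * e) = P * (2 * e) by ring.
have -> : (x 0 i - y 0 i) ^+ 2 = (y 0 i - x 0 i) ^+ 2 by ring.
set w := (y 0 i - x 0 i) ^+ 2 in h *.
have h' : (2 ^+ 2 * P ^+ 2 * e ^+ 2 + 2 ^+ 2 * P ^+ 2 * w) != 0.
  by rewrite -mulrDr mulf_neq0// ?mulf_neq0 ?expf_neq0 ?gt_eqF.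
rewrite [X in _ / X = _](_ : _ = 4 * P ^+ 2 * (e ^+ 2 + w)); last by ring.
by field; rewrite h gt_eqF.
Qed.

Lemma Qk_ge0 e xi : 0 <= Qk e xi. Proof. exact: expR_ge0. Qed.
Lemma Qk_le1 e xi : 0 <= e -> Qk e xi <= 1.
Proof.
move=> e0; rewrite -expR0 ler_expR oppr_le0 mulr_ge0// mulr_ge0 ?sumr_ge0//.
by rewrite mulr_ge0 ?pi_ge0.
Qed.
Lemma Pk_ge0 e x y : 0 < e -> 0 <= Pk e x y.
Proof. by move=> e0; apply: prodr_ge0 => i _; exact: cauchy_ge0. Qed.
Lemma PkC e x y : Pk e x y = Pk e y x.
Proof. by apply: eq_bigr => i _; congr (_ / (_ + _)); ring. Qed.
Lemma mC_Qk e : 0 < e -> mCn (fun xi => rc (Qk e xi)).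
Proof.
move=> e0; have [h _] := @Qk_fourier e 1 0 0 e0 (expr1n _ _).
have : mCn (fun xi => rc (Qk e xi) * (ph 1 xi 0 * ph (- 1) 0 xi)) by exact: iC_mC h.
congr mC; apply/funext => t; rewrite /ph -expiD dotpC mulN1r mul1r subrr expi0.
by rewrite mulr1.
Qed.
Lemma iC_Qk e : 0 < e -> iCn (fun xi => rc (Qk e xi)).
Proof.
move=> e0; have [h _] := @Qk_fourier e 1 0 0 e0 (expr1n _ _).
apply: iC_domC h _; first exact: mC_Qk.
by move=> t; rewrite !cabsM !cabs_ph !mulr1.
Qed.
Lemma m_Pk2 e : 0 < e -> measurable_fun setT (fun p : tup * tup => Pk e (rt p.1) (rt p.2)).
Proof.
move=> e0; apply: measurable_prod => i _.
under eq_fun do rewrite !rtE.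
have h := @cauchy_meas R e 0 e0.
rewrite (_ : (fun p : tup * tup => _) = (fun z : R => e / pi / (e ^+ 2 + (z - 0) ^+ 2)) \o
  (fun p : tup * tup => tnth p.2 i - tnth p.1 i)); last first.
  by apply/funext => p /=; rewrite subr0.
apply: (measurableT_comp h); apply: measurable_funB.
- apply: (measurableT_comp (measurable_tnth i)); exact: measurable_snd.
- apply: (measurableT_comp (measurable_tnth i)); exact: measurable_fst.
Qed.
Lemma m_Pk e x : 0 < e -> measurable_fun setT (fun t : tup => Pk e x (rt t)).
Proof.
move=> e0; have := measurableT_comp (m_Pk2 e0) (pair1_measurable (tuple_of_row x)).
by rewrite /comp/=; under eq_fun do rewrite rtK.
Qed.
Lemma Pk_int e x : 0 < e -> (\int[mu R n]_t (Pk e x (rt t))%:E = 1%:E)%E.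
Proof.
move=> e0.
rewrite (eq_integral (fun t : tup => (\prod_i (e / pi / (e ^+ 2 + (tnth t i - x 0 i) ^+ 2)))%:E)); last first.
  by move=> t _; congr EFin; apply: eq_bigr => i _; rewrite rtE.
rewrite (@ge0_integral_prod _ n (fun i z => e / pi / (e ^+ 2 + (z - x 0 i) ^+ 2))).
- by rewrite big1// => i _; rewrite /Rintegral cauchy_int.
- by move=> i; exact: cauchy_meas.
- by move=> i z; exact: cauchy_ge0.
- by move=> i; exact: cauchy_integrable.
Qed.
Lemma Pk_integrable e x : 0 < e -> (mu R n).-integrable setT (EFin \o (fun t : tup => Pk e x (rt t))).
Proof.
move=> e0; apply/integrableP; split; first by apply/measurable_EFinP; exact: m_Pk.
under eq_integral do rewrite /= ger0_norm ?Pk_ge0//.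
by rewrite Pk_int// ltry.
Qed.

(** The factor [Qk] makes the double integral absolutely convergent; after Fubini the integral over
    frequencies is [Qk_fourier]. *)
Lemma poisson_smooth e s x g : 0 < e -> s ^+ 2 = 1 -> iCn g ->
  cIn (fun xi => rc (Qk e xi) * (ph s xi x * Fr (- s) g xi)) =
  cIn (fun y => rc (Pk e x y) * g y).
Proof.
move=> e0 s1 ig; have mg := iC_mC ig.
pose H (p : tup * tup) := rc (Qk e (rt p.1)) * (ph s (rt p.1) x *
   (ph (- s) (rt p.2) (rt p.1) * g (rt p.2))).
have mH : mC H.
  apply: mCM; first exact: (mC_fst (mC_Qk e0)).
  apply: mCM; first exact: (mC_fst (f := fun z => ph s z x) (mC_ph _ _)).
  by apply: mCM; [exact: mC_ph2'|exact: mC_snd].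
have iy xi : iC (mu R n) (fun t : tup => ph (- s) (rt t) xi * g (rt t)).
  exact: iCn_ph.
rewrite /cIn; transitivity (cI (mu R n) (fun t : tup => cI (mu R n) (fun u : tup => H (t, u)))).
  congr cI; apply/funext => t; rewrite /Fr /cIn -!cIZ//; last exact: iCZ.
rewrite (cI_fubini (F := H))//.
  congr cI; apply/funext => u; rewrite -(Qk_fourier x (rt u) e0 s1).2 mulrC -cIZ; last first.
    exact: (Qk_fourier x (rt u) e0 s1).1.
  by congr cI; apply/funext => t; rewrite /H /=; ring.
rewrite (eq_integral (fun t : tup => (Qk e (rt t))%:E * \int[mu R n]_u (cabs (g (rt u)))%:E)%E).
  rewrite ge0_integralZr//; last 3 first.
  - by apply/measurable_EFinP; case: (mC_Qk e0).
  - by move=> t _; rewrite lee_fin Qk_ge0.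
  - by apply: integral_ge0 => t _; rewrite lee_fin cabs_ge0.
  rewrite lte_mul_pinfty//.
  - by apply: integral_ge0 => t _; rewrite lee_fin Qk_ge0.
  - rewrite ge0_fin_numE; last by apply: integral_ge0 => t _; rewrite lee_fin Qk_ge0.
    have := iC_cabs_lty (iC_Qk e0); congr (_ < _)%E; apply: eq_integral => t _.
    by rewrite cabs_real ger0_norm ?Qk_ge0.
  - exact: iC_cabs_lty.
move=> t _; rewrite -ge0_integralZl//.
- apply: eq_integral => u _; rewrite /H /= !cabsM !cabs_ph !mul1r cabs_real.
  by rewrite ger0_norm ?Qk_ge0// EFinM.
- exact: m_cabsE.
- by move=> u _; rewrite lee_fin cabs_ge0.
- by rewrite lee_fin Qk_ge0.
Qed.

Lemma Fr_iC_Qk e s f : 0 < e -> iCn f -> iCn (fun xi => rc (Qk e xi) * Fr s f xi).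
Proof.
move=> e0 h; have [B hB] := Fr_bound s h.
rewrite /iCn; under eq_fun do rewrite mulrC.
apply: (@iCMb _ _ _ _ _ _ B); [exact: mCn_Fr (iC_mC h)|exact: iC_Qk|].
by move=> t; exact: hB.
Qed.

(** After Fubini the left side is the quadratic form of [Pk] applied to [f]. As [Pk] is symmetric
    with integral 1 in each variable, Schur's test applies. The 4 comes from two uses of
    [cI_norm]. *)
Lemma poisson_plancherel e s f : 0 < e -> s ^+ 2 = 1 -> iCn f ->
  (\int[mu R n]_t (Qk e (rt t) * cabs (Fr s f (rt t)) ^+ 2)%:E <=
   4%:E * \int[mu R n]_t (cabs (f (rt t)) ^+ 2)%:E)%E.
Proof.
move=> e0 s1 itf; have mf := iC_mC itf.
have icf : iCn (fun x => cconj (f x)).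
  apply: (@iC_domC _ _ _ _ _ _ (mC_conj mf) itf) => t.
  by rewrite cabs_conj.
have [B hB] := Fr_bound s itf.
have iQ : iCn (fun xi => rc (Qk e xi) * (Fr s f xi * cconj (Fr s f xi))).
  rewrite /iCn; under eq_fun do rewrite mulrA mulrC.
  apply: (@iCMb _ _ _ _ _ _ B).
  - by apply: mC_conj; exact: mCn_Fr.
  - exact: Fr_iC_Qk.
  - by move=> t; rewrite cabs_conj.
have -> : (\int[mu R n]_t (Qk e (rt t) * cabs (Fr s f (rt t)) ^+ 2)%:E =
   (cre (cIn (fun xi => rc (Qk e xi) * (Fr s f xi * cconj (Fr s f xi)))))%:E)%E.
  pose F xi := rc (Qk e xi) * (Fr s f xi * cconj (Fr s f xi)).
  have -> : cre (cIn F) = fine (\int[mu R n]_t (cre (F (rt t)))%:E)%E by [].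
  rewrite fineK; last by apply: integrable_fin_num => //; case: iQ.
  by apply: eq_integral => t _; congr EFin; rewrite /F mul_cconj cre_rcM.
apply: (@le_trans _ _ (cabs (cIn (fun xi => rc (Qk e xi) * (Fr s f xi * cconj (Fr s f xi)))))%:E).
  by rewrite lee_fin (le_trans (ler_norm _))// cre_le.
have -> : cIn (fun xi => rc (Qk e xi) * (Fr s f xi * cconj (Fr s f xi))) =
   cIn (fun x => cIn (fun y => rc (Pk e x y) * cconj (f y)) * f x).
  pose H (p : tup * tup) := rc (Qk e (rt p.1)) * (ph s (rt p.1) (rt p.2) *
     Fr (- s) (fun x => cconj (f x)) (rt p.1)) * f (rt p.2).
  have mH : mC H.
    apply: mCM; last exact: mC_snd.
    apply: mCM; first exact: (mC_fst (mC_Qk e0)).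
    by apply: mCM; [exact: mC_ph2|apply: mC_fst; apply: mCn_Fr; exact: iC_mC icf].
  transitivity (cI (mu R n) (fun t : tup => cI (mu R n) (fun u : tup => H (t, u)))).
    congr cI; apply/funext => t.
    rewrite conj_Fr// {1}/Fr /cIn mulrCA mulrC -cIZ; last exact: iCn_ph.
    by congr cI; apply/funext => u; rewrite /H /= [ph s (rt t) _]phC; ring.
  rewrite (cI_fubini (F := H))//.
    congr cI; apply/funext => u; rewrite -(@poisson_smooth e s)// -cIZr//.
    apply: iC_domC (Fr_iC_Qk (- s) e0 icf) _; last first.
      by move=> t; rewrite !cabsM cabs_ph mul1r.
    apply: mCM; first exact: mC_Qk.
    by apply: mCM; [exact: mC_ph|apply: mCn_Fr; exact: iC_mC icf].
  rewrite (eq_integral (fun t : tup => (cabs (rc (Qk e (rt t)) * Fr (- s) (fun x => cconj (f x)) (rt t)))%:E * \int[mu R n]_u (cabs (f (rt u)))%:E)%E).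
    rewrite ge0_integralZr//; last 3 first.
    - by apply: m_cabsE; exact: iC_mC (Fr_iC_Qk (- s) e0 icf).
    - by move=> t _; rewrite lee_fin cabs_ge0.
    - by apply: integral_ge0 => t _; rewrite lee_fin cabs_ge0.
    rewrite lte_mul_pinfty//.
    - by apply: integral_ge0 => t _; rewrite lee_fin cabs_ge0.
    - rewrite ge0_fin_numE; last by apply: integral_ge0 => t _; rewrite lee_fin cabs_ge0.
      exact: iC_cabs_lty (Fr_iC_Qk (- s) e0 icf).
    - exact: iC_cabs_lty.
  move=> t _; rewrite -ge0_integralZl//.
  - by apply: eq_integral => u _; rewrite /H /= !cabsM !cabs_ph !mul1r EFinM.
  - exact: m_cabsE.
  - by move=> u _; rewrite lee_fin cabs_ge0.
  - by rewrite lee_fin cabs_ge0.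
pose u (t : tup) := cabs (f (rt t)).
have mu_ : measurable_fun setT u by exact: m_cabs.
have u0 t : 0 <= u t by exact: cabs_ge0.
pose K (p : tup * tup) := rc (Pk e (rt p.1) (rt p.2)) * cconj (f (rt p.2)) * f (rt p.1).
have mK : mC K.
  apply: mCM; last exact: mC_fst.
  apply: mCM; first by apply: mC_rc; exact: m_Pk2.
  exact: (mC_snd (f := fun y => cconj (f y)) (mC_conj mf)).
have mKs x : mC (fun t : tup => rc (Pk e x (rt t)) * cconj (f (rt t))).
  by apply: mCM; [apply: mC_rc; exact: m_Pk|exact: mC_conj].
have iK x : iC (mu R n) (fun t : tup => rc (Pk e x (rt t)) * cconj (f (rt t))).
  (* For fixed [e] the kernel is bounded by its value on the diagonal, so integrability of [f] is
     enough. *)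
  pose D := (e / pi / e ^+ 2) ^+ n.
  apply: (@iCMb _ _ _ _ _ _ D) => //.
  - by apply: mC_rc; exact: m_Pk.
  - move=> t; rewrite cabs_real ger0_norm ?Pk_ge0// /D -[n in leRHS]card_ord -prodr_const.
    apply: ler_prod => i _; rewrite cauchy_ge0//=; apply: ler_wpM2l.
      by apply: divr_ge0; [exact: ltW|exact: pi_ge0].
    by rewrite lef_pV2 ?posrE ?ltr_pwDl ?exprn_gt0 ?sqr_ge0// lerDl sqr_ge0.
apply: (@le_trans _ _ (2%:E * \int[mu R n]_t (2%:E * \int[mu R n]_y (cabs (K (t, y)))%:E))%E).
  apply: (le_trans (cI_norm _ _)).
    apply: mCM => //.
    apply: (@mC_cI _ _ _ _ _ (mu R n) (fun p : tup * tup => rc (Pk e (rt p.1) (rt p.2)) * cconj (f (rt p.2)))).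
    apply: mCM; first by apply: mC_rc; exact: m_Pk2.
    exact: (mC_snd (f := fun y => cconj (f y)) (mC_conj mf)).
  rewrite lee_wpmul2l//; apply: ge0_le_integral => //.
  - by move=> t _; rewrite lee_fin cabs_ge0.
  - apply: m_cabsE; apply: mCM => //.
    apply: (@mC_cI _ _ _ _ _ (mu R n) (fun p : tup * tup => rc (Pk e (rt p.1) (rt p.2)) * cconj (f (rt p.2)))).
    apply: mCM; first by apply: mC_rc; exact: m_Pk2.
    exact: (mC_snd (f := fun y => cconj (f y)) (mC_conj mf)).
  - apply: measurable_funeM.
    apply: (measurable_fun_fubini_tonelli_F (fun p => (cabs (K p))%:E)).
      exact: m_cabsE.
    by move=> p; rewrite lee_fin cabs_ge0.
  - move=> t _; rewrite -cIZr; last exact: iK.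
    by apply: cI_norm; apply: mCM => //; exact: mC_cst.
have mKE : measurable_fun setT (fun p : tup * tup => (cabs (K p))%:E) by exact: m_cabsE.
rewrite ge0_integralZl//; last 2 first.
- apply: (measurable_fun_fubini_tonelli_F (fun p => (cabs (K p))%:E)) => //.
  by move=> p; rewrite lee_fin cabs_ge0.
- by move=> t _; apply: integral_ge0 => y _; rewrite lee_fin cabs_ge0.
rewrite muleA -EFinM (_ : 2 * 2 = 4 :> R); last by ring.
rewrite lee_wpmul2l//.
(* [J] and [J'] are the two halves of [a b <= (a^2 + b^2) / 2]; each integrates to half of the
   squared L^2 norm. *)
pose J (p : tup * tup) : \bar R := (2^-1 * (u p.1 ^+ 2 * Pk e (rt p.1) (rt p.2)))%:E.
pose J' (p : tup * tup) : \bar R := (2^-1 * (u p.2 ^+ 2 * Pk e (rt p.1) (rt p.2)))%:E.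
have J0 p : (0 <= J p)%E by rewrite lee_fin !mulr_ge0 ?sqr_ge0 ?Pk_ge0.
have J'0 p : (0 <= J' p)%E by rewrite lee_fin !mulr_ge0 ?sqr_ge0 ?Pk_ge0.
have mJ : measurable_fun setT J.
  apply/measurable_EFinP; apply: measurable_funM => //; apply: measurable_funM; last exact: m_Pk2.
  by apply: measurable_funX; apply: (measurableT_comp mu_); exact: measurable_fst.
have mJ' : measurable_fun setT J'.
  apply/measurable_EFinP; apply: measurable_funM => //; apply: measurable_funM; last exact: m_Pk2.
  by apply: measurable_funX; apply: (measurableT_comp mu_); exact: measurable_snd.
have EJ : (\int[mu R n]_t \int[mu R n]_y J (t, y) = 2^-1%:E * \int[mu R n]_t (u t ^+ 2)%:E)%E.
  rewrite -ge0_integralZl//.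
  - apply: eq_integral => t _; rewrite /J /=.
    rewrite (eq_integral (fun y : tup => (2^-1 * u t ^+ 2)%:E * (Pk e (rt t) (rt y))%:E)%E).
      rewrite ge0_integralZl ?Pk_int ?mule1 ?EFinM//.
      - by apply/measurable_EFinP; exact: m_Pk.
      - by move=> y _; rewrite lee_fin Pk_ge0.
      - by rewrite lee_fin mulr_ge0 ?sqr_ge0.
    by move=> y _; rewrite mulrA EFinM.
  - by apply/measurable_EFinP; exact: measurable_funX.
  - by move=> t _; rewrite lee_fin sqr_ge0.
have EJ' : (\int[mu R n]_t \int[mu R n]_y J' (t, y) = 2^-1%:E * \int[mu R n]_t (u t ^+ 2)%:E)%E.
  rewrite -EJ; transitivity (\int[mu R n]_y \int[mu R n]_t J' (t, y))%E.
    exact: fubini_tonelli.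
  congr (integral _ _ _); apply/funext => y; congr (integral _ _ _); apply/funext => t.
  by rewrite /J /J' /fst /snd PkC.
rewrite (_ : (\int[mu R n]_t (cabs (f (rt t)) ^+ 2)%:E)%E =
   (\int[mu R n]_t \int[mu R n]_y J (t, y) + \int[mu R n]_t \int[mu R n]_y J' (t, y))%E); last first.
  rewrite EJ EJ' -ge0_muleDl ?lee_fin//.
  - by rewrite -EFinD (_ : 2^-1 + 2^-1 = 1 :> R) ?mul1e//; field.
have EK : (\int[mu R n]_x \int[mu R n]_y (cabs (K (x, y)))%:E =
    \int[(mu R n \x mu R n)%E]_p (cabs (K p))%:E)%E.
  by rewrite fubini_tonelli1// => p; rewrite lee_fin cabs_ge0.
rewrite EK -!fubini_tonelli1// -ge0_integralD//.
apply: ge0_le_integral => //.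
- by move=> p _; rewrite lee_fin cabs_ge0.
- exact: emeasurable_funD.
- move=> p _; rewrite /J /J' /K -EFinD lee_fin !cabsM cabs_real cabs_conj ger0_norm ?Pk_ge0// -/(u p.1) -/(u p.2).
  have := Pk_ge0 (rt p.1) (rt p.2) e0; move: (Pk _ _ _) (u p.1) (u p.2) => P a b P0.
  have := mulr_ge0 P0 (sqr_ge0 (a - b)); lra.
Qed.

Lemma cvg_harm0 : (k.+1%:R^-1 : R) @[k --> \oo] --> 0.
Proof. exact: cvg_harmonic. Qed.

Lemma cvg_Qk (xi : pt) : Qk k.+1%:R^-1 xi @[k --> \oo] --> (1 : R).
Proof.
have : expR (- (k.+1%:R^-1 * (2 * pi * \sum_i `|xi 0 i|))) @[k --> \oo] -->
    expR (- (0 * (2 * pi * \sum_i `|xi 0 i|))).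
  apply: (@cvg_comp _ _ _ (fun k => - (k.+1%:R^-1 * (2 * pi * \sum_i `|xi 0 i|))) expR).
    by apply: cvgN; apply: cvgZl; exact: cvg_harm0.
  exact: continuous_expR.
by rewrite mul0r oppr0 expR0.
Qed.

Lemma cvg_Qk_mul (xi : pt) (c : R) : Qk k.+1%:R^-1 xi * c @[k --> \oo] --> c.
Proof.
have : Qk k.+1%:R^-1 xi * c @[k --> \oo] --> 1 * c by apply: cvgZl; exact: cvg_Qk.
by rewrite mul1r.
Qed.

(** Fatou's lemma as the regularisation is removed. Square integrability of [f] is not assumed, the
    right side may be infinite. *)
Lemma plancherel_le s f : s ^+ 2 = 1 -> iCn f ->
  (\int[mu R n]_t (cabs (Fr s f (rt t)) ^+ 2)%:E <=
   4%:E * \int[mu R n]_t (cabs (f (rt t)) ^+ 2)%:E)%E.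
Proof.
move=> s1 itf; have mf := iC_mC itf.
apply: (@fatou_le _ _ _ _ (fun k t => Qk k.+1%:R^-1 (rt t) * cabs (Fr s f (rt t)) ^+ 2)).
- move=> k; apply: measurable_funM.
    by have [] := mC_Qk (_ : 0 < k.+1%:R^-1 :> R) => //; rewrite invr_gt0.
  by apply: measurable_funX; apply: m_cabs; exact: mCn_Fr.
- by move=> k t; rewrite mulr_ge0 ?Qk_ge0 ?sqr_ge0.
- by move=> t; exact: cvg_Qk_mul.
- by move=> k; apply: poisson_plancherel => //; rewrite invr_gt0.
Qed.

(** At distance at least [d] in coordinate [i], the kernel of width [e] is at most [e (1 + d^-2)]
    times the kernel of width 1, which still has integral 1. *)
Lemma Pk_far (e : R) (x : pt) i (d : R) : 0 < e -> 0 < d ->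
  (\int[mu R n]_t ((if d <= `|tnth t i - x 0 i| then Pk e x (rt t) else 0)%:E) <=
   (e * (1 + d ^- 2))%:E)%E.
Proof.
move=> e0 d0; have p0 := pi_gt0 R.
pose f (j : 'I_n) (z : R) := if j == i then
   e * (1 + d ^- 2) * (1 / pi / (1 ^+ 2 + (z - x 0 j) ^+ 2)) else
   e / pi / (e ^+ 2 + (z - x 0 j) ^+ 2).
have c0 : 0 <= e * (1 + d ^- 2) by rewrite mulr_ge0 ?ltW// ltr_pwDl// invr_ge0 sqr_ge0.
have f0 j z : 0 <= f j z.
  rewrite /f; case: ifP => _; last exact: cauchy_ge0.
  by apply: mulr_ge0; [exact: c0|exact: cauchy_ge0].
have mf j : measurable_fun setT (f j).
  rewrite /f; case: (j == i); last exact: cauchy_meas.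
  apply: measurable_funM => //; exact: (@cauchy_meas R 1).
have itf j : leb.-integrable setT (EFin \o f j).
  rewrite /f; case: (j == i); last exact: cauchy_integrable.
  exact: (integrableZl measurableT _ (cauchy_integrable (x 0 j) (@ltr01 R))).
have If j : (\int[leb]_z f j z)%R = if j == i then e * (1 + d ^- 2) else 1.
  rewrite /f; case: (j == i); last by rewrite /Rintegral cauchy_int.
  rewrite RintegralZl//; last exact: cauchy_integrable.
  by rewrite /Rintegral cauchy_int//= mulr1.
have <- : (\int[mu R n]_t (\prod_j f j (tnth t j))%:E)%E = (e * (1 + d ^- 2))%:E.
  rewrite ge0_integral_prod//; congr EFin; rewrite (bigD1 i)//= big1 ?mulr1.
    by rewrite If eqxx.
  by move=> j /negbTE ji; rewrite If ji.
apply: ge0_le_integral => //.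
- by move=> t _; rewrite lee_fin; case: ifP => // _; exact: Pk_ge0.
- apply/measurable_EFinP; apply: measurable_fun_ifT => //.
  + rewrite (_ : (fun t : tup => _) = (fun z : R => d <= z) \o (fun t : tup => `|tnth t i - x 0 i|))//.
    apply: measurableT_comp.
      by apply: measurable_fun_ler.
    apply: measurableT_comp => //; apply: measurable_funB => //; exact: measurable_tnth.
  + exact: m_Pk.
- apply/measurable_EFinP; apply: measurable_prod => j _.
  by apply: (measurableT_comp (mf j)); exact: measurable_tnth.
- move=> t _; rewrite lee_fin; case: ifP => dz; last by rewrite prodr_ge0.
  apply: ler_prod => j _; rewrite rtE cauchy_ge0//= /f; case: eqP => [->|//].
  have z2 : d ^+ 2 <= (tnth t i - x 0 i) ^+ 2.
    by rewrite -[leRHS]real_normK ?num_real// ler_pXn2r ?nnegrE// ltW.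
  move: z2; set w := (_ - _) ^+ 2 => z2.
  have w0 : 0 < w by rewrite (lt_le_trans _ z2)// exprn_gt0.
  rewrite expr1n [leRHS](_ : _ = e / pi * ((1 + d ^- 2) / (1 + w))); last first.
    by rewrite div1r mulrACA.
  apply: ler_wpM2l; first by apply: divr_ge0; exact: ltW.
  rewrite ler_pdivlMr ?ltr_pwDl ?(ltW w0)// -[leRHS]mul1r mulrC ler_pdivrMr ?ltr_pwDl ?exprn_gt0 ?(ltW w0)//.
  rewrite (@le_trans _ _ ((1 + d ^- 2) * w))//; last first.
    by rewrite mul1r ler_wpM2l// ?lerDr ?sqr_ge0// addr_ge0// invr_ge0 sqr_ge0.
  rewrite mulrDl mul1r addrC lerD2l mulrC ler_pdivlMr ?exprn_gt0// mul1r//.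
Qed.

(** The regularised integral [L k] is evaluated twice: by dominated convergence it tends to the
    inversion integral, and as a Poisson integral of [g] it tends to [g x]. *)
Lemma fourier_inversion (s : R) (g : pt -> R[i]) (B : R) (x : pt) : s ^+ 2 = 1 -> iCn g ->
  (forall y, cabs (g y) <= B) ->
  (forall eta : R, 0 < eta -> exists2 d : R, 0 < d & forall y : pt,
      (forall i, `|y 0 i - x 0 i| < d) -> cabs (g y - g x) <= eta) ->
  iCn (Fr (- s) g) -> Fr s (Fr (- s) g) x = g x.
Proof.
move=> s1 ig gB gc iF.
have mg := iC_mC ig; have mF := iC_mC iF.
pose L k := cIn (fun xi => rc (Qk k.+1%:R^-1 xi) * (ph s xi x * Fr (- s) g xi)).
have k0 k : 0 < (k.+1%:R^-1 : R) by rewrite invr_gt0.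
have [c1 c2] : cre (L k) @[k --> \oo] --> cre (Fr s (Fr (- s) g) x) /\
    cim (L k) @[k --> \oo] --> cim (Fr s (Fr (- s) g) x).
  apply: (cI_dct (g := fun t : tup => cabs (Fr (- s) g (rt t)))).
  - move=> k; apply: mCM; first exact: mC_Qk.
    by apply: mCM; [exact: mC_ph|].
  - by apply: mCM; [exact: mC_ph|].
  - exact: i_cabs.
  - move=> k t; rewrite !cabsM cabs_ph mul1r cabs_real ger0_norm ?Qk_ge0//.
    by rewrite ler_piMl ?cabs_ge0// Qk_le1// ltW.
  - by move=> t; under eq_fun do rewrite cre_rcM; exact: cvg_Qk_mul.
  - by move=> t; under eq_fun do rewrite cim_rcM; exact: cvg_Qk_mul.
have LE k : L k = cIn (fun y => rc (Pk k.+1%:R^-1 x y) * g y) by exact: poisson_smooth.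
have B0 : 0 <= B by exact: le_trans (cabs_ge0 _) (gB 0).
(* Near [x] the integrand is within [eta]. Far from [x] some coordinate differs by at least [d];
   summing [Pk_far] over the coordinates, with [2 B] bounding the difference, gives [D]. *)
have key eta : 0 < eta -> exists D, forall k, cabs (L k - g x) <= 2 * eta + D * k.+1%:R^-1.
  move=> eta0; have [d d0 hd] := gc _ eta0.
  exists (2 * (\sum_(i < n) (2 * B * (1 + d ^- 2)))) => k.
  have iP := Pk_integrable x (k0 k).
  have mP := m_Pk x (k0 k).
  have iPk : iC (mu R n) (fun t : tup => rc (Pk k.+1%:R^-1 x (rt t))).
    by apply: (iC_dom (mC_rc mP) iP) => t; rewrite cabs_real ger0_norm// Pk_ge0.
  have iPg (z : R[i]) : iC (mu R n) (fun t : tup => rc (Pk k.+1%:R^-1 x (rt t)) * z).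
    by under eq_fun do rewrite mulrC; exact: iCZ.
  have iPg' : iC (mu R n) (fun t : tup => rc (Pk k.+1%:R^-1 x (rt t)) * g (rt t)).
    under eq_fun do rewrite mulrC; exact: (@iCMb _ _ _ _ _ _ B).
  have -> : L k - g x = cIn (fun y => rc (Pk k.+1%:R^-1 x y) * (g y - g x)).
    rewrite LE; have E : - g x = cIn (fun y => rc (Pk k.+1%:R^-1 x y) * (- g x)).
      by rewrite /cIn cIZr// cI_rc /Rintegral Pk_int//= mul1r.
    rewrite [in LHS]E /cIn -cI_add//; congr cI; apply/funext => t; ring.
  rewrite -lee_fin; apply: (le_trans (cI_norm _ _)).
    by apply: mCM; [exact: mC_rc|apply: mCD => //; exact: mC_cst].
  pose far i (t : tup) := if d <= `|tnth t i - x 0 i| then Pk k.+1%:R^-1 x (rt t) else 0.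
  have far0 i t : 0 <= far i t by rewrite /far; case: ifP => // _; exact: Pk_ge0.
  have mfar i : measurable_fun setT (far i).
    apply: measurable_fun_ifT => //.
    rewrite (_ : (fun t : tup => _) = (fun z : R => d <= z) \o (fun t : tup => `|tnth t i - x 0 i|))//.
    apply: measurableT_comp; first by apply: measurable_fun_ler.
    by apply: measurableT_comp => //; apply: measurable_funB => //; exact: measurable_tnth.
  rewrite -(mulrA 2 (\sum_(i < n) _)) -mulrDr EFinM lee_wpmul2l//.
  apply: (@le_trans _ _ (\int[mu R n]_t (eta%:E * (Pk k.+1%:R^-1 x (rt t))%:E +
     \sum_(i < n) (2 * B)%:E * (far i t)%:E))%E).
    apply: ge0_le_integral => //.
    - by move=> t _; rewrite lee_fin cabs_ge0.
    - apply: m_cabsE; apply: mCM; [exact: mC_rc|apply: mCD => //; exact: mC_cst].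
    - apply: emeasurable_funD.
        by apply: measurable_funeM; exact/measurable_EFinP.
      apply: emeasurable_sum => i; apply: measurable_funeM; exact/measurable_EFinP.
    - move=> t _; rewrite -EFinM; under eq_bigr do rewrite -EFinM.
      rewrite sumEFin -EFinD lee_fin cabsM cabs_real ger0_norm ?Pk_ge0//.
      have S0 : 0 <= \sum_(i < n) 2 * B * far i t.
        by apply: sumr_ge0 => i _; rewrite !mulr_ge0.
      have [/existsP[i hi]|/existsPn h] := boolP [exists i, d <= `|tnth t i - x 0 i|].
        have h2 : 2 * B * far i t <= \sum_(i < n) 2 * B * far i t.
          by rewrite (bigD1 i)//= lerDl; apply: sumr_ge0 => j _; rewrite !mulr_ge0.
        apply: (@le_trans _ _ (2 * B * far i t)); last first.
          by apply: (le_trans h2); rewrite lerDr mulr_ge0 ?Pk_ge0// ltW.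
        rewrite /far hi mulrC ler_wpM2r ?Pk_ge0// (le_trans (cabsD _ _))//.
        by rewrite cabsN mulr2n mulrDl mul1r lerD.
      rewrite ler_wpDr// mulrC ler_wpM2r ?Pk_ge0//; apply: hd => i.
      by rewrite rtE ltNge; exact: h.
  rewrite ge0_integralD//; last 4 first.
  - by move=> t _; rewrite mule_ge0// lee_fin ?Pk_ge0// ltW.
  - by apply: measurable_funeM; exact/measurable_EFinP.
  - by move=> t _; apply: sume_ge0 => i _; rewrite mule_ge0// lee_fin// mulr_ge0.
  - apply: emeasurable_sum => i; apply: measurable_funeM; exact/measurable_EFinP.
  rewrite ge0_integralZl ?Pk_int ?mule1//; last 3 first.
  - exact/measurable_EFinP.
  - by move=> t _; rewrite lee_fin Pk_ge0.
  - by rewrite lee_fin ltW.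
  rewrite EFinD leeD2l// ge0_integral_sum//; last 2 first.
  - by move=> i; apply: measurable_funeM; exact/measurable_EFinP.
  - by move=> i t _; rewrite mule_ge0// lee_fin// mulr_ge0.
  rewrite mulr_suml -sumEFin; apply: lee_sum => i _.
  rewrite ge0_integralZl//; last 3 first.
  - exact/measurable_EFinP.
  - by move=> t _; rewrite lee_fin.
  - by rewrite lee_fin mulr_ge0.
  have -> : 2 * B * (1 + d ^- 2) / k.+1%:R = (2 * B) * (k.+1%:R^-1 * (1 + d ^- 2)).
    by rewrite -mulrA [X in _ * X]mulrC.
  rewrite [X in (_ <= X)%E]EFinM; apply: lee_wpmul2l; first by rewrite lee_fin mulr_ge0.
  exact: (@Pk_far _ x i d).
have lim (h : R[i] -> R) : (forall z w, `|h z - h w| <= cabs (z - w)) ->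
    h (L k) @[k --> \oo] --> h (g x).
  move=> hh; apply/cvgrPdist_le => eta eta0.
  have e4 : 0 < eta / 4 by rewrite divr_gt0.
  have [D hD] := key _ e4.
  have D0 : 0 < `|D| + 1 by rewrite ltr_wpDl.
  have w0 : 0 < eta / 2 / (`|D| + 1) by rewrite !divr_gt0.
  near=> k; rewrite distrC (le_trans (hh _ _))// (le_trans (hD k))//.
  have : D * k.+1%:R^-1 <= eta / 2; last by move: (D * _) => w; lra.
  apply: (@le_trans _ _ ((`|D| + 1) * k.+1%:R^-1)).
    apply: ler_wpM2r; first exact: ltW.
    by rewrite (le_trans (ler_norm D))// lerDl.
  rewrite mulrC -ler_pdivlMr// -[leLHS]ger0_norm ?invr_ge0//; near: k.
  by have /cvgr0Pnorm_le/(_ _ w0) := cvg_harm0.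
apply: c_ext.
- apply: (cvg_unique _ c1); first exact: norm_hausdorff.
  apply: lim => z w; apply: le_trans (cre_le _).
  by rewrite creD; case: w.
- apply: (cvg_unique _ c2); first exact: norm_hausdorff.
  apply: lim => z w; apply: le_trans (cim_le _).
  by rewrite cimD; case: w.
Unshelve. all: by end_near. Qed.

End Fourier.

(** * Smooth functions *)

Section Smooth.
Variables (R : realType) (n : nat).
Notation pt := 'rV[R]_n.
Implicit Types (h g : pt -> R) (x : pt).

Definition eb (i : 'I_n) : pt := delta_mx 0 i.
Definition pd (i : 'I_n) h : pt -> R := fun x => derive h x (eb i).
Definition pder h x i (a : R) : Prop := is_derive x (eb i) h a.

Lemma pder_line h x i a : pder h x i a <-> der (fun t => h (t *: eb i + x)) 0 a.
Proof.
have E : (fun k : R => k^-1 *: ((h \o shift x) (k *: eb i) - h x)) =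
   (fun k : R => k^-1 *: (((fun t => h (t *: eb i + x)) \o shift 0) (k *: (1 : R)) -
      (fun t => h (t *: eb i + x)) 0)).
  by apply/funext => k /=; rewrite addr0 scale0r add0r /GRing.scale /= mulr1.
split=> -[h1 h2]; split.
- by move: h1; rewrite /derivable E.
- by move: h2; rewrite /derive E.
- by move: h1; rewrite /derivable E.
- by move: h2; rewrite /derive E.
Qed.
Lemma pder_at h x i a (y : R) : pder h (y *: eb i + x) i a ->
  der (fun t => h (t *: eb i + x)) y a.
Proof.
move=> /pder_line d.
have := @dchain _ (fun t => t - y) (fun t => h (t *: eb i + (y *: eb i + x))) y 1 a.
rewrite subrr => /(_ d); rewrite mulr1.
have -> : (fun z : R => h ((z - y) *: eb i + (y *: eb i + x))) = (fun t => h (t *: eb i + x)).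
  by apply/funext => t; rewrite addrA -scalerDl subrK.
apply; rewrite -[X in der _ _ X](subr0 1); apply: dD; [exact: dId|rewrite oppr0; exact: dC].
Qed.
Lemma pderE h x i a : pder h x i a -> pd i h x = a. Proof. by case. Qed.
Lemma derivable_pder h x i : derivable h x (eb i) -> pder h x i (pd i h x).
Proof. by move=> ?; split. Qed.
Lemma pder_derivable h x i a : pder h x i a -> derivable h x (eb i). Proof. by case. Qed.
Lemma pderD h g x i a b : pder h x i a -> pder g x i b -> pder (fun x => h x + g x) x i (a + b).
Proof. by move=> h1 h2; exact: is_deriveD. Qed.
Lemma pderM h g x i a b : pder h x i a -> pder g x i b ->
  pder (fun x => h x * g x) x i (a * g x + h x * b).
Proof.
move=> h1 h2; apply: is_derive_eq (is_deriveM h1 h2) _.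
by rewrite /GRing.scale /= addrC mulrC.
Qed.
Lemma pder_comp h (F : R -> R) x i a b : der F (h x) b -> pder h x i a ->
  pder (fun x => F (h x)) x i (b * a).
Proof.
move=> dF /pder_line dh; apply/pder_line.
apply: (@dchain _ (fun t => h (t *: eb i + x)) F) => //.
by rewrite scale0r add0r.
Qed.
Lemma pder_cst c x i : pder (fun=> c) x i 0.
Proof. by apply/pder_line; exact: dC. Qed.
Lemma pder_coord j x i : pder (fun x : pt => x 0 j) x i (i == j)%:R.
Proof.
apply/pder_line; rewrite (_ : (fun t : R => _) = (fun t => t * (i == j)%:R + x 0 j)).
  apply: deq; first by drv.
  by rewrite mul1r mulr0 !addr0.
by apply/funext => t; rewrite !mxE eqxx /= eq_sym.
Qed.
Lemma pder_scale h (c : R) x i a : pder h (c *: x) i a ->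
  pder (fun x => h (c *: x)) x i (a * c).
Proof.
move=> /pder_line d; apply/pder_line.
rewrite (_ : (fun t : R => _) = (fun t => (fun u => h (u *: eb i + c *: x)) (c * t))); last first.
  by apply/funext => t; rewrite scalerDr scalerA.
apply: (@dchain _ (fun t => c * t) (fun u => h (u *: eb i + c *: x))); first by rewrite mulr0.
exact: dMl.
Qed.
Lemma pder_near h g x i a : pder h x i a -> (\forall y \near x, h y = g y) -> pder g x i a.
Proof.
move=> [h1 h2] hg; have hg' : {near x, h =1 g} by [].
split; first exact: (near_eq_derivable hg' h1).
by rewrite -(near_eq_derive _ hg').
Qed.

Lemma dpart_rcons s i h : dpart (rcons s i) h = dpart s (pd i h).
Proof. by elim: s => //= j s ->. Qed.
Lemma smooth_pd i h : smooth h -> smooth (pd i h).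
Proof. by move=> sh s; rewrite -dpart_rcons; exact: sh. Qed.
Lemma smooth_cont h : smooth h -> continuous h.
Proof. by move=> /(_ [::])[]. Qed.
Lemma smooth_pder h x i : smooth h -> pder h x i (pd i h x).
Proof. by move=> /(_ [::])[_ d]; apply: derivable_pder; exact: d. Qed.

(** Coinduction for smoothness: [P] is an invariant preserved by partial derivatives, so iterated
    derivatives never have to be computed. *)
Lemma smooth_class (P : (pt -> R) -> Prop) :
  (forall h, P h -> continuous h /\ forall i, exists2 g, P g & forall x, pder h x i (g x)) ->
  forall h, P h -> smooth h.
Proof.
move=> H h Ph s.
have : P (dpart s h).
  elim: s => //= i s /H[_ /(_ i)[g Pg dg]].
  by rewrite (_ : (fun x => _) = g)//; apply/funext => x; exact: pderE (dg x).
move=> /H[c d]; split => // x i; have [g _ /(_ x)] := d i.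
exact: pder_derivable.
Qed.

(** Differentiating a product or a composition leaves [S] but stays among sums and products of
    members of [S]. *)
Inductive alg (S : (pt -> R) -> Prop) : (pt -> R) -> Prop :=
| alg_base h : S h -> alg S h
| alg_add h g : alg S h -> alg S g -> alg S (fun x => h x + g x)
| alg_mul h g : alg S h -> alg S g -> alg S (fun x => h x * g x).

Lemma ptcont_add h g : continuous h -> continuous g -> continuous (fun x => h x + g x).
Proof. by move=> ch cg x; exact: (cvgD (ch x) (cg x)). Qed.
Lemma ptcont_mul h g : continuous h -> continuous g -> continuous (fun x => h x * g x).
Proof. by move=> ch cg x; exact: (cvgM (ch x) (cg x)). Qed.

Lemma smooth_alg (S : (pt -> R) -> Prop) :
  (forall h, S h -> continuous h /\ forall i, exists2 g, alg S g & forall x, pder h x i (g x)) ->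
  forall h, alg S h -> smooth h.
Proof.
move=> H; apply: smooth_class => h; elim=> {h} [h Sh|h g _ [ch dh] _ [cg dg]|h g ah [ch dh] ag [cg dg]].
- exact: H.
- split => [|i]; first exact: ptcont_add.
  have [h' ah' dh'] := dh i; have [g' ag' dg'] := dg i.
  exists (fun x => h' x + g' x); first exact: alg_add.
  by move=> x; exact: pderD.
- split => [|i]; first exact: ptcont_mul.
  have [h' ah' dh'] := dh i; have [g' ag' dg'] := dg i.
  exists (fun x => h' x * g x + h x * g' x); last by move=> x; exact: pderM.
  by apply: alg_add; apply: alg_mul.
Qed.

Lemma smooth_step h : smooth h -> continuous h /\
  forall i, exists2 g, alg (@smooth R n) g & forall x, pder h x i (g x).
Proof.
move=> sh; split; first exact: smooth_cont.
move=> i; exists (pd i h); first by apply: alg_base; exact: smooth_pd.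
by move=> x; exact: smooth_pder.
Qed.
Lemma smooth_mul h g : smooth h -> smooth g -> smooth (fun x => h x * g x).
Proof.
move=> sh sg; apply: (smooth_alg smooth_step).
by apply: alg_mul; apply: alg_base.
Qed.
Lemma smooth_add h g : smooth h -> smooth g -> smooth (fun x => h x + g x).
Proof.
move=> sh sg; apply: (smooth_alg smooth_step).
by apply: alg_add; apply: alg_base.
Qed.
Lemma smooth_cst c : smooth (fun _ : pt => c).
Proof.
apply: (@smooth_class (fun h => exists c, h = (fun=> c))); last by exists c.
move=> _ [{}c ->]; split; first exact: (@cst_continuous pt R c).
by move=> i; exists (fun=> 0); [exists 0|move=> x; exact: pder_cst].
Qed.
Lemma smooth_opp h : smooth h -> smooth (fun x => - h x).
Proof.
move=> sh; have := smooth_mul (smooth_cst (-1)) sh.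
by under eq_fun do rewrite mulN1r.
Qed.
Lemma smooth_sub h g : smooth h -> smooth g -> smooth (fun x => h x - g x).
Proof. by move=> sh sg; exact: (smooth_add sh (smooth_opp sg)). Qed.
Lemma smooth_coord j : smooth (fun x : pt => x 0 j).
Proof.
apply: (@smooth_class (fun h => smooth h \/ h = (fun x : pt => x 0 j))); last by right.
move=> h [sh|->].
  split; first exact: smooth_cont.
  by move=> i; exists (pd i h); [left; exact: smooth_pd|move=> x; exact: smooth_pder].
split; first exact: coord_continuous.
move=> i; exists (fun=> (i == j)%:R); first by left; exact: smooth_cst.
by move=> x; exact: pder_coord.
Qed.
Lemma smooth_sum (I : Type) (s : seq I) (F : I -> pt -> R) :
  (forall i, smooth (F i)) -> smooth (fun x => \sum_(i <- s) F i x).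
Proof.
move=> sF; elim: s => [|i s IH].
  by under eq_fun do rewrite big_nil; exact: smooth_cst.
by under eq_fun do rewrite big_cons; exact: smooth_add.
Qed.
Lemma smooth_dotpp : smooth (fun x : pt => dotp x x).
Proof. by apply: smooth_sum => i; apply: smooth_mul; exact: smooth_coord. Qed.

Lemma smooth_scale h (c : R) : smooth h -> smooth (fun x => h (c *: x)).
Proof.
move=> sh.
pose S := (fun g => exists2 h, smooth h & exists c', g = (fun x => c' * h (c *: x))).
apply: (@smooth_class S); last first.
  by exists h => //; exists 1; apply/funext => x; rewrite mul1r.
move=> _ [{sh}h sh [c' ->]]; split.
  apply: ptcont_mul; first exact: (@cst_continuous pt R c').
  move=> x; apply: (@continuous_comp _ _ _ (fun x : pt => c *: x) h); last exact: smooth_cont.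
  exact: scaler_continuous.
move=> i; exists (fun x => (c' * c) * pd i h (c *: x)).
  by exists (pd i h); [exact: smooth_pd|exists (c' * c)].
move=> x; have := pderM (pder_cst c' x i) (pder_scale (smooth_pder (c *: x) i sh)).
rewrite (_ : 0 * _ + _ = c' * c * pd i h (c *: x))//; ring.
Qed.

(** The whole sequence of derivatives is the witness; for trigonometric functions and power series
    it is explicit. *)
Definition sm1 (F : R -> R) := exists D : nat -> R -> R,
  D 0%N = F /\ forall k (x : R), der (D k) x (D k.+1 x).
Lemma sm1_D (F : R -> R) : sm1 F -> exists2 G, sm1 G & forall x : R, der F x (G x).
Proof.
move=> [D [<- dD]]; exists (D 1%N); last by move=> x; exact: dD.
by exists (fun k => D k.+1).
Qed.

Lemma smooth_comp (F : R -> R) h : sm1 F -> smooth h -> smooth (fun x => F (h x)).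
Proof.
move=> sF sh.
pose S := (fun g => smooth g \/ exists2 F, sm1 F & g = (fun x => F (h x))).
apply: (@smooth_alg S); last by apply: alg_base; right; exists F.
move=> g [sg|[{sF}F /sm1_D[G sG dF] ->]].
  split; first exact: smooth_cont.
  move=> i; exists (pd i g); last by move=> x; exact: smooth_pder.
  by apply: alg_base; left; exact: smooth_pd.
split.
  move=> x; apply: continuous_comp; first exact: smooth_cont.
  exact: d_cont (dF _).
move=> i; exists (fun x => G (h x) * pd i h x).
  by apply: alg_mul; apply: alg_base; [right; exists G|left; exact: smooth_pd].
by move=> x; apply: pder_comp => //; exact: smooth_pder.
Qed.

Lemma cont_at_local h g x : continuous g -> (\forall y \near x, h y = g y) ->
  {for x, continuous h}.
Proof.
move=> cg hg; have := cg x.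
have E : g x = h x by apply/esym; exact: (nbhs_singleton hg).
move=> cgx A /= hA; have h1 : nbhs x (g @^-1` A) by apply: cgx; rewrite E.
have H2 : nbhs x ([set y | h y = g y] `&` (g @^-1` A)) by apply: (@filterI pt (nbhs x) _).
by apply: (@filterS pt (nbhs x) _ _ _ _ H2) => y [/= hy gy]; rewrite /preimage /= hy.
Qed.

(** Serves for [phi0], defined by a limit that is a fixed finite sum only near each point. *)
Lemma smooth_local h :
  (forall x, exists2 g, smooth g & \forall y \near x, h y = g y) -> smooth h.
Proof.
move=> H; apply: (@smooth_class (fun h => forall x, exists2 g, smooth g & \forall y \near x, h y = g y)) => //.
move=> {H}h H; split.
  by move=> x; have [g sg hg] := H x; exact: (cont_at_local (smooth_cont sg) hg).
move=> i; exists (pd i h).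
  move=> x; have [g sg hg] := H x; exists (pd i g); first exact: smooth_pd.
  have /= := nbhs_interior hg; apply: filterS => y hy.
  by apply: near_eq_derive.
move=> x; have [g sg hg] := H x; apply: derivable_pder.
have := smooth_pder x i sg => /pder_near /(_ _)/pder_derivable; apply.
by near=> y; apply/esym; near: y; exact: hg.
Unshelve. all: by end_near. Qed.

Lemma enorm_ge0 (x : pt) : 0 <= enorm x. Proof. exact: sqrtr_ge0. Qed.
Lemma dotpp_ge0 (x : pt) : 0 <= dotp x x.
Proof. by apply: sumr_ge0 => i _; rewrite -expr2 sqr_ge0. Qed.
Lemma enorm_sqr (x : pt) : enorm x ^+ 2 = dotp x x.
Proof. by rewrite sqr_sqrtr// dotpp_ge0. Qed.
Lemma coord_le_enorm (x : pt) i : `|x 0 i| <= enorm x.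
Proof.
rewrite -sqrtr_sqr ler_wsqrtr// /dotp (bigD1 i)//= -expr2 lerDl.
by apply: sumr_ge0 => j _; rewrite -expr2 sqr_ge0.
Qed.
Lemma enorm_le_sum (x : pt) : enorm x <= \sum_i `|x 0 i|.
Proof.
have S0 : 0 <= \sum_i `|x 0 i| by exact: sumr_ge0.
rewrite -(@ler_pXn2r _ 2) ?nnegrE ?enorm_ge0// enorm_sqr /dotp.
rewrite expr2 mulr_suml; apply: ler_sum => i _.
rewrite -expr2 -real_normK ?num_real// expr2 ler_wpM2l// (bigD1 i)//= lerDl.
exact: sumr_ge0.
Qed.
Lemma enormZ (c : R) (x : pt) : enorm (c *: x) = `|c| * enorm x.
Proof.
rewrite /enorm -sqrtr_sqr -sqrtrM ?sqr_ge0//; congr Num.sqrt.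
by rewrite /dotp mulr_sumr; apply: eq_bigr => i _; rewrite !mxE; ring.
Qed.
Lemma enorm_cont : continuous (@enorm R n).
Proof.
move=> x; apply: (@continuous_comp _ _ _ (fun x : pt => dotp x x) Num.sqrt).
  exact: (smooth_cont smooth_dotpp).
exact: sqrt_continuous.
Qed.

Definition bsupp (T : zmodType) (f : pt -> T) := exists r : R, forall x i, r < `|x 0 i| -> f x = 0.

Lemma bsupp_bounded h : continuous h -> bsupp h -> exists B, forall x, `|h x| <= B.
Proof.
move=> ch [r hr].
have cK : compact [set x : pt | forall i, `[- `|r|, `|r|]%classic (x ord0 i)].
  by apply: (@rV_compact R n (fun=> `[- `|r|, `|r|]%classic)) => i; exact: segment_compact.
have /compact_bounded[M [_ /(_ (`|M| + 1))]] := continuous_compact (continuous_subspaceT ch) cK.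
rewrite (le_lt_trans (ler_norm M)) ?ltrDl// => /(_ isT) hM.
exists (`|M| + 1) => x.
have [/existsP[i hi]|/existsPn hx] := boolP [exists i, `|r| < `|x 0 i|].
  by rewrite (hr x i) ?normr0 ?addr_ge0// (le_lt_trans (ler_norm r)).
apply: hM => /=; exists x => // i /=; rewrite in_itv/= -ler_norml leNgt; exact: hx.
Qed.
Lemma bsupp_pd h i : smooth h -> bsupp h -> bsupp (pd i h).
Proof.
move=> sh [r hr]; exists r => x j hx.
apply: pderE; apply: pder_near (pder_cst 0 x i) _.
have : \forall y \near x, r < `|(y : pt) 0 j|.
  have c : continuous (fun y : pt => `|y 0 j|).
    by move=> y; apply: continuous_comp; [exact: coord_continuous|exact: norm_continuous].
  by apply: (c x [set z | r < z]); apply: open_nbhs_nbhs; split => //; exact: open_gt.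
by apply: filterS => y hy; rewrite (hr y j hy).
Qed.
End Smooth.
Arguments eb {R n} i.

(** * Schwartz functions and the Fourier transform *)

Lemma sm1_trig (R : realType) : sm1 (@cos R) /\ sm1 (@sin R).
Proof.
pose D k (x : R) := sin (x + k%:R * (pi / 2)).
have dD k (x : R) : der (D k) x (D k.+1 x).
  apply: deq; first by apply: dsin; apply: dD; [exact: dId|exact: dC].
  have -> : D k.+1 x = sin (x + k%:R * (pi / 2) + pi / 2).
    by rewrite /D -addrA; congr (sin (_ + _)); move: (pi / 2) => P; rewrite -natr1; ring.
  by rewrite addr0 mulr1 sinDpihalf.
split.
  exists (fun k => D k.+1); split => [|k x]; last exact: dD.
  by apply/funext => x; rewrite /D mul1r sinDpihalf.
exists D; split => [|k x]; last exact: dD.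
by apply/funext => x; rewrite /D mul0r addr0.
Qed.

Lemma der_under d (T : measurableType d) (R : realType) (mu : {measure set T -> \bar R})
    (h h' : R -> T -> R) (G : T -> R) (a : R) :
  (forall t, mu.-integrable setT (EFin \o h t)) ->
  (forall t y, der (h^~ y) t (h' t y)) ->
  mu.-integrable setT (EFin \o G) -> (forall t y, `|h' t y| <= G y) ->
  der (fun t => \int[mu]_y h t y) a (\int[mu]_y h' a y).
Proof.
move=> ih dh iG hG.
have E t y : partial1of2 h t y = h' t y.
  by rewrite partial1of2E; have [_ ->] := dh t y.
have aI : `]a - 1, a + 1[%classic a by rewrite /= in_itv/=; apply/andP; split; lra.
have G0 y : 0 <= G y by exact: le_trans (normr_ge0 _) (hG a y).
have i1 x : `]a - 1, a + 1[%classic x -> mu.-integrable setT (EFin \o h x) by move=> _; exact: ih.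
have d1 x y : `]a - 1, a + 1[%classic x -> setT y -> derivable (h ^~ y) x 1.
  by move=> _ _; have [] := dh x y.
have g1 x y : `]a - 1, a + 1[%classic x -> setT y -> `|partial1of2 h x y| <= G y.
  by move=> _ _; rewrite E.
split.
- exact: (derivable_under_integral measurableT aI i1 d1 G0 iG g1).
- rewrite -derive1E (differentiation_under_integral measurableT aI i1 d1 G0 iG g1).
  by apply: eq_Rintegral => y _; exact: E.
Qed.

Section Rapid.
Variables (R : realType) (n : nat).
Notation pt := 'rV[R]_n.
Notation rt := (@row_of_tuple R n).
Notation tup := (n.-tuple R).
Implicit Types (f : pt -> R[i]).

(** Decay without regularity: enough for the transform to be smooth, and stable under multiplication
    by functions of polynomial growth. *)
Definition rapid f := mCn f /\
  forall k, exists C : R, forall x, (1 + enorm x) ^+ k * cabs (f x) <= C.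

Lemma onep_enorm (x : pt) : 1 <= 1 + enorm x. Proof. by rewrite lerDl enorm_ge0. Qed.
Lemma onep_enorm0 (x : pt) : 0 < 1 + enorm x.
Proof. exact: lt_le_trans ltr01 (onep_enorm x). Qed.

(** In each coordinate [1 + x_i^2 <= (1 + |x|)^2], so decay of order [2 n] dominates the integrable
    product weight. *)
Lemma Pk_weight (x : pt) : (pi ^+ n)^-1 * (1 + enorm x) ^- (2 * n) <= Pk 1 0 x.
Proof.
have p0 := pi_gt0 R; have X := onep_enorm0 x.
have -> : (pi ^+ n)^-1 * (1 + enorm x) ^- (2 * n) = \prod_(i < n) (pi^-1 * (1 + enorm x) ^- 2).
  by rewrite prodr_const card_ord exprMn exprVn exprVn -exprM.
apply: ler_prod => i _; apply/andP; split.
  by apply: mulr_ge0; rewrite invr_ge0; [exact: ltW|apply: exprn_ge0; exact: ltW].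
rewrite div1r; apply: ler_wpM2l; first by rewrite invr_ge0 ltW.
rewrite lef_pV2 ?posrE ?exprn_gt0// ?ltr_pwDl ?sqr_ge0// mxE subr0 expr1n.
rewrite sqrrD !expr1n mul1r -real_normK ?num_real//.
have := coord_le_enorm x i; have := enorm_ge0 x; have := normr_ge0 (x 0 i).
move: `|x 0 i| (enorm x) => a b a0 b0 ab; rewrite mulr2n; nra.
Qed.
Lemma rapid_Pk f : rapid f -> exists2 C, 0 <= C & forall x, cabs (f x) <= C * Pk 1 0 x.
Proof.
move=> [_ /(_ (2 * n)%N)[C hC]]; have p0 := pi_gt0 R.
have C0 : 0 <= C.
  by apply: le_trans (hC 0); rewrite mulr_ge0 ?cabs_ge0// exprn_ge0// ltW// onep_enorm0.
exists (C * pi ^+ n); first by rewrite mulr_ge0// exprn_ge0// ltW.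
move=> x; have X := onep_enorm0 x.
have pn : 0 < (pi : R) ^+ n by rewrite exprn_gt0.
apply: (@le_trans _ _ (C * pi ^+ n * ((pi ^+ n)^-1 * (1 + enorm x) ^- (2 * n)))).
  rewrite mulrA mulfK ?gt_eqF// ler_pdivlMr ?exprn_gt0// mulrC; exact: hC.
apply: ler_wpM2l; last exact: Pk_weight.
by rewrite mulr_ge0// ltW.
Qed.
Lemma rapid_iC f : rapid f -> iCn f.
Proof.
move=> rf; have [C C0 hC] := rapid_Pk rf; case: rf => mf _.
apply: (iC_dom (g := fun t : tup => C * Pk 1 0 (rt t))) => //.
exact: (integrableZl measurableT C (Pk_integrable 0 ltr01)).
Qed.

Lemma rapid_mulb f (g : pt -> R[i]) (B : R) (j : nat) : rapid f -> mCn g ->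
  (forall x, cabs (g x) <= B * (1 + enorm x) ^+ j) -> rapid (fun x => g x * f x).
Proof.
move=> [mf hf] mg gB; split; first exact: mCM.
move=> k; have [C hC] := hf (k + j)%N; exists (`|B| * C) => x.
have X := onep_enorm0 x.
rewrite cabsM mulrA; apply: (@le_trans _ _ (`|B| * ((1 + enorm x) ^+ (k + j) * cabs (f x)))).
  rewrite mulrA ler_wpM2r ?cabs_ge0// exprD mulrCA ler_wpM2l ?exprn_ge0 ?(ltW X)//.
  by rewrite (le_trans (gB x))// ler_wpM2r ?ler_norm// exprn_ge0 ?(ltW X).
by rewrite ler_wpM2l.
Qed.

(** The factor brought down by differentiating [ph s] in direction [i]. *)
Definition cxi (s : R) (i : 'I_n) (x : pt) : R[i] := Complex 0 (s * (2 * pi * x 0 i)).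
Lemma cabs_imag (a : R) : cabs (Complex 0 a) = `|a|.
Proof. by rewrite /cabs /= expr0n /= add0r sqrtr_sqr. Qed.
Lemma mCn_coord i : measurable_fun setT (fun t : tup => rt t 0 i).
Proof. under eq_fun do rewrite rtE; exact: measurable_tnth. Qed.
Lemma rapid_cxi f s i : rapid f -> rapid (fun x => cxi s i x * f x).
Proof.
move=> rf; apply: (@rapid_mulb _ _ (`|s * (2 * pi)|) 1) => //.
  split => /=; first exact: measurable_cst.
  apply: measurable_funM => //; apply: measurable_funM => //; exact: mCn_coord.
move=> x; rewrite cabs_imag mulrA normrM expr1 ler_wpM2l//.
by rewrite (le_trans (coord_le_enorm x i))// lerDr.
Qed.

Lemma dotp_line (x xi : pt) i (t : R) : dotp x (t *: eb i + xi) = t * x 0 i + dotp x xi.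
Proof.
rewrite /dotp; under eq_bigr do rewrite !mxE eqxx /= mulrDr.
rewrite big_split/= (bigD1 i)//= eqxx mulr1 big1 ?addr0; first by rewrite mulrC.
by move=> j ji; rewrite eq_sym (negbTE ji) mulr0 mulr0 || rewrite (negbTE ji) !mulr0.
Qed.

Lemma pder_Fr s f xi i : rapid f ->
  pder (fun z => cre (Fr s f z)) xi i (cre (Fr s (fun x => cxi s i x * f x) xi)) /\
  pder (fun z => cim (Fr s f z)) xi i (cim (Fr s (fun x => cxi s i x * f x) xi)).
Proof.
move=> rf; have rg := rapid_cxi s i rf.
have iF := rapid_iC rf; have iG := rapid_iC rg.
pose th (x : pt) (t : R) := s * (2 * pi * (t * x 0 i + dotp x xi)).
have dth (x : pt) (t : R) : der (th x) t (s * (2 * pi * x 0 i)).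
  by apply: deq; [rewrite /th; drv|cbv beta; move: (pi : R) => P; ring].
have G1 (t : R) (y : tup) : cabs (ph s (rt y) (t *: eb i + xi) * (cxi s i (rt y) * f (rt y))) <=
    cabs (cxi s i (rt y) * f (rt y)) by rewrite cabsM cabs_ph mul1r.
have E0 (z : R[i]) (x : pt) (t : R) : ph s x (t *: eb i + xi) * z = expi (th x t) * z.
  by rewrite /ph dotp_line.
split; apply/pder_line.
- have := @der_under _ _ _ (mu R n)
    (fun t y => cre (ph s (rt y) (t *: eb i + xi) * f (rt y)))
    (fun t y => cre (ph s (rt y) (t *: eb i + xi) * (cxi s i (rt y) * f (rt y))))
    (fun y => cabs (cxi s i (rt y) * f (rt y))) 0.
  rewrite scale0r add0r; apply.
  + by move=> t; have [] := iCn_ph s (t *: eb i + xi) iF.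
  + move=> t y; rewrite E0; under eq_fun do rewrite E0 creM.
    rewrite creM cimM creM /=; have d := dth (rt y) t; apply: deq; first by drv.
    cbv beta; move: (cos _) (sin _) (pi : R) => c s' P; ring.
  + exact: i_cabs iG.
  + by move=> t y; rewrite (le_trans (cre_le _)).
- have := @der_under _ _ _ (mu R n)
    (fun t y => cim (ph s (rt y) (t *: eb i + xi) * f (rt y)))
    (fun t y => cim (ph s (rt y) (t *: eb i + xi) * (cxi s i (rt y) * f (rt y))))
    (fun y => cabs (cxi s i (rt y) * f (rt y))) 0.
  rewrite scale0r add0r; apply.
  + by move=> t; have [] := iCn_ph s (t *: eb i + xi) iF.
  + move=> t y; rewrite E0; under eq_fun do rewrite E0 cimM.
    rewrite cimM creM cimM /=; have d := dth (rt y) t; apply: deq; first by drv.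
    cbv beta; move: (cos _) (sin _) (pi : R) => c s' P; ring.
  + exact: i_cabs iG.
  + by move=> t y; rewrite (le_trans (cim_le _)).
Qed.

Lemma cos_lip (a b : R) : `|cos a - cos b| <= `|a - b|.
Proof.
wlog ab : a b / b <= a.
  move=> H; have [/H//|/ltW/H] := leP b a.
  by rewrite distrC [in X in _ <= X]distrC.
rewrite [leRHS]ger0_norm ?subr_ge0// ler_norml; apply/andP; split.
- have h : - cos a - - cos b <= a - b.
    apply: (@der_le _ (fun x => - cos x) id (fun x => - - sin x) (fun=> 1) _ _ ab
      (fun x _ => dN (dCos x)) (fun x _ => dId x)) => x _.
    by rewrite opprK sin_le1.
  by lra.
- apply: (@der_le _ cos id (fun x => - sin x) (fun=> 1) _ _ ab
    (fun x _ => dCos x) (fun x _ => dId x)) => x _.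
  by have := sin_geN1 x; lra.
Qed.
Lemma sin_lip (a b : R) : `|sin a - sin b| <= `|a - b|.
Proof.
wlog ab : a b / b <= a.
  move=> H; have [/H//|/ltW/H] := leP b a.
  by rewrite distrC [in X in _ <= X]distrC.
rewrite [leRHS]ger0_norm ?subr_ge0// ler_norml; apply/andP; split.
- have h : - sin a - - sin b <= a - b.
    apply: (@der_le _ (fun x => - sin x) id (fun x => - cos x) (fun=> 1) _ _ ab
      (fun x _ => dN (dSin x)) (fun x _ => dId x)) => x _.
    by have := cos_geN1 x; lra.
  by lra.
- apply: (@der_le _ sin id cos (fun=> 1) _ _ ab
    (fun x _ => dSin x) (fun x _ => dId x)) => x _; exact: cos_le1.
Qed.
Lemma expi_lip (a b : R) : cabs (expi a - expi b) <= 2 * `|a - b|.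
Proof.
rewrite (le_trans (cabs_le _))//= mulr2n mulrDl mul1r lerD// ?cos_lip// sin_lip//.
Qed.

(** The transform is even Lipschitz, because [f] has finite first moments. *)
Lemma Fr_cont s f : rapid f ->
  continuous (fun z => cre (Fr s f z)) /\ continuous (fun z => cim (Fr s f z)).
Proof.
move=> rf; have iF := rapid_iC rf.
have [D D0 hD] : exists2 D : R, 0 <= D & forall x y : pt, cabs (Fr s f x - Fr s f y) <= D * `|x - y|.
  have rh : rapid (fun x => rc (\sum_i `|x 0 i|) * f x).
    apply: (@rapid_mulb _ _ n%:R 1) => //.
      apply: mC_rc; apply: measurable_sum => i; apply: measurableT_comp => //; exact: mCn_coord.
    move=> x; rewrite cabs_real ger0_norm ?sumr_ge0// expr1.
    have -> : n%:R * (1 + enorm x) = \sum_(i < n) (1 + enorm x) by rewrite sumr_const card_ord mulr_natl.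
    by apply: ler_sum => i _; rewrite (le_trans (coord_le_enorm x i))// lerDr.
  have ih := i_cabs (rapid_iC rh).
  pose W := (\int[mu R n]_t cabs (rc (\sum_i `|rt t 0 i|) * f (rt t)))%R.
  have W0 : 0 <= W by apply: Rintegral_ge0 => t _; exact: cabs_ge0.
  exists (2 * (2 * `|s * (2 * pi)| * W)); first by rewrite !mulr_ge0.
  move=> x y.
  have -> : Fr s f x - Fr s f y = cIn (fun z => (ph s z x - ph s z y) * f z).
    rewrite /Fr /cIn -[X in _ + X]mulN1r -cIZ; last exact: iCn_ph.
    rewrite -cI_add; [|exact: iCn_ph|by apply: iCZ; exact: iCn_ph].
    by congr cI; apply/funext => t; ring.
  apply: (@le_trans _ _ (2 * (\int[mu R n]_t (2 * (`|s * (2 * pi)| * `|x - y|) * cabs (rc (\sum_i `|rt t 0 i|) * f (rt t))))%R)).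
    apply: cI_norm_le.
    - apply: mCM; last by case: rf.
      apply: mCD; first exact: mC_ph.
      under eq_fun do rewrite -mulN1r; apply: mCM; [exact: mC_cst|exact: mC_ph].
    - move=> t; rewrite !cabsM cabs_real (ger0_norm (x := \sum_i `|_ 0 i|)) ?sumr_ge0// [leRHS]mulrA; apply: ler_wpM2r; first exact: cabs_ge0.
      rewrite (le_trans (expi_lip _ _))// -[leRHS]mulrA; apply: ler_wpM2l => //.
      rewrite -mulrBr -mulrBr [X in `|X|]mulrA normrM -[leRHS]mulrA; apply: ler_wpM2l => //.
      rewrite /dotp -sumrB mulrC mulr_suml (le_trans (ler_norm_sum _ _ _))//; apply: ler_sum => i _.
      rewrite -mulrBr normrM ler_wpM2l//.
      have -> : x 0 i - y 0 i = (x - y) 0 i by rewrite !mxE.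
      rewrite [leRHS]/Num.norm/= mx_normrE.
      exact: (le_bigmax _ (fun ij => `|(x - y) ij.1 ij.2|) (0, i)).
    - exact: (integrableZl measurableT _ ih).
  rewrite RintegralZl// -/W le_eqVlt; apply/orP; left; apply/eqP; ring.
have L (h : R[i] -> R) : (forall z w, `|h z - h w| <= cabs (z - w)) -> continuous (fun z => h (Fr s f z)).
  move=> hh x A /nbhs_ballP[e /= e0 he].
  have D1 : 0 < D + 1 by rewrite ltr_wpDl.
  apply: (@filterS pt (nbhs x) _ (ball x (e / (D + 1)))); last first.
    by apply: nbhsx_ballx; rewrite divr_gt0.
  move=> y; rewrite mx_norm_ball /ball_ /= => hy; apply: he => /=.
  rewrite /ball /= (le_lt_trans (hh _ _))// (le_lt_trans (hD x y))//.
  apply: (@le_lt_trans _ _ ((D + 1) * `|x - y|)); first by rewrite ler_wpM2r// lerDl.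
  by rewrite mulrC -ltr_pdivlMr.
split; apply: L => z w.
- by apply: le_trans (cre_le _); rewrite creD; case: w.
- by apply: le_trans (cim_le _); rewrite cimD; case: w.
Qed.

Definition csmooth f := smooth (fun x => cre (f x)) /\ smooth (fun x => cim (f x)).

Lemma Fr_smooth s f : rapid f -> csmooth (Fr s f).
Proof.
move=> rf; split.
- apply: (@smooth_class _ _ (fun h => exists2 f, rapid f & h = (fun z => cre (Fr s f z)))); last by exists f.
  move=> _ [{rf}f rf ->]; split; first by have [] := Fr_cont s rf.
  move=> i; exists (fun z => cre (Fr s (fun x => cxi s i x * f x) z)).
    by exists (fun x => cxi s i x * f x) => //; exact: rapid_cxi.
  by move=> x; have [] := pder_Fr s x i rf.
- apply: (@smooth_class _ _ (fun h => exists2 f, rapid f & h = (fun z => cim (Fr s f z)))); last by exists f.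
  move=> _ [{rf}f rf ->]; split; first by have [] := Fr_cont s rf.
  move=> i; exists (fun z => cim (Fr s (fun x => cxi s i x * f x) z)).
    by exists (fun x => cxi s i x * f x) => //; exact: rapid_cxi.
  by move=> x; have [] := pder_Fr s x i rf.
Qed.

Definition mulx s (l : seq 'I_n) f : pt -> R[i] := foldr (fun i g => fun x => cxi s i x * g x) f l.
Lemma rapid_mulx s l f : rapid f -> rapid (mulx s l f).
Proof. by move=> rf; elim: l => //= i l IH; exact: rapid_cxi. Qed.
Lemma dpart_Fr s l f : rapid f ->
  dpart l (fun z => cre (Fr s f z)) = (fun z => cre (Fr s (mulx s l f) z)) /\
  dpart l (fun z => cim (Fr s f z)) = (fun z => cim (Fr s (mulx s l f) z)).
Proof.
move=> rf; elim: l => //= i l [-> ->]; have r := rapid_mulx s l rf.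
split; apply/funext => x; apply: pderE.
- by have [] := pder_Fr s x i r.
- by have [] := pder_Fr s x i r.
Qed.

Lemma csmooth_mCn f : csmooth f -> mCn f.
Proof.
move=> [s1 s2]; split.
- exact: (@continuous_measurable_tuple R n (fun x => cre (f x)) (smooth_cont s1)).
- exact: (@continuous_measurable_tuple R n (fun x => cim (f x)) (smooth_cont s2)).
Qed.
Lemma csmoothM f g : csmooth f -> csmooth g -> csmooth (fun x => f x * g x).
Proof.
move=> [f1 f2] [g1 g2]; split.
- by under eq_fun do rewrite creM; apply: smooth_sub; apply: smooth_mul.
- by under eq_fun do rewrite cimM; apply: smooth_add; apply: smooth_mul.
Qed.
Lemma csmooth_rc (h : pt -> R) : smooth h -> csmooth (fun x => rc (h x)).
Proof. by move=> sh; split => //=; exact: smooth_cst. Qed.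
Lemma csmooth_cxi s i : csmooth (cxi s i).
Proof.
split => /=; first exact: smooth_cst.
apply: smooth_mul; first exact: smooth_cst.
by apply: smooth_mul; [exact: smooth_cst|exact: smooth_coord].
Qed.

Lemma schwartz_rapid f : schwartz f -> rapid f.
Proof.
move=> [s1 [s2 d]]; split; first exact: csmooth_mCn.
move=> k; have [C hC] := d [::] k; exists C => x; have := hC x.
by rewrite /cpart /= -cE.
Qed.

(** Every multiplier piece is of this kind; its product with any smooth function is again of this
    kind, and its transform is Schwartz. *)
Definition Ccs f := csmooth f /\ bsupp f.
Lemma Ccs_bounded f : Ccs f -> exists2 B, 0 <= B & forall x, cabs (f x) <= B.
Proof.
move=> [[s1 s2] [r hr]].
have [B1 h1] : exists B, forall x, `|cre (f x)| <= B.
  by apply: bsupp_bounded; [exact: smooth_cont|exists r => x i /hr ->].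
have [B2 h2] : exists B, forall x, `|cim (f x)| <= B.
  by apply: bsupp_bounded; [exact: smooth_cont|exists r => x i /hr ->].
exists (B1 + B2) => [|x]; first by rewrite addr_ge0// (le_trans _ (h1 0), le_trans _ (h2 0)).
by rewrite (le_trans (cabs_le _))// lerD.
Qed.
Lemma enorm_box (x : pt) (r : R) : (forall i, `|x 0 i| <= r) -> enorm x <= n%:R * r.
Proof.
move=> h; rewrite (le_trans (enorm_le_sum x))//.
have -> : n%:R * r = \sum_(i < n) r by rewrite sumr_const card_ord mulr_natl.
by apply: ler_sum => i _; exact: h.
Qed.
Lemma Ccs_rapid f : Ccs f -> rapid f.
Proof.
move=> cf; have [B B0 hB] := Ccs_bounded cf; have [sf [r hr]] := cf.
split; first exact: csmooth_mCn.
move=> k; exists ((1 + n%:R * `|r|) ^+ k * B) => x.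
have [/existsP[i hi]|/existsPn h] := boolP [exists i, `|r| < `|x 0 i|].
  rewrite (hr x i) ?cabs0 ?mulr0 ?mulr_ge0 ?exprn_ge0// ?addr_ge0// ?mulr_ge0//.
  by rewrite (le_lt_trans (ler_norm r)).
apply: ler_pM => //; rewrite ?exprn_ge0 ?cabs_ge0 ?(ltW (onep_enorm0 x))//.
apply: lerXn2r; rewrite ?nnegrE ?(ltW (onep_enorm0 x)) ?addr_ge0 ?mulr_ge0//.
rewrite lerD2l; apply: enorm_box => i; rewrite leNgt; exact: h.
Qed.
Lemma CcsM f g : csmooth f -> Ccs g -> Ccs (fun x => f x * g x).
Proof.
move=> sf [sg [r hr]]; split; first exact: csmoothM.
by exists r => x i hx; rewrite (hr x i hx) mulr0.
Qed.
Definition cpd i f : pt -> R[i] := fun x => Complex (pd i (fun x => cre (f x)) x) (pd i (fun x => cim (f x)) x).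
Lemma Ccs_cpd i f : Ccs f -> Ccs (cpd i f).
Proof.
move=> [[s1 s2] [r hr]]; split; first by split => /=; exact: smooth_pd.
have [r1 h1] : bsupp (pd i (fun x => cre (f x))).
  by apply: bsupp_pd => //; exists r => x j /hr ->.
have [r2 h2] : bsupp (pd i (fun x => cim (f x))).
  by apply: bsupp_pd => //; exists r => x j /hr ->.
exists (Num.max r1 r2) => x j; rewrite gt_max => /andP[l1 l2].
by rewrite /cpd (h1 x j l1) (h2 x j l2).
Qed.

Lemma rt_upd (t : tup) i (y : R) : rt (upd t i y) = y *: eb i + rt (upd t i 0).
Proof.
apply/rowP => j; rewrite !mxE !tnth_upd eqxx /=.
by case: eqP => _; rewrite ?mulr1 ?mulr0 ?addr0 ?add0r.
Qed.
Lemma der_upd (h : pt -> R) (t : tup) i (y a : R) :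
  pder h (rt (upd t i y)) i a -> der (fun z => h (rt (upd t i z))) y a.
Proof.
move=> d; under eq_fun do rewrite rt_upd; apply: pder_at.
by rewrite -rt_upd.
Qed.

Lemma cint_cpd i f : Ccs f -> cIn (cpd i f) = 0.
Proof.
move=> cf; have [[s1 s2] [r hr]] := cf; have cg := Ccs_cpd i cf.
have [B B0 hB] := Ccs_bounded cg; have [[g1 g2] [r' hr']] := cg.
have K (h : pt -> R) : smooth h -> (forall (x : pt) j, r < `|x 0 j| -> h x = 0) ->
    (forall (x : pt) j, r' < `|x 0 j| -> pd i h x = 0) -> (forall x, `|pd i h x| <= B) ->
    (\int[mu R n]_t pd i h (rt t) = 0)%R.
  move=> sh h0 d0 dB.
  apply: (@integral_coord_derive _ _ i (fun t => h (rt t)) _ B (Num.max r r')).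
  - exact: (@continuous_measurable_tuple R n (pd i h) (smooth_cont (smooth_pd i sh))).
  - by move=> t; exact: dB.
  - by move=> t j; rewrite gt_max => /andP[_ l]; apply: (d0 _ j); rewrite rtE.
  - by move=> t j; rewrite gt_max => /andP[l _]; apply: (h0 _ j); rewrite rtE.
  - by move=> t y; apply: der_upd; exact: smooth_pder.
  - move=> t y; under eq_fun do rewrite rt_upd.
    have d : pder (pd i h) (y *: eb i + rt (upd t i 0)) i (pd i (pd i h) (y *: eb i + rt (upd t i 0))).
      by apply: smooth_pder; exact: smooth_pd.
    exact: (d_cont (pder_at d)).
apply: c_ext => /=; apply: K => //.
- by move=> x j /hr ->.
- by move=> x j /hr' [].
- by move=> x; apply: le_trans (hB x); exact: cre_le (cpd i f x).
- by move=> x j /hr ->.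
- by move=> x j /hr' [].
- by move=> x; apply: le_trans (hB x); exact: cim_le (cpd i f x).
Qed.

Lemma smooth_phase (s : R) (xi : pt) : csmooth (fun x => ph s x xi).
Proof.
have sth : smooth (fun x : pt => s * (2 * pi * dotp x xi)).
  do 2 (apply: smooth_mul; first exact: smooth_cst).
  apply: smooth_sum => i; apply: smooth_mul; [exact: smooth_coord|exact: smooth_cst].
have trig := @sm1_trig R.
by case: trig => t1 t2; split; apply: smooth_comp.
Qed.

(** The derivative of [ph s x xi * f x] in [x] has vanishing integral. *)
Lemma Fr_cpd s i f xi : Ccs f -> Fr s (cpd i f) xi = - (cxi s i xi * Fr s f xi).
Proof.
move=> cf; have [sf bf] := cf.
have cpf : Ccs (fun x => ph s x xi * f x) by exact (CcsM (smooth_phase s xi) cf).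
have := cint_cpd i cpf.
have E x : cpd i (fun x => ph s x xi * f x) x = cxi s i xi * (ph s x xi * f x) + ph s x xi * cpd i f x.
  have dth : pder (fun x => s * (2 * pi * dotp x xi)) x i (s * (2 * pi * xi 0 i)).
    apply/pder_line; under eq_fun do rewrite dotpC dotp_line.
    by apply: deq; [drv|cbv beta; move: (pi : R) => P; ring].
  have dc := pder_comp (F := cos) (dCos _) dth; have ds := pder_comp (F := sin) (dSin _) dth.
  have [s1 s2] := sf.
  have d1 := smooth_pder x i s1; have d2 := smooth_pder x i s2.
  apply: c_ext; rewrite /cpd /=.
  - rewrite (_ : (fun x => _) = (fun x => cos (s * (2 * pi * dotp x xi)) * cre (f x) +
        (-1) * (sin (s * (2 * pi * dotp x xi)) * cim (f x)))); last first.
      by apply/funext => y; rewrite creM mulN1r.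
    rewrite (pderE (pderD (pderM dc d1) (pderM (pder_cst (-1) x i) (pderM ds d2)))).
    rewrite !(creD, creM, cimM) /=; move: (cos _) (sin _) => c s'; ring.
  - rewrite (_ : (fun x => _) = (fun x => cos (s * (2 * pi * dotp x xi)) * cim (f x) +
        (sin (s * (2 * pi * dotp x xi)) * cre (f x)))); last first.
      by apply/funext => y; rewrite cimM.
    rewrite (pderE (pderD (pderM dc d2) (pderM ds d1))).
    rewrite !(cimD, creM, cimM) /=; move: (cos _) (sin _) => c s'; ring.
have if1 : iCn (fun x => ph s x xi * f x) by exact: rapid_iC (Ccs_rapid cpf).
have if2 : iCn (fun x => ph s x xi * cpd i f x).
  by apply: iCn_ph; exact: rapid_iC (Ccs_rapid (Ccs_cpd i cf)).
rewrite /cIn; under eq_cI do rewrite E.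
rewrite cI_add//; last exact: iCZ.
rewrite cIZ// => /eqP; rewrite addrC addr_eq0 => /eqP; exact.
Qed.

(** Induction on [k]: [|xi|] is at most the sum of the [|xi_i|], and each of them is traded for a
    derivative of [f] by [Fr_cpd], using [2 pi >= 1]. *)
Lemma Fr_decay s f k : s ^+ 2 = 1 -> Ccs f -> exists C, forall xi, (1 + enorm xi) ^+ k * cabs (Fr s f xi) <= C.
Proof.
move=> s1 cf; elim: k f cf => [|k IH] f cf.
  have [B hB] := Fr_bound s (rapid_iC (Ccs_rapid cf)).
  by exists B => xi; rewrite expr0 mul1r.
have [C hC] := IH f cf.
have /choice[D hD] : forall i, exists D, forall xi, (1 + enorm xi) ^+ k * cabs (Fr s (cpd i f) xi) <= D.
  by move=> i; apply: IH; exact: Ccs_cpd.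
exists (C + \sum_i D i) => xi; have X := onep_enorm0 xi.
rewrite exprS -mulrA mulrDl mul1r lerD//.
apply: (@le_trans _ _ (\sum_i (`|xi 0 i| * ((1 + enorm xi) ^+ k * cabs (Fr s f xi))))).
  by rewrite -mulr_suml ler_wpM2r ?mulr_ge0 ?cabs_ge0 ?exprn_ge0 ?(ltW X)// enorm_le_sum.
apply: ler_sum => i _; apply: le_trans (hD i xi).
rewrite mulrCA ler_wpM2l ?exprn_ge0 ?(ltW X)// Fr_cpd// cabsN.
rewrite cabsM ler_wpM2r ?cabs_ge0// cabs_imag !normrM.
have -> : `|s| = 1 by apply/eqP; rewrite -(@eqrXn2 _ 2)// real_normK ?num_real// s1 expr1n.
have p0 := pi_ge0 R; have p2 := pi_ge2 R.
rewrite mul1r; apply: ler_peMl => //; rewrite !ger0_norm//; lra.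
Qed.

Lemma Fr_schwartz s f : s ^+ 2 = 1 -> Ccs f -> schwartz (Fr s f).
Proof.
move=> s1 cf; have rf := Ccs_rapid cf; have [h1 h2] := Fr_smooth s rf.
split => //; split => // l k.
have cm : Ccs (mulx s l f).
  elim: l => [|i l IH]; first exact cf.
  exact (CcsM (csmooth_cxi s i) IH).
have [C hC] := Fr_decay k s1 cm; exists C => x.
have [E1 E2] := dpart_Fr s l rf.
by rewrite /cpart E1 E2 -cE.
Qed.

End Rapid.

(** * Convolution with the kernel of a multiplier *)

Section Conv.
Variables (R : realType) (n : nat).
Notation pt := 'rV[R]_n.
Notation rt := (@row_of_tuple R n).
Notation tup := (n.-tuple R).
Implicit Types (M g f : pt -> R[i]).

Definition convol M g (y : pt) : R[i] := cIn (fun x => g x * Fr 1 M (y - x)).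
(* The weight has all its conjugate L^p' norms finite, so that L1w contains every
   L^p, and on L1w the convolution with a Schwartz kernel converges absolutely. *)
Definition L1w g := iCn (fun x => rc (Pk 1 0 x) * g x).

Lemma dotpBr (x y z : pt) : dotp x (y - z) = dotp x y - dotp x z.
Proof. by rewrite /dotp -sumrB; apply: eq_bigr => i _; rewrite !mxE mulrBr. Qed.
Lemma phB (s : R) (x y z : pt) : ph s x (y - z) = ph s x y * ph (- s) x z.
Proof. by rewrite /ph -expiD; congr expi; rewrite dotpBr; ring. Qed.

(** Peetre's inequality [1 + b^2 <= 2 (1 + a^2) (1 + (a - b)^2)] in each coordinate. *)
Lemma Pk_shift (x y : pt) : Pk 1 0 (y - x) <= 2 ^+ n * (\prod_i (1 + y 0 i ^+ 2)) * Pk 1 0 x.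
Proof.
have p0 := pi_gt0 R.
have -> : 2 ^+ n = \prod_(i < n) (2 : R) by rewrite prodr_const card_ord.
rewrite -!big_split/=; apply: ler_prod => i _; rewrite cauchy_ge0//= !mxE !subr0 expr1n.
rewrite mulrCA; apply: ler_wpM2l; first by rewrite div1r invr_ge0 ltW.
set a := y 0 i; set b := x 0 i.
have h1 : 0 < 1 + (a - b) ^+ 2 by rewrite ltr_pwDl ?sqr_ge0.
have h2 : 0 < 1 + b ^+ 2 by rewrite ltr_pwDl ?sqr_ge0.
rewrite ler_pdivlMr// mulrC ler_pdivrMr//.
have := sqr_ge0 (a * (a - b)); have := sqr_ge0 (a - 2 * b); have := sqr_ge0 (2 * a - b); nra.
Qed.

Lemma m_subr2 : measurable_fun setT (fun p : tup * tup => tuple_of_row (rt p.1 - rt p.2)).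
Proof.
apply/measurable_fun_tnthP => i /=.
rewrite (_ : _ \o _ = (fun p : tup * tup => tnth p.1 i - tnth p.2 i)).
  apply: measurable_funB.
  - by apply: (measurableT_comp (measurable_tnth i)); exact: measurable_fst.
  - by apply: (measurableT_comp (measurable_tnth i)); exact: measurable_snd.
by apply/funext => p /=; rewrite tnth_mktuple !mxE.
Qed.
Lemma mC_sub2 (K : pt -> R[i]) : mCn K -> mC (fun p : tup * tup => K (rt p.1 - rt p.2)).
Proof.
move=> mK; have := mC_comp m_subr2 mK.
by under eq_fun do rewrite rtK.
Qed.
Lemma mC_sub1 (K : pt -> R[i]) (y : pt) : mCn K -> mC (fun t : tup => K (y - rt t)).
Proof.
move=> mK; have := mC_comp (pair1_measurable (tuple_of_row y)) (mC_sub2 mK).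
by under eq_fun do rewrite rtK.
Qed.

Section withM.
Variable M : pt -> R[i].
Hypothesis cM : Ccs M.
Let iM : iCn M := rapid_iC (Ccs_rapid cM).
Let K := Fr 1 M.
Let rK : rapid K := schwartz_rapid (Fr_schwartz (expr1n _ 2) cM).
Let mK : mCn K := rK.1.

Lemma K_shift : exists2 D, 0 <= D &
  forall x y, cabs (K (y - x)) <= D * (\prod_i (1 + y 0 i ^+ 2)) * Pk 1 0 x.
Proof.
have [C C0 hC] := rapid_Pk rK; exists (C * 2 ^+ n); first by rewrite mulr_ge0// exprn_ge0.
move=> x y; rewrite (le_trans (hC _))// -!mulrA ler_wpM2l// !mulrA; exact: Pk_shift.
Qed.

Lemma conv_iC g y : mCn g -> L1w g -> iCn (fun x => g x * K (y - x)).
Proof.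
move=> mg wg; have [D D0 hD] := K_shift.
apply: (@iC_domC _ _ _ _ _ (fun t : tup => rc (D * \prod_i (1 + y 0 i ^+ 2)) * (rc (Pk 1 0 (rt t)) * g (rt t)))).
- by apply: mCM; [exact: mg|exact: mC_sub1].
- exact: iCZ.
- move=> t; rewrite !cabsM !cabs_real (ger0_norm (x := Pk _ _ _)) ?Pk_ge0// mulrA mulrC.
  apply: ler_wpM2r; first exact: cabs_ge0.
  rewrite (le_trans (hD _ _))//; apply: ler_wpM2r; first exact: Pk_ge0.
  exact: ler_norm.
Qed.

Lemma mCn_conv g : mCn g -> mCn (convol M g).
Proof.
move=> mg; apply: (@mC_cI _ _ _ _ _ (mu R n) (fun p : tup * tup => g (rt p.2) * K (rt p.1 - rt p.2))).
by apply: mCM; [exact: mC_snd|exact: mC_sub2].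
Qed.

Lemma convD g h y : mCn g -> mCn h -> L1w g -> L1w h ->
  convol M (fun x => g x + h x) y = convol M g y + convol M h y.
Proof.
move=> mg mh wg wh; rewrite /convol /cIn -cI_add; [|exact: conv_iC|exact: conv_iC].
by congr cI; apply/funext => t; rewrite mulrDl.
Qed.

Lemma conv_sup g A y : mCn g -> (forall x, cabs (K x) <= A) -> 0 <= A ->
  ((cabs (convol M g y))%:E <= (2 * A)%:E * \int[mu R n]_t (cabs (g (rt t)))%:E)%E.
Proof.
move=> mg hA A0; have mgK : mC (fun t : tup => g (rt t) * K (y - rt t)).
  by apply: mCM; [exact: mg|exact: mC_sub1].
apply: (le_trans (cI_norm _ mgK)).
rewrite EFinM -muleA; apply: lee_wpmul2l; first by rewrite lee_fin.
rewrite -ge0_integralZl//; last 2 first.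
- exact: m_cabsE.
- by move=> t _; rewrite lee_fin cabs_ge0.
apply: ge0_le_integral => //.
- by move=> t _; rewrite lee_fin cabs_ge0.
- exact: m_cabsE.
- by apply: measurable_funeM; exact: m_cabsE.
- by move=> t _; rewrite -EFinM lee_fin cabsM mulrC; apply: ler_wpM2r; [exact: cabs_ge0|].
Qed.

Lemma iCn_prod_fubini (f h : pt -> R[i]) : iCn f -> iCn h ->
  (\int[mu R n]_t \int[mu R n]_u (cabs (f (rt t)) * cabs (h (rt u)))%:E < +oo)%E.
Proof.
move=> jf jh; have mf := iC_mC jf; have mh := iC_mC jh.
have fh0 (k : pt -> R[i]) : (0 <= \int[mu R n]_u (cabs (k (rt u)))%:E)%E.
  by apply: integral_ge0 => u _; rewrite lee_fin cabs_ge0.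
have -> : (\int[mu R n]_t \int[mu R n]_u (cabs (f (rt t)) * cabs (h (rt u)))%:E =
   \int[mu R n]_t ((cabs (f (rt t)))%:E * \int[mu R n]_u (cabs (h (rt u)))%:E))%E.
  apply: eq_integral => t _; rewrite -ge0_integralZl//.
  - exact: m_cabsE.
  - by move=> u _; rewrite lee_fin cabs_ge0.
  - by rewrite lee_fin cabs_ge0.
rewrite ge0_integralZr//; last 2 first.
- exact: m_cabsE.
- by move=> u _; rewrite lee_fin cabs_ge0.
rewrite lte_mul_pinfty//; last exact: iC_cabs_lty.
by rewrite ge0_fin_numE//; exact: iC_cabs_lty.
Qed.

Lemma conv_Fr g y : iCn g -> convol M g y = Fr 1 (fun z => M z * Fr (-1) g z) y.
Proof.
move=> ig; have mg := iC_mC ig; have mM := iC_mC iM.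
pose H (p : tup * tup) := g (rt p.1) * (ph 1 (rt p.2) (y - rt p.1) * M (rt p.2)).
have HE p : H p = ph 1 (rt p.2) y * M (rt p.2) * (ph (-1) (rt p.1) (rt p.2) * g (rt p.1)).
  by rewrite /H phB (phC (-1) (rt p.2)); ring.
have mH : mC H.
  suff : mC (fun p : tup * tup => ph 1 (rt p.2) y * M (rt p.2) * (ph (-1) (rt p.1) (rt p.2) * g (rt p.1))).
    by congr mC; apply/funext => p; rewrite HE.
  apply: mCM; last by apply: mCM; [exact: mC_ph2|exact: mC_fst].
  by apply: mCM; [exact: (mC_snd (f := fun z => ph 1 z y) (mC_ph _ _))|exact: mC_snd].
transitivity (cI (mu R n) (fun t : tup => cI (mu R n) (fun u : tup => H (t, u)))).
  by rewrite /convol /cIn; congr cI; apply/funext => t; rewrite -cIZ//; exact: iCn_ph.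
rewrite (cI_fubini (F := H))//.
  congr cI; apply/funext => u; rewrite mulrA /Fr /cIn -cIZ; last exact: iCn_ph.
  by congr cI; apply/funext => t; rewrite HE.
have -> : (\int[mu R n]_t \int[mu R n]_u (cabs (H (t, u)))%:E =
  \int[mu R n]_t \int[mu R n]_u (cabs (g (rt t)) * cabs (M (rt u)))%:E)%E.
  apply: eq_integral => t _; apply: eq_integral => u _.
  by rewrite /H /= !cabsM cabs_ph mul1r.
exact: iCn_prod_fubini.
Qed.

(** Plancherel's inequality is used for [M * Fr (-1) g] and for [g], hence 4 times 4. *)
Lemma conv_L2_iCn g B : iCn g -> (forall x, cabs (M x) <= B) -> 0 <= B ->
  (\int[mu R n]_t (cabs (convol M g (rt t)) ^+ 2)%:E <=
   (16 * B ^+ 2)%:E * \int[mu R n]_t (cabs (g (rt t)) ^+ 2)%:E)%E.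
Proof.
move=> ig hB B0; have mg := iC_mC ig.
have [D hD] := Fr_bound (-1) ig.
have mF := mCn_Fr (-1) mg.
have iMF : iCn (fun z => M z * Fr (-1) g z).
  rewrite /iCn; under eq_fun do rewrite mulrC.
  by apply: (@iCMb _ _ _ _ _ _ D).
under eq_integral do rewrite conv_Fr//.
apply: (le_trans (plancherel_le (expr1n _ 2) iMF)).
have -> : 16 * B ^+ 2 = 4 * (B ^+ 2 * 4) by ring.
rewrite EFinM -muleA; apply: lee_wpmul2l; first by rewrite lee_fin.
rewrite EFinM -muleA.
apply: (@le_trans _ _ ((B ^+ 2)%:E * \int[mu R n]_t (cabs (Fr (-1) g (rt t)) ^+ 2)%:E)%E); last first.
  apply: lee_wpmul2l; first by rewrite lee_fin sqr_ge0.
  by apply: plancherel_le => //; rewrite sqrrN expr1n.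
rewrite -ge0_integralZl//; last 3 first.
- by apply/measurable_EFinP; apply: measurable_funX; exact: m_cabs.
- by move=> t _; rewrite lee_fin sqr_ge0.
- by rewrite lee_fin sqr_ge0.
apply: ge0_le_integral => //.
- by move=> t _; rewrite lee_fin sqr_ge0.
- by apply/measurable_EFinP; apply: measurable_funX; apply: m_cabs; exact: mCM (iC_mC iM) mF.
- by apply: measurable_funeM; apply/measurable_EFinP; apply: measurable_funX; exact: m_cabs.
- move=> t _; rewrite -EFinM lee_fin cabsM exprMn; apply: ler_wpM2r; first exact: sqr_ge0.
  by rewrite ler_pXn2r// nnegrE cabs_ge0.
Qed.

Definition rst (g : pt -> R[i]) (c : pt -> bool) : pt -> R[i] := fun x => if c x then g x else 0.
Lemma mCn_rst g c : mCn g -> measurable_fun setT (fun t : tup => c (rt t)) -> mCn (rst g c).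
Proof.
move=> [m1 m2] mc; split.
- rewrite (_ : (fun _ => _) = (fun t : tup => if c (rt t) then cre (g (rt t)) else 0)).
    by apply: measurable_fun_ifT.
  by apply/funext => t; rewrite /rst; case: ifP.
- rewrite (_ : (fun _ => _) = (fun t : tup => if c (rt t) then cim (g (rt t)) else 0)).
    by apply: measurable_fun_ifT.
  by apply/funext => t; rewrite /rst; case: ifP.
Qed.
Lemma cabs_rst g c x : cabs (rst g c x) <= cabs (g x).
Proof. by rewrite /rst; case: ifP => // _; rewrite cabs0 cabs_ge0. Qed.
Lemma L1w_dom g h : mCn h -> L1w g -> (forall x, cabs (h x) <= cabs (g x)) -> L1w h.
Proof.
move=> mh wg hg; apply: (iC_domC _ wg).
  by apply: mCM => //; apply: mC_rc; exact: m_Pk.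
by move=> t; rewrite !cabsM; apply: ler_wpM2l => //; exact: cabs_ge0.
Qed.

Lemma Pk1_gt0 (x : pt) : 0 < Pk 1 0 x.
Proof.
apply: prodr_gt0 => i _; rewrite expr1n !divr_gt0 ?pi_gt0// ltr_pwDl// sqr_ge0//.
Qed.

(** Where the weight [Pk 1 0] is at least [1/(k+1)], [g] is integrable. These truncations converge
    under the convolution by domination, and Fatou's lemma carries the bound over to [g]. *)
Lemma conv_L2 g B : mCn g -> L1w g -> (forall x, cabs (M x) <= B) -> 0 <= B ->
  (\int[mu R n]_t (cabs (convol M g (rt t)) ^+ 2)%:E <=
   (16 * B ^+ 2)%:E * \int[mu R n]_t (cabs (g (rt t)) ^+ 2)%:E)%E.
Proof.
move=> mg wg hB B0.
pose c k (x : pt) := k.+1%:R^-1 <= Pk 1 0 x.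
have mc k : measurable_fun setT (fun t : tup => c k (rt t)).
  rewrite (_ : (fun _ => _) = (fun z : R => k.+1%:R^-1 <= z) \o (fun t : tup => Pk 1 0 (rt t)))//.
  apply: measurableT_comp; first by apply: measurable_fun_ler.
  exact: m_Pk.
have mgk k : mCn (rst g (c k)) by exact: mCn_rst.
have igk k : iCn (rst g (c k)).
  apply: (@iC_domC _ _ _ _ _ (fun t : tup => rc k.+1%:R * (rc (Pk 1 0 (rt t)) * g (rt t)))) ; [exact: mgk|exact: iCZ|].
  move=> t; rewrite /rst; case: ifP => [h|_]; last by rewrite cabs0 cabs_ge0.
  rewrite !cabsM !cabs_real !ger0_norm ?Pk_ge0// mulrA -[leLHS]mul1r.
  apply: ler_wpM2r; first exact: cabs_ge0.
  by rewrite mulrC -ler_pdivrMr// div1r.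
have Ec (x : pt) : \forall k \near \oo, c k x.
  have /cvgr0Pnorm_le/(_ _ (Pk1_gt0 x)) := @cvg_harm0 R.
  by apply: filterS => k; rewrite ger0_norm ?invr_ge0.
have cv (y : pt) : cabs (convol M (rst g (c k)) y) ^+ 2 @[k --> \oo] --> cabs (convol M g y) ^+ 2.
  have [c1 c2] : cre (convol M (rst g (c k)) y) @[k --> \oo] --> cre (convol M g y) /\
      cim (convol M (rst g (c k)) y) @[k --> \oo] --> cim (convol M g y).
    have lim (h : R[i] -> R) (t : tup) : h (rst g (c k) (rt t) * K (y - rt t)) @[k --> \oo] -->
        h (g (rt t) * K (y - rt t)).
      apply: cvg_near_cst; apply: filterS (Ec (rt t)) => k ck.
      by rewrite /rst ck.
    apply: (cI_dct (g := fun t : tup => cabs (g (rt t) * K (y - rt t)))).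
    - by move=> k; apply: mCM; [exact: mgk|exact: mC_sub1].
    - by apply: mCM; [exact: mg|exact: mC_sub1].
    - by apply: i_cabs; exact: conv_iC.
    - move=> k t; rewrite !cabsM; apply: ler_wpM2r; [exact: cabs_ge0|exact: cabs_rst].
    - by move=> t; exact: lim.
    - by move=> t; exact: lim.
  rewrite cabs_sqr; under eq_fun do rewrite cabs_sqr.
  by apply: cvgD; apply: cvgM.
apply: (@fatou_le _ _ _ _ (fun k t => cabs (convol M (rst g (c k)) (rt t)) ^+ 2)).
- by move=> k; apply: measurable_funX; apply: m_cabs; exact: mCn_conv.
- by move=> k t; exact: sqr_ge0.
- by move=> t; exact: cv.
- move=> k; apply: (le_trans (conv_L2_iCn (igk k) hB B0)).
  apply: lee_wpmul2l; first by rewrite lee_fin mulr_ge0// sqr_ge0.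
  apply: ge0_le_integral => //.
  + by move=> t _; rewrite lee_fin sqr_ge0.
  + by apply/measurable_EFinP; apply: measurable_funX; exact: (m_cabs (mgk k)).
  + by apply/measurable_EFinP; apply: measurable_funX; exact: m_cabs.
  + by move=> t _; rewrite lee_fin ler_pXn2r ?nnegrE ?cabs_ge0// cabs_rst.
Qed.

Lemma swap_int (H : tup * tup -> R[i]) : mC H ->
  (\int[mu R n]_t \int[mu R n]_u (cabs (H (t, u)))%:E =
   \int[mu R n]_u \int[mu R n]_t (cabs (H (t, u)))%:E)%E.
Proof.
move=> mH; apply: (@fubini_tonelli _ _ _ _ _ (mu R n) (mu R n) (fun p => (cabs (H p))%:E)).
- exact: m_cabsE.
- by move=> p; rewrite lee_fin cabs_ge0.
Qed.

(** Transposition: letting the multiplier act on the test function amounts to convolving [g]. This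
    is how a multiplied distribution is recognised as a function. *)
Lemma conv_pair g f : mCn g -> L1w g -> rapid f ->
  iCn (fun x => convol M g x * f x) /\
  cIn (fun x => g x * Fr (-1) (fun z => M z * Fr 1 f z) x) = cIn (fun x => convol M g x * f x).
Proof.
move=> mg wg rf; have if_ := rapid_iC rf; have mf := iC_mC if_; have mM := iC_mC iM.
have E (x : pt) : Fr (-1) (fun z => M z * Fr 1 f z) x = cIn (fun y => f y * K (y - x)).
  pose H (p : tup * tup) := ph (-1) (rt p.1) x * M (rt p.1) * (ph 1 (rt p.2) (rt p.1) * f (rt p.2)).
  have mH : mC H.
    apply: mCM; last by apply: mCM; [exact: mC_ph2'|exact: mC_snd].
    by apply: mCM; [exact: (mC_fst (f := fun z => ph (-1) z x) (mC_ph _ _))|exact: mC_fst].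
  transitivity (cI (mu R n) (fun t : tup => cI (mu R n) (fun u : tup => H (t, u)))).
    congr cI; apply/funext => t; rewrite mulrA {1}/Fr /cIn -cIZ//; exact: iCn_ph.
  rewrite (cI_fubini (F := H))//.
    congr cI; apply/funext => u; rewrite /K /Fr /cIn -cIZ; last exact: iCn_ph.
    congr cI; apply/funext => t; rewrite /H /= phB (phC 1 (rt u)); ring.
  have -> : (\int[mu R n]_t \int[mu R n]_u (cabs (H (t, u)))%:E =
    \int[mu R n]_t \int[mu R n]_u (cabs (M (rt t)) * cabs (f (rt u)))%:E)%E.
    apply: eq_integral => t _; apply: eq_integral => u _.
    by rewrite /H /= !cabsM !cabs_ph !mul1r.
  exact: iCn_prod_fubini.
have [D D0 hD] := K_shift.
pose W (y : pt) := \prod_i (1 + y 0 i ^+ 2).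
have W0 y : 0 <= W y by apply: prodr_ge0 => i _; rewrite addr_ge0// sqr_ge0.
have mW : mCn (fun y => rc (D * W y)).
  apply: mC_rc; apply: measurable_funM => //; apply: measurable_prod => i _.
  apply: measurable_funD => //; apply: measurable_funX; exact: mCn_coord.
have rWf : rapid (fun y => rc (D * W y) * f y).
  apply: (@rapid_mulb _ _ _ _ D (n * 2)%N) => // y; rewrite cabs_real ger0_norm ?mulr_ge0//.
  apply: ler_wpM2l => //; rewrite mulnC exprM.
  have -> : (1 + enorm y) ^+ 2 ^+ n = \prod_(i < n) (1 + enorm y) ^+ 2 by rewrite prodr_const card_ord.
  apply: ler_prod => i _; rewrite addr_ge0 ?sqr_ge0//=.
  have := coord_le_enorm y i; have := enorm_ge0 y.
  by rewrite -[y 0 i ^+ 2]real_normK ?num_real//; have := normr_ge0 (y 0 i); nra.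
pose H (p : tup * tup) := g (rt p.1) * (f (rt p.2) * K (rt p.2 - rt p.1)).
have mH : mC H.
  apply: mCM; first exact: mC_fst.
  apply: mCM; first exact: mC_snd.
  exact: (mC_comp (@measurable_swap _ _ tup tup) (mC_sub2 mK)).
(* [K_shift] separates the kernel into a weight in the first variable, absorbed by [L1w g], and a
   polynomial in the second, absorbed by the decay of [f]. *)
have fin : (\int[mu R n]_t \int[mu R n]_u (cabs (H (t, u)))%:E < +oo)%E.
  apply: le_lt_trans (@iCn_prod_fubini (fun x => rc (Pk 1 0 x) * g x) _ wg (rapid_iC rWf)).
  have mm1 (k : tup * tup -> R) : measurable_fun setT k -> (forall p, 0 <= k p) ->
     measurable_fun setT (fun t : tup => \int[mu R n]_u (k (t, u))%:E)%E.
    move=> mk k0; apply: (@measurable_fun_fubini_tonelli_F _ _ _ _ _ (mu R n) (fun p => (k p)%:E)).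
    - exact/measurable_EFinP.
    - by move=> p; rewrite lee_fin.
  have mm2 : measurable_fun setT (fun p : tup * tup => cabs (rc (Pk 1 0 (rt p.1)) * g (rt p.1)) * cabs (rc (D * W (rt p.2)) * f (rt p.2))).
    apply: measurable_funM; apply: m_cabs.
    - exact: (mC_fst (f := fun z => rc (Pk 1 0 z) * g z) (iC_mC wg)).
    - exact: (mC_snd (f := fun z => rc (D * W z) * f z) (iC_mC (rapid_iC rWf))).
  apply: ge0_le_integral => //.
  - by move=> t _; apply: integral_ge0 => u _; rewrite lee_fin cabs_ge0.
  - by apply: (mm1 (fun p => cabs (H p))); [exact: m_cabs|move=> p; exact: cabs_ge0].
  - by apply: (mm1 _ mm2) => p; rewrite mulr_ge0 ?cabs_ge0.
  move=> t _; apply: ge0_le_integral => //.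
  - by move=> u _; rewrite lee_fin cabs_ge0.
  - exact: (measurableT_comp (m_cabsE mH) (pair1_measurable t)).
  - by apply/measurable_EFinP; exact: (measurableT_comp mm2 (pair1_measurable t)).
  move=> u _; rewrite lee_fin /H /= !cabsM !cabs_real !ger0_norm ?Pk_ge0 ?mulr_ge0//.
  have := hD (rt t) (rt u); rewrite -/(W _) => hk.
  have h0 : 0 <= cabs (g (rt t)) * cabs (f (rt u)) by rewrite mulr_ge0 ?cabs_ge0.
  have := ler_wpM2l h0 hk.
  by congr (_ <= _); ring.
have EE : cIn (fun x => g x * Fr (-1) (fun z => M z * Fr 1 f z) x) =
    cI (mu R n) (fun t : tup => cI (mu R n) (fun u : tup => H (t, u))).
  congr cI; apply/funext => t; rewrite E /cIn -cIZ//.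
  rewrite /iCn; under eq_fun do rewrite mulrC.
  have [A hA] := Fr_bound 1 iM.
  apply: (@iCMb _ _ _ _ _ _ A); [|exact: if_|by move=> u; exact: hA].
  exact: (mC_comp (pair2_measurable t) (mC_sub2 mK)).
have EC (u : tup) : cI (mu R n) (fun t : tup => H (t, u)) = convol M g (rt u) * f (rt u).
  rewrite /convol /cIn -cIZr; last exact: conv_iC.
  by congr cI; apply/funext => t; rewrite /H /= [f _ * _]mulrC mulrA.
split.
  rewrite /iCn; under eq_fun do rewrite -EC.
  apply: (@iC_cI _ _ _ _ _ _ _ (fun p => H (p.2, p.1))).
    exact: (mC_comp (@measurable_swap _ _ tup tup) mH).
  exact (eq_ind _ (fun z => (z < +oo)%E) fin _ (swap_int mH)).
rewrite EE (cI_fubini mH fin) /cIn; congr cI; apply/funext => u; exact (EC u).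
Qed.

Lemma Pk1_le1 (x : pt) : Pk 1 0 x <= 1.
Proof.
have {2}-> : 1 = \prod_(i < n) (1 : R) :> R by rewrite prodr_const expr1n.
apply: ler_prod => i _; rewrite cauchy_ge0//= expr1n div1r.
have p1 : 1 <= (pi : R) by apply: le_trans (pi_ge2 R); rewrite ler1n.
have h : 1 <= 1 + (x 0 i - (0 : pt) 0 i) ^+ 2 by rewrite lerDl sqr_ge0.
rewrite -invfM invf_le1 ?mulr_ege1// mulr_gt0// (lt_le_trans _ p1, lt_le_trans _ h)//.
Qed.

(** [Pk |g|] is at most [Pk] where [|g| <= 1] and at most [|g|^p] elsewhere. *)
Lemma Lp_L1w g (p : R) : 1 <= p -> mCn g ->
  (\int[mu R n]_t (cabs (g (rt t)) `^ p)%:E < +oo)%E -> L1w g.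
Proof.
move=> p1 mg h.
have mp : measurable_fun setT (fun t : tup => cabs (g (rt t)) `^ p).
  exact: (measurableT_comp (measurable_powR p) (m_cabs mg)).
have ip : (mu R n).-integrable setT (EFin \o (fun t : tup => cabs (g (rt t)) `^ p)).
  apply/integrableP; split; first exact/measurable_EFinP.
  by under eq_integral do rewrite /= ger0_norm ?powR_ge0//.
apply: (@iC_dom _ _ _ _ _ (fun t : tup => Pk 1 0 (rt t) + cabs (g (rt t)) `^ p)).
- by apply: mCM => //; apply: mC_rc; exact: m_Pk.
- exact: (integrableD measurableT (Pk_integrable 0 (@ltr01 R)) ip).
- move=> t; rewrite cabsM cabs_real ger0_norm ?Pk_ge0//.
  have := Pk1_le1 (rt t); have := Pk_ge0 0 (rt t) (@ltr01 R); have := cabs_ge0 (g (rt t)).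
  move: (cabs _) (Pk _ _ _) => a b a0 b0 b1.
  have [a1|a1] := leP a 1.
    by apply: ler_wpDr; [exact: powR_ge0|rewrite ler_piMr].
  apply: ler_wpDl => //; apply: (@le_trans _ _ a); first by rewrite ler_piMl.
  by rewrite -[leLHS]powRr1//; apply: ler_powR => //; exact: ltW.
Qed.

End withM.
End Conv.

(** * Interpolation *)

Lemma powRV (R : realType) (x r : R) : 0 <= x -> x^-1 `^ r = (x `^ r)^-1.
Proof. by move=> x0; rewrite -powR_inv1// -powRrM mulN1r powRN. Qed.

Lemma pow2N_lt1 (R : realType) (e : R) : 0 < e -> 2 `^ (- e) < 1 :> R.
Proof.
move=> e0; rewrite powRN invf_lt1 ?powR_gt0//.
have : (1 : R) `^ e < 2 `^ e by apply: gt0_ltr_powR; rewrite ?nnegrE// ltr1n.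
by rewrite powR1.
Qed.

(** The surviving terms form a geometric progression of ratio [2^-e] whose largest term is at most
    [(min l a)^e]. *)
Lemma geom_sum (R : realType) (a e : R) (J : nat) (l : R) : 0 < a -> 0 < e -> 0 < l ->
  \sum_(k < J) (if l / 2 ^+ k <= a then (l / 2 ^+ k) `^ e else 0) <=
  (Num.min l a) `^ e / (1 - 2 `^ (- e)).
Proof.
move=> a0 e0; set q := 2 `^ (- e).
have q1 : q < 1 by exact: pow2N_lt1.
have q0 : 0 < q by rewrite powR_gt0.
have d0 : 0 < 1 - q by rewrite subr_gt0.
elim: J l => [|J IH] l l0; first by rewrite big_ord0 divr_ge0 ?powR_ge0// ltW.
rewrite big_ord_recl expr0 divr1.
have -> : \sum_(i < J) (if l / 2 ^+ lift ord0 i <= a then (l / 2 ^+ lift ord0 i) `^ e else 0) =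
   \sum_(i < J) (if (l / 2) / 2 ^+ i <= a then ((l / 2) / 2 ^+ i) `^ e else 0).
  by apply: eq_bigr => i _; rewrite lift0 exprS invfM mulrA.
have l20 : 0 < l / 2 by rewrite divr_gt0.
have {IH} := IH _ l20; set S := \sum_(i < J) _ => IH.
have [la|la] := leP l a.
  have l2a : Num.min (l / 2) a = l / 2 by apply/min_idPl; lra.
  rewrite l2a in IH.
  apply: (@le_trans _ _ (l `^ e + (l / 2) `^ e / (1 - q))); first by rewrite lerD2l.
  have -> : (l / 2) `^ e = l `^ e * q.
    by rewrite powRM ?invr_ge0 ?(ltW l0)// /q powRN powRV.
  have -> : l `^ e + l `^ e * q / (1 - q) = l `^ e / (1 - q); last by [].
  by field; rewrite gt_eqF.
rewrite add0r (le_trans IH)// ler_wpM2r ?invr_ge0 ?(ltW d0)//.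
apply: ge0_ler_powR; rewrite ?nnegrE ?le_min ?(ltW l20) ?(ltW a0) ?(ltW e0)//.
by rewrite ge_min lexx orbT.
Qed.

Lemma dyadic_pos (R : realType) (L : R) J (l : R) : l / 2 ^+ J < L -> L <= l ->
  exists2 k : 'I_J, l / 2 ^+ k.+1 < L & L <= l / 2 ^+ k.
Proof.
elim: J l => [|J IH] l; first by rewrite expr0 divr1 => /lt_le_trans h /h; rewrite ltxx.
move=> h1 h2; have [h|h] := leP L (l / 2).
  have h1' : l / 2 / 2 ^+ J < L by rewrite -mulrA -invfM -exprS.
  have [k k1 k2] := IH (l / 2) h1' h.
  by exists (lift ord0 k); rewrite lift0 exprS invfM mulrA.
by exists ord0; rewrite ?expr0 ?divr1 ?expr1.
Qed.

Lemma int_minkowski d (T : measurableType d) (R : realType) (mu : {measure set T -> \bar R})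
    (h k : T -> R) (r : R) : 1 <= r -> measurable_fun setT h -> measurable_fun setT k ->
  (forall t, 0 <= h t) -> (forall t, 0 <= k t) ->
  ((\int[mu]_t ((h t + k t) `^ r)%:E) `^ r^-1 <=
   (\int[mu]_t (h t `^ r)%:E) `^ r^-1 + (\int[mu]_t (k t `^ r)%:E) `^ r^-1)%E.
Proof.
move=> r1 mh mk h0 k0; have := minkowski_EFin mu mh mk r1; rewrite Lnorm.unlock.
have E (f : T -> R) : (forall t, 0 <= f t) ->
   (\int[mu]_x `|(f x)%:E| `^ r = \int[mu]_x (f x `^ r)%:E)%E.
  by move=> f0; apply: eq_integral => x _; rewrite /= ger0_norm.
by rewrite !E// => t; rewrite addr_ge0.
Qed.

Section Interp.
Variables (R : realType) (n : nat).
Notation pt := 'rV[R]_n.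
Notation rt := (@row_of_tuple R n).
Notation tup := (n.-tuple R).

(** At level [l] the function is cut according to its size. The large part contributes at most
    [l / 4] in supremum, so where the convolution exceeds [l] the small part dominates and the L^2
    bound controls it. Since [r > 2], the dyadic levels that see a given value of [g] sum
    geometrically. *)
Lemma marcinkiewicz (M : pt -> R[i]) (A B p r N : R) (g : pt -> R[i]) :
  Ccs M -> 0 < A -> 0 < B -> (forall x, cabs (Fr 1 M x) <= A) -> (forall x, cabs (M x) <= B) ->
  1 < p -> p < 2 -> 0 < N -> mCn g ->
  (\int[mu R n]_t (cabs (g (rt t)) `^ p)%:E <= N%:E)%E ->
  r = p / (p - 1) ->
  (\int[mu R n]_t (cabs (convol M g (rt t)) `^ r)%:E <=
    (2 `^ r * 32 * B ^+ 2 * ((8 * A * N) `^ (r - 2) / (1 - 2 `^ (- (r - 2)))) * N)%:E)%E.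
Proof.
move=> cM A0 B0 hA hB p1 p2 N0 mg gN rE.
have pp : 0 < p - 1 by rewrite subr_gt0.
have r2 : 0 < r - 2.
  rewrite rE (_ : p / (p - 1) - 2 = (2 - p) / (p - 1)); first by rewrite divr_gt0// subr_gt0.
  by field; rewrite gt_eqF.
have wg : L1w g by apply: (Lp_L1w (ltW p1) mg (le_lt_trans gN (ltry _))).
(* The 8 is chosen for [hihi]: where [c] fails, [|g| <= l / (8 A N) |g|^p], and [conv_sup]
   multiplies the integral by [2 A], leaving [l / 4]. *)
pose c l (x : pt) := l * cabs (g x) `^ (p - 1) <= 8 * A * N.
have mgp e : measurable_fun setT (fun t : tup => cabs (g (rt t)) `^ e).
  exact: (measurableT_comp (measurable_powR e) (m_cabs mg)).
have mc l : measurable_fun setT (fun t : tup => c l (rt t)).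
  rewrite (_ : (fun _ => _) = (fun z : R => z <= 8 * A * N) \o (fun t : tup => l * cabs (g (rt t)) `^ (p - 1)))//.
  apply: measurableT_comp; first by apply: measurable_fun_ler.
  exact: measurable_funM.
pose lo l := rst g (c l).
pose hi l := rst g (fun x => ~~ c l x).
have mlo l : mCn (lo l) by exact: mCn_rst.
have mhi l : mCn (hi l) by apply: mCn_rst => //; exact: measurable_neg.
have wlo l : L1w (lo l) by apply: (L1w_dom (mlo l) wg) => x; exact: cabs_rst.
have whi l : L1w (hi l) by apply: (L1w_dom (mhi l) wg) => x; exact: cabs_rst.
have gE l y : convol M g y = convol M (lo l) y + convol M (hi l) y.
  rewrite -convD//; congr (convol M _ y); apply/funext => x; rewrite /lo /hi /rst.
  by case: (c l x); rewrite ?addr0 ?add0r.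
have B2 : 0 <= 16 * B ^+ 2 by apply: mulr_ge0 => //; exact: sqr_ge0.
have AN0 : 0 < 8 * A * N by rewrite !mulr_gt0.
have hihi l y : 0 < l -> cabs (convol M (hi l) y) <= l / 4.
  move=> l0; rewrite -lee_fin (le_trans (conv_sup cM y (mhi l) hA (ltW A0)))//.
  have -> : l / 4 = (2 * A) * (l / (8 * A)) by field; rewrite gt_eqF.
  rewrite [leRHS]EFinM; apply: lee_wpmul2l; first by rewrite lee_fin mulr_ge0// ltW.
  have -> : l / (8 * A) = l / (8 * A * N) * N by field; rewrite !gt_eqF.
  apply: (@le_trans _ _ ((l / (8 * A * N))%:E * \int[mu R n]_t (cabs (g (rt t)) `^ p)%:E)%E); last first.
    by rewrite [leRHS]EFinM; apply: lee_wpmul2l => //; rewrite lee_fin divr_ge0// ltW.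
  rewrite -ge0_integralZl//; last 3 first.
  - exact/measurable_EFinP.
  - by move=> t _; rewrite lee_fin powR_ge0.
  - by rewrite lee_fin divr_ge0// ltW.
  apply: ge0_le_integral => //.
  - by move=> t _; rewrite lee_fin cabs_ge0.
  - exact: (m_cabsE (mhi l)).
  - by apply: measurable_funeM; exact/measurable_EFinP.
  move=> t _; rewrite -EFinM lee_fin /hi /rst /c -ltNge; case: ifP => [h|_]; last first.
    by rewrite cabs0 mulr_ge0 ?powR_ge0// divr_ge0// ltW.
  rewrite -mulr_powRB1 ?cabs_ge0 ?(lt_trans ltr01)//.
  have := cabs_ge0 (g (rt t)); move: h; move: (cabs (g (rt t))) => w; move: (w `^ _) => u h w0.
  rewrite mulrCA ler_peMr// mulrAC ler_pdivlMr// mul1r; exact: ltW.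
have keyl l y : 0 < l -> l < cabs (convol M g y) -> l ^+ 2 <= 2 * cabs (convol M (lo l) y) ^+ 2.
  move=> l0; rewrite (gE l) => h.
  have := hihi l y l0; have := lt_le_trans h (cabsD _ _); have := cabs_ge0 (convol M (lo l) y).
  by move: (cabs _) (cabs _) => u w; nra.
pose lam m k : R := 2 ^+ m / 2 ^+ k.+1.
have lam0 m k : 0 < lam m k by rewrite divr_gt0// exprn_gt0.
(* Only values in [(2^-m, 2^m]] are kept, so [2 m] dyadic levels suffice; [lam m k] is the level
   just below such a value, within a factor 2. Fatou's lemma removes the truncation. *)
pose F m (y : pt) := if (2 ^+ m / 2 ^+ (2 * m) < cabs (convol M g y)) && (cabs (convol M g y) <= 2 ^+ m)
  then cabs (convol M g y) `^ r else 0.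
have mTg := mCn_conv cM mg.
have mT2 l : measurable_fun setT (fun t : tup => (cabs (convol M (lo l) (rt t)) ^+ 2)%:E).
  by apply/measurable_EFinP; apply: measurable_funX; apply: m_cabs; exact: mCn_conv.
have ml2 l : measurable_fun setT (fun t : tup => (cabs (lo l (rt t)) ^+ 2)%:E).
  by apply/measurable_EFinP; apply: measurable_funX; apply: m_cabs; exact: mlo.
pose co m k := 2 `^ r * 2 * lam m k `^ (r - 2).
have co0 m k : 0 <= co m k by rewrite !mulr_ge0 ?powR_ge0.
have FS m y : F m y <= \sum_(k < 2 * m) co m k * cabs (convol M (lo (lam m k)) y) ^+ 2.
  rewrite /F; case: ifP => [/andP[h1 h2]|_]; last first.
    by apply: sumr_ge0 => k _; rewrite mulr_ge0// sqr_ge0.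
  have [k k1 k2] := dyadic_pos h1 h2.
  rewrite (bigD1 k)//= ler_wpDr//.
    by apply: sumr_ge0 => j _; rewrite mulr_ge0// sqr_ge0.
  have l0 := lam0 m k.
  have k2' : cabs (convol M g y) <= 2 * lam m k.
    rewrite (le_trans k2)// le_eqVlt; apply/orP; left; apply/eqP.
    by rewrite /lam exprS; field; rewrite expf_neq0.
  apply: (@le_trans _ _ ((2 * lam m k) `^ r)).
    apply: ge0_ler_powR => //; rewrite ?nnegrE ?cabs_ge0 ?mulr_ge0// ?(ltW l0)//.
    by rewrite ltW// (lt_trans _ (_ : 2 < r))// -subr_gt0.
  rewrite powRM ?(ltW l0)// /co -!mulrA; apply: ler_wpM2l; first exact: powR_ge0.
  have -> : lam m k `^ r = lam m k `^ (r - 2) * lam m k ^+ 2.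
    by rewrite -powR_mulrn ?(ltW l0)// -powRD ?subrK// (gt_eqF l0) implybT.
  rewrite [leRHS]mulrCA; apply: ler_wpM2l; first exact: powR_ge0.
  exact: keyl.
have F0 m y : 0 <= F m y by rewrite /F; case: ifP => // _; exact: powR_ge0.
have mF m : measurable_fun setT (fun t : tup => F m (rt t)).
  apply: measurable_fun_ifT => //.
  - apply: measurable_and; first by apply: measurable_fun_ltr => //; exact: m_cabs.
    by apply: measurable_fun_ler => //; exact: m_cabs.
  - exact: (measurableT_comp (measurable_powR r) (m_cabs mTg)).
apply: (@fatou_le _ _ _ _ (fun m t => F m (rt t))) => //.
  move=> t; set L := cabs _; have [L0|L0] := eqVneq L 0.
    apply: cvg_near_cst; near=> m; rewrite /F -/L L0 powR0; first by rewrite if_same.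
    by rewrite gt_eqF// (lt_trans _ (_ : 2 < r))// -subr_gt0.
  have {}L0 : 0 < L by rewrite lt_neqAle eq_sym L0 cabs_ge0.
  apply: cvg_near_cst; exists (Num.truncn (L + L^-1)).+1 => // m /= hm.
  have hm2 : L + L^-1 < 2 ^+ m.
    rewrite (lt_le_trans (truncnS_gt _))// (@le_trans _ _ m%:R) ?ler_nat//.
    by rewrite -natrX ler_nat ltnW// ltn_expl.
  have Li : 0 < L^-1 by rewrite invr_gt0.
  rewrite /F -/L; case: ifPn => //; rewrite negb_and => /orP[|].
    rewrite -leNgt mul2n -addnn exprD invfM mulrA mulfV ?expf_neq0// mul1r.
    rewrite -[leLHS]invrK lef_pV2 ?posrE ?exprn_gt0// => /(lt_le_trans hm2).
    by rewrite ltNge lerDr (ltW L0).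
  rewrite -ltNge => /(lt_trans hm2); rewrite ltNge lerDl (ltW Li)//.
move=> m.
apply: (@le_trans _ _ (\int[mu R n]_t (\sum_(k < 2 * m) (co m k)%:E * (cabs (convol M (lo (lam m k)) (rt t)) ^+ 2)%:E))%E).
  apply: ge0_le_integral => //.
  - by move=> t _; rewrite lee_fin.
  - exact/measurable_EFinP.
  - by apply: emeasurable_sum => k; exact: measurable_funeM.
  - move=> t _; under eq_bigr do rewrite -EFinM.
    by rewrite sumEFin lee_fin.
rewrite ge0_integral_sum//; last 2 first.
- by move=> k; exact: measurable_funeM.
- by move=> k t _; rewrite -EFinM lee_fin mulr_ge0// sqr_ge0.
apply: (@le_trans _ _ (\sum_(k < 2 * m) \int[mu R n]_t ((co m k * (16 * B ^+ 2))%:E * (cabs (lo (lam m k) (rt t)) ^+ 2)%:E))%E).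
  apply: lee_sum => k _; rewrite ge0_integralZl//; last 2 first.
  - by move=> t _; rewrite lee_fin sqr_ge0.
  - by rewrite lee_fin.
  rewrite ge0_integralZl//; last 2 first.
  - by move=> t _; rewrite lee_fin sqr_ge0.
  - by rewrite lee_fin; apply: mulr_ge0 => //; exact: B2.
  rewrite [(co m k * _)%:E]EFinM -muleA; apply: lee_wpmul2l; first by rewrite lee_fin.
  exact: (conv_L2 cM (mlo _) (wlo _) hB (ltW B0)).
rewrite -ge0_integral_sum//; last 2 first.
- by move=> k; exact: measurable_funeM.
- by move=> k t _; rewrite -EFinM lee_fin; apply: mulr_ge0; [apply: mulr_ge0 => //; exact: B2|exact: sqr_ge0].
set Q := (8 * A * N) `^ (r - 2) / _.
have cB : 0 <= 2 `^ r * 32 * B ^+ 2.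
  by apply: mulr_ge0; [apply: mulr_ge0 => //; exact: powR_ge0|exact: sqr_ge0].
have Q0 : 0 <= Q.
  by rewrite divr_ge0 ?powR_ge0// subr_ge0 ltW// pow2N_lt1.
apply: (@le_trans _ _ ((2 `^ r * 32 * B ^+ 2 * Q)%:E * \int[mu R n]_t (cabs (g (rt t)) `^ p)%:E)%E); last first.
  rewrite [leRHS]EFinM; apply: lee_wpmul2l => //.
  by rewrite lee_fin; apply: mulr_ge0.
rewrite -ge0_integralZl//; last 3 first.
- exact/measurable_EFinP.
- by move=> t _; rewrite lee_fin powR_ge0.
- by rewrite lee_fin; apply: mulr_ge0.
apply: ge0_le_integral => //.
- by move=> t _; apply: sume_ge0 => k _; rewrite -EFinM lee_fin; apply: mulr_ge0; [apply: mulr_ge0 => //; exact: B2|exact: sqr_ge0].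
- by apply: emeasurable_sum => k; exact: measurable_funeM.
- by apply: measurable_funeM; exact/measurable_EFinP.
move=> t _; under eq_bigr do rewrite -EFinM.
rewrite sumEFin -EFinM lee_fin; set G := cabs (g (rt t)).
have [G0|G0] := eqVneq G 0.
  rewrite big1; first by apply: mulr_ge0; [exact: mulr_ge0|exact: powR_ge0].
  move=> k _; have := cabs_rst g (c (lam m k)) (rt t); rewrite -/G G0 => h.
  have -> : cabs (lo (lam m k) (rt t)) = 0 by apply/eqP; rewrite eq_le h cabs_ge0.
  by rewrite expr0n mulr0.
have {}G0 : 0 < G by rewrite lt_neqAle eq_sym G0 cabs_ge0.
have u0 : 0 < G `^ (p - 1) by exact: powR_gt0.
(* At this point the small part at level [l] is nonzero exactly when [l <= a], which turns the sum
   over levels into [geom_sum]. *)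
pose a := 8 * A * N / G `^ (p - 1).
have a0 : 0 < a by rewrite divr_gt0.
have -> : \sum_(k < 2 * m) co m k * (16 * B ^+ 2) * cabs (lo (lam m k) (rt t)) ^+ 2 =
   2 `^ r * 32 * B ^+ 2 * G ^+ 2 * \sum_(k < 2 * m) (if (2 ^+ m / 2) / 2 ^+ k <= a then ((2 ^+ m / 2) / 2 ^+ k) `^ (r - 2) else 0).
  rewrite mulr_sumr; apply: eq_bigr => k _; rewrite /co.
  have -> : (2 ^+ m / 2) / 2 ^+ k = lam m k by rewrite /lam exprS invfM mulrA.
  rewrite /lo /rst /c -/G ler_pdivlMr//; case: ifP => _; last by rewrite cabs0 expr0n !mulr0.
  by rewrite -/G; ring.
rewrite -(mulrA (_ * B ^+ 2) (G ^+ 2)) -(mulrA (_ * B ^+ 2) Q); apply: ler_wpM2l => //.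
have gs := geom_sum (2 * m) a0 r2 (_ : 0 < 2 ^+ m / 2).
apply: (@le_trans _ _ (G ^+ 2 * (a `^ (r - 2) / (1 - 2 `^ (- (r - 2)))))).
  apply: ler_wpM2l; first exact: sqr_ge0.
  apply: (le_trans (gs _)); first by rewrite divr_gt0// exprn_gt0.
  have d0 : 0 <= (1 - 2 `^ (- (r - 2)))^-1.
    by rewrite invr_ge0 subr_ge0 ltW// pow2N_lt1.
  apply: ler_wpM2r => //; apply: ge0_ler_powR; rewrite ?nnegrE ?(ltW r2) ?(ltW a0)//.
    by rewrite le_min (ltW a0) ltW// divr_gt0// exprn_gt0.
  by rewrite ge_min lexx orbT.
rewrite /Q -mulrA [X in _ <= _ * X]mulrC mulrA mulrA; apply: ler_wpM2r.
  by rewrite invr_ge0 subr_ge0 ltW// pow2N_lt1.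
(* The remaining power is [|g|^(2 - (p - 1) (r - 2)) = |g|^p], by the choice of [r]. *)
rewrite /a powRM ?(ltW AN0)// ?invr_ge0 ?(ltW u0)// mulrCA; apply: ler_wpM2l; first exact: powR_ge0.
rewrite powRV ?(ltW u0)// -powRrM -powRN -powR_mulrn ?(ltW G0)// -powRD ?(gt_eqF G0) ?implybT//.
rewrite le_eqVlt; apply/orP; left; apply/eqP; congr (_ `^ _).
by rewrite rE; field; rewrite gt_eqF.
Unshelve. all: by end_near. Qed.

Lemma Lpn_int (p : R) (g : pt -> R[i]) : mCn g ->
  Lpn p%:E g = ((\int[mu R n]_t (cabs (g (rt t)) `^ p)%:E) `^ p^-1)%E.
Proof.
move=> mg; rewrite /Lpn intRnE//.
- by apply/measurable_EFinP; exact: (measurableT_comp (measurable_powR p) (m_cabs mg)).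
- by move=> x; rewrite lee_fin powR_ge0.
Qed.

(* Pointwise, not essential, bound when p = 1: it is what the kernel estimate
   gives, and it spares null sets when pieces are added. *)
Definition nb (p : R) (g : pt -> R[i]) (Y : R) : Prop :=
  if p == 1 then forall x, cabs (g x) <= Y else (Lpn (p / (p - 1))%:E g <= Y%:E)%E.

Lemma nb_Lpn p g Y : nb p g Y -> (Lpn (pconj p) g <= Y%:E)%E.
Proof.
rewrite /nb /pconj; case: eqP => // _ h.
rewrite /Lpn; apply: ereal_inf_lbound; exists Y => //=.
rewrite /meas_n [X in \1_X](_ : _ = set0); last first.
  by rewrite -subset0 => y /=; rewrite ltNge h.
rewrite intRnE//.
- by rewrite /In; under eq_integral do rewrite indic0; rewrite integral0.
- suff -> : (fun t : tup => (\1_(set0 : set pt) (rt t) : R)%:E) = cst 0%E by exact: measurable_cst.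
  by apply/funext => t; rewrite indic0.
Qed.

Lemma nb_le p g Y Z : nb p g Y -> Y <= Z -> nb p g Z.
Proof.
rewrite /nb; case: ifP => _ h YZ; first by move=> x; exact: le_trans (h x) YZ.
by apply: (le_trans h); rewrite lee_fin.
Qed.

Lemma nb_add p (f g : pt -> R[i]) Y Z : 1 <= p -> p <= 2 -> mCn f -> mCn g -> nb p f Y -> nb p g Z ->
  nb p (fun x => f x + g x) (Y + Z).
Proof.
move=> p1 p2 mf mg; rewrite /nb; case: eqP => [_|/eqP pn1] hf hg.
  by move=> x; apply: (le_trans (cabsD _ _)); apply: lerD.
have {pn1}p1 : 1 < p by rewrite lt_neqAle eq_sym pn1.
have pp : 0 < p - 1 by rewrite subr_gt0.
set r := p / (p - 1) in hf hg *.
have r1 : 1 <= r by rewrite /r ler_pdivlMr// mul1r; lra.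
have r0 : 0 < r by exact: lt_le_trans ltr01 r1.
have mf' := m_cabs mf; have mg' := m_cabs mg.
have mfg : mCn (fun x => f x + g x) by exact: mCD.
rewrite EFinD; apply: le_trans (leeD hf hg).
rewrite (Lpn_int r mf) (Lpn_int r mg) (Lpn_int r mfg).
apply: le_trans (int_minkowski (mu R n) r1 mf' mg' (fun t => cabs_ge0 _) (fun t => cabs_ge0 _)).
apply: gt0_ler_poweR; first by rewrite invr_ge0 ltW.
- by rewrite in_itv/= leey andbT; apply: integral_ge0 => t _; rewrite lee_fin powR_ge0.
- by rewrite in_itv/= leey andbT; apply: integral_ge0 => t _; rewrite lee_fin powR_ge0.
apply: ge0_le_integral => //.
- by move=> t _; rewrite lee_fin powR_ge0.
- by apply/measurable_EFinP; exact: (measurableT_comp (measurable_powR r) (m_cabs mfg)).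
- by apply/measurable_EFinP; apply: (measurableT_comp (measurable_powR r)); exact: measurable_funD.
- move=> t _; rewrite lee_fin; apply: ge0_ler_powR; rewrite ?nnegrE ?(ltW r0) ?cabs_ge0 ?addr_ge0 ?cabs_ge0//.
  exact: cabsD.
Qed.

(** The endpoints are treated directly: at [p = 1] the exponent [r] is infinite, and at [p = 2] the
    geometric constant [1 / (1 - 2^-(r - 2))] of the interpolation is infinite. *)
Lemma convol_Lp (p : R) : 1 <= p -> p <= 2 -> exists2 C : R, 0 < C &
  forall (M : pt -> R[i]) (A B : R), Ccs M -> 0 < A -> 0 < B ->
  (forall x, cabs (Fr 1 M x) <= A) -> (forall x, cabs (M x) <= B) ->
  forall (g : pt -> R[i]) (N : R), mCn g -> 0 < N -> (Lpn p%:E g <= N%:E)%E ->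
  L1w g /\ nb p (convol M g) (C * A `^ (2 / p - 1) * B `^ (2 - 2 / p) * N).
Proof.
move=> p1 p2; have p0 : 0 < p by exact: lt_le_trans ltr01 p1.
have Np (g : pt -> R[i]) (N : R) : mCn g -> 0 < N -> (Lpn p%:E g <= N%:E)%E ->
    (\int[mu R n]_t (cabs (g (rt t)) `^ p)%:E <= (N `^ p)%:E)%E.
  move=> mg N0; rewrite Lpn_int//; set I := (\int[_]_t _)%E => h.
  have I0 : (0 <= I)%E by apply: integral_ge0 => t _; rewrite lee_fin powR_ge0.
  have -> : I = ((I `^ p^-1) `^ p)%E by rewrite -poweRrM mulVf ?gt_eqF// poweRe1.
  rewrite -poweR_EFin; apply: gt0_ler_poweR => //; rewrite ?(ltW p0)//.
  - by rewrite in_itv/= leey andbT poweR_ge0.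
  - by rewrite in_itv/= leey andbT lee_fin ltW.
have [p11|pn1] := eqVneq p 1.
  exists 2 => // M A B cM A0 B0 hA hB g N mg N0 h.
  have {h} := Np g N mg N0 h; rewrite p11 powRr1 ?(ltW N0)// => h.
  have wg : L1w g by apply: (@Lp_L1w _ _ g 1) => //; exact: le_lt_trans h (ltry _).
  split => //; rewrite /nb eqxx !divr1 subrr powRr0 mulr1 => y.
  have -> : (2 : R) - 1 = 1 by ring.
  rewrite powRr1 ?(ltW A0)//.
  rewrite -lee_fin (le_trans (conv_sup cM y mg hA (ltW A0)))// [leRHS]EFinM.
  apply: lee_wpmul2l; first by rewrite lee_fin mulr_ge0// ltW.
  apply: le_trans h; rewrite le_eqVlt; apply/orP; left; apply/eqP.
  by apply: eq_integral => t _; rewrite powRr1// cabs_ge0.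
have {pn1}p1 : 1 < p by rewrite lt_neqAle eq_sym pn1.
have pp : 0 < p - 1 by rewrite subr_gt0.
pose r := p / (p - 1).
have r0 : 0 < r by rewrite divr_gt0.
suff [D D0 HD] : exists2 D : R, 0 < D & forall (M : pt -> R[i]) (A B : R), Ccs M -> 0 < A -> 0 < B ->
  (forall x, cabs (Fr 1 M x) <= A) -> (forall x, cabs (M x) <= B) ->
  forall (g : pt -> R[i]) (N : R), mCn g -> L1w g -> 0 < N ->
  (\int[mu R n]_t (cabs (g (rt t)) `^ p)%:E <= N%:E)%E ->
  (\int[mu R n]_t (cabs (convol M g (rt t)) `^ r)%:E <=
    (D * A `^ (r - 2) * B `^ 2 * N `^ (r - 1))%:E)%E.
  exists (D `^ r^-1); first exact: powR_gt0.
  move=> M A B cM A0 B0 hA hB g N mg N0 h.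
  have {}h := Np g N mg N0 h.
  have wg : L1w g by apply: (Lp_L1w (ltW p1) mg (le_lt_trans h (ltry _))).
  split => //; rewrite /nb gt_eqF// -/r Lpn_int; last exact: mCn_conv.
  have NP0 : 0 < N `^ p by exact: powR_gt0.
  have H := HD M A B cM A0 B0 hA hB g _ mg wg NP0 h.
  set Y := (\int[_]_t _)%E in H *.
  have Y0 : (0 <= Y)%E by apply: integral_ge0 => t _; rewrite lee_fin powR_ge0.
  set X := D * A `^ _ * _ * _ in H.
  have X0 : 0 <= X by rewrite !mulr_ge0 ?powR_ge0// ltW.
  apply: (@le_trans _ _ (X%:E `^ r^-1)%E).
    apply: gt0_ler_poweR => //; first by rewrite invr_ge0 ltW.
    - by rewrite in_itv/= leey andbT.
    - by rewrite in_itv/= leey andbT lee_fin.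
  rewrite poweR_EFin lee_fin /X !powRM ?mulr_ge0 ?powR_ge0 ?(ltW D0)// -!powRrM.
  have -> : (r - 2) / r = 2 / p - 1 by rewrite /r; field; rewrite !gt_eqF.
  have -> : 2 / r = 2 - 2 / p by rewrite /r; field; rewrite !gt_eqF.
  have -> : p * ((r - 1) / r) = 1 by rewrite /r; field; rewrite !gt_eqF.
  by rewrite powRr1// ltW.
have [p22|pn2] := eqVneq p 2.
  have r2 : r = 2 by rewrite /r p22 (_ : (2 : R) - 1 = 1) ?divr1//; ring.
  exists 16 => // M A B cM A0 B0 hA hB g N mg wg N0.
  rewrite r2 p22 subrr powRr0 mulr1.
  have -> : (2 : R) - 1 = 1 by ring.
  rewrite powRr1 ?(ltW N0)// => h.
  have sq (f : pt -> R[i]) : (\int[mu R n]_t (cabs (f (rt t)) `^ 2)%:E = \int[mu R n]_t (cabs (f (rt t)) ^+ 2)%:E)%E.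
    by apply: eq_integral => t _; rewrite powR_mulrn// cabs_ge0.
  rewrite sq in h; rewrite sq powR_mulrn ?(ltW B0)//.
  apply: (le_trans (conv_L2 cM mg wg hB (ltW B0))); rewrite [leRHS]EFinM.
  by apply: lee_wpmul2l => //; rewrite lee_fin mulr_ge0// sqr_ge0.
have {pn2}p2 : p < 2 by rewrite lt_neqAle pn2.
have r2 : 0 < r - 2.
  rewrite /r (_ : p / (p - 1) - 2 = (2 - p) / (p - 1)); first by rewrite divr_gt0// subr_gt0.
  by field; rewrite gt_eqF.
have q1 := pow2N_lt1 r2.
exists (2 `^ r * 32 * (8 `^ (r - 2) / (1 - 2 `^ (- (r - 2))))).
  by rewrite !mulr_gt0 ?powR_gt0// invr_gt0 subr_gt0.
move=> M A B cM A0 B0 hA hB g N mg wg N0 h.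
apply: (le_trans (marcinkiewicz cM A0 B0 hA hB p1 p2 N0 mg h (erefl _))); rewrite -/r lee_fin.
rewrite !powRM ?mulr_ge0 ?(ltW A0) ?(ltW N0)//.
have -> : N `^ (r - 1) = N `^ (r - 2) * N.
  rewrite -[X in _ * X]powRr1 ?(ltW N0)// -powRD; first by congr (_ `^ _); ring.
  by rewrite (gt_eqF N0) implybT.
rewrite powR_mulrn ?(ltW B0)// le_eqVlt; apply/orP; left; apply/eqP.
by move: (1 - _)^-1 => z; ring.
Qed.
End Interp.

(** * Van der Corput estimates *)

Section Vdc.
Variable R : realType.
Implicit Types (f E : R -> R).

Lemma der_const_eq f g (h : R -> R) (a b : R) : (forall y : R, Num.min a b <= y <= Num.max a b -> der f y (h y)) ->
  (forall y : R, Num.min a b <= y <= Num.max a b -> der g y (h y)) -> f a = g a -> f b = g b.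
Proof.
move=> df dg fga.
have [ab|ba] := leP a b.
  have mi : Num.min a b = a by exact/min_idPl.
  have ma : Num.max a b = b by exact/max_idPr.
  rewrite mi ma in df dg.
  have h1 := der_le ab df dg (fun x _ => lexx (h x)).
  have h2 := der_le ab dg df (fun x _ => lexx (h x)).
  lra.
have mi : Num.min a b = b by apply/min_idPr; exact: ltW.
have ma : Num.max a b = a by apply/max_idPl; exact: ltW.
rewrite mi ma in df dg.
have h1 := der_le (ltW ba) df dg (fun x _ => lexx (h x)).
have h2 := der_le (ltW ba) dg df (fun x _ => lexx (h x)).
lra.
Qed.

(** The primitives from [-k], normalised at 0, agree wherever two of them are valid; taking [k]
    according to the point glues them on the whole line. *)
Lemma primitive_ex f : continuous f -> exists2 F, F 0 = 0 & forall y : R, der F y (f y).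
Proof.
move=> cf.
pose P (k : nat) (y : R) : R := (\int[@lebesgue_measure R]_(t in `[(- k%:R), y]) f t)%R.
have dP k (y : R) : - k%:R < y -> der (P k) y (f y).
  move=> ky; have yu : y < y + 1 by rewrite ltrDl.
  have [|d1 d2] := @continuous_FTC1_closed R f (- k%:R) y (y + 1) yu _ ky (cf y).
    apply: continuous_compact_integrable; first exact: segment_compact.
    exact: continuous_subspaceT.
  split; first exact: d1.
  by rewrite -derive1E; exact: d2.
pose F k (y : R) := P k y - P k 0.
have dF k (y : R) : - k%:R < y -> der (F k) y (f y).
  by move=> ky; apply: deq (dD (dP k y ky) (dC (- P k 0) y)) _; rewrite addr0.
have FF k l (y : R) : (0 < k)%N -> (0 < l)%N -> - k%:R < y -> - l%:R < y -> F k y = F l y.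
  move=> k0 l0 ky ly; apply: (@der_const_eq _ _ f 0 y).
  - move=> z /andP[z1 _]; apply: dF; apply: lt_le_trans z1; rewrite lt_min ky andbT.
    by rewrite oppr_lt0 ltr0n.
  - move=> z /andP[z1 _]; apply: dF; apply: lt_le_trans z1; rewrite lt_min ly andbT.
    by rewrite oppr_lt0 ltr0n.
  - by rewrite /F !subrr.
pose k (y : R) := (Num.truncn `|y|).+1.
have ky (y : R) : - (k y)%:R < y.
  rewrite ltrNl; apply: le_lt_trans (truncnS_gt `|y|).
  by rewrite -normrN ler_norm.
exists (fun y => F (k y) y) => [|y]; first by rewrite /F subrr.
apply: (d_near (dF (k y) y (ky y))).
have Kz : \forall z \near y, - (k y)%:R < z by exact: lt_nbhsr (ky y).
by apply: filterS Kz => z hz; exact: FF.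
Qed.

(** Up to [c^(-1/2)] the trivial bound [|E w| <= w] is enough; beyond it one integration by parts
    is. *)
Lemma vdc_pos (c d : R) E : 0 < c -> E 0 = 0 -> (forall y : R, der E y (cos (c * y ^+ 2 + d))) ->
  forall w, 0 <= w -> `|E w| <= 4 / Num.sqrt c.
Proof.
move=> c0 E0 dE.
have s0 : 0 < Num.sqrt c by rewrite sqrtr_gt0.
pose w0 := (Num.sqrt c)^-1.
have w00 : 0 < w0 by rewrite invr_gt0.
have cw : c * w0 ^+ 2 = 1 by rewrite /w0 exprVn sqr_sqrtr ?mulfV ?gt_eqF// ltW.
have small w : 0 <= w -> `|E w| <= w.
  move=> w1; have h1 := der_le w1 (fun x _ => dE x) (fun x _ => dId x) (fun x _ => cos_le1 _).
  have dOp (x : R) : der (fun y : R => - y) x (-1) by exact: dOpp.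
  have h2 := der_le w1 (fun x _ => dOp x) (fun x _ => dE x) (fun x _ => cos_geN1 _).
  by rewrite ler_norml; lra.
move=> w w1; have [ww|ww] := leP w w0.
  rewrite (le_trans (small w w1))// (le_trans ww)// -[leLHS]mul1r ler_wpM2r ?ler1n// ltW//.
(* [E] minus its boundary term: the derivative of [G] is what an integration by parts leaves, and it
   is compared with that of a multiple of [1 / y]. *)
pose G (y : R) := E y - sin (c * y ^+ 2 + d) / (2 * c * y).
have dG (y : R) : w0 <= y <= w -> der G y (sin (c * y ^+ 2 + d) / (2 * c * y ^+ 2)).
  move=> /andP[y1 _]; have y0 : 0 < y by exact: lt_le_trans w00 y1.
  have cy : 2 * c * y != 0 by rewrite !mulf_neq0 ?gt_eqF.
  have dq : der (fun y : R => c * y ^+ 2 + d) y (2 * c * y).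
    apply: deq; first by apply: dD; [apply: dM; [exact: dC|apply: dX; exact: dId]|exact: dC].
    by cbv beta; ring.
  have dl : der (fun y : R => 2 * c * y) y (2 * c).
    apply: deq; first by apply: dM; [exact: dC|exact: dId].
    by cbv beta; ring.
  apply: deq; first by apply: dD; [exact: dE|apply: dN; apply: dM; [apply: dsin; exact: dq|apply: (dV cy dl)]].
  move: (sin _) (cos _) => sn cs; field; by rewrite !gt_eqF.
have dH (e y : R) : w0 <= y <= w -> der (fun y => e / (2 * c) * - y^-1) y (e / (2 * c * y ^+ 2)).
  move=> /andP[y1 _]; have y0 : 0 < y by exact: lt_le_trans w00 y1.
  apply: deq; first by apply: dM; [exact: dC|apply: dN; apply: dV; [rewrite gt_eqF|exact: dId]].
  by cbv beta; change (id y) with y; field; rewrite !gt_eqF.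
have pos (y : R) : w0 <= y <= w -> 0 <= (2 * c * y ^+ 2)^-1.
  move=> /andP[y1 _]; have y0 : 0 < y by exact: lt_le_trans w00 y1.
  by rewrite invr_ge0 !mulr_ge0 ?ltW.
have h1 : G w - G w0 <= 1 / (2 * c) * - w^-1 - 1 / (2 * c) * - w0^-1.
  apply: (der_le (ltW ww) dG (dH 1)) => y hy.
  by apply: ler_wpM2r; [exact: pos|exact: sin_le1].
have h2 : -1 / (2 * c) * - w^-1 - -1 / (2 * c) * - w0^-1 <= G w - G w0.
  apply: (der_le (ltW ww) (dH (-1)) dG) => y hy.
  by apply: ler_wpM2r; [exact: pos|exact: sin_geN1].
have e4 : (2 * c)^-1 * w0^-1 = w0 / 2.
  have c1 : c = w0 ^- 2 by apply: (mulIf (_ : w0 ^+ 2 != 0)); rewrite ?cw ?mulVf ?expf_neq0 ?gt_eqF.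
  by rewrite c1; field; rewrite gt_eqF.
have bs y : w0 <= y -> `|sin (c * y ^+ 2 + d) / (2 * c * y)| <= w0 / 2.
  move=> y1; have y0 : 0 < y by exact: lt_le_trans w00 y1.
  rewrite normrM; apply: (@le_trans _ _ (1 * (2 * c * w0)^-1)); last first.
    by rewrite mul1r invfM e4.
  apply: ler_pM => //; first by rewrite ler_norml sin_le1 sin_geN1.
  rewrite normrV ?unitfE ?mulf_neq0 ?gt_eqF// gtr0_norm ?mulr_gt0//.
  by rewrite lef_pV2 ?posrE ?mulr_gt0// ler_wpM2l// mulr_ge0// ltW.
have e1 := bs w (ltW ww); have e2 := bs w0 (lexx _).
have e3 := small w0 (ltW w00).
have e5 : 0 <= (2 * c)^-1 * w^-1 by rewrite mulr_ge0// invr_ge0 ?mulr_ge0 ?(ltW c0).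
have -> : 4 / Num.sqrt c = 4 * w0 by [].
move: h1 h2 e1 e2 e3; rewrite /G !ler_norml !mulrN !mulNr !mul1r.
move: (sin _ / _) (sin _ / _) (E w) (E w0) => a1 a2 a3 a4 h1 h2 /andP[b1 b2] /andP[b3 b4] /andP[b5 b6].
by apply/andP; split; lra.
Qed.

Lemma vdc (c d : R) E : c != 0 -> E 0 = 0 -> (forall y : R, der E y (cos (c * y ^+ 2 + d))) ->
  forall w, `|E w| <= 4 / Num.sqrt `|c|.
Proof.
move=> c0 E0 dE w.
wlog cp : c d c0 dE / 0 < c.
  move=> H; have [cp|cn] := ltP 0 c; first exact: (H c d).
  have c1 : 0 < - c by rewrite oppr_gt0 lt_neqAle c0.
  rewrite -(normrN c); apply: (H (- c) (- d)) => //; first by rewrite gt_eqF.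
  by move=> y; rewrite -cosN mulNr -opprD opprK.
rewrite (gtr0_norm cp); have [w0|w0] := leP 0 w; first exact: (vdc_pos cp E0 dE).
have -> : `|E w| = `|(fun y => - E (- y)) (- w)| by rewrite /= opprK normrN.
apply: (@vdc_pos c d (fun y => - E (- y)) cp _ _ (- w)); rewrite ?oppr0 ?E0 ?oppr0// ?oppr_ge0 ?(ltW w0)//.
move=> y; apply: deq; first by apply: dN; apply: (@dchain _ (fun y => - y) E); [exact: dE|exact: dOpp].
by rewrite sqrrN mulrN1 opprK.
Qed.

(** Completing the square turns the linear term into a shift of [y] and a constant phase. As [vdc]
    bounds the primitive on the whole line, the bound does not depend on [x]. The sine is the cosine
    with phase [- pi / 2]. *)
Lemma vdc_primitive (tau x : R) : tau != 0 -> exists Ec Es : R -> R,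
  [/\ (forall y : R, der Ec y (cos (2 * pi * (tau * y ^+ 2 + x * y)))),
      (forall y : R, der Es y (sin (2 * pi * (tau * y ^+ 2 + x * y)))),
      (forall y, `|Ec y| <= 4 / Num.sqrt `|tau|) & (forall y, `|Es y| <= 4 / Num.sqrt `|tau|)].
Proof.
move=> t0; have p0 := pi_gt0 R.
pose s0 := - x / (2 * tau).
pose c := 2 * pi * tau.
have c0 : c != 0 by rewrite mulf_neq0// mulf_neq0// gt_eqF.
have key (d : R) : exists2 E : R -> R, (forall y : R, der E y (cos (2 * pi * (tau * y ^+ 2 + x * y) + d))) &
    forall y, `|E y| <= 4 / Num.sqrt `|tau|.
  pose d' := d - 2 * pi * (x ^+ 2 / (4 * tau)).
  have cc : continuous (fun y : R => cos (c * y ^+ 2 + d')).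
    move=> y; have dd : der (fun y : R => cos (c * y ^+ 2 + d')) y (- sin (c * y ^+ 2 + d') * (0 * y ^+ 2 + c * (2%:R * y ^+ 1 * 1) + 0)).
      by apply: dcos; apply: dD; [apply: dM; [exact: dC|apply: dX; exact: dId]|exact: dC].
    exact: d_cont dd.
  have [E E0 dE] := primitive_ex cc.
  exists (fun y => E (y - s0)) => y.
    apply: deq; first by apply: (@dchain _ (fun y => y - s0) E); [exact: dE|apply: dD; [exact: dId|exact: dC]].
    rewrite addr0 mulr1; congr cos; rewrite /c /d' /s0; move: (pi : R) => P; field.
    exact: t0.
  apply: (le_trans (vdc c0 E0 dE _)); rewrite ler_wpM2l// lef_pV2 ?posrE ?sqrtr_gt0 ?normr_gt0//.
  rewrite ler_wsqrtr// /c normrM ler_peMl// ger0_norm ?mulr_ge0 ?(ltW p0)//.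
  by have := pi_ge2 R; lra.
have [Ec dEc bEc] := key 0; have [Es dEs bEs] := key (- (pi / 2)).
exists Ec, Es; split => // y; first by apply: deq (dEc y) _; rewrite addr0.
by apply: deq (dEs y) _; rewrite cosBpihalf.
Qed.
End Vdc.

(** * Oscillatory integrals with quadratic phase in R^n *)

Section Osc.
Variables (R : realType) (n : nat).
Notation pt := 'rV[R]_n.
Notation rt := (@row_of_tuple R n).
Notation tup := (n.-tuple R).
Implicit Types (f g : pt -> R[i]) (h : pt -> R).

Lemma smooth_of_pder h : continuous h ->
  (forall i, exists2 g, smooth g & forall x, pder h x i (g x)) -> smooth h.
Proof.
move=> ch dh; apply: (@smooth_class _ _ (fun k => smooth k \/ k = h)); last by right.
move=> k [sk|->]; last by split => // i; have [g sg hg] := dh i; exists g => //; left.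
split; first exact: smooth_cont.
by move=> i; exists (pd i k) => [|x]; [left; exact: smooth_pd|exact: smooth_pder].
Qed.

Lemma csmooth_cst (z : R[i]) : csmooth (fun _ : pt => z).
Proof. by split; exact: smooth_cst. Qed.
Lemma csmooth_prod (I : Type) (s : seq I) (F : I -> pt -> R[i]) :
  (forall i, csmooth (F i)) -> csmooth (fun x => \prod_(i <- s) F i x).
Proof.
move=> sF; elim: s => [|i s IH].
  by under eq_fun do rewrite big_nil; exact: csmooth_cst.
by under eq_fun do rewrite big_cons; exact: csmoothM.
Qed.
Lemma cpdM i f g x : csmooth f -> csmooth g ->
  cpd i (fun x => f x * g x) x = cpd i f x * g x + f x * cpd i g x.
Proof.
move=> [f1 f2] [g1 g2].
have a1 := smooth_pder x i f1; have a2 := smooth_pder x i f2.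
have b1 := smooth_pder x i g1; have b2 := smooth_pder x i g2.
apply: c_ext; rewrite /cpd /=.
- rewrite (_ : (fun x => _) = (fun x => cre (f x) * cre (g x) + (-1) * (cim (f x) * cim (g x)))); last first.
    by apply/funext => y; rewrite creM mulN1r.
  rewrite (pderE (pderD (pderM a1 b1) (pderM (pder_cst (-1) x i) (pderM a2 b2)))).
  by rewrite !(creD, creM, cimM) /=; ring.
- rewrite (_ : (fun x => _) = (fun x => cre (f x) * cim (g x) + cim (f x) * cre (g x))); last first.
    by apply/funext => y; rewrite cimM.
  rewrite (pderE (pderD (pderM a1 b2) (pderM a2 b1))).
  by rewrite !(cimD, creM, cimM) /=; ring.
Qed.
Lemma cpd_cst (i : 'I_n) (z : R[i]) (x : pt) : cpd i (fun=> z) x = 0.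
Proof. by apply: c_ext; rewrite /cpd /= (pderE (pder_cst _ x i)). Qed.
Lemma cpd_prod0 i (s : seq 'I_n) (F : 'I_n -> pt -> R[i]) x : (forall j, csmooth (F j)) ->
  (forall j, j \in s -> cpd i (F j) x = 0) -> cpd i (fun x => \prod_(j <- s) F j x) x = 0.
Proof.
move=> sF; elim: s => [|j s IH] h.
  by under eq_fun do rewrite big_nil; exact: cpd_cst.
under eq_fun do rewrite big_cons.
rewrite cpdM; [|exact: sF|exact: csmooth_prod].
rewrite h ?mem_head// IH ?mulr0 ?mul0r ?addr0// => k ks; apply: h.
by rewrite inE ks orbT.
Qed.
Definition cpds (s : seq 'I_n) f := foldr (fun i g => cpd i g) f s.
Lemma Ccs_cpds s f : Ccs f -> Ccs (cpds s f).
Proof. by move=> cf; elim: s => [|i s IH] //=; exact: Ccs_cpd. Qed.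

(** [g] collects the factors of coordinates set aside by the induction: for [i :: s] the coordinates
    of [s] are integrated by parts with [e i] inside [g], and [i] comes last. *)
Lemma ibp (e E : 'I_n -> pt -> R[i]) : (forall i, csmooth (E i)) -> (forall i, csmooth (e i)) ->
  (forall i x, cpd i (E i) x = e i x) -> (forall i j x, i != j -> cpd j (E i) x = 0) ->
  (forall i j x, i != j -> cpd j (e i) x = 0) -> forall s, uniq s ->
  forall f g, Ccs f -> csmooth g -> (forall i x, i \in s -> cpd i g x = 0) ->
  cIn (fun x => f x * (g x * \prod_(i <- s) e i x)) =
  (-1) ^+ size s * cIn (fun x => cpds s f x * (g x * \prod_(i <- s) E i x)).
Proof.
move=> sE se dE dE0 de0; elim=> [|i s IH] /=.
  by move=> _ f g _ _ _; rewrite expr0 mul1r; congr cIn; apply/funext => x; rewrite !big_nil.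
move=> /andP[is_ us] f g cf sg g0.
have sp : csmooth (fun x => \prod_(j <- s) E j x) by exact: csmooth_prod.
have cs := Ccs_cpds s cf.
have -> : cIn (fun x => f x * (g x * \prod_(j <- i :: s) e j x)) =
    cIn (fun x => f x * (g x * e i x * \prod_(j <- s) e j x)).
  by congr cIn; apply/funext => x; rewrite big_cons !mulrA.
have sge : csmooth (fun x => g x * e i x) by exact: csmoothM sg (se i).
have ge0 j x : j \in s -> cpd j (fun x => g x * e i x) x = 0.
  move=> js; have ij : i != j by apply: contra is_ => /eqP ->.
  have jis : j \in i :: s by rewrite inE js orbT.
  by rewrite (cpdM _ _ sg (se i)) (g0 _ _ jis) mul0r add0r (de0 _ _ _ ij) mulr0.
rewrite (IH us f _ cf sge ge0).
rewrite exprS mulN1r mulNr -mulrN; congr (_ * _).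
have sis : csmooth (fun x => \prod_(j <- i :: s) E j x) by exact: csmooth_prod.
pose F x := cpds s f x * (g x * \prod_(j <- i :: s) E j x).
have sgE : csmooth (fun x => g x * \prod_(j <- i :: s) E j x) by exact: csmoothM sg sis.
have cF : Ccs F.
  rewrite /F (_ : (fun x => _) = (fun x => (g x * \prod_(j <- i :: s) E j x) * cpds s f x)).
    exact: CcsM sgE cs.
  by apply/funext => x; rewrite mulrC.
have := cint_cpd i cF.
have dF x : cpd i F x = cpd i (cpds s f) x * (g x * \prod_(j <- i :: s) E j x) +
    cpds s f x * (g x * e i x * \prod_(j <- s) E j x).
  have cs1 := cs.1.
  rewrite /F (cpdM _ _ cs1 sgE); congr (_ + _ * _); rewrite (cpdM _ _ sg sis).
  rewrite (g0 _ _ (mem_head _ _)) mul0r add0r -mulrA; congr (_ * _).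
  have -> : (fun x => \prod_(j <- i :: s) E j x) = (fun x => E i x * \prod_(j <- s) E j x).
    by apply/funext => y; rewrite big_cons.
  rewrite (cpdM _ _ (sE i) sp) dE (cpd_prod0 sE) ?mulr0 ?addr0// => j js; apply: dE0.
  by apply: contra is_ => /eqP <-.
have i1 : iCn (fun x => cpd i (cpds s f) x * (g x * \prod_(j <- i :: s) E j x)).
  rewrite (_ : (fun x => _) = (fun x => (g x * \prod_(j <- i :: s) E j x) * cpd i (cpds s f) x)); last first.
    by apply/funext => x; rewrite mulrC.
  exact: rapid_iC (Ccs_rapid (CcsM sgE (Ccs_cpd i cs))).
have i2 : iCn (fun x => cpds s f x * (g x * e i x * \prod_(j <- s) E j x)).
  rewrite (_ : (fun x => _) = (fun x => (g x * e i x * \prod_(j <- s) E j x) * cpds s f x)); last first.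
    by apply/funext => x; rewrite mulrC.
  exact: rapid_iC (Ccs_rapid (CcsM (csmoothM sge sp) cs)).
rewrite (_ : cpd i F = (fun x => cpd i (cpds s f) x * (g x * \prod_(j <- i :: s) E j x) +
    cpds s f x * (g x * e i x * \prod_(j <- s) E j x))); last by apply/funext => x; exact: dF.
rewrite /cIn (cI_add i1 i2) => /eqP; rewrite addrC addr_eq0 => /eqP h; exact: h.
Qed.

Definition chirp (tau : R) (x xi : pt) : R[i] := expi (2 * pi * (tau * dotp xi xi + dotp x xi)).

Lemma pder_coord_fun (G : R -> R) (a : R) i j (x : pt) : der G (x 0 i) a ->
  pder (fun y : pt => G (y 0 i)) x j (a * (j == i)%:R).
Proof. by move=> dG; apply: (pder_comp (F := G)) => //; exact: pder_coord. Qed.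

Lemma smooth_coord_primitive (G g : R -> R) i : (forall y : R, der G y (g y)) ->
  smooth (fun x : pt => g (x 0 i)) -> smooth (fun x : pt => G (x 0 i)).
Proof.
move=> dG sg; apply: smooth_of_pder.
  move=> x; apply: (@continuous_comp _ _ _ (fun x : pt => x 0 i) G).
    exact: (smooth_cont (smooth_coord R i)).
  exact: d_cont (dG (x 0 i)).
move=> j; exists (fun x => g (x 0 i) * (j == i)%:R).
  exact (smooth_mul sg (@smooth_cst R n (j == i)%:R)).
by move=> x; exact: pder_coord_fun.
Qed.

(** One integration by parts in each coordinate moves a full mixed derivative onto [f]. The 8 is 4
    for the real part of the primitive plus 4 for the imaginary part. *)
Lemma chirp_bound (tau : R) (x : pt) f : tau != 0 -> Ccs f ->
  cabs (cIn (fun xi => f xi * chirp tau x xi)) <=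
  2 * ((8 / Num.sqrt `|tau|) ^+ n * \int[mu R n]_t cabs (cpds (enum 'I_n) f (rt t))).
Proof.
move=> t0 cf; set K := 8 / _.
pose q i (u : R) : R := 2 * pi * (tau * u ^+ 2 + x 0 i * u).
have /choice[Ec hEc] := fun i : 'I_n => vdc_primitive (x 0 i) t0.
have {hEc}/choice[Es hE] := hEc.
pose e i (xi : pt) : R[i] := expi (q i (xi 0 i)).
pose E i (xi : pt) : R[i] := Complex (Ec i (xi 0 i)) (Es i (xi 0 i)).
have dq i (u : R) : der (q i) u (2 * pi * (tau * (2 * u) + x 0 i)).
  rewrite /q; apply: deq; first by drv.
  by cbv beta; move: (pi : R) => P; ring.
have se i : csmooth (e i).
  have sq : smooth (fun xi : pt => q i (xi 0 i)).
    rewrite /q; apply: smooth_mul; first exact: smooth_cst.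
    apply: smooth_add; apply: smooth_mul; try exact: smooth_cst; try exact: smooth_coord.
    by under eq_fun do rewrite expr2; apply: smooth_mul; exact: smooth_coord.
  by have [t1 t2] := @sm1_trig R; split; exact: smooth_comp.
have sE i : csmooth (E i).
  have [d1 d2 _ _] := hE i; have [s1 s2] := se i.
  by split; [exact: smooth_coord_primitive d1 s1|exact: smooth_coord_primitive d2 s2].
have dE i j (z : pt) : cpd j (E i) z = e i z * rc (j == i)%:R.
  have [d1 d2 _ _] := hE i.
  apply: c_ext; rewrite /cpd ?creM ?cimM /=.
  - by rewrite (pderE (pder_coord_fun j (d1 (z 0 i)))) mulr0 subr0.
  - by rewrite (pderE (pder_coord_fun j (d2 (z 0 i)))) mulr0 add0r.
have de0 i j (z : pt) : i != j -> cpd j (e i) z = 0.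
  move=> /negPf ij; apply: c_ext; rewrite /cpd /=.
  - have dc := @dcos R (q i) _ _ (dq i (z 0 i)).
    by rewrite (pderE (pder_coord_fun j dc)) eq_sym ij mulr0.
  - have dc := @dsin R (q i) _ _ (dq i (z 0 i)).
    by rewrite (pderE (pder_coord_fun j dc)) eq_sym ij mulr0.
have dE1 i z : cpd i (E i) z = e i z by rewrite dE eqxx mulr1.
have dE0 i j z : i != j -> cpd j (E i) z = 0.
  by move=> /negPf ij; rewrite dE eq_sym ij mulr0.
have g0 i (z : pt) : i \in enum 'I_n -> cpd i (fun=> 1) z = 0 by move=> _; exact: cpd_cst.
have := ibp sE se dE1 dE0 de0 (enum_uniq 'I_n) cf (csmooth_cst 1) g0.
have -> : (fun xi => f xi * (1 * \prod_(i <- enum 'I_n) e i xi)) = (fun xi => f xi * chirp tau x xi).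
  apply/funext => xi; rewrite mul1r big_enum /= -expi_sum; congr (_ * expi _).
  rewrite /q /dotp -mulr_sumr big_split /= -mulr_sumr; congr (_ * (_ * _ + _)).
move=> ->; set F := (fun xi => cpds _ f xi * _).
have -> : cabs ((-1) ^+ size (enum 'I_n) * cIn F) = cabs (cIn F).
  by rewrite -signr_odd; case: odd; rewrite ?expr1 ?mulN1r ?cabsN// expr0 mul1r.
have cs := Ccs_cpds (enum 'I_n) cf; have ic := rapid_iC (Ccs_rapid cs).
have sp : csmooth (fun z => \prod_(i <- enum 'I_n) E i z) by exact: csmooth_prod.
have icb := i_cabs ic.
rewrite -RintegralZl; [|exact: measurableT|exact: icb].
apply: cI_norm_le.
- apply: mCM; first exact: iC_mC ic.
  by under eq_fun do rewrite mul1r; exact (csmooth_mCn sp).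
- move=> t; rewrite /F mul1r cabsM mulrC; apply: ler_wpM2r; first exact: cabs_ge0.
  rewrite -[X in K ^+ X](size_enum_ord n); elim: (enum 'I_n) => [|i s IH].
    by rewrite big_nil expr0 (_ : 1 = expi 0 :> R[i]) ?cabs_expi// expi0.
  rewrite big_cons cabsM exprS; apply: ler_pM; rewrite ?cabs_ge0//.
  apply: (le_trans (cabs_le _)); have [_ _ b1 b2] := hE i.
  apply: (le_trans (lerD (b1 _) (b2 _))).
  by rewrite /K -mulrDl (_ : 4 + 4 = 8 :> R)//; ring.
- exact: (integrableZl measurableT (K ^+ n) icb).
Qed.
End Osc.

(** * Phase amplitudes *)

Section Amp.
Variable R : realType.
Implicit Types (p a b : R -> R -> R).
Variable X : nat -> R -> R.
Hypothesis dX_ : forall k (u : R), der (X k) u (X k.+1 u).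
Hypothesis suppX : forall k u, ~~ (8^-1 <= u <= 8) -> X k u = 0.

(* In the variable u = |xi|^2 the frequency of the symbol is th. *)
Definition th (del u : R) : R := Num.sqrt (u - del ^+ 2 * u ^+ 2).
Definition ka (del u : R) : R := (th del u)^-1.
(** With 1/8, [th^2 = u (1 - del^2 u)] is positive on [0 < u < 32] and at least [u / 2] on the
    window [[1/8, 8]] of the cutoffs. *)
Definition small (del : R) := 0 <= del <= 8^-1.

(* The amplitudes must be bounded uniformly in del and stable under d/du and under
   the integration by parts of amp_step. *)
Inductive pol : (R -> R -> R) -> Prop :=
| pol_cst c : pol (fun _ _ => c)
| pol_del : pol (fun del _ => del)
| pol_u : pol (fun _ u => u)
| pol_th : pol th
| pol_ka : pol ka
| pol_add p q : pol p -> pol q -> pol (fun del u => p del u + q del u)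
| pol_mul p q : pol p -> pol q -> pol (fun del u => p del u * q del u).

Inductive amp : (R -> R -> R) -> Prop :=
| amp_X k : amp (fun _ u => X k u)
| amp_mul p a : pol p -> amp a -> amp (fun del u => p del u * a del u)
| amp_add a b : amp a -> amp b -> amp (fun del u => a del u + b del u).

Lemma th2_gt0 del u : small del -> 0 < u < 32 -> 0 < u - del ^+ 2 * u ^+ 2.
Proof.
move=> /andP[d0 d1] /andP[u0 u1].
have d2 : del ^+ 2 <= 64^-1 by nra.
have h : del ^+ 2 * u ^+ 2 <= 64^-1 * u ^+ 2 by rewrite ler_wpM2r// sqr_ge0.
have h2 : u ^+ 2 <= 32 * u by nra.
lra.
Qed.
Lemma th2_ge del u : small del -> 8^-1 <= u <= 8 -> u / 2 <= u - del ^+ 2 * u ^+ 2.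
Proof.
move=> /andP[d0 d1] /andP[u0 u1].
have d2 : del ^+ 2 <= 64^-1 by nra.
have h : del ^+ 2 * u ^+ 2 <= 64^-1 * u ^+ 2 by rewrite ler_wpM2r// sqr_ge0.
have h2 : u ^+ 2 <= 8 * u by nra.
lra.
Qed.
Lemma th_gt0 del u : small del -> 0 < u < 32 -> 0 < th del u.
Proof. by move=> d0 u0; rewrite sqrtr_gt0; exact: th2_gt0. Qed.
Lemma th_sqr del u : small del -> 0 < u < 32 -> th del u ^+ 2 = u - del ^+ 2 * u ^+ 2.
Proof. by move=> d0 u0; rewrite sqr_sqrtr// ltW// th2_gt0. Qed.

Definition dth del u := (1 - 2 * del ^+ 2 * u) * (ka del u / 2).
Lemma d_th del u : small del -> 0 < u < 32 -> der (th del) u (dth del u).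
Proof.
move=> d0 u0; have t0 := th_gt0 d0 u0; have s0 := th2_gt0 d0 u0.
have ds := is_derive1_sqrt s0.
have dq : der (fun u : R => u - del ^+ 2 * u ^+ 2) u (1 - 2 * del ^+ 2 * u).
  apply: deq; first by apply: dD; [exact: dId|apply: dN; apply: dM; [exact: dC|apply: dX; exact: dId]].
  by cbv beta; change (id u) with u; ring.
change (der (fun u => Num.sqrt (u - del ^+ 2 * u ^+ 2)) u (dth del u)).
apply: deq; first exact: (@dchain R (fun u => u - del ^+ 2 * u ^+ 2) (@Num.sqrt R) _ _ _ ds dq).
rewrite /dth /ka /th; move: (Num.sqrt _) t0 => s ts; rewrite /th in ts.
by rewrite mulrC invfM (mulrC _^-1).
Qed.

Lemma pol_dth : pol dth.
Proof.
rewrite /dth; apply: pol_mul.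
  rewrite (_ : (fun del u => 1 - 2 * del ^+ 2 * u) = (fun del u => 1 + (-2) * (del * (del * u)))).
    do 2 (apply: pol_add || apply: pol_cst || apply: pol_mul); first exact: pol_cst.
    by apply: pol_mul; [exact: pol_del|apply: pol_mul; [exact: pol_del|exact: pol_u]].
  by apply/funext => del; apply/funext => u; ring.
apply: pol_mul; [exact: pol_ka|exact: pol_cst].
Qed.

Lemma pol_der p : pol p -> exists2 p', pol p' &
  forall del u, small del -> 0 < u < 32 -> der (p del) u (p' del u).
Proof.
elim=> [c| | | | |{}p q pp [p' pp' dp] pq [q' pq' dq]|{}p q pp [p' pp' dp] pq [q' pq' dq]].
- by exists (fun _ _ => 0); [exact: pol_cst|move=> *; exact: dC].
- by exists (fun _ _ => 0); [exact: pol_cst|move=> *; exact: dC].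
- by exists (fun _ _ => 1); [exact: pol_cst|move=> *; exact: dId].
- by exists dth; [exact: pol_dth|exact: d_th].
- exists (fun del u => (-1) * (ka del u * (ka del u * dth del u))).
    apply: pol_mul; first exact: pol_cst.
    by do 2 (apply: pol_mul; first exact: pol_ka); exact: pol_dth.
  move=> del u d0 u0; have t0 := th_gt0 d0 u0.
  apply: deq; first by apply: dV; [rewrite gt_eqF|exact: d_th].
  by rewrite /ka expr2 invfM mulN1r mulNr mulrA.
- exists (fun del u => p' del u + q' del u); first exact: pol_add.
  by move=> del u d0 u0; apply: dD; [exact: dp|exact: dq].
- exists (fun del u => p' del u * q del u + p del u * q' del u).
    by apply: pol_add; apply: pol_mul.
  by move=> del u d0 u0; apply: dM; [exact: dp|exact: dq].
Qed.

Lemma pol_bdd p : pol p -> exists C, forall del u, small del -> 8^-1 <= u <= 8 -> `|p del u| <= C.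
Proof.
elim=> [c| | | | |{}p q pp [C1 h1] pq [C2 h2]|{}p q pp [C1 h1] pq [C2 h2]].
- by exists `|c|.
- by exists 1 => del u /andP[d0 d1] _; rewrite ger0_norm//; lra.
- by exists 8 => del u _ /andP[u0 u1]; rewrite ger0_norm//; lra.
- exists 8 => del u d0 u0.
  have u1 : 0 < u < 32 by move: u0 => /andP[? ?]; apply/andP; split; lra.
  have t0 := th_gt0 d0 u1; rewrite gtr0_norm//; have := th_sqr d0 u1.
  by move: u0 d0 => /andP[? ?] /andP[? ?]; nra.
- exists 8 => del u d0 u0.
  have u1 : 0 < u < 32 by move: u0 => /andP[? ?]; apply/andP; split; lra.
  have t0 := th_gt0 d0 u1; rewrite gtr0_norm ?invr_gt0// -[leRHS]invrK lef_pV2 ?posrE//.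
  have := th2_ge d0 u0; rewrite -th_sqr// => h.
  rewrite leNgt; apply/negP => hh; case/andP: u0 => u0 _.
  have : th del u ^+ 2 < 64^-1 by nra.
  lra.
- exists (C1 + C2) => del u d0 u0; apply: (le_trans (ler_normD _ _)).
  by apply: lerD; [exact: h1|exact: h2].
- exists (C1 * C2) => del u d0 u0; rewrite normrM.
  by apply: ler_pM => //; [exact: h1|exact: h2].
Qed.

Lemma amp_supp a : amp a -> forall del u, ~~ (8^-1 <= u <= 8) -> a del u = 0.
Proof.
elim=> [k|p {}a _ _ IH|{}a b _ IH1 _ IH2] del u hu; first exact: suppX.
- by rewrite IH// mulr0.
- by rewrite IH1// IH2// addr0.
Qed.

(** Outside [(0, 32)] a function supported in [[1/8, 8]] is locally zero. Amplitudes are thus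
    differentiable everywhere although [th] is only controlled inside. *)
Lemma d_out (f : R -> R) : (forall u, ~~ (8^-1 <= u <= 8) -> f u = 0) ->
  forall u : R, ~~ (0 < u < 32) -> der f u 0.
Proof.
move=> f0 u hu; apply: (d_near (dC 0 u)).
have [u0|u0] := leP u 0.
  have : \forall v \near u, v < 8^-1 by apply: lt_nbhsl; apply: le_lt_trans u0 _; rewrite invr_gt0.
  by apply: filterS => v hv; rewrite f0// negb_and -!ltNge hv.
have u1 : 32 <= u by move: hu; rewrite u0 /= -leNgt.
have : \forall v \near u, 8 < v by apply: lt_nbhsr; apply: lt_le_trans u1; lra.
by apply: filterS => v hv; rewrite f0// negb_and -!ltNge hv orbT.
Qed.

Lemma in_win (u : R) : 8^-1 <= u <= 8 -> 0 < u < 32.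
Proof. by move=> /andP[? ?]; apply/andP; split; lra. Qed.

Lemma amp_der a : amp a -> exists2 a', amp a' &
  forall del u, small del -> der (a del) u (a' del u).
Proof.
move=> ha.
have [a' ha' da] : exists2 a', amp a' & forall del u, small del -> 0 < u < 32 -> der (a del) u (a' del u).
  elim: ha => [k|p {}a hp ha [a' ha' da]|{}a b ha [a' ha' da] hb [b' hb' db]].
  - by exists (fun _ u => X k.+1 u); [exact: amp_X|move=> del u _ _; exact: dX_].
  - have [p' hp' dp] := pol_der hp.
    exists (fun del u => p' del u * a del u + p del u * a' del u).
      by apply: amp_add; apply: amp_mul.
    by move=> del u d0 u0; apply: dM; [exact: dp|exact: da].
  - exists (fun del u => a' del u + b' del u); first exact: amp_add.
    by move=> del u d0 u0; apply: dD; [exact: da|exact: db].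
exists a' => // del u d0; have [u0|u0] := boolP (0 < u < 32); first exact: da.
have -> : a' del u = 0 by apply: (amp_supp ha'); apply: contra u0; exact: in_win.
by apply: d_out => // v; exact: (amp_supp ha).
Qed.

Lemma X_bdd k : exists C, forall u, `|X k u| <= C.
Proof.
have cX : {within `[8^-1 : R, 8], continuous (X k)}.
  by apply: continuous_subspaceT => u; exact: d_cont (dX_ k u).
have [c _ hc] := @EVT_max R (X k) 8^-1 8 (ltac:(lra)) cX.
have [d _ hd] := @EVT_min R (X k) 8^-1 8 (ltac:(lra)) cX.
exists (`|X k c| + `|X k d|) => u; have [u0|u0] := boolP (8^-1 <= u <= 8); last first.
  by rewrite suppX// normr0 addr_ge0.
have h1 := hc u; have h2 := hd u; rewrite in_itv/= in h1; rewrite in_itv/= in h2.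
have {}h1 := h1 u0; have {}h2 := h2 u0.
have := ler_norm (X k c); have := normr_ge0 (X k c); have := normr_ge0 (X k d).
have := ler_norm (- X k d); rewrite normrN => a1 a2 a3 a4.
by rewrite ler_norml; apply/andP; split; lra.
Qed.

Lemma amp_bdd a : amp a -> exists2 C, 0 <= C & forall del u, small del -> `|a del u| <= C.
Proof.
elim=> [k|p {}a hp ha [C C0 hC]|{}a b ha [C C0 hC] hb [D D0 hD]].
- by have [C hC] := X_bdd k; exists C => [|del u _]; [exact: le_trans (normr_ge0 _) (hC 0)|].
- have [D hD] := pol_bdd hp.
  exists (`|D| * C) => [|del u d0]; first exact: mulr_ge0.
  have [u0|u0] := boolP (8^-1 <= u <= 8); last by rewrite (amp_supp ha)// mulr0 normr0 mulr_ge0.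
  rewrite normrM; apply: ler_pM => //; last exact: hC.
  by apply: le_trans (hD _ _ d0 u0) (ler_norm D).
- exists (C + D) => [|del u d0]; first exact: addr_ge0.
  by apply: (le_trans (ler_normD _ _)); apply: lerD; [exact: hC|exact: hD].
Qed.

(** Real form of amplitudes times [exp (- del T u)] and [exp] of [i T th]; differentiation in [u]
    stays in this form, with new amplitudes that carry a factor [T]. *)
Definition Ew (del T : R) a b (u : R) : R :=
  expR (- (del * T * u)) * (a del u * cos (T * th del u) + b del u * sin (T * th del u)).

Lemma Ew_supp del T a b u : amp a -> amp b -> ~~ (8^-1 <= u <= 8) -> Ew del T a b u = 0.
Proof. by move=> ha hb u0; rewrite /Ew (amp_supp ha)// (amp_supp hb)// !mul0r addr0 mulr0. Qed.

Lemma Ew_der a b a' b' del T : amp a -> amp b -> amp a' -> amp b' -> small del ->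
  (forall del u, small del -> der (a del) u (a' del u)) ->
  (forall del u, small del -> der (b del) u (b' del u)) ->
  forall u : R, der (Ew del T a b) u
   (Ew del T (fun del u => a' del u + T * (dth del u * b del u + (-1) * (del * a del u)))
             (fun del u => b' del u + T * ((-1) * (dth del u * a del u) + (-1) * (del * b del u))) u).
Proof.
move=> ha hb ha' hb' d0 da db u.
have [u0|u0] := boolP (0 < u < 32); last first.
  have uw : ~~ (8^-1 <= u <= 8) by apply: contra u0; exact: in_win.
  rewrite [X in der _ _ X](_ : _ = 0).
    by apply: d_out => // v; exact: Ew_supp.
  by rewrite /Ew (amp_supp ha)// (amp_supp hb)// (amp_supp ha')// (amp_supp hb')// !(mulr0, addr0, mul0r).
have dt := d_th d0 u0.
have dT : der (fun u => T * th del u) u (T * dth del u).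
  by apply: deq; [apply: dM; [exact: dC|exact: dt]|rewrite mul0r add0r].
have dl : der (fun u : R => - (del * T * u)) u (- (del * T)).
  by apply: deq; [apply: dN; apply: dM; [exact: dC|exact: dId]|rewrite mul0r add0r mulr1].
apply: deq.
  apply: dM; first by apply: dexp; exact: dl.
  apply: dD; apply: dM.
  - exact: da.
  - by apply: dcos; exact: dT.
  - exact: db.
  - by apply: dsin; exact: dT.
rewrite /Ew; cbv beta; move: (expR _) (cos _) (sin _) => e c s; ring.
Qed.

(** The phase [- del u + i th] has a derivative in [u] of modulus [1 / (2 th)]. Dividing by it
    yields [A] and [B], which stay bounded uniformly in [del]; each such step gains a factor
    [1 / T]. *)
Lemma amp_step a b : amp a -> amp b -> exists A B A' B', [/\ amp A, amp B, amp A', amp B' &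
  forall del T u, small del -> 0 < T -> der (Ew del T A B) u (T * Ew del T a b u + Ew del T A' B' u)].
Proof.
move=> ha hb.
pose q (del u : R) := 1 + (-2) * (del * (del * u)).
have pq : pol q.
  apply: pol_add; first exact: pol_cst.
  apply: pol_mul; first exact: pol_cst.
  by apply: pol_mul; [exact: pol_del|apply: pol_mul; [exact: pol_del|exact: pol_u]].
(* A and B solve a linear system of determinant (2 del th)^2 + q^2 = 1, so no
   division is needed. *)
pose A (del u : R) := (-4) * (th del u * (th del u * (del * a del u))) + (-2) * (th del u * (q del u * b del u)).
pose B (del u : R) := 2 * (th del u * (q del u * a del u)) + (-4) * (th del u * (th del u * (del * b del u))).
have hA : amp A.
  apply: amp_add; apply: (amp_mul (pol_cst _)); apply: (amp_mul pol_th).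
  - by apply: (amp_mul pol_th); apply: (amp_mul pol_del).
  - by apply: (amp_mul pq).
have hB : amp B.
  apply: amp_add; apply: (amp_mul (pol_cst _)); apply: (amp_mul pol_th).
  - by apply: (amp_mul pq).
  - by apply: (amp_mul pol_th); apply: (amp_mul pol_del).
have [A' hA' dA] := amp_der hA; have [B' hB' dB] := amp_der hB.
exists A, B, A', B'; split; [exact: hA|exact: hB|exact: hA'|exact: hB'|].
move=> del T u d0 T0.
apply: deq; first exact: (Ew_der T hA hB hA' hB' d0 dA dB u).
have [u0|u0] := boolP (8^-1 <= u <= 8); last first.
  rewrite /Ew (amp_supp ha)// (amp_supp hb)// (amp_supp hA)// (amp_supp hB)// (amp_supp hA')// (amp_supp hB')//.
  by rewrite !(mulr0, addr0, mul0r).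
have u1 := in_win u0; have t0 := th_gt0 d0 u1; have t2 := th_sqr d0 u1.
have tn : th del u != 0 by rewrite gt_eqF.
have e1 : dth del u * B del u + (-1) * (del * A del u) = a del u.
  have -> : dth del u * B del u + (-1) * (del * A del u) =
    a del u * (4 * del ^+ 2 * th del u ^+ 2 + (1 - 2 * del ^+ 2 * u) ^+ 2).
    by rewrite /dth /ka /A /B /q; field; rewrite tn.
  by rewrite t2; ring.
have e2 : (-1) * (dth del u * A del u) + (-1) * (del * B del u) = b del u.
  have -> : (-1) * (dth del u * A del u) + (-1) * (del * B del u) =
    b del u * (4 * del ^+ 2 * th del u ^+ 2 + (1 - 2 * del ^+ 2 * u) ^+ 2).
    by rewrite /dth /ka /A /B /q; field; rewrite tn.
  by rewrite t2; ring.
rewrite /Ew e1 e2; move: (expR _) (cos _) (sin _) => e c s; ring.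
Qed.

Notation pt := 'rV[R]_1.
Notation rt := (@row_of_tuple R 1).
Notation tup := (1.-tuple R).
(** Viewed on rows of length 1, so that the transform in R^n already built serves in dimension
    one. *)
Definition Eh del T a b (x : pt) : R[i] := rc (Ew del T a b (x 0 0)).

Lemma smooth_Ew del T a b : small del -> amp a -> amp b -> smooth (fun x : pt => Ew del T a b (x 0 0)).
Proof.
move=> d0 ha hb.
apply: (@smooth_class _ _ (fun h => exists a b, [/\ amp a, amp b & h = (fun x : pt => Ew del T a b (x 0 0))])); last by exists a, b.
move=> _ [{ha}a [{hb}b [ha hb ->]]].
have [a' ha' da] := amp_der ha; have [b' hb' db] := amp_der hb.
have dE := Ew_der T ha hb ha' hb' d0 da db.
split.
  by move=> x; apply: continuous_comp; [exact: coord_continuous|exact: d_cont (dE _)].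
move=> i; set a1 := (fun del u => a' del u + T * _) in dE.
set b1 := (fun del u => b' del u + T * _) in dE.
exists (fun x : pt => Ew del T a1 b1 (x 0 0)).
  exists a1, b1; split => //; apply: amp_add => //; apply: (amp_mul (pol_cst _)).
  - by apply: amp_add; [exact: (amp_mul pol_dth)|apply: (amp_mul (pol_cst _)); exact: (amp_mul pol_del)].
  - by apply: amp_add; apply: (amp_mul (pol_cst _)); [exact: (amp_mul pol_dth)|exact: (amp_mul pol_del)].
move=> x; have := pder_comp (dE _) (pder_coord 0 x i).
by rewrite (ord1 i) eqxx mulr1.
Qed.

Lemma Ew_bdd a b : amp a -> amp b -> exists2 C, 0 <= C & forall del T u, small del -> 0 < T -> `|Ew del T a b u| <= C.
Proof.
move=> ha hb; have [C C0 hC] := amp_bdd ha; have [D D0 hD] := amp_bdd hb.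
exists (C + D) => [|del T u d0 T0]; first exact: addr_ge0.
have [u0|u0] := boolP (8^-1 <= u <= 8); last by rewrite Ew_supp// normr0 addr_ge0.
rewrite /Ew normrM -[leRHS]mul1r; apply: ler_pM => //.
  rewrite ger0_norm ?expR_ge0// -expR0 ler_expR oppr_le0 !mulr_ge0//.
  - by case/andP: d0.
  - exact: ltW.
  - by case/andP: u0 => u0 _; apply: le_trans u0; rewrite invr_ge0.
apply: (le_trans (ler_normD _ _)); rewrite !normrM; apply: lerD.
- rewrite -[leRHS]mulr1; apply: ler_pM => //; first exact: hC.
  by rewrite ler_norml cos_geN1 cos_le1.
- rewrite -[leRHS]mulr1; apply: ler_pM => //; first exact: hD.
  by rewrite ler_norml sin_geN1 sin_le1.
Qed.

Lemma Ccs_Eh del T a b : small del -> amp a -> amp b -> Ccs (Eh del T a b).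
Proof.
move=> d0 ha hb; split; first by apply: csmooth_rc; exact: smooth_Ew.
exists 8 => x i hx; rewrite /Eh Ew_supp//; rewrite (ord1 i) in hx.
apply/negP => /andP[u0 u1]; move: hx; rewrite ltNge ger0_norm ?u1//.
by apply: le_trans u0; rewrite invr_ge0.
Qed.

Lemma Pk1E (e : R) (x : pt) : Pk e 0 x = e / pi / (e ^+ 2 + (x 0 0) ^+ 2).
Proof. by rewrite /Pk big_ord1 mxE subr0. Qed.

Lemma Eh_L2 a b : amp a -> amp b -> exists C : R, forall del T, small del -> 0 < T ->
  (\int[mu R 1]_t (cabs (Eh del T a b (rt t)) ^+ 2)%:E <= C%:E)%E.
Proof.
move=> ha hb; have [C C0 hC] := Ew_bdd ha hb; have p0 := pi_gt0 R.
(* On the window [1 + u^2 <= 65], so [65 pi Pk 1 0] dominates its indicator and has known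
   integral. *)
exists (C ^+ 2 * (65 * pi)) => del T d0 T0.
have c0 : 0 <= C ^+ 2 * (65 * pi) by apply: mulr_ge0; [exact: sqr_ge0|rewrite mulr_ge0// ltW].
apply: (@le_trans _ _ ((C ^+ 2 * (65 * pi))%:E * \int[mu R 1]_t (Pk 1 0 (rt t))%:E)%E); last first.
  by rewrite Pk_int// mule1.
rewrite -ge0_integralZl//; last 2 first.
- by apply/measurable_EFinP; exact: m_Pk.
- by move=> t _; rewrite lee_fin Pk_ge0.
apply: ge0_le_integral => //.
- by move=> t _; rewrite lee_fin sqr_ge0.
- apply/measurable_EFinP; apply: measurable_funX; apply: m_cabs.
  by apply: csmooth_mCn; case: (Ccs_Eh T d0 ha hb).
- by apply: measurable_funeM; apply/measurable_EFinP; exact: m_Pk.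
move=> t _; rewrite -EFinM lee_fin /Eh cabs_real.
set u := rt t 0 0; have [u0|u0] := boolP (8^-1 <= u <= 8); last first.
  by rewrite Ew_supp// normr0 expr0n mulr_ge0// Pk_ge0.
rewrite -mulrA -[leLHS]mulr1; apply: ler_pM => //; rewrite ?sqr_ge0//.
  by rewrite ler_pXn2r ?nnegrE//; exact: hC.
rewrite Pk1E -/u expr1n div1r.
have h1 : 0 < 1 + u ^+ 2 by rewrite ltr_pwDl// sqr_ge0.
have -> : 65 * pi * (pi^-1 / (1 + u ^+ 2)) = 65 / (1 + u ^+ 2).
  by move: (pi : R) p0 => P P0; field; rewrite !gt_eqF.
rewrite ler_pdivlMr// mul1r; move: u0 => /andP[? ?]; nra.
Qed.

Definition Fh del T a b : pt -> R[i] := Fr (-1) (Eh del T a b).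

(** The factors produced by repeated integration by parts are remembered only through this L^2
    bound, uniform in [del] and [T]. *)
Definition sq (G : R -> R -> pt -> R) :=
  (forall del T, small del -> measurable_fun setT (fun t : tup => G del T (rt t))) /\
  (forall del T x, 0 <= G del T x) /\
  exists C : R, forall del T, small del -> 0 < T -> (\int[mu R 1]_t (G del T (rt t) ^+ 2)%:E <= C%:E)%E.

Lemma sq_add G H : sq G -> sq H -> sq (fun del T x => G del T x + H del T x).
Proof.
move=> [m1 [p1 [C1 h1]]] [m2 [p2 [C2 h2]]]; split; first by move=> del T d0; apply: measurable_funD; [exact: m1|exact: m2].
split; first by move=> *; exact: addr_ge0.
exists (2 * C1 + 2 * C2) => del T d0 T0.
have mG := m1 del T d0; have mH := m2 del T d0.
apply: (@le_trans _ _ (\int[mu R 1]_t (2%:E * (G del T (rt t) ^+ 2)%:E + 2%:E * (H del T (rt t) ^+ 2)%:E))%E).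
  apply: ge0_le_integral => //.
  - by move=> t _; rewrite lee_fin sqr_ge0.
  - by apply/measurable_EFinP; apply: measurable_funX; exact: measurable_funD.
  - by apply: emeasurable_funD; apply: measurable_funeM; apply/measurable_EFinP; exact: measurable_funX.
  - move=> t _; rewrite -!EFinM -EFinD lee_fin; move: (G _ _ _) (H _ _ _) => x y.
    by have := sqr_ge0 (x - y); nra.
rewrite ge0_integralD//; last 4 first.
- by move=> t _; rewrite -EFinM lee_fin mulr_ge0// sqr_ge0.
- by apply: measurable_funeM; apply/measurable_EFinP; exact: measurable_funX.
- by move=> t _; rewrite -EFinM lee_fin mulr_ge0// sqr_ge0.
- by apply: measurable_funeM; apply/measurable_EFinP; exact: measurable_funX.
rewrite !ge0_integralZl//; try (by apply/measurable_EFinP; exact: measurable_funX); try (by move=> t _; rewrite lee_fin sqr_ge0).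
have -> : (2 * C1 + 2 * C2)%:E = (2%:E * C1%:E + 2%:E * C2%:E)%E by rewrite -!EFinM -EFinD.
by apply: leeD; apply: lee_wpmul2l => //; [exact: h1|exact: h2].
Qed.
Lemma sq0 : sq (fun _ _ _ => 0).
Proof.
split; first by move=> *; exact: measurable_cst.
split => //; exists 0 => del T _ _.
rewrite (eq_integral (cst 0%E)) ?integral0// => t _; by rewrite expr0n.
Qed.
Lemma sq_Fh a b : amp a -> amp b -> sq (fun del T x => cabs (Fh del T a b x)).
Proof.
move=> ha hb; split.
  move=> del T d0; apply: m_cabs; apply: mCn_Fr.
  by apply: csmooth_mCn; case: (Ccs_Eh T d0 ha hb).
split; first by move=> *; exact: cabs_ge0.
have [C hC] := Eh_L2 ha hb; exists (4 * C) => del T d0 T0.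
have ii := rapid_iC (Ccs_rapid (Ccs_Eh T d0 ha hb)).
apply: (le_trans (plancherel_le _ ii)); first by rewrite sqrrN expr1n.
by rewrite EFinM lee_wpmul2l//; exact: hC.
Qed.

(** Each use of [amp_step] pays for a factor [T] either with [2 pi |x|], from the exact derivative,
    or with new amplitudes; hence a polynomial in [|x|]. Plancherel's inequality bounds all the
    transforms that occur. *)
Lemma Fh_decay N a b : amp a -> amp b -> exists2 G : nat -> R -> R -> pt -> R, (forall k, sq (G k)) &
  forall del T x, small del -> 0 < T ->
   T ^+ N * cabs (Fh del T a b x) <= \sum_(k < N.+1) (2 * pi * `|x 0 0|) ^+ k * G k del T x.
Proof.
elim: N a b => [|N IH] a b ha hb.
  exists (fun _ del T x => cabs (Fh del T a b x)); first by move=> _; exact: sq_Fh.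
  by move=> del T x _ _; rewrite big_ord1 !expr0.
have [A [B [A' [B' [hA hB hA' hB' step]]]]] := amp_step ha hb.
have [G1 s1 h1] := IH _ _ hA hB; have [G2 s2 h2] := IH _ _ hA' hB'.
(* The term that acquired a factor [2 pi |x|] moves from index [k] to [k + 1]. *)
exists (fun k del T x => (if k is k'.+1 then G1 k' del T x else 0) + G2 k del T x).
  by move=> [|k]; apply: sq_add => //; exact: sq0.
move=> del T x d0 T0.
have z0 : 0 <= 2 * pi * `|x 0 0| by rewrite !mulr_ge0// pi_ge0.
have cAB := Ccs_Eh T d0 hA hB; have cAB' := Ccs_Eh T d0 hA' hB'; have cab := Ccs_Eh T d0 ha hb.
have key : T * cabs (Fh del T a b x) <= 2 * pi * `|x 0 0| * cabs (Fh del T A B x) + cabs (Fh del T A' B' x).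
  have E : Fr (-1) (cpd 0 (Eh del T A B)) x = rc T * Fh del T a b x + Fh del T A' B' x.
    have -> : cpd 0 (Eh del T A B) = (fun y => rc T * Eh del T a b y + Eh del T A' B' y).
      apply/funext => y; have := pder_comp (step del T (y 0 0) d0 T0) (pder_coord 0 y 0).
      rewrite eqxx mulr1 => py; apply: c_ext; rewrite /cpd /Eh /=.
        by rewrite (pderE py) mul0r subr0.
      by rewrite (pderE (pder_cst _ y 0)) !(mulr0, mul0r, addr0).
    have i1 := rapid_iC (Ccs_rapid cab); have i2 := rapid_iC (Ccs_rapid cAB').
    rewrite /Fh /Fr /cIn -cIZ; last exact: iCn_ph.
    rewrite -cI_add; [|by apply: iCZ; exact: iCn_ph|exact: iCn_ph].
    by congr cI; apply/funext => t; ring.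
  rewrite Fr_cpd// in E.
  have E2 : rc T * Fh del T a b x = - (cxi (-1) 0 x * Fr (-1) (Eh del T A B) x) - Fh del T A' B' x.
    by rewrite E addrK.
  have -> : T * cabs (Fh del T a b x) = cabs (rc T * Fh del T a b x).
    by rewrite cabsM cabs_real gtr0_norm.
  rewrite E2 (le_trans (cabsD _ _))// !cabsN cabsM lerD2r ler_wpM2r ?cabs_ge0//.
  rewrite /cxi cabs_imag !normrM normrN1 mul1r (ger0_norm (pi_ge0 R)) ger0_norm//.
rewrite exprSr -mulrA; apply: le_trans (ler_wpM2l (exprn_ge0 N (ltW T0)) key) _.
rewrite mulrDr mulrCA.
under eq_bigr do rewrite mulrDr.
rewrite big_split/=; apply: lerD.
  rewrite big_ord_recl mulr0 add0r.
  under eq_bigr do rewrite lift0 exprS -mulrA.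
  rewrite -mulr_sumr; apply: ler_wpM2l => //; exact: h1.
rewrite big_ord_recr/= (le_trans (h2 del T x d0 T0))// lerDl mulr_ge0// ?exprn_ge0//.
by have [_ [-> _]] := s2 N.+1.
Qed.
End Amp.

(** * Weighted bounds for the subordination density *)

Section Weight.
Variable R : realType.
Variable X : nat -> R -> R.
Hypothesis dX_ : forall k (u : R), der (X k) u (X k.+1 u).
Hypothesis suppX : forall k u, ~~ (8^-1 <= u <= 8) -> X k u = 0.
Notation pt := 'rV[R]_1.
Notation rt := (@row_of_tuple R 1).
Notation tup := (1.-tuple R).

Lemma sq_sum N (G : nat -> R -> R -> pt -> R) : (forall k, sq (G k)) ->
  sq (fun del T x => \sum_(k < N) G k del T x).
Proof.
move=> sG; elim: N => [|N IH].
  rewrite (_ : (fun _ _ _ => _) = (fun _ _ _ => 0)); first exact: sq0.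
  by do 3 apply/funext => ?; rewrite big_ord0.
rewrite (_ : (fun _ _ _ => _) = (fun del T x => \sum_(k < N) G k del T x + G N del T x)); first exact: sq_add.
by do 3 apply/funext => ?; rewrite big_ord_recr.
Qed.

Lemma hhat_weight m a b : amp X a -> amp X b -> exists2 C : R, 0 <= C &
  forall del T, small del -> 1 <= T -> forall y : pt -> R,
  measurable_fun setT (fun t : tup => y (rt t)) -> (forall x, 0 <= y x <= 1) ->
  (forall x, y x ^+ 2 * `|x 0 0| ^+ m.+2 <= 1) ->
  (\int[mu R 1]_t (cabs (Fh del T a b (rt t)) * y (rt t))%:E <= (C * Num.sqrt T ^- m.+1)%:E)%E.
Proof.
move=> ha hb; have p0 := pi_gt0 R.
have [G sG hG] := Fh_decay dX_ suppX m.+2 ha hb.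
pose H del T x := cabs (Fh del T a b x) + \sum_(k < m.+3) G k del T x.
have sH : sq H by apply: sq_add; [exact: (sq_Fh dX_ suppX)|exact: sq_sum].
have [mH [H0 [CH hH]]] := sH.
have p2 : 1 <= 2 * pi :> R by have := pi_ge2 R; lra.
(* [(2 pi)^(2 k)] occurs for [k] up to [m + 2], and the 2 covers [T^2 + x^2 <= 2 max (T, |x|)^2]. *)
pose c : R := 2 * (2 * pi) ^+ (m.+2 * 2).
have c2 : 2 <= c by rewrite /c ler_peMr// exprn_ege1.
have c0 : 0 <= c by exact: le_trans c2.
exists (`|CH| + c * pi) => [|del T d0 T1 y my y01 yn]; first by rewrite addr_ge0// mulr_ge0 ?(ltW p0).
have T0 : 0 < T by exact: lt_le_trans ltr01 T1.
have s0 : 0 < Num.sqrt T by rewrite sqrtr_gt0.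
pose e := Num.sqrt T ^- m.+1.
have e0 : 0 < e by rewrite invr_gt0 exprn_gt0.
have e2 : e ^+ 2 = T ^- m.+1 by rewrite /e exprVn -exprM mulnC exprM sqr_sqrtr// ltW.
have PT (x : pt) : 0 <= Pk T 0 x by exact: Pk_ge0.
have key x : cabs (Fh del T a b x) * y x <= e * (H del T x ^+ 2 + c * pi * Pk T 0 x).
  pose V := Num.sqrt (c * e ^+ 2 * pi * Pk T 0 x).
  have V2 : V ^+ 2 = c * e ^+ 2 * pi * Pk T 0 x.
    rewrite sqr_sqrtr//; apply: mulr_ge0 => //; apply: mulr_ge0; last exact: ltW.
    by apply: mulr_ge0 => //; exact: sqr_ge0.
  have V0 : 0 <= V by exact: sqrtr_ge0.
  pose w := T ^+ 2 + x 0 0 ^+ 2.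
  have w0 : 0 < w by rewrite ltr_pwDl ?exprn_gt0 ?sqr_ge0.
  have V2' : V ^+ 2 = c / (w * T ^+ m).
    rewrite V2 e2 Pk1E -/w exprS; move: (pi : R) p0 => P P0.
    by field; rewrite !gt_eqF// ?exprn_gt0.
  have /andP[y0 y1] := y01 x.
  have G0 k : 0 <= G k del T x by have [_ [h _]] := sG k; exact: h.
  have leV v : 0 <= v -> v ^+ 2 * (w * T ^+ m) <= c -> v <= V.
    move=> v0 hv; rewrite -(@ler_pXn2r _ 2)// ?nnegrE// V2' ler_pdivlMr// mulr_gt0// exprn_gt0//.
  have xn : x 0 0 ^+ 2 = `|x 0 0| ^+ 2 by rewrite real_normK ?num_real.
  have FV : cabs (Fh del T a b x) * y x <= H del T x * V.
    (* Beyond [T] the decay of [y] alone gives [y <= V]. Below [T] the [m + 2] powers of [T] gained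
       in [Fh_decay] outweigh the powers of [|x|]. *)
    have [xT|xT] := leP T `|x 0 0|.
      apply: ler_pM => //; first exact: cabs_ge0.
        by rewrite /H lerDl sumr_ge0.
      apply: leV => //; apply: le_trans c2.
      have h1 : w <= 2 * `|x 0 0| ^+ 2.
        rewrite /w xn mulr2n mulrDl mul1r lerD2r ler_pXn2r// nnegrE// ltW//.
      have h2 : T ^+ m <= `|x 0 0| ^+ m by apply: lerXn2r; rewrite ?nnegrE ?normr_ge0 ?(ltW T0).
      apply: (@le_trans _ _ (y x ^+ 2 * (2 * `|x 0 0| ^+ 2 * `|x 0 0| ^+ m))).
        apply: ler_wpM2l; first exact: sqr_ge0.
        by apply: ler_pM => //; [exact: ltW|rewrite exprn_ge0// ltW].
      have -> : y x ^+ 2 * (2 * `|x 0 0| ^+ 2 * `|x 0 0| ^+ m) = 2 * (y x ^+ 2 * `|x 0 0| ^+ m.+2).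
        by rewrite -[m.+2]/(2 + m)%N exprD; ring.
      by have := yn x; lra.
    have TN : 0 < T ^+ m.+2 by exact: exprn_gt0.
    apply: (@le_trans _ _ (\sum_(k < m.+3) G k del T x * V)); last first.
      rewrite -mulr_suml; apply: ler_wpM2r => //; rewrite /H lerDr; exact: cabs_ge0.
    have hF : cabs (Fh del T a b x) <= T ^- m.+2 * \sum_(k < m.+3) (2 * pi * `|x 0 0|) ^+ k * G k del T x.
      by rewrite mulrC ler_pdivlMr// mulrC; exact: hG.
    apply: (le_trans (ler_wpM2r y0 hF)).
    rewrite -[leLHS]mulrA mulr_suml mulr_sumr; apply: ler_sum => k _.
    have -> : T ^- m.+2 * ((2 * pi * `|x 0 0|) ^+ k * G k del T x * y x) =
       G k del T x * (T ^- m.+2 * ((2 * pi * `|x 0 0|) ^+ k) * y x) by ring.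
    apply: ler_wpM2l => //; apply: leV.
      by rewrite !mulr_ge0 ?exprn_ge0 ?invr_ge0 ?exprn_ge0 ?mulr_ge0 ?(ltW p0) ?(ltW T0).
    have xk : (`|x 0 0| ^+ k) ^+ 2 * y x ^+ 2 <= T ^+ m.+2.
      have [x1|x1] := leP `|x 0 0| 1.
        apply: (@le_trans _ _ 1); last exact: exprn_ege1.
        rewrite -exprM -[leRHS]mulr1; apply: ler_pM; rewrite ?sqr_ge0 ?exprn_ge0// ?exprn_ile1//.
      apply: (@le_trans _ _ ((`|x 0 0| ^+ m.+2) ^+ 2 * y x ^+ 2)).
        apply: ler_wpM2r; first exact: sqr_ge0.
        rewrite ler_pXn2r ?nnegrE ?exprn_ge0//; apply: ler_weXn2l; first exact: ltW.
        by rewrite -ltnS ltn_ord.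
      apply: (@le_trans _ _ (`|x 0 0| ^+ m.+2)); last by apply: lerXn2r; rewrite ?nnegrE ?normr_ge0 ?(ltW T0) ?(ltW xT).
      have := ler_wpM2l (exprn_ge0 m.+2 (normr_ge0 (x 0 0))) (yn x).
      by rewrite mulr1; congr (_ <= _); ring.
    have wT : w <= 2 * T ^+ 2.
      by rewrite /w xn mulr2n mulrDl mul1r lerD2l; apply: lerXn2r; rewrite ?nnegrE ?normr_ge0 ?(ltW T0) ?(ltW xT).
    have pk : (2 * pi) ^+ k ^+ 2 <= (2 * pi) ^+ (m.+2 * 2) :> R.
      rewrite -exprM; apply: ler_weXn2l => //; rewrite leq_mul2r /= -ltnS; exact: ltn_ord.
    have -> : (T ^- m.+2 * (2 * pi * `|x 0 0|) ^+ k * y x) ^+ 2 =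
        (T ^- m.+2) ^+ 2 * ((2 * pi) ^+ k ^+ 2 * ((`|x 0 0| ^+ k) ^+ 2 * y x ^+ 2)).
      by rewrite !exprMn; ring.
    apply: (@le_trans _ _ ((T ^- m.+2) ^+ 2 * ((2 * pi) ^+ (m.+2 * 2) * (T ^+ m.+2)) * (2 * T ^+ 2 * T ^+ m))).
      have q0 : 0 <= (2 * pi) ^+ k ^+ 2 :> R by exact: sqr_ge0.
      have q1 : 0 <= (`|x 0 0| ^+ k) ^+ 2 * y x ^+ 2 by apply: mulr_ge0; exact: sqr_ge0.
      apply: ler_pM.
      - by apply: mulr_ge0; [exact: sqr_ge0|exact: mulr_ge0].
      - by rewrite mulr_ge0 ?exprn_ge0 ?(ltW w0) ?(ltW T0).
      - by apply: ler_wpM2l; [exact: sqr_ge0|apply: ler_pM].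
      - by apply: ler_wpM2r => //; rewrite exprn_ge0// ltW.
    rewrite /c le_eqVlt; apply/orP; left; apply/eqP.
    rewrite -[m.+2]/(2 + m)%N !exprD; move: ((2 * pi) ^+ _) => z.
    by field; rewrite !gt_eqF ?exprn_gt0.
  apply: (le_trans FV).
  (* Young's inequality, with the factor [e] balancing the two terms so that both integrate to a
     multiple of [e]. *)
  have -> : e * (H del T x ^+ 2 + c * pi * Pk T 0 x) = e * H del T x ^+ 2 + e^-1 * V ^+ 2.
    by rewrite V2; field; rewrite gt_eqF.
  have := sqr_ge0 (e * H del T x - V); have hv : 0 <= H del T x * V by rewrite mulr_ge0.
  rewrite sqrrB => h; rewrite -(ler_pM2l e0).
  have -> : e * (e * H del T x ^+ 2 + e^-1 * V ^+ 2) = (e * H del T x) ^+ 2 + V ^+ 2.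
    by field; rewrite gt_eqF.
  have : e * H del T x * V *+ 2 = 2 * (e * (H del T x * V)) by rewrite mulr2n; ring.
  by have := mulr_ge0 (ltW e0) hv; lra.
have mF : measurable_fun setT (fun t : tup => cabs (Fh del T a b (rt t))).
  by have [h _] := sq_Fh dX_ suppX ha hb; exact: h.
have mHT := mH del T d0.
have mPk := m_Pk 0 T0 : measurable_fun setT (fun t : tup => Pk T 0 (rt t)).
apply: (@le_trans _ _ (\int[mu R 1]_t (e%:E * (H del T (rt t) ^+ 2)%:E + (e * (c * pi))%:E * (Pk T 0 (rt t))%:E))%E).
  apply: ge0_le_integral => //.
  - by move=> t _; rewrite lee_fin mulr_ge0 ?cabs_ge0//; case/andP: (y01 (rt t)).
  - by apply/measurable_EFinP; exact: measurable_funM.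
  - apply: emeasurable_funD; apply: measurable_funeM; apply/measurable_EFinP => //; exact: measurable_funX.
  - by move=> t _; rewrite -!EFinM -EFinD lee_fin -mulrA -mulrDr; exact: key.
have ec0 : 0 <= e * (c * pi) by apply: mulr_ge0; [exact: ltW|apply: mulr_ge0 => //; exact: ltW].
rewrite ge0_integralD//; last 4 first.
- by move=> t _; rewrite -EFinM lee_fin mulr_ge0 ?(ltW e0)// sqr_ge0.
- by apply: measurable_funeM; apply/measurable_EFinP; exact: measurable_funX.
- by move=> t _; rewrite -EFinM lee_fin mulr_ge0.
- by apply: measurable_funeM; exact/measurable_EFinP.
rewrite ge0_integralZl//; last 3 first.
- by apply/measurable_EFinP; exact: measurable_funX.
- by move=> t _; rewrite lee_fin sqr_ge0.
- by rewrite lee_fin ltW.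
rewrite ge0_integralZl//; last 2 first.
- exact/measurable_EFinP.
- by move=> t _; rewrite lee_fin.
rewrite Pk_int// mule1 -/e.
have -> : (`|CH| + c * pi) * e = e * `|CH| + e * (c * pi) by ring.
rewrite EFinD leeD2r// EFinM; apply: lee_wpmul2l; first by rewrite lee_fin ltW.
by apply: (le_trans (hH del T d0 T0)); rewrite lee_fin ler_norm.
Qed.
End Weight.

(** * The dispersive kernel bound *)

Section Kernel.
Variable (R : realType) (n : nat).
Notation pt := 'rV[R]_n.
Notation rt := (@row_of_tuple R n).
Notation tup := (n.-tuple R).

Lemma box_int (g : pt -> R[i]) (B r : R) : mCn g -> 0 <= B -> 0 < r -> (forall x, cabs (g x) <= B) ->
  (forall (x : pt) i, r < `|x 0 i| -> g x = 0) ->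
  (\int[mu R n]_t (cabs (g (rt t)))%:E <= (B * (2 * r) ^+ n)%:E)%E.
Proof.
move=> mg B0 r0 gB gr.
pose c (z : R) : R := if `|z| <= r then 1 else 0.
have cE : c = \1_(`[-r, r]%classic).
  apply/funext => z; rewrite /c indicE mem_setE in_itv/= -ler_norml.
  by case: (_ <= _).
have mc : measurable_fun setT c by rewrite cE; exact: measurable_indic.
have c0 z : 0 <= c z by rewrite /c; case: ifP.
have Ic : (\int[@lebesgue_measure R]_z (c z)%:E = (2 * r)%:E)%E.
  have -> : (\int[@lebesgue_measure R]_z (c z)%:E)%E = lebesgue_measure (`[-r, r]%classic : set R).
    by rewrite cE integral_indic// setIT.
  rewrite lebesgue_measure_itv/= lte_fin.
  by rewrite (_ : - r < r); [rewrite -EFinD opprK mulr2n mulrDl mul1r|lra].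
have ic : (@lebesgue_measure R).-integrable setT (EFin \o c).
  apply/integrableP; split; first exact/measurable_EFinP.
  under eq_integral do rewrite /= ger0_norm ?c0//.
  by rewrite Ic ltry.
have P1 : (\int[mu R n]_t (\prod_i c (tnth t i))%:E)%E = ((2 * r) ^+ n)%:E.
  rewrite (@ge0_integral_prod _ n (fun _ => c))//.
  by rewrite /Rintegral Ic/= prodr_const card_ord.
have mP : measurable_fun setT (fun t : tup => \prod_i c (tnth t i)).
  by apply: measurable_prod => i _; apply: (measurableT_comp mc); exact: measurable_tnth.
rewrite EFinM -P1 -ge0_integralZl//; last 2 first.
- exact/measurable_EFinP.
- by move=> t _; rewrite lee_fin; apply: prodr_ge0.
apply: ge0_le_integral => //.
- by move=> t _; rewrite lee_fin cabs_ge0.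
- exact: m_cabsE.
- by apply: measurable_funeM; exact/measurable_EFinP.
move=> t _; rewrite -EFinM lee_fin.
have [/existsP[i hi]|/existsPn h] := boolP [exists i, r < `|tnth t i|].
  by rewrite (gr (rt t) i) ?rtE// cabs0 mulr_ge0// prodr_ge0.
rewrite big1 ?mulr1// => i _; rewrite /c; have := h i.
by rewrite -leNgt => ->.
Qed.

Lemma Ccs_inversion s (g : pt -> R[i]) : s ^+ 2 = 1 -> Ccs g -> Fr s (Fr (- s) g) = g.
Proof.
move=> s1 cg; apply/funext => x.
have [B B0 gB] := Ccs_bounded cg.
have ig := rapid_iC (Ccs_rapid cg).
have s1' : (- s) ^+ 2 = 1 by rewrite sqrrN.
have iF : iCn (Fr (- s) g) by exact: rapid_iC (schwartz_rapid (Fr_schwartz s1' cg)).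
apply: (fourier_inversion (B := B)) => //.
move=> eta eta0; have [[c1 c2] _] := cg.
have e2 : 0 < eta / 2 by rewrite divr_gt0.
have cont (h : pt -> R) : smooth h -> exists2 d : R, 0 < d & forall y : pt,
    (forall i, `|y 0 i - x 0 i| < d) -> `|h y - h x| < eta / 2.
  move=> sh; have /(_ x) ch := smooth_cont sh.
  have : nbhs (h x) (ball (h x) (eta / 2)) by exact: nbhsx_ballx.
  move=> /ch /nbhs_ballP[d /= d0 hd]; exists d => // y hy.
  rewrite distrC; apply: (hd y); split => // i j; rewrite (ord1 i) /ball /= distrC.
  exact: hy.
have [d1 d10 h1] := cont _ c1; have [d2 d20 h2] := cont _ c2.
exists (Num.min d1 d2); first by rewrite lt_min d10 d20.
move=> y hy; rewrite (le_trans (cabs_le _))//.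
have -> : cre (g y - g x) = cre (g y) - cre (g x) by rewrite creD; case: (g x).
have -> : cim (g y - g x) = cim (g y) - cim (g x) by rewrite cimD; case: (g x).
have l1 : `|cre (g y) - cre (g x)| < eta / 2.
  by apply: h1 => i; have := hy i; rewrite lt_min => /andP[].
have l2 : `|cim (g y) - cim (g x)| < eta / 2.
  by apply: h2 => i; have := hy i; rewrite lt_min => /andP[].
lra.
Qed.

Lemma smooth_dpart (h : pt -> R) s : smooth h -> smooth (dpart s h).
Proof. by move=> sh; elim: s => [|i s IH]; [exact: sh|exact: (smooth_pd i IH)]. Qed.
Lemma bsupp_dpart (h : pt -> R) s : smooth h -> bsupp h -> bsupp (dpart s h).
Proof.
move=> sh bh; elim: s => [|i s IH]; first exact: bh.
change (bsupp (pd i (dpart s h))); exact: (bsupp_pd _ (smooth_dpart s sh) IH).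
Qed.

Lemma cpds_scale (h : pt -> R) c s x : smooth h ->
  cpds s (fun x => rc (h (c *: x))) x = rc (c ^+ size s * dpart s h (c *: x)).
Proof.
move=> sh; elim: s x => [|i s IH] x; first by rewrite /= expr0 mul1r.
have -> : cpds (i :: s) (fun x => rc (h (c *: x))) x = cpd i (fun x => rc (c ^+ size s * dpart s h (c *: x))) x.
  by rewrite /= (_ : cpds s _ = (fun x => rc (c ^+ size s * dpart s h (c *: x))))//; apply/funext => y; exact: IH.
have p := pderM (pder_cst (c ^+ size s) x i) (pder_scale (smooth_pder (c *: x) i (smooth_dpart s sh))).
apply: c_ext; rewrite /cpd /=; last by rewrite (pderE (pder_cst _ x i)).
by rewrite (pderE p) mul0r add0r exprSr -mulrA (mulrC c).
Qed.

Lemma bsupp_radius (h : pt -> R) : smooth h -> bsupp h -> exists B r : R,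
  [/\ 0 <= B, 0 < r, (forall x, `|h x| <= B) & forall (x : pt) i, r < `|x 0 i| -> h x = 0].
Proof.
move=> sh bh; have [B hB] := bsupp_bounded (smooth_cont sh) bh; have [r hr] := bh.
exists B, (`|r| + 1); split.
- exact: le_trans (normr_ge0 _) (hB 0).
- by rewrite ltr_wpDl.
- exact: hB.
- by move=> x i hx; apply: (hr x i); apply: le_lt_trans hx; rewrite (le_trans (ler_norm r))// lerDl.
Qed.

Lemma scale_supp (h : pt -> R) (r lam : R) : 0 < lam -> (forall (x : pt) i, r < `|x 0 i| -> h x = 0) ->
  forall (x : pt) i, r * lam < `|x 0 i| -> h (lam^-1 *: x) = 0.
Proof.
move=> l0 hr x i hx; apply: (hr _ i); rewrite mxE normrM gtr0_norm ?invr_gt0//.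
by rewrite mulrC ltr_pdivlMr.
Qed.

Lemma Ccs_scale (h : pt -> R) lam : 0 < lam -> smooth h -> bsupp h -> Ccs (fun x => rc (h (lam^-1 *: x))).
Proof.
move=> l0 sh bh; have [B [r [_ _ _ hr]]] := bsupp_radius sh bh.
split; first by apply: csmooth_rc; exact: smooth_scale.
by exists (r * lam) => x i hx; rewrite (scale_supp l0 hr hx).
Qed.

Lemma chirpE tau (x xi : pt) : chirp tau x xi = expi (2 * pi * (tau * dotp xi xi)) * ph 1 xi x.
Proof. by rewrite /chirp /ph mul1r (dotpC x) mulrDr expiD. Qed.

(** [tau] is measured in units of [lam^-2]. The first bound is the volume of the support, the second
    is [chirp_bound], written as a square times [|tau|^n] to include [tau = 0] and to match the
    hypotheses of [hhat_weight]. *)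
Lemma chirp_scaled (phi : pt -> R) : smooth phi -> bsupp phi -> (0 < n)%N -> exists2 C : R, 0 < C &
  forall (lam : R), 0 < lam -> forall (tau : R) (x : pt),
  let I := cabs (cIn (fun xi => rc (phi (lam^-1 *: xi)) * chirp (tau / lam ^+ 2) x xi)) in
  I <= C * lam ^+ n /\ (I / (C * lam ^+ n)) ^+ 2 * `|tau| ^+ n <= 1.
Proof.
move=> sphi bphi n0.
have [B1 [r1 [B10 r10 hB1 hr1]]] := bsupp_radius sphi bphi.
have [B2 [r2 [B20 r20 hB2 hr2]]] := bsupp_radius (smooth_dpart (enum 'I_n) sphi) (bsupp_dpart (enum 'I_n) sphi bphi).
pose C := 2 * (B1 * (2 * r1) ^+ n + 8 ^+ n * (B2 * (2 * r2) ^+ n)) + 1.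
have c10 : 0 <= B1 * (2 * r1) ^+ n by rewrite mulr_ge0// exprn_ge0// mulr_ge0// ltW.
have c20 : 0 <= 8 ^+ n * (B2 * (2 * r2) ^+ n).
  by rewrite !mulr_ge0// exprn_ge0// mulr_ge0// ltW.
have C0 : 0 < C by rewrite /C; lra.
exists C => // lam l0 tau x /=.
set f := fun xi => rc (phi (lam^-1 *: xi)); set I := cabs _.
have cf : Ccs f by exact: Ccs_scale.
have Ln : 0 < lam ^+ n by exact: exprn_gt0.
have I0 : 0 <= I by exact: cabs_ge0.
have mf : mCn f := iC_mC (rapid_iC (Ccs_rapid cf)).
have mch : mCn (fun xi => chirp (tau / lam ^+ 2) x xi).
  apply: mC_expi; apply: measurable_funM => //; apply: measurable_funD.
    apply: measurable_funM => //.
    exact: (@continuous_measurable_tuple R n (fun z : pt => dotp z z) (smooth_cont (@smooth_dotpp R n))).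
  by under eq_fun do rewrite dotpC; exact: m_dotp.
have fin (r B : R) (g : pt -> R[i]) : Ccs g -> 0 <= B -> 0 < r -> (forall x, cabs (g x) <= B) ->
    (forall (x : pt) i, r < `|x 0 i| -> g x = 0) -> (\int[mu R n]_t cabs (g (rt t)) <= B * (2 * r) ^+ n)%R.
  move=> cg b0 r0 gB gr; have ig := rapid_iC (Ccs_rapid cg).
  rewrite /Rintegral -lee_fin fineK; first exact: (box_int (iC_mC ig)).
  by apply: integrable_fin_num => //; exact: i_cabs.
have b1 : I <= 2 * (B1 * (2 * r1) ^+ n) * lam ^+ n.
  have -> : 2 * (B1 * (2 * r1) ^+ n) * lam ^+ n = 2 * (B1 * (2 * (r1 * lam)) ^+ n).
    by rewrite !exprMn; ring.
  apply: (@le_trans _ _ (2 * \int[mu R n]_t cabs (f (rt t)))%R).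
    apply: cI_norm_le; [exact: mCM| |exact: i_cabs (rapid_iC (Ccs_rapid cf))].
    by move=> t; rewrite cabsM cabs_expi mulr1.
  apply: ler_wpM2l => //; apply: fin => //; first exact: mulr_gt0.
    by move=> z; rewrite cabs_real.
  by move=> z i hz; rewrite /f (scale_supp l0 hr1 hz).
split.
  apply: (le_trans b1); apply: ler_wpM2r; first exact: ltW.
  by rewrite /C; lra.
have [->|t0] := eqVneq tau 0; first by rewrite normr0 expr0n gtn_eqF// mulr0.
have tp : 0 < `|tau| by rewrite normr_gt0.
have l2 : 0 < lam ^+ 2 by exact: exprn_gt0.
have t20 : tau / lam ^+ 2 != 0 by rewrite mulf_neq0// invr_eq0 gt_eqF.
have sE : Num.sqrt `|tau / lam ^+ 2| = Num.sqrt `|tau| / lam.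
  have li : 0 < lam^-1 by rewrite invr_gt0.
  by rewrite normrM normfV (gtr0_norm l2) sqrtrM// -exprVn sqrtr_sqr (gtr0_norm li).
have st : 0 < Num.sqrt `|tau| by rewrite sqrtr_gt0.
have b2 : I <= C * lam ^+ n * Num.sqrt `|tau| ^- n.
  apply: (le_trans (chirp_bound x t20 cf)); rewrite sE.
  apply: (@le_trans _ _ (2 * ((8 / (Num.sqrt `|tau| / lam)) ^+ n * (B2 * (2 * r2) ^+ n)))).
    apply: ler_wpM2l => //; apply: ler_wpM2l.
      by rewrite exprn_ge0// divr_ge0// divr_ge0// ltW.
    have -> : B2 * (2 * r2) ^+ n = (B2 / lam ^+ n) * (2 * (r2 * lam)) ^+ n.
      by rewrite !exprMn; field; rewrite gt_eqF.
    apply: fin.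
    - exact: Ccs_cpds.
    - by rewrite divr_ge0// ltW.
    - exact: mulr_gt0.
    - move=> z; rewrite cpds_scale// size_enum_ord cabs_real normrM mulrC exprVn.
      by rewrite (gtr0_norm (_ : 0 < (lam ^+ n)^-1)) ?invr_gt0//; apply: ler_wpM2r => //; rewrite invr_ge0 ltW.
    - by move=> z i hz; rewrite cpds_scale// (scale_supp l0 hr2 hz) mulr0.
  have -> : (8 / (Num.sqrt `|tau| / lam)) ^+ n = 8 ^+ n * lam ^+ n * Num.sqrt `|tau| ^- n.
    by rewrite invfM invrK mulrCA !exprMn exprVn; ring.
  have -> : 2 * (8 ^+ n * lam ^+ n / Num.sqrt `|tau| ^+ n * (B2 * (2 * r2) ^+ n)) =
     (2 * (8 ^+ n * (B2 * (2 * r2) ^+ n))) * lam ^+ n * Num.sqrt `|tau| ^- n by ring.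
  apply: ler_wpM2r; first by rewrite invr_ge0 exprn_ge0// ltW.
  apply: ler_wpM2r; first exact: ltW.
  by rewrite /C; lra.
have CL : 0 < C * lam ^+ n by exact: mulr_gt0.
have h : I / (C * lam ^+ n) <= Num.sqrt `|tau| ^- n by rewrite ler_pdivrMr// mulrC.
have -> : `|tau| ^+ n = (Num.sqrt `|tau| ^+ n) ^+ 2 by rewrite -exprM mulnC exprM sqr_sqrtr.
rewrite -exprMn -[leRHS](expr1n _ 2) ler_pXn2r ?nnegrE//.
- by rewrite -ler_pdivlMr ?exprn_gt0// div1r.
- by rewrite mulr_ge0 ?exprn_ge0 ?(ltW st)// divr_ge0// ltW.
Qed.
End Kernel.

(** * The kernel of a dyadic piece in dimension at least two *)

Section Kernel2.
Variable (R : realType) (m : nat).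
Let n := m.+2.
Notation pt := 'rV[R]_n.
Notation rt := (@row_of_tuple R n).
Notation rt1 := (@row_of_tuple R 1).
Notation tup := (n.-tuple R).
Notation tup1 := (1.-tuple R).
Variable X : nat -> R -> R.
Hypothesis dX_ : forall k (u : R), der (X k) u (X k.+1 u).
Hypothesis suppX : forall k u, ~~ (8^-1 <= u <= 8) -> X k u = 0.

(** Fubini in [xi] and [tau]: the integral over [tau] is Fourier inversion in [|xi|^2], the one over
    [xi] is a chirp. The power [lam^(n-1)] is the volume [lam^n] times the [1 / lam] of the
    symbol. *)
Lemma kernel_bound (phi : pt -> R) a b : smooth phi -> bsupp phi -> amp X a -> amp X b ->
  exists2 C : R, 0 <= C & forall del T lam, small del -> 1 <= T -> 0 < lam -> forall x : pt,
  cabs (Fr 1 (fun xi => rc (lam^-1 * Ew del T a b (dotp xi xi / lam ^+ 2) * phi (lam^-1 *: xi))) x) <=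
  C * lam ^+ m.+1 * Num.sqrt T ^- m.+1.
Proof.
move=> sphi bphi ha hb.
have [C0 C00 hC0] := chirp_scaled sphi bphi (ltn0Sn _).
have [Cw Cw0 hw] := hhat_weight dX_ suppX m ha hb.
exists (2 * (C0 * Cw)) => [|del T lam d0 T1 l0 x]; first by rewrite !mulr_ge0// ltW.
have cE := Ccs_Eh dX_ suppX T d0 ha hb.
pose f xi := rc (phi (lam^-1 *: xi)).
have cf : Ccs f by exact: Ccs_scale.
have ff := rapid_iC (Ccs_rapid cf); have mf := iC_mC ff.
have N1 : (- 1) ^+ 2 = 1 :> R by rewrite sqrrN expr1n.
have iF : iCn (Fh del T a b) := rapid_iC (schwartz_rapid (Fr_schwartz N1 cE)).
have mF := iC_mC iF.
pose I (tau : R) := cIn (fun xi => f xi * chirp (tau / lam ^+ 2) x xi).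
pose q (xi : pt) : 'rV[R]_1 := const_mx (dotp xi xi / lam ^+ 2).
pose H (p : tup * tup1) := (ph 1 (rt p.1) x * (rc lam^-1 * f (rt p.1))) * (ph 1 (rt1 p.2) (q (rt p.1)) * Fh del T a b (rt1 p.2)).
have phq (tau : 'rV[R]_1) xi : ph 1 tau (q xi) = expi (2 * pi * (tau 0 0 / lam ^+ 2 * dotp xi xi)).
  rewrite /ph /q mul1r; congr expi; congr (_ * _).
  by rewrite {1}/dotp big_ord1 mxE; ring.
have mq : measurable_fun setT (fun p : tup * tup1 => 2 * pi * (rt1 p.2 0 0 / lam ^+ 2 * dotp (rt p.1) (rt p.1))).
  apply: measurable_funM => //; apply: measurable_funM.
    apply: measurable_funM => //.
    exact: (measurableT_comp (mCn_coord 0) measurable_snd).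
  have md := @continuous_measurable_tuple R n (fun z : pt => dotp z z) (smooth_cont (@smooth_dotpp R n)).
  exact: (measurableT_comp md measurable_fst).
have mH : mC H.
  apply: mCM.
    apply: mCM; first exact: (mC_comp measurable_fst (mC_ph 1 x)).
    apply: mCM; first exact: mC_cst.
    exact: (mC_comp measurable_fst mf).
  apply: mCM; last exact: (mC_comp measurable_snd mF).
  have -> : (fun p : tup * tup1 => ph 1 (rt1 p.2) (q (rt p.1))) =
      (fun p : tup * tup1 => expi (2 * pi * (rt1 p.2 0 0 / lam ^+ 2 * dotp (rt p.1) (rt p.1)))).
    by apply/funext => p; exact: phq.
  exact: mC_expi mq.
have E1 : Fr 1 (fun xi => rc (lam^-1 * Ew del T a b (dotp xi xi / lam ^+ 2) * phi (lam^-1 *: xi))) x =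
    cI (mu R n) (fun t : tup => cI (mu R 1) (fun u : tup1 => H (t, u))).
  congr cI; apply/funext => t; rewrite /H /= cIZ; last exact: (iCn_ph 1 (q (rt t)) iF).
  have -> : cI (mu R 1) (fun u : tup1 => ph 1 (rt1 u) (q (rt t)) * Fh del T a b (rt1 u)) = Eh del T a b (q (rt t)).
    by rewrite -[in RHS](Ccs_inversion (expr1n _ 2) cE).
  by rewrite /Eh /q mxE /f !rcM; ring.
have fin : (\int[mu R n]_t \int[mu R 1]_u (cabs (H (t, u)))%:E < +oo)%E.
  have -> : (\int[mu R n]_t \int[mu R 1]_u (cabs (H (t, u)))%:E =
     \int[mu R n]_t ((cabs (rc lam^-1 * f (rt t)))%:E * \int[mu R 1]_u (cabs (Fh del T a b (rt1 u)))%:E))%E.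
    apply: eq_integral => t _; rewrite -ge0_integralZl//.
    - by apply: eq_integral => u _; rewrite /H /= !cabsM !cabs_ph !mul1r EFinM.
    - exact: m_cabsE.
    - by move=> u _; rewrite lee_fin cabs_ge0.
    - by rewrite lee_fin cabs_ge0.
  have fh0 : (0 <= \int[mu R 1]_u (cabs (Fh del T a b (rt1 u)))%:E)%E.
    by apply: integral_ge0 => u _; rewrite lee_fin cabs_ge0.
  have fg0 : (0 <= \int[mu R n]_t (cabs (rc lam^-1 * f (rt t)))%:E)%E.
    by apply: integral_ge0 => u _; rewrite lee_fin cabs_ge0.
  have iz : iC (mu R n) (fun t : tup => rc lam^-1 * f (rt t)) by exact: iCZ.
  rewrite ge0_integralZr//; last 2 first.
  - by apply: m_cabsE; exact: iC_mC iz.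
  - by move=> u _; rewrite lee_fin cabs_ge0.
  rewrite lte_mul_pinfty//; last exact: iC_cabs_lty.
  by rewrite ge0_fin_numE//; exact: iC_cabs_lty.
have E2 (u : tup1) : cI (mu R n) (fun t : tup => H (t, u)) = rc lam^-1 * Fh del T a b (rt1 u) * I (rt1 u 0 0).
  rewrite /I /cIn -cIZ.
    congr cI; apply/funext => t; rewrite /H /= phq chirpE; ring.
  rewrite (_ : (fun t : tup => _) = (fun t : tup => chirp (rt1 u 0 0 / lam ^+ 2) x (rt t) * f (rt t))); last first.
    by apply/funext => t; rewrite mulrC.
  apply: (@iCMb _ _ _ _ _ _ 1); [|exact: ff|by move=> t; rewrite cabs_expi].
  apply: mC_expi; apply: measurable_funM => //; apply: measurable_funD.
    apply: measurable_funM => //.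
    exact: (@continuous_measurable_tuple R n (fun z : pt => dotp z z) (smooth_cont (@smooth_dotpp R n))).
  by under eq_fun do rewrite dotpC; exact: m_dotp.
have Ln : 0 < lam ^+ n by exact: exprn_gt0.
pose y (tau : 'rV[R]_1) := cabs (I (tau 0 0)) / (C0 * lam ^+ n).
have D0 : 0 < C0 * lam ^+ n by exact: mulr_gt0.
have mI : mC (fun u : tup1 => I (rt1 u 0 0)).
  apply: (@mC_cI _ _ _ _ _ (mu R n) (fun p : tup1 * tup => f (rt p.2) * chirp (rt1 p.1 0 0 / lam ^+ 2) x (rt p.2))).
  apply: mCM; first exact: (mC_comp measurable_snd mf).
  apply: mC_expi; apply: measurable_funM => //; apply: measurable_funD.
    apply: measurable_funM.
      by apply: measurable_funM => //; exact: (measurableT_comp (mCn_coord 0) measurable_fst).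
    have md := @continuous_measurable_tuple R n (fun z : pt => dotp z z) (smooth_cont (@smooth_dotpp R n)).
    exact: (measurableT_comp md measurable_snd).
  under eq_fun do rewrite dotpC.
  exact: (measurableT_comp (m_dotp x) measurable_snd).
have my : measurable_fun setT (fun t : tup1 => y (rt1 t)).
  by apply: measurable_funM => //; exact: m_cabs mI.
have := hw del T d0 T1 y my.
have y01 z : 0 <= y z <= 1.
  rewrite /y divr_ge0 ?cabs_ge0 ?(ltW D0)//= ler_pdivrMr// mul1r.
  by have [h _] := hC0 lam l0 (z 0 0) x.
have yn z : y z ^+ 2 * `|z 0 0| ^+ n <= 1 by have [_ h] := hC0 lam l0 (z 0 0) x.
move=> /(_ y01 yn) hint.
rewrite E1 (cI_fubini mH fin) -lee_fin.
have mF2 : mC (fun u : tup1 => cI (mu R n) (fun t : tup => H (t, u))).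
  rewrite (_ : (fun u : tup1 => _) = (fun u : tup1 => rc lam^-1 * Fh del T a b (rt1 u) * I (rt1 u 0 0))).
    by apply: mCM => //; apply: mCM => //; exact: mC_cst.
  by apply/funext => u; exact: E2.
apply: (le_trans (cI_norm _ mF2)).
have -> : (\int[mu R 1]_u (cabs (cI (mu R n) (fun t : tup => H (t, u))))%:E =
   \int[mu R 1]_u ((lam^-1 * (C0 * lam ^+ n))%:E * (cabs (Fh del T a b (rt1 u)) * y (rt1 u))%:E))%E.
  apply: eq_integral => u _; rewrite E2 !cabsM cabs_real gtr0_norm ?invr_gt0// -EFinM; congr EFin.
  by rewrite /y; field; rewrite !gt_eqF.
have mFc : measurable_fun setT (fun u : tup1 => cabs (Fh del T a b (rt1 u))) by exact: m_cabs.
rewrite ge0_integralZl//; last 3 first.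
- by apply/measurable_EFinP; exact: measurable_funM.
- by move=> u _; rewrite lee_fin mulr_ge0 ?cabs_ge0//; case/andP: (y01 (rt1 u)).
- by rewrite lee_fin mulr_ge0 ?invr_ge0 ?(ltW l0) ?(ltW D0).
apply: (@le_trans _ _ (2%:E * ((lam^-1 * (C0 * lam ^+ n))%:E * (Cw * Num.sqrt T ^- m.+1)%:E))%E).
  apply: lee_wpmul2l => //; apply: lee_wpmul2l => //.
  by rewrite lee_fin mulr_ge0 ?invr_ge0 ?(ltW l0) ?(ltW D0).
rewrite -!EFinM lee_fin /n exprS le_eqVlt; apply/orP; left; apply/eqP.
by field; rewrite !gt_eqF// exprn_gt0// sqrtr_gt0 (lt_le_trans ltr01 T1).
Qed.
End Kernel2.

(** * The symbol *)

Section PowerSeries.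
Variable R : realType.
Implicit Types (c : nat -> R) (x t : R).

(** Domination by an exponential series; it is stable under [pseries_diffs], so all derived series
    converge everywhere. *)
Definition expgrow c := exists A B : R, forall k, `|c k| <= A * (B ^+ k / k`!%:R).

Lemma expgrow_diffs c : expgrow c -> expgrow (pseries_diffs c).
Proof.
move=> [A [B h]]; exists (A * B), B => k; rewrite /pseries_diffs normrM ger0_norm//.
have := ler_wpM2l (ler0n R k.+1) (h k.+1); congr (_ <= _).
rewrite factS natrM exprS; field.
by rewrite pnatr_eq0 -lt0n fact_gt0 /= nat1r pnatr_eq0.
Qed.

Lemma expgrow_cvg c x : expgrow c -> cvgn (pseries c x).
Proof.
move=> [A [B h]]; apply: normed_cvg.
apply: (@series_le_cvg _ _ (fun k => `|A| * exp_coeff (`|B| * `|x|) k)).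
- by move=> k; exact: normr_ge0.
- by move=> k; rewrite mulr_ge0// exp_coeff_ge0// mulr_ge0.
- move=> k; rewrite /= normrM normrX; apply: (le_trans (ler_wpM2r (exprn_ge0 k (normr_ge0 x)) (h k))).
  apply: (le_trans (ler_norm _)); rewrite !normrM !normrX normr_id normfV.
  rewrite /exp_coeff /= exprMn -!mulrA; do 2 (apply: ler_wpM2l => //; rewrite ?exprn_ge0//).
  by rewrite mulrC (ger0_norm (ler0n _ _)) lexx.
- set u := exp_coeff _; have -> : series (fun k => `|A| * u k) = (fun N => `|A| * series u N).
    by apply/funext => N; rewrite /series /= mulr_sumr.
  apply/cvg_ex; eexists; apply: cvgM; [exact: cvg_cst|exact: is_cvg_series_exp_coeff].
Qed.

Definition psum c (x : R) : R := limn (pseries c x).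

Lemma psum_der c x : expgrow c -> der (psum c) x (psum (pseries_diffs c) x).
Proof.
move=> h; apply: (@pseries_snd_diffs _ c (`|x| + 1)).
- exact: expgrow_cvg.
- by apply: expgrow_cvg; exact: expgrow_diffs.
- by apply: expgrow_cvg; do 2 apply: expgrow_diffs.
- by rewrite [ltRHS]ger0_norm ?ltrDl// addr_ge0.
Qed.

Lemma sm1_psum c : expgrow c -> sm1 (psum c).
Proof.
move=> h; exists (fun k => psum (iter k (@pseries_diffs R) c)); split => // k x.
by rewrite iterS; apply: psum_der; elim: k => [|k IH] //=; exact: expgrow_diffs.
Qed.

Definition scoef t (k : nat) : R := (-1) ^+ k * t ^+ k.*2.+1 / k.*2.+1`!%:R.
(* sin (t * sqrt y) / sqrt y as an entire function of y, hence also
   sinh (t * sqrt (- y)) / sqrt (- y): the symbol is smooth across delta r = 1. *)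
Definition Sser t : R -> R := psum (scoef t).

Lemma fact_le (a b : nat) : (a <= b)%N -> (a`! <= b`!)%N.
Proof.
elim: b => [|b IH]; first by rewrite leqn0 => /eqP ->.
rewrite leq_eqVlt => /predU1P[->//|]; rewrite ltnS => /IH h.
by rewrite factS (leq_trans h)// leq_pmull.
Qed.

Lemma scoef_grow t : expgrow (scoef t).
Proof.
exists `|t|, (`|t| ^+ 2) => k.
rewrite /scoef normrM normfV normrM normrX normrN1 expr1n mul1r normrX exprS -mulrA.
apply: ler_wpM2l => //; rewrite -exprM mul2n; apply: ler_wpM2l; first exact: exprn_ge0.
rewrite ger0_norm// lef_pV2 ?posrE ?ltr0n ?fact_gt0// ler_nat; apply: fact_le.
by rewrite (leq_trans _ (leqnSn _))// -addnn leq_addr.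
Qed.

Lemma Sser_cvg t z : \sum_(0 <= k < N) scoef t k * z ^+ k @[N --> \oo] --> Sser t z.
Proof. exact (@expgrow_cvg (scoef t) z (scoef_grow t)). Qed.

Lemma Sser_sin t a : Sser t (a ^+ 2) * a = sin (t * a).
Proof.
have c1 : (\sum_(0 <= k < N) scoef t k * (a ^+ 2) ^+ k) * a @[N --> \oo] --> Sser t (a ^+ 2) * a.
  by apply: cvgZl; exact: Sser_cvg.
have c2 := @cvg_sin_coeff' R (t * a).
apply: (cvg_unique _ c1); first exact: norm_hausdorff.
suff -> : (fun N => (\sum_(0 <= k < N) scoef t k * (a ^+ 2) ^+ k) * a) = series (sin_coeff' (t * a)) by [].
apply/funext => N; rewrite /series /= mulr_suml; apply: eq_bigr => k _.
rewrite /sin_coeff' /scoef -exprM mul2n exprMn [a ^+ k.*2.+1]exprSr.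
by rewrite -[(-1) ^ k]/((-1) ^+ k); ring.
Qed.

Lemma sinh_cvg x : \sum_(0 <= k < N) x ^+ k.*2.+1 / k.*2.+1`!%:R @[N --> \oo] --> (expR x - expR (- x)) / 2.
Proof.
(* [N] terms of the odd series correspond to [2 N] terms of the exponential series, whose even terms
   cancel. *)
have dbl : (fun N => N.*2) @ \oo --> \oo.
  by apply/cvgnyPge => A; exists A => // N /= AN; rewrite (leq_trans AN)// -addnn leq_addr.
have ce y : series (exp_coeff y) N.*2 @[N --> \oo] --> expR y.
  exact: (cvg_comp _ _ dbl (is_cvg_series_exp_coeff y)).
have c : (series (exp_coeff x) N.*2 - series (exp_coeff (- x)) N.*2) / 2 @[N --> \oo] --> (expR x - expR (- x)) / 2.
  by apply: cvgZl; apply: cvgB; exact: ce.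
suff -> : (fun N => \sum_(0 <= k < N) x ^+ k.*2.+1 / k.*2.+1`!%:R) =
  (fun N => (series (exp_coeff x) N.*2 - series (exp_coeff (- x)) N.*2) / 2) by [].
apply/funext; elim=> [|N IH]; first by rewrite /series /= !big_geq// subrr mul0r.
rewrite big_nat_recr// IH doubleS /series /= !big_nat_recr//=.
rewrite /exp_coeff /= !exprSr -(mulN1r x) !exprMn -signr_odd odd_double expr0 !mul1r.
set s1 := \sum_(0 <= i < _) _; set s2 := \sum_(0 <= i < _) _.
by field; rewrite !pnatr_eq0 -!lt0n !fact_gt0.
Qed.

Lemma Sser_sinh t b : Sser t (- b ^+ 2) * b = sinh (t * b).
Proof.
have c1 : (\sum_(0 <= k < N) scoef t k * (- b ^+ 2) ^+ k) * b @[N --> \oo] --> Sser t (- b ^+ 2) * b.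
  by apply: cvgZl; exact: Sser_cvg.
have c2 := @sinh_cvg (t * b).
apply: (cvg_unique _ c1); first exact: norm_hausdorff.
suff -> : (fun N => (\sum_(0 <= k < N) scoef t k * (- b ^+ 2) ^+ k) * b) =
   (fun N => \sum_(0 <= k < N) (t * b) ^+ k.*2.+1 / k.*2.+1`!%:R) by [].
apply/funext => N; rewrite mulr_suml; apply: eq_bigr => k _.
have Eb : (- b ^+ 2) ^+ k = (-1) ^+ k * b ^+ k.*2 by rewrite -[- b ^+ 2]mulN1r exprMn -exprM mul2n.
rewrite /scoef Eb [(t * b) ^+ _]exprMn [b ^+ k.*2.+1]exprSr.
have -> : (-1) ^+ k * t ^+ k.*2.+1 / k.*2.+1`!%:R * ((-1) ^+ k * b ^+ k.*2) * b =
  ((-1) ^+ k) ^+ 2 * (t ^+ k.*2.+1 * (b ^+ k.*2 * b) / k.*2.+1`!%:R) by ring.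
by rewrite sqrr_sign mul1r.
Qed.

Lemma Sser0 t : Sser t 0 = t.
Proof.
have c1 := @Sser_cvg t 0.
apply: (cvg_unique _ c1); first exact: norm_hausdorff.
apply: cvg_near_cst; exists 1%N => // -[//|N] _ /=.
rewrite big_nat_recl//= big1 ?addr0; first by rewrite /scoef /= !expr0 expr1 mul1r mulr1 divr1.
by move=> k _; rewrite expr0n mulr0.
Qed.

Lemma sm1_expR : sm1 (@expR R).
Proof. by exists (fun _ => expR); split => // k x; exact: dExp. Qed.

(** In terms of [r^2 - del^2 r^4], which is [a^2] or [- b^2], the oscillating, critical and
    hyperbolic cases are one entire function. *)
Lemma msymE del t r : 0 <= del -> 0 <= r ->
  msym del t r = expR (- (del * t * r ^+ 2)) * Sser t (r ^+ 2 - del ^+ 2 * r ^+ 2 ^+ 2).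
Proof.
move=> d0 r0; rewrite /msym; congr (_ * _).
have dr0 : 0 <= del * r by exact: mulr_ge0.
case: ifPn => [h|]; last rewrite -leNgt => h.
  set a := r * _; have a2 : r ^+ 2 - del ^+ 2 * r ^+ 2 ^+ 2 = a ^+ 2.
    have s0 : 0 <= 1 - del ^+ 2 * r ^+ 2 by rewrite subr_ge0 -exprMn expr_le1// ltW.
    by rewrite /a [in RHS]exprMn (sqr_sqrtr s0); ring.
  rewrite a2; case: eqP => [->|/eqP an]; first by rewrite expr0n Sser0.
  by rewrite -Sser_sin mulfK.
set b := r * _; have b2 : r ^+ 2 - del ^+ 2 * r ^+ 2 ^+ 2 = - b ^+ 2.
  have s0 : 0 <= del ^+ 2 * r ^+ 2 - 1 by rewrite subr_ge0 -exprMn expr_ge1.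
  by rewrite /b [in RHS]exprMn (sqr_sqrtr s0); ring.
rewrite b2; case: eqP => [->|/eqP bn]; first by rewrite expr0n oppr0 Sser0.
by rewrite -Sser_sinh mulfK.
Qed.

Lemma smooth_msym n del t : 0 <= del -> smooth (fun xi : 'rV[R]_n => msym del t (enorm xi)).
Proof.
move=> d0.
have -> : (fun xi : 'rV[R]_n => msym del t (enorm xi)) = (fun xi : 'rV[R]_n =>
    expR (- (del * t) * dotp xi xi) * Sser t (dotp xi xi - del ^+ 2 * (dotp xi xi * dotp xi xi))).
  apply/funext => xi; rewrite msymE ?enorm_ge0// !enorm_sqr expr2; congr (expR _ * _).
  by rewrite mulNr.
have sd := @smooth_dotpp R n.
apply: smooth_mul.
  apply: (smooth_comp sm1_expR); apply: smooth_mul; [exact: smooth_cst|exact: sd].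
apply: (smooth_comp (sm1_psum (scoef_grow t))); apply: smooth_sub; first exact: sd.
by apply: smooth_mul; [exact: smooth_cst|apply: smooth_mul].
Qed.

(** Homogeneity: every dyadic piece reduces to [|xi|] of size 1, with [del lam] and [t lam] as the
    only parameters. *)
Lemma msym_scale del t r lam : 0 < lam -> 0 <= del -> 0 <= r ->
  msym del t r = lam^-1 * msym (del * lam) (t * lam) (r / lam).
Proof.
move=> l0 d0 r0; have ln : lam != 0 by rewrite gt_eqF.
have -> : lam^-1 * msym (del * lam) (t * lam) (r / lam) = msym del t r; last by [].
rewrite /msym.
have E1 : del * lam * (r / lam) = del * r by field.
have E2 : (del * lam) ^+ 2 * (r / lam) ^+ 2 = del ^+ 2 * r ^+ 2 by field.
have E3 : del * lam * (t * lam) * (r / lam) ^+ 2 = del * t * r ^+ 2 by field.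
rewrite E1 E2 E3 mulrCA; congr (_ * _).
have aux (s : R) (f : R -> R) : lam^-1 * (if r / lam * s == 0 then t * lam else f (t * lam * (r / lam * s)) / (r / lam * s)) =
    (if r * s == 0 then t else f (t * (r * s)) / (r * s)).
  have -> : t * lam * (r / lam * s) = t * (r * s) by field.
  have -> : (r / lam * s == 0) = (r * s == 0) by rewrite !mulf_eq0 invr_eq0 (negbTE ln) orbF.
  case: eqP => [_|/eqP h]; first by field.
  move: (f _) => z; field; rewrite ln andbT /=.
  by move: h; rewrite mulf_eq0 negb_or => /andP[-> ->].
by case: ifP => _; exact: aux.
Qed.

Lemma sin_abs_le (x : R) : `|sin x| <= `|x|.
Proof. by have := sin_lip x 0; rewrite sin0 !subr0. Qed.

Lemma sinh_le (x : R) : 0 <= x -> sinh x <= x * expR x.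
Proof.
move=> x0; rewrite /sinh ler_pdivrMr//.
have h := expR_ge1Dx (- (2 * x)).
have E : expR (- x) = expR (- (2 * x)) * expR x by rewrite -expRD; congr expR; ring.
by rewrite E; have := expR_gt0 x; nra.
Qed.
Lemma sinh_ge0 (x : R) : 0 <= x -> 0 <= sinh x.
Proof. by move=> x0; rewrite /sinh divr_ge0// subr_ge0 ler_expR; lra. Qed.
Lemma sinh_le2 (x : R) : sinh x <= expR x / 2.
Proof. by rewrite /sinh ler_pM2r ?invr_gt0// gerBl expR_ge0. Qed.

Lemma sinc_le (t a : R) : 0 < t -> 0 <= a -> `|if a == 0 then t else sin (t * a) / a| <= t.
Proof.
move=> t0 a0; case: eqP => [_|/eqP an]; first by rewrite gtr0_norm.
have ap : 0 < a by rewrite lt_neqAle eq_sym an.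
rewrite normrM normfV (gtr0_norm ap) ler_pdivrMr// (le_trans (sin_abs_le _))//.
by rewrite ger0_norm// mulr_ge0// ltW.
Qed.
Lemma sinhc_le (t b : R) : 0 < t -> 0 <= b -> 0 <= (if b == 0 then t else sinh (t * b) / b) <= t * expR (t * b).
Proof.
move=> t0 b0; have tb : 0 <= t * b by rewrite mulr_ge0// ltW.
case: eqP => [->|/eqP bn]; first by rewrite mulr0 expR0 mulr1 lexx ltW.
have bp : 0 < b by rewrite lt_neqAle eq_sym bn.
rewrite divr_ge0 ?sinh_ge0//= ler_pdivrMr// (le_trans (sinh_le tb))//.
by rewrite le_eqVlt; apply/orP; left; apply/eqP; ring.
Qed.

Lemma sqrt_diff_le (D r : R) : 0 <= r -> 1 <= D * r -> 0 <= D ->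
  let b := r * Num.sqrt (D ^+ 2 * r ^+ 2 - 1) in
  [/\ 0 <= b, b <= D * r ^+ 2 & b ^+ 2 = (D * r ^+ 2) ^+ 2 - r ^+ 2].
Proof.
move=> r0 h D0 b.
have s0 : 0 <= D ^+ 2 * r ^+ 2 - 1 by rewrite subr_ge0 -exprMn expr_ge1// mulr_ge0.
have b0 : 0 <= b by rewrite mulr_ge0// sqrtr_ge0.
have b2 : b ^+ 2 = (D * r ^+ 2) ^+ 2 - r ^+ 2 by rewrite /b exprMn sqr_sqrtr//; ring.
split => //; rewrite -(@ler_pXn2r _ 2)// ?nnegrE ?mulr_ge0 ?sqr_ge0//.
by rewrite b2 gerBl sqr_ge0.
Qed.

(** In the hyperbolic case [sinh (t b) / b <= t exp (t b)], and [b <= del r^2] lets the damping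
    absorb the exponential. *)
Lemma msym_le_t del t r : 0 <= del -> 0 < t -> 0 <= r -> `|msym del t r| <= t.
Proof.
move=> d0 t0 r0; rewrite /msym normrM.
have E0 : 0 <= expR (- (del * t * r ^+ 2)) by exact: expR_ge0.
case: ifPn => [h|]; last rewrite -leNgt => h.
  rewrite -[leRHS]mul1r; apply: ler_pM => //.
    rewrite ger0_norm// -expR0 ler_expR oppr_le0 !mulr_ge0//; exact: ltW.
  by apply: sinc_le => //; rewrite mulr_ge0// sqrtr_ge0.
have [b0 b1 b2] := sqrt_diff_le r0 h d0; set b := r * _ in b0 b1 b2 *.
have /andP[g0 g1] := sinhc_le t0 b0; rewrite (ger0_norm g0) ger0_norm//.
apply: (le_trans (ler_wpM2l E0 g1)); rewrite mulrCA -expRD -[leRHS]mulr1.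
apply: ler_wpM2l; first exact: ltW.
by rewrite -expR0 ler_expR; nra.
Qed.

Lemma exp_decay (x : R) : 0 < x -> x ^+ 2 * expR (- x) <= 2.
Proof.
move=> x0; have h := expR_ge1Dxn 1 (ltW x0).
rewrite expRN ler_pdivrMr ?expR_gt0//.
have : 1 + x ^+ 2 / 2 <= expR x by move: h; rewrite (_ : 2`! = 2)%N.
lra.
Qed.

Lemma msym_damped : exists2 C : R, 0 < C & forall del t r, 8^-1 <= del -> 0 < t -> 2^-1 <= r <= 2 ->
  `|msym del t r| <= C / t.
Proof.
(* [exp_decay] gives [t^2 exp (- t / k) <= 2 k^2], and [k <= 32] in every use of [key]. *)
exists (32 * 64); first by rewrite mulr_gt0.
move=> del t r d8 t0 /andP[r1 r2].
have d0 : 0 < del by apply: lt_le_trans d8; rewrite invr_gt0.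
have r0 : 0 < r by apply: lt_le_trans r1; rewrite invr_gt0.
have key (k : R) : 0 < k -> k <= 32 -> t * expR (- (t / k)) <= 32 * 64 / t.
  move=> k0 k1; rewrite ler_pdivlMr// mulrAC -expr2.
  have := exp_decay (divr_gt0 t0 k0); move: (expR_ge0 (- (t / k))); set E := expR _ => E0.
  rewrite exprMn exprVn => h.
  have -> : t ^+ 2 * E = k ^+ 2 * (t ^+ 2 / k ^+ 2 * E) by field; rewrite gt_eqF.
  apply: (le_trans (ler_wpM2l (sqr_ge0 k) h)); nra.
rewrite /msym normrM.
have E0 : 0 <= expR (- (del * t * r ^+ 2)) by exact: expR_ge0.
case: ifPn => [h|]; last rewrite -leNgt => h.
  have a0 : 0 <= r * Num.sqrt (1 - del ^+ 2 * r ^+ 2) by rewrite mulr_ge0 ?sqrtr_ge0// ltW.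
  rewrite (ger0_norm E0); apply: (le_trans (ler_wpM2l E0 (sinc_le t0 a0))).
  apply: le_trans (key 32 _ _) => //; rewrite mulrC; apply: ler_wpM2l; first exact: ltW.
  have h32 : 32^-1 <= del * r ^+ 2.
    have h4 : 4^-1 <= r ^+ 2 by nra.
    by have := ler_pM (_ : 0 <= 8^-1) (_ : 0 <= 4^-1) d8 h4; rewrite !invr_ge0 !ler0n => /(_ isT isT); lra.
  rewrite ler_expR lerN2; have := ler_wpM2l (ltW t0) h32.
  by congr (_ <= _); ring.
have [b0 b1 b2] := sqrt_diff_le (ltW r0) h (ltW d0); set b := r * _ in b0 b1 b2 *.
(* Rationalise: [(del r^2 - b) (del r^2 + b) = r^2], and the second factor is at most
   [2 del r^2]. *)
have gap : (2 * del)^-1 <= del * r ^+ 2 - b.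
  have s : (del * r ^+ 2 - b) * (del * r ^+ 2 + b) = r ^+ 2 by rewrite -subr_sqr b2; ring.
  have p : 0 < del * r ^+ 2 + b by rewrite ltr_wpDr// mulr_gt0// exprn_gt0.
  have -> : del * r ^+ 2 - b = r ^+ 2 / (del * r ^+ 2 + b) by apply: (mulIf (lt0r_neq0 p)); rewrite s divfK// gt_eqF.
  rewrite ler_pdivlMr// mulrC ler_pdivrMr ?mulr_gt0//.
  by nra.
have [c|c] := leP (del * r) 2.
  have d4 : del <= 4 by nra.
  have /andP[g0 g1] := sinhc_le t0 b0; rewrite (ger0_norm g0) (ger0_norm E0).
  apply: (le_trans (ler_wpM2l E0 g1)); rewrite mulrCA -expRD.
  apply: le_trans (key (2 * del) _ _); [|by rewrite mulr_gt0|lra].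
  apply: ler_wpM2l; first exact: ltW.
  rewrite ler_expR; have := ler_wpM2l (ltW t0) gap; lra.
have b4 : del / 8 <= b.
  rewrite -(@ler_pXn2r _ 2)// ?nnegrE ?divr_ge0 ?(ltW d0)//.
  rewrite b2; have h1 : 4 <= (del * r) ^+ 2 by nra.
  have h2 : (del * r) ^+ 2 * (r ^+ 2) = (del * r ^+ 2) ^+ 2 by ring.
  have h3 : r ^+ 2 <= (del * r ^+ 2) ^+ 2 / 4 by rewrite -h2; nra.
  have h4 : 4^-1 <= r ^+ 2 by nra.
  have h5 : (del * r ^+ 2) ^+ 2 = del ^+ 2 * (r ^+ 2) ^+ 2 by ring.
  have h6 : 16^-1 <= (r ^+ 2) ^+ 2 by nra.
  have h7 : del ^+ 2 * 16^-1 <= (del * r ^+ 2) ^+ 2 by rewrite h5 ler_wpM2l// sqr_ge0.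
  have -> : (del / 8) ^+ 2 = del ^+ 2 / 64 by field.
  by have := sqr_ge0 del; lra.
have bp : 0 < b by apply: lt_le_trans b4; rewrite divr_gt0.
have tb : 0 <= t * b by rewrite mulr_ge0// ltW.
rewrite gt_eqF// (ger0_norm E0) (ger0_norm (divr_ge0 (sinh_ge0 tb) (ltW bp))).
apply: (@le_trans _ _ (expR (- (t / (2 * del))) * (4 / del))).
  rewrite mulrA ler_pdivrMr//.
  apply: (@le_trans _ _ (expR (- (del * t * r ^+ 2)) * (expR (t * b) / 2))).
    by apply: ler_wpM2l => //; exact: sinh_le2.
  rewrite mulrA -expRD.
  apply: (@le_trans _ _ (expR (- (t / (2 * del))) * 2^-1)).
    apply: ler_wpM2r => //; rewrite ler_expR.
    by have := ler_wpM2l (ltW t0) gap; lra.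
  rewrite -mulrA; apply: ler_wpM2l; first exact: expR_ge0.
  rewrite mulrAC ler_pdivlMr//; lra.
rewrite mulrA ler_pdivrMr// expRN.
have := expR_ge1Dx (t / (2 * del)) => h1.
have x0 : 0 < t / (2 * del) by rewrite divr_gt0// mulr_gt0.
rewrite mulrC ler_pdivrMr ?expR_gt0//.
apply: (@le_trans _ _ (32 * 64 / t * del * (t / (2 * del)))).
  have -> : 32 * 64 / t * del * (t / (2 * del)) = 32 * 32 by field; rewrite !gt_eqF.
  by lra.
apply: ler_wpM2l; first by rewrite mulr_ge0 ?divr_ge0 ?(ltW d0) ?(ltW t0).
lra.
Qed.

(** On the annulus [del r <= 1/4], so the symbol is in its oscillating form [sin (T th) / th], and
    the cutoff equals 1 there. *)
Lemma msym_Ew (X : nat -> R -> R) del T r : small del -> 2^-1 <= r <= 2 -> X 0%N (r ^+ 2) = 1 ->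
  msym del T r = Ew del T (fun _ u => 0 * X 0%N u) (fun d u => ka d u * X 0%N u) (r ^+ 2).
Proof.
move=> d0 /andP[r1 r2] X1.
have r0 : 0 < r by apply: lt_le_trans r1; rewrite invr_gt0.
have u1 : 0 < r ^+ 2 < 32 by apply/andP; split; nra.
have t0 := th_gt0 d0 u1.
rewrite /msym /Ew X1 mul0r mul0r add0r mulr1.
have h : del * r < 1 by case/andP: d0 => *; nra.
have -> : r * Num.sqrt (1 - del ^+ 2 * r ^+ 2) = th del (r ^+ 2).
  rewrite /th -[X in X * _](ger0_norm (ltW r0)) -sqrtr_sqr -sqrtrM ?sqr_ge0//.
  by congr Num.sqrt; ring.
rewrite h gt_eqF// mulrC [in RHS]mulrC /ka [_^-1 * _]mulrC; congr (_ * expR _).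
Qed.
End PowerSeries.

(** * Littlewood-Paley decomposition *)

Section LP.
Variables (R : realType) (n : nat) (phi : 'rV[R]_n -> R).
Notation pt := 'rV[R]_n.
Hypothesis adm : LP_admissible phi.

Lemma phi_supp (xi : pt) : phi xi != 0 -> 2^-1 < enorm xi < 2.
Proof. by move=> h; have [_ [hs _]] := adm; apply: hs; apply: subset_closure. Qed.
Lemma phi_small (xi : pt) : enorm xi <= 2^-1 -> phi xi = 0.
Proof.
move=> h; apply/eqP; apply: contraT => /phi_supp/andP[h1 _].
by move: (lt_le_trans h1 h); rewrite ltxx.
Qed.
Lemma phi_large (xi : pt) : 2 <= enorm xi -> phi xi = 0.
Proof.
move=> h; apply/eqP; apply: contraT => /phi_supp/andP[_ h1].
by move: (lt_le_trans h1 h); rewrite ltxx.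
Qed.
Lemma smooth_phi : smooth phi. Proof. by case: adm. Qed.
Lemma enorm_pow j (xi : pt) : enorm (2 ^- j *: xi) = 2 ^- j * enorm xi.
Proof. by rewrite enormZ ger0_norm// invr_ge0 exprn_ge0. Qed.

(** The terms with [j > N] vanish because [2^-j |xi| <= 1/2], so the limit is reached after finitely
    many terms. *)
Lemma phi0E N (xi : pt) : enorm xi <= 2 ^+ N ->
  phi0 phi xi = 1 - \sum_(1 <= j < N.+1) phi (2 ^- j *: xi).
Proof.
move=> h; rewrite /phi0; congr (1 - _); apply: lim_near_cst; first exact: norm_hausdorff.
exists N.+1 => // M /= NM; rewrite (@big_cat_nat _ _ _ N.+1)//= [X in _ + X](_ : _ = 0) ?addr0// big_nat; apply: big1.
move=> j /andP[Nj _]; apply: phi_small; rewrite enorm_pow.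
case: j Nj => // j; rewrite ltnS => Nj.
rewrite mulrC ler_pdivrMr ?exprn_gt0// exprS mulrA mulVf// mul1r (le_trans h)//.
by apply: ler_weXn2l => //; rewrite ler1n.
Qed.

Lemma phi0_one (xi : pt) : enorm xi <= 1 -> phi0 phi xi = 1.
Proof. by move=> h; rewrite (@phi0E 0)// big_geq// subr0. Qed.
Lemma phi0_large (xi : pt) : 2 <= enorm xi -> phi0 phi xi = 0.
Proof. by case: adm => _ [_ h]; exact: h. Qed.

Lemma pow2_ge (x : R) : exists N : nat, x < 2 ^+ N.
Proof.
exists (Num.truncn x).+1; apply: (lt_le_trans (truncnS_gt x)).
by rewrite -natrX ler_nat ltnW// ltn_expl.
Qed.

Lemma smooth_phi0 : smooth (phi0 phi).
Proof.
apply: smooth_local => x; have [N hN] := pow2_ge (enorm x).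
exists (fun xi => 1 - \sum_(1 <= j < N.+1) phi (2 ^- j *: xi)).
  apply: smooth_sub; first exact: smooth_cst.
  by apply: smooth_sum => j; apply: smooth_scale; exact: smooth_phi.
have hx : nbhs x (@enorm R n @^-1` [set z | z < 2 ^+ N]).
  by apply: (@enorm_cont R n x); exact: lt_nbhsl.
by apply: (@filterS pt (nbhs x) _ _ _ _ hx) => y /= hy; apply: phi0E; exact: ltW.
Qed.

Lemma bsupp_of (h : pt -> R) : (forall xi, 2 <= enorm xi -> h xi = 0) -> bsupp h.
Proof.
by move=> hh; exists 2 => x i hx; apply: hh; apply: le_trans (ltW hx) (coord_le_enorm x i).
Qed.
Lemma bsupp_phi : bsupp phi. Proof. by apply: bsupp_of; exact: phi_large. Qed.
Lemma bsupp_phi0 : bsupp (phi0 phi). Proof. by apply: bsupp_of; exact: phi0_large. Qed.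

(** Shifting the summation index by one relates consecutive scales; iterated, this cuts the
    low-frequency block into dyadic pieces. *)
Lemma phi0_double (xi : pt) : phi0 phi xi = phi0 phi (2 *: xi) + phi xi.
Proof.
have [N hN] := pow2_ge (enorm xi).
rewrite (phi0E (ltW hN)) (@phi0E N.+1); last first.
  by rewrite enormZ ger0_norm// exprS; apply: ler_wpM2l => //; exact: ltW.
rewrite (@big_ltn _ _ _ 1 N.+2)// expr1 scalerA mulVf// scale1r.
have -> : \sum_(2 <= i < N.+2) phi (2 ^- i *: (2 *: xi)) = \sum_(1 <= j < N.+1) phi (2 ^- j *: xi).
  rewrite big_add1 /=; apply: eq_bigr => j _; by rewrite scalerA exprSr invfM divfK.
by ring.
Qed.

Lemma phi0_dyadic K (xi : pt) :
  phi0 phi xi = phi0 phi (2 ^+ K *: xi) + \sum_(k < K) phi (2 ^+ k *: xi).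
Proof.
elim: K => [|K IH]; first by rewrite expr0 scale1r big_ord0 addr0.
by rewrite IH phi0_double scalerA -exprS big_ord_recr/= -addrA [phi _ + _]addrC.
Qed.

Lemma phij_sum N (xi : pt) : enorm xi <= 2 ^+ N -> \sum_(0 <= j < N.+1) phij phi j xi = 1.
Proof.
move=> h; rewrite big_ltn// /= (phi0E h).
rewrite [X in _ + X](_ : _ = \sum_(1 <= j < N.+1) phi (2 ^- j *: xi)) ?subrK//.
by rewrite big_nat [RHS]big_nat; apply: eq_bigr => -[].
Qed.

Lemma phij_supp j (xi : pt) : phij phi j xi != 0 ->
  enorm xi < 2 ^+ j.+1 /\ ((0 < j)%N -> 2 ^+ j < 2 * enorm xi).
Proof.
case: j => [|j] /= h.
  split => //; rewrite ltNge; apply/negP => /phi0_large h0; by rewrite h0 eqxx in h.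
have /andP[h1 h2] := phi_supp h; rewrite enorm_pow in h1 h2.
have p0 : 0 < 2 ^+ j.+1 :> R by exact: exprn_gt0.
split => [|_].
  by move: h2; rewrite mulrC ltr_pdivrMr// -exprS.
move: h1; rewrite mulrC ltr_pdivlMr// => h1.
by rewrite -(ltr_pM2l (_ : 0 < 2^-1 :> R)) ?invr_gt0// mulrA mulVf// mul1r.
Qed.

Definition nbr (j : nat) : seq nat := if j is j'.+1 then [:: j'; j'.+1; j'.+2] else [:: 0; 1]%N.

Lemma pow2_lt (a b : nat) : 2 ^+ a < 2 ^+ b :> R -> (a < b)%N.
Proof.
by move=> h; rewrite ltnNge; apply/negP => ba; move: h; rewrite ltNge ler_weXn2l// ler1n.
Qed.

(** On the support of block [j] all other terms of the partition of unity vanish. *)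
Lemma nbr_sum j (xi : pt) : phij phi j xi != 0 -> \sum_(l <- nbr j) phij phi l xi = 1.
Proof.
move=> h; have [h1 h2] := phij_supp h.
rewrite -(phij_sum (ltW h1)); case: j h h1 h2 => [|j] h h1 h2.
  by rewrite /nbr big_ltn// big_nat1 !big_cons big_nil addr0.
rewrite (@big_cat_nat _ _ _ j)//=; last by rewrite (leq_trans (leqnSn _)) ?leqnSn// ltnW.
rewrite [X in _ = X + _]big_nat [X in _ = X + _]big1 ?add0r; last first.
  move=> l /andP[_ lj]; apply/eqP; apply: contraT => /phij_supp[h3 _].
  have : 2 ^+ j.+1 < 2 ^+ l.+2 :> R.
    by apply: (lt_trans (h2 isT)); rewrite exprS ltr_pM2l.
  by move=> /pow2_lt; rewrite !ltnS leqNgt lj.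
have -> // : index_iota j j.+3 = [:: j; j.+1; j.+2].
by rewrite /index_iota (_ : (j.+3 - j)%N = 3%N)// -addn3 addKn.
Qed.

Lemma nbr_sum0 (xi : pt) : enorm xi <= 2 -> \sum_(l <- nbr 0) phij phi l xi = 1.
Proof.
by move=> h; rewrite -(@phij_sum 1 xi)// big_ltn// big_nat1 !big_cons big_nil addr0.
Qed.

Lemma smooth_phij j : smooth (phij phi j).
Proof. by case: j => [|j]; [exact: smooth_phi0|apply: smooth_scale; exact: smooth_phi]. Qed.
Lemma bsupp_phij j : bsupp (phij phi j).
Proof.
exists (2 ^+ j.+1) => x i hx; apply/eqP; apply: contraT => /phij_supp[h _].
by move: (lt_trans h (lt_le_trans hx (coord_le_enorm x i))); rewrite ltxx.
Qed.

Lemma der_uniq (f : R -> R) (x a b : R) : der f x a -> der f x b -> a = b.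
Proof. by move=> [_ <-] [_ <-]. Qed.

(** [phi0] restricted to a line is 1 on [[-1, 1]] and 0 beyond 2, and its derivatives along the line
    are known. Hence [phi0 (u / 4) - phi0 (8 u)] is 1 on [[1/4, 4]] and, for positive [u], 0 outside
    [[1/8, 8]]. *)
Lemma bump_ex : (0 < n)%N -> exists X : nat -> R -> R, [/\
  (forall k (u : R), der (X k) u (X k.+1 u)),
  (forall k u, ~~ (8^-1 <= u <= 8) -> X k u = 0) &
  (forall u, 4^-1 <= u <= 4 -> X 0%N u = 1)].
Proof.
move=> n0; pose i0 : 'I_n := Ordinal n0; pose e : pt := eb i0.
have e1 : enorm e = 1.
  rewrite /enorm /dotp (bigD1 i0)//= big1 ?addr0; first by rewrite /e !mxE !eqxx mulr1 sqrtr1.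
  by move=> j /negbTE ji; rewrite /e !mxE ji andbF mulr0.
have ee (s : R) : enorm (s *: e) = `|s| by rewrite enormZ e1 mulr1.
pose D k (s : R) := dpart (nseq k i0) (phi0 phi) (s *: e).
have dD_ k (s : R) : der (D k) s (D k.+1 s).
  have := pder_at (smooth_pder (s *: eb i0 + 0) i0 (smooth_dpart (nseq k i0) smooth_phi0)).
  rewrite /D addr0; under [X in der X]eq_fun do rewrite addr0.
  exact.
pose g k (u : R) := 4 ^- k * D k (4^-1 * u) - 8 ^+ k * D k (8 * u).
have dg k (u : R) : der (g k) u (g k.+1 u).
  have dl (c : R) : der (fun u => D k (c * u)) u (D k.+1 (c * u) * c).
    by apply: (@dchain _ (fun u => c * u) (D k)); [exact: dD_|exact: dMl].
  apply: deq.
    apply: dD; first by apply: dM; [exact: dC|exact: dl].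
    by apply: dN; apply: dM; [exact: dC|exact: dl].
  by rewrite /g !exprS invfM; ring.
have g00 (u : R) : `|u| < 8^-1 \/ 8 < u -> g 0%N u = 0.
  rewrite /g /D /= !expr0 invr1 !mul1r => -[h|h].
    rewrite !phi0_one ?subrr// ee normrM ger0_norm//; move: h; have := normr_ge0 u; lra.
  have u0 : 0 <= u by apply: le_trans (ltW h).
  rewrite !phi0_large ?subrr// ee ger0_norm ?mulr_ge0//; lra.
have g0 k (u : R) : `|u| < 8^-1 \/ 8 < u -> g k u = 0.
  elim: k u => [|k IH] u hu; first exact: g00.
  have nz : \forall v \near u, 0 = g k v.
    case: hu => hu.
      move: hu; rewrite ltr_norml => /andP[h1 h2].
      have n1 : \forall v \near u, - 8^-1 < v by exact: lt_nbhsr.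
      have n2 : \forall v \near u, v < 8^-1 by exact: lt_nbhsl.
      apply: filterS2 n1 n2 => v v1 v2; rewrite IH//; left.
      by rewrite ltr_norml v1 v2.
    have n1 : \forall v \near u, 8 < v by exact: lt_nbhsr.
    by apply: filterS n1 => v v1; rewrite IH//; right.
  exact: (der_uniq (dg k u) (d_near (dC 0 u) nz)).
(* [g] need not vanish for negative [u]; being zero near 0, it can be cut off there without losing
   smoothness. *)
exists (fun k u => if 0 < u then g k u else 0); split.
- move=> k u; have [u0|u0] := ltP 0 u.
    apply: (d_near (dg k u)).
    have n1 : \forall v \near u, 0 < v by exact: lt_nbhsr.
    by apply: filterS n1 => v ->.
  apply: (d_near (dC 0 u)).
  have n1 : \forall v \near u, v < 8^-1 by apply: lt_nbhsl; apply: le_lt_trans u0 _; rewrite invr_gt0.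
  apply: filterS n1 => v v8; case: ifP => // v0; rewrite g0//; left.
  by rewrite gtr0_norm.
- move=> k u; case: ifP => // u0; rewrite negb_and -!ltNge => /orP[h|h]; rewrite g0//; last by right.
  by left; rewrite gtr0_norm.
- move=> u /andP[u1 u2]; have u0 : 0 < u by apply: lt_le_trans u1; rewrite invr_gt0.
  rewrite u0 /g /D /= !expr0 invr1 !mul1r phi0_one ?phi0_large ?subr0// ee gtr0_norm ?mulr_gt0//.
  + lra.
  + by rewrite mulrC ler_pdivrMr// mul1r.
Qed.
End LP.

(** * Bounds on the dyadic pieces of the symbol *)

Section PowLemmas.
Variable R : realType.
Implicit Types (t l e c : R).
Lemma powR_le_neg t l e : 0 < t -> 0 < l -> 1 <= t * l -> e <= 0 -> l `^ e <= t `^ (- e).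
Proof.
move=> t0 l0 h e0; rewrite powRN -[leRHS]mul1r ler_pdivlMr ?powR_gt0// mulrC -powRM ?(ltW t0) ?(ltW l0)//.
by rewrite -(powRr0 (t * l)); apply: ler_powR.
Qed.
Lemma powR_le_pos t l e : 0 < t -> 0 < l -> t * l <= 1 -> 0 <= e -> l `^ e <= t `^ (- e).
Proof.
move=> t0 l0 h e0; rewrite powRN -[leRHS]mul1r ler_pdivlMr ?powR_gt0// mulrC -powRM ?(ltW t0) ?(ltW l0)//.
have : (t * l) `^ e <= 1 `^ e by apply: ge0_ler_powR; rewrite ?nnegrE ?mulr_ge0 ?(ltW t0) ?(ltW l0).
by rewrite powR1.
Qed.
Lemma powRDp t (a b : R) : 0 < t -> t `^ (a + b) = t `^ a * t `^ b.
Proof. by move=> t0; rewrite powRD// (gt_eqF t0) implybT. Qed.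
(** The interpolated value of the pair [A = c l^n], [B = c] supplied by [crude_piece]. *)
Lemma powR_split c l (th : R) (n : nat) : 0 < c -> 0 < l ->
  (c * l ^+ n) `^ th * c `^ (1 - th) = c * l `^ (n%:R * th).
Proof.
move=> c0 l0; rewrite powRM ?(ltW c0) ?exprn_ge0 ?(ltW l0)// -(powR_mulrn n (ltW l0)) -powRrM.
rewrite mulrAC -powRDp// (_ : th + (1 - th) = 1) ?powRr1 ?(ltW c0)//; ring.
Qed.
End PowLemmas.

Definition Mp (R : realType) (n : nat) (Phi : 'rV[R]_n -> R) (del t lam : R) (xi : 'rV[R]_n) : R[i] :=
  rc (msym del t (enorm xi) * Phi (lam^-1 *: xi)).

Lemma Ccs_Mp (R : realType) n (Phi : 'rV[R]_n -> R) del t lam : smooth Phi -> bsupp Phi -> 0 <= del -> 0 < lam ->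
  Ccs (Mp Phi del t lam).
Proof.
move=> sP bP d0 l0; have [B [r [_ _ _ hr]]] := bsupp_radius sP bP; split.
  apply: csmooth_rc; apply: smooth_mul; first exact: smooth_msym.
  exact: smooth_scale.
by exists (r * lam) => x i hx; rewrite /Mp (scale_supp l0 hr hx) mulr0.
Qed.

(** The kernel is bounded by the supremum of the multiplier times the volume of its support, of
    order [lam^n]. *)
Lemma crude_piece (R : realType) n (Phi : 'rV[R]_n -> R) : smooth Phi -> bsupp Phi -> exists2 C : R, 0 < C &
  forall del t lam s, 0 <= del -> 0 < lam -> 0 < s ->
  (forall xi, Phi (lam^-1 *: xi) != 0 -> `|msym del t (enorm xi)| <= s) ->
  (forall xi, cabs (Mp Phi del t lam xi) <= C * s) /\
  (forall x, cabs (Fr 1 (Mp Phi del t lam) x) <= C * s * lam ^+ n).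
Proof.
move=> sP bP; have [B [r [B0 r0 hB hr]]] := bsupp_radius sP bP.
have Q0 : 0 <= B * (2 * r) ^+ n by rewrite mulr_ge0// exprn_ge0// mulr_ge0// ltW.
exists (B + 2 * (B * (2 * r) ^+ n) + 1); first by lra.
move=> del t lam s d0 l0 s0 hs.
have cM := Ccs_Mp t sP bP d0 l0.
have b1 xi : cabs (Mp Phi del t lam xi) <= B * s.
  rewrite /Mp cabs_real; have [->|h] := eqVneq (Phi (lam^-1 *: xi)) 0.
    by rewrite mulr0 normr0 mulr_ge0// ltW.
  by rewrite normrM mulrC; apply: ler_pM => //; exact: hs.
split.
  move=> xi; apply: (le_trans (b1 xi)); apply: ler_wpM2r; first exact: ltW.
  by lra.
move=> x; have iM := rapid_iC (Ccs_rapid cM).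
apply: (@le_trans _ _ (2 * ((B * s) * (2 * (r * lam)) ^+ n))).
  rewrite -lee_fin; apply: (le_trans (cI_norm _ (iC_mC (iCn_ph 1 x iM)))).
  rewrite EFinM; apply: lee_wpmul2l => //.
  have -> : (\int[mu R n]_t0 (cabs (ph 1 (row_of_tuple t0) x * Mp Phi del t lam (row_of_tuple t0)))%:E =
     \int[mu R n]_t0 (cabs (Mp Phi del t lam (row_of_tuple t0)))%:E)%E.
    by apply: eq_integral => u _; rewrite cabsM cabs_ph mul1r.
  apply: (box_int (iC_mC iM)) => //; rewrite ?mulr_ge0 ?mulr_gt0 ?(ltW s0)//.
  by move=> z i hz; rewrite /Mp (scale_supp l0 hr hz) mulr0.
have -> : 2 * (B * s * (2 * (r * lam)) ^+ n) = 2 * (B * (2 * r) ^+ n) * s * lam ^+ n by rewrite !exprMn; ring.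
apply: ler_wpM2r; first by rewrite exprn_ge0// ltW.
apply: ler_wpM2r; first exact: ltW.
by lra.
Qed.

Lemma dispersive_piece (R : realType) n (phi : 'rV[R]_n -> R) : LP_admissible phi -> (0 < n)%N ->
  exists2 C : R, 0 < C & forall del t lam, 0 <= del -> 0 < t -> 0 < lam -> 1 <= t * lam -> small (del * lam) ->
  (forall xi, cabs (Mp phi del t lam xi) <= C * lam^-1) /\
  (forall x, cabs (Fr 1 (Mp phi del t lam) x) <= C * lam ^+ n.-1 * Num.sqrt (t * lam) ^- n.-1).
Proof.
move=> adm n0; have [X [dX_ sX X1]] := bump_ex adm n0.
(* The symbol has no cosine part; the zero amplitude is written as a multiple of [X 0] to belong to
   [amp]. *)
pose a (_ u : R) := 0 * X 0%N u; pose b (d u : R) := ka d u * X 0%N u.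
have ha : amp X a by apply: (amp_mul (pol_cst 0)); exact: amp_X.
have hb : amp X b by apply: (amp_mul (@pol_ka R)); exact: amp_X.
have sphi := smooth_phi adm; have bphi := bsupp_phi adm.
have [CE CE0 hE] := Ew_bdd dX_ sX ha hb.
have [Cc Cc0 hc] := crude_piece sphi bphi.
have ring_ lam xi : 0 < lam -> phi (lam^-1 *: xi) != 0 -> 2^-1 <= enorm xi / lam <= 2.
  move=> l0 /(phi_supp adm); rewrite enormZ gtr0_norm ?invr_gt0// mulrC => /andP[h1 h2].
  by rewrite !ltW.
have key del t lam xi : 0 <= del -> 0 < lam -> small (del * lam) -> phi (lam^-1 *: xi) != 0 ->
    msym del t (enorm xi) = lam^-1 * Ew (del * lam) (t * lam) a b (dotp xi xi / lam ^+ 2).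
  move=> d0 l0 sd hphi; have hr := ring_ lam xi l0 hphi.
  rewrite (@msym_scale _ _ _ _ lam)// ?enorm_ge0//; congr (_ * _).
  rewrite (@msym_Ew _ X)//; first by rewrite expr_div_n enorm_sqr.
  case/andP: hr => h1 h2; apply: X1; set r := enorm xi / lam in h1 h2 *.
  by apply/andP; split; nra.
have crude del t lam : 0 <= del -> 0 < t -> 0 < lam -> small (del * lam) ->
   forall xi, phi (lam^-1 *: xi) != 0 -> `|msym del t (enorm xi)| <= (CE + 1) * lam^-1.
  move=> d0 t0 l0 sd xi h; have li : 0 < lam^-1 by rewrite invr_gt0.
  rewrite (key del t lam)// normrM mulrC (gtr0_norm li).
  apply: ler_wpM2r; first by rewrite invr_ge0 ltW.
  by apply: (le_trans (hE _ _ _ sd (mulr_gt0 t0 l0))); lra.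
have EM del t lam : 0 <= del -> 0 < lam -> small (del * lam) -> Mp phi del t lam =
    (fun xi => rc (lam^-1 * Ew (del * lam) (t * lam) a b (dotp xi xi / lam ^+ 2) * phi (lam^-1 *: xi))).
  move=> d0 l0 sd; apply/funext => xi; rewrite /Mp.
  by have [->|h] := eqVneq (phi (lam^-1 *: xi)) 0; [rewrite !mulr0|rewrite (key del t lam)].
have [CK CK0 hK] : exists2 C : R, 0 <= C & forall del t lam, 0 <= del -> 0 < t -> 0 < lam -> 1 <= t * lam -> small (del * lam) ->
   forall x, cabs (Fr 1 (Mp phi del t lam) x) <= C * lam ^+ n.-1 * Num.sqrt (t * lam) ^- n.-1.
  (* In dimension one the asserted kernel bound contains no power of [lam] or of [t lam], and
     [crude_piece] yields it; [kernel_bound] covers the other dimensions. *)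
  case: n phi adm n0 sphi bphi hc ring_ key crude EM => [|[|m]] phi adm // n0 sphi bphi hc ring_ key crude EM.
    exists (Cc * (CE + 1)); first by rewrite mulr_ge0// ?(ltW Cc0)//; lra.
    move=> del t lam d0 t0 l0 T1 sd x.
    have s0 : 0 < (CE + 1) * lam^-1 by rewrite mulr_gt0 ?invr_gt0//; lra.
    have [_ h] := hc del t lam _ d0 l0 s0 (crude del t lam d0 t0 l0 sd).
    apply: (le_trans (h x)); rewrite /= !expr0 invr1 !mulr1 expr1.
    by rewrite le_eqVlt; apply/orP; left; apply/eqP; field; rewrite gt_eqF.
  have [C C0 hC] := kernel_bound dX_ sX sphi bphi ha hb.
  exists C => // del t lam d0 t0 l0 T1 sd x; rewrite EM//; exact: hC.
exists (Cc * (CE + 1) + CK); first by rewrite ltr_pwDl// mulr_gt0//; lra.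
move=> del t lam d0 t0 l0 T1 sd.
have s0 : 0 < (CE + 1) * lam^-1 by rewrite mulr_gt0 ?invr_gt0//; lra.
have [h _] := hc del t lam _ d0 l0 s0 (crude del t lam d0 t0 l0 sd).
split.
  move=> xi; apply: (le_trans (h xi)); rewrite mulrA; apply: ler_wpM2r; first by rewrite invr_ge0 ltW.
  by rewrite lerDl.
move=> x; apply: (le_trans (hK del t lam d0 t0 l0 T1 sd x)).
apply: ler_wpM2r; first by rewrite invr_ge0 exprn_ge0// sqrtr_ge0.
apply: ler_wpM2r; first by rewrite exprn_ge0// ltW.
by rewrite lerDr mulr_ge0 ?(ltW Cc0)//; lra.
Qed.

(* A is the L^1 -> L^oo bound, B the L^2 bound, interpolated with th = 2 / p - 1. *)
Definition good (R : realType) n (th C : R) (Phi : 'rV[R]_n -> R) (del t lam : R) := exists A B : R,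
  [/\ 0 < A, 0 < B, (forall x, cabs (Fr 1 (Mp Phi del t lam) x) <= A),
      (forall xi, cabs (Mp Phi del t lam xi) <= B) & A `^ th * B `^ (1 - th) <= C * t `^ (1 - n%:R * th)].

(** The symbol is at most [t] and [lam <= 1 / t]. Only bounded support of [Phi] enters, so the lemma
    also serves the ball around the origin left over from the low-frequency block. *)
Lemma good_low (R : realType) n (th : R) (Phi : 'rV[R]_n -> R) : 0 <= th -> smooth Phi -> bsupp Phi ->
  exists2 C : R, 0 < C & forall del t lam, 0 <= del -> 0 < t -> 0 < lam -> t * lam <= 1 -> good th C Phi del t lam.
Proof.
move=> th0 sP bP; have [C C0 hC] := crude_piece sP bP.
exists C => // del t lam d0 t0 l0 T1.
have [h1 h2] := hC del t lam t d0 l0 t0 (fun xi _ => msym_le_t d0 t0 (enorm_ge0 xi)).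
exists (C * t * lam ^+ n), (C * t); split => //; rewrite ?mulr_gt0 ?exprn_gt0//.
rewrite powR_split ?mulr_gt0// powRDp// powRr1 ?(ltW t0)// mulrA; apply: ler_wpM2l.
  by rewrite mulr_ge0 ?ltW.
by apply: powR_le_pos => //; rewrite mulr_ge0.
Qed.

(** [n th <= 2] is used in the damped regime and [(n + 1) th <= 2] in the dispersive one; in both,
    the surplus power of [lam] is nonpositive and [t lam >= 1] converts it into a power of [t]. *)
Lemma good_phi (R : realType) n (th : R) (phi : 'rV[R]_n -> R) : LP_admissible phi -> (0 < n)%N ->
  0 <= th -> n%:R * th <= 2 -> (n%:R + 1) * th <= 2 ->
  exists2 C : R, 0 < C & forall del t lam, 0 <= del -> 0 < t -> 0 < lam -> good th C phi del t lam.
Proof.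
move=> adm n0 th0 nth nth1.
have sphi := smooth_phi adm; have bphi := bsupp_phi adm.
have [C1 C10 h1] := good_low th0 sphi bphi.
have [Cc Cc0 hc] := crude_piece sphi bphi.
have [Cd Cd0 hd] := @msym_damped R.
have [C3 C30 h3] := dispersive_piece adm n0.
have gm C C' del t lam : 0 < t -> C <= C' -> good th C phi del t lam -> good th C' phi del t lam.
  move=> t0 CC [A [B [A0 B0 hA hB hAB]]]; exists A, B; split => //.
  by apply: (le_trans hAB); apply: ler_wpM2r => //; exact: powR_ge0.
exists (C1 + Cc * Cd + C3); first by rewrite !addr_gt0// mulr_gt0.
move=> del t lam d0 t0 l0.
have cd : 0 < Cc * Cd by rewrite mulr_gt0.
have [T1|T1] := leP (t * lam) 1; first by apply: (gm C1) => //; [lra|exact: h1].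
have Tp : 0 < t * lam by exact: mulr_gt0.
have [D8|D8] := leP 8^-1 (del * lam).
  apply: (gm (Cc * Cd)) => //; first lra.
  pose s := lam^-1 * (Cd / (t * lam)).
  have s0 : 0 < s by rewrite mulr_gt0 ?invr_gt0// divr_gt0.
  have [|b1 b2] := hc del t lam s d0 l0 s0.
    move=> xi h; rewrite (@msym_scale _ _ _ _ lam)// ?enorm_ge0// normrM gtr0_norm ?invr_gt0//.
    apply: ler_wpM2l; first by rewrite invr_ge0 ltW.
    apply: hd => //; move: h => /(phi_supp adm); rewrite enormZ gtr0_norm ?invr_gt0// mulrC => /andP[a1 a2].
    by rewrite !ltW.
  have cs : 0 < Cc * s by exact: mulr_gt0.
  exists (Cc * s * lam ^+ n), (Cc * s); split => //; first by rewrite mulr_gt0 ?exprn_gt0.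
  rewrite (powR_split _ _ cs l0) /s.
  (* The symbol has size [1 / (t lam^2)] here, so interpolation gives [t^-1 lam^(n th - 2)]. *)
  have -> : Cc * (lam^-1 * (Cd / (t * lam))) * lam `^ (n%:R * th) = Cc * Cd * t^-1 * lam `^ (n%:R * th - 2).
    rewrite powRDp// powRN powR_mulrn ?(ltW l0)//; field; by rewrite !gt_eqF.
  have -> : 1 - n%:R * th = (-1) + (- (n%:R * th - 2)) by ring.
  rewrite (powRDp _ (- (n%:R * th - 2)) t0) powR_inv1 ?(ltW t0)// mulrA; apply: ler_wpM2l.
    by rewrite mulr_ge0 ?invr_ge0 ?(ltW t0) ?(ltW cd).
  by apply: powR_le_neg => //; [exact: ltW|lra].
apply: (gm C3) => //; first lra.
have sd : small (del * lam) by rewrite /small mulr_ge0 ?(ltW l0)//= ltW.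
have [b1 b2] := h3 del t lam d0 t0 l0 (ltW T1) sd.
have sT : 0 < Num.sqrt (t * lam) by rewrite sqrtr_gt0.
exists (C3 * lam ^+ n.-1 * Num.sqrt (t * lam) ^- n.-1), (C3 * lam^-1); split => //.
- by rewrite !mulr_gt0 ?invr_gt0 ?exprn_gt0.
- by rewrite mulr_gt0 ?invr_gt0.
have nE : n.-1%:R = n%:R - 1 :> R by rewrite -subn1 natrB.
pose k : R := n.-1%:R.
have E1 : lam ^+ n.-1 = lam `^ k by rewrite /k powR_mulrn// ltW.
have E2 : Num.sqrt (t * lam) ^- n.-1 = (t * lam) `^ (- (k / 2)).
  have -> : k / 2 = 2^-1 * n.-1%:R by rewrite mulrC.
  by rewrite powRN powRrM powR12_sqrt ?(ltW Tp)// powR_mulrn// sqrtr_ge0.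
have E3 : lam^-1 = lam `^ (-1) by rewrite powR_inv1// ltW.
have L0 x : 0 <= lam `^ x by exact: powR_ge0.
rewrite E1 E2 E3 !powRM ?mulr_ge0 ?powR_ge0 ?(ltW C30) ?(ltW t0) ?(ltW l0)// -!powRrM.
have -> : C3 `^ th * lam `^ (k * th) * (t `^ (- (k / 2) * th) * lam `^ (- (k / 2) * th)) *
     (C3 `^ (1 - th) * lam `^ (-1 * (1 - th))) =
   (C3 `^ th * C3 `^ (1 - th)) * t `^ (- (k / 2) * th) *
   (lam `^ (k * th) * lam `^ (- (k / 2) * th) * lam `^ (-1 * (1 - th))) by ring.
rewrite -!powRDp// (_ : th + (1 - th) = 1) ?powRr1 ?(ltW C30)//; last by ring.
rewrite -mulrA; apply: ler_wpM2l; first exact: ltW.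
(* [e] is the total power of [lam]. It equals [((n + 1) th - 2) / 2], and this is where the lower
   bound on [p] is used in full. *)
set e := k * th + - (k / 2) * th + -1 * (1 - th).
have -> : 1 - n%:R * th = - (k / 2) * th + - e by rewrite /e /k nE; field.
rewrite (powRDp (- (k / 2) * th) (- e) t0); apply: ler_wpM2l; first exact: powR_ge0.
apply: powR_le_neg => //; first exact: ltW.
have -> : e = ((n%:R + 1) * th - 2) / 2 by rewrite /e /k nE; field.
by lra.
Qed.

(** * Multipliers on tempered distributions *)

Section Repr.
Variables (R : realType) (n : nat).
Notation pt := 'rV[R]_n.
Notation rt := (@row_of_tuple R n).
Notation tup := (n.-tuple R).
Implicit Types (h m : pt -> R) (M f g : pt -> R[i]) (w v : distr R n).
Let s1 : 1 ^+ 2 = 1 :> R := expr1n R 2.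
Let sN1 : (-1) ^+ 2 = 1 :> R. Proof. by rewrite sqrrN expr1n. Qed.

Lemma Ccs_Fr M s f : Ccs M -> rapid f -> Ccs (fun xi => M xi * Fr s f xi).
Proof.
move=> cM rf; have -> : (fun xi => M xi * Fr s f xi) = (fun xi => Fr s f xi * M xi).
  by apply/funext => xi; rewrite mulrC.
exact: CcsM (Fr_smooth s rf) cM.
Qed.
Lemma schwartz_Fr M f : Ccs M -> rapid f -> schwartz (Fr (-1) (fun xi => M xi * Fr 1 f xi)).
Proof. by move=> cM rf; apply: (Fr_schwartz sN1); exact: Ccs_Fr. Qed.

Lemma fmult_E h w f : Ccs (fun xi => rc (h xi)) -> schwartz f ->
  fmult h w f = w (Fr (-1) (fun xi => rc (h xi) * Fr 1 f xi)).
Proof.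
move=> ch sf; have rf := schwartz_rapid sf.
by rewrite /fmult IFTE ?FTE//; [exact: rapid_iC (Ccs_rapid (Ccs_Fr 1 ch rf))|exact: rapid_iC].
Qed.

(** The test function is localised by [h] before [m] acts, so every transform taken is that of a
    compactly supported smooth function, although [m] itself has no bounded support. *)
Lemma fmult_comp h m w f : Ccs (fun xi => rc (h xi)) -> smooth m -> schwartz f ->
  fmult h (fmult m w) f = w (Fr (-1) (fun xi => rc (m xi * h xi) * Fr 1 f xi)).
Proof.
move=> ch sm sf; have rf := schwartz_rapid sf; have cF := Ccs_Fr 1 ch rf.
rewrite fmult_E// /fmult IFTE; last exact: rapid_iC (schwartz_rapid (schwartz_Fr ch rf)).
rewrite (Ccs_inversion s1 cF).
have E : (fun xi => Complex (m xi) 0 * (rc (h xi) * Fr 1 f xi)) = (fun xi => rc (m xi * h xi) * Fr 1 f xi).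
  by apply/funext => xi; rewrite rcM -mulrA.
rewrite E FTE// -E; exact: rapid_iC (Ccs_rapid (CcsM (csmooth_rc sm) cF)).
Qed.

Lemma Ccs_add f g : Ccs f -> Ccs g -> Ccs (fun x => f x + g x).
Proof.
move=> [[f1 f2] [r hr]] [[g1 g2] [r' hr']]; split.
  split; [under eq_fun do rewrite creD|under eq_fun do rewrite cimD]; exact: smooth_add.
exists (Num.max r r') => x i; rewrite gt_max => /andP[h1 h2].
by rewrite (hr x i h1) (hr' x i h2) addr0.
Qed.
Lemma Ccs_zero : Ccs (fun _ : pt => 0 : R[i]).
Proof. by split; [exact: csmooth_cst|exists 0]. Qed.
Lemma Ccs_sum (I : Type) (S : seq I) (F : I -> pt -> R[i]) : (forall i, Ccs (F i)) ->
  Ccs (fun x => \sum_(i <- S) F i x).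
Proof.
move=> cF; elim: S => [|i S IH].
  by under eq_fun do rewrite big_nil; exact: Ccs_zero.
by under eq_fun do rewrite big_cons; exact: Ccs_add.
Qed.

Lemma tempered_sum v (I : Type) (S : seq I) (F : I -> pt -> R[i]) : tempered v -> (forall i, Ccs (F i)) ->
  v (Fr (-1) (fun x => \sum_(i <- S) F i x)) = \sum_(i <- S) v (Fr (-1) (F i)).
Proof.
move=> [lin _] cF; elim: S => [|i S IH].
  rewrite big_nil.
  have -> : Fr (-1) (fun x => \sum_(i <- [::]) F i x) = (fun=> 0).
    apply/funext => xi; rewrite /Fr (_ : (fun x => _) = (fun=> rc 0)).
      by rewrite /cIn cI_rc /Rintegral integral0.
    by apply/funext => x; rewrite big_nil mulr0.
  have sz : schwartz (fun _ : pt => 0 : R[i]).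
    have := Fr_schwartz sN1 Ccs_zero; congr schwartz; apply/funext => xi.
    rewrite /Fr (_ : (fun x => _) = (fun=> rc 0)); last by apply/funext => x; rewrite mulr0.
    by rewrite /cIn cI_rc /Rintegral integral0.
  (* Linearity with coefficient -1 forces [v] to vanish at the zero function. *)
  have := lin (-1) _ _ sz sz; rewrite (_ : (fun x => _) = (fun _ : pt => 0)) ?mulN1r ?addNr//.
rewrite big_cons -IH -[v (Fr (-1) (F i))]mul1r -lin; last 2 first.
- exact: Fr_schwartz.
- by apply: Fr_schwartz => //; exact: Ccs_sum.
congr v; apply/funext => xi; rewrite mul1r /Fr /cIn -cI_add; last 2 first.
- exact: iCn_ph (rapid_iC (Ccs_rapid (cF i))).
- exact: iCn_ph (rapid_iC (Ccs_rapid (Ccs_sum S cF))).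
by congr cI; apply/funext => t; rewrite big_cons mulrDr.
Qed.

(** A representing function of the block [h] of [v] turns a further multiplier [M] into a
    convolution, by transposition. *)
Lemma repr_piece M h v g f : Ccs M -> Ccs (fun xi => rc (h xi)) -> represents (fmult h v) g -> L1w g -> schwartz f ->
  iCn (fun x => convol M g x * f x) /\
  v (Fr (-1) (fun xi => rc (h xi) * (M xi * Fr 1 f xi))) = cIn (fun x => convol M g x * f x).
Proof.
move=> cM ch [m1 [m2 rep]] wg sf; have rf := schwartz_rapid sf.
have mg : mCn g by split.
have [i1 E1] := conv_pair cM mg wg rf; split => //.
have sp := schwartz_Fr cM rf.
have := rep _ sp; rewrite fmult_E// (Ccs_inversion s1 (Ccs_Fr 1 cM rf)) => ->.
rewrite cintE ?E1//.
have [C C0 hC] := rapid_Pk (schwartz_rapid sp).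
apply: (@iC_domC _ _ _ _ _ (fun t : tup => rc C * (rc (Pk 1 0 (rt t)) * g (rt t)))).
- by apply: mCM; [exact: mg|exact: iC_mC (rapid_iC (schwartz_rapid sp))].
- exact: iCZ.
- move=> t; rewrite !cabsM !cabs_real !ger0_norm ?Pk_ge0// mulrA mulrC.
  by apply: ler_wpM2r; [exact: cabs_ge0|exact: hC].
Qed.

Lemma dnorm_EFin_ge0 (p : R) w : (0 <= dnorm p%:E w)%E.
Proof. by apply: le_ereal_inf_tmp => _ [g _ <-]; rewrite /Lpn poweR_ge0. Qed.

Lemma nb_sum (p : R) (I : Type) (S : seq I) (F : I -> pt -> R[i]) Y : 1 <= p -> p <= 2 -> 0 <= Y ->
  (forall i, mCn (F i)) -> (forall i, nb p (F i) Y) -> nb p (fun x => \sum_(i <- S) F i x) ((size S)%:R * Y).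
Proof.
move=> p1 p2 Y0 mF nF; elim: S => [|i S IH].
  rewrite mul0r (_ : (fun x => _) = (fun=> 0)); last by apply/funext => x; rewrite big_nil.
  rewrite /nb; case: eqP => [_ x|/eqP pn1]; first by rewrite cabs0.
  have pp : 0 < p - 1 by rewrite subr_gt0 lt_neqAle eq_sym pn1.
  have r0 : 0 < p / (p - 1) by rewrite divr_gt0//; lra.
  rewrite Lpn_int; last exact: mC_cst.
  rewrite (_ : (\int[_]_t _)%E = 0%E); first by rewrite poweR0r// invr_neq0// gt_eqF.
  by rewrite (eq_integral (cst 0%E)) ?integral0// => t _; rewrite cabs0 powR0// gt_eqF.
rewrite (_ : (fun x => _) = (fun x => F i x + \sum_(i <- S) F i x)); last first.
  by apply/funext => x; rewrite big_cons.
rewrite -[(size (i :: S))%:R]nat1r mulrDl mul1r; apply: nb_add => //.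
by apply: mC_sum => j; exact: mF.
Qed.

(** Each piece [hs k] is multiplied by a sum of cutoffs [ph_ l] equal to 1 on its support. The
    output is then a finite sum of convolutions of functions representing the blocks of [v]; the
    triangle inequality counts [K] times [size L] of them. *)
Lemma dnorm_mult (p kap : R) (K : nat) (L : seq nat) (hs : nat -> pt -> R) (ph_ : nat -> pt -> R)
    h m v : 1 <= p -> p <= 2 -> 0 < kap -> (0 < K)%N -> (0 < size L)%N -> tempered v ->
  Ccs (fun xi => rc (h xi)) -> smooth m ->
  (forall k, Ccs (fun xi => rc (hs k xi))) -> (forall l, Ccs (fun xi => rc (ph_ l xi))) ->
  (forall xi, m xi * h xi = \sum_(k < K) hs k xi) ->
  (forall k xi, hs k xi * (\sum_(l <- L) ph_ l xi) = hs k xi) ->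
  (forall k g N, mCn g -> 0 < N -> (Lpn p%:E g <= N%:E)%E ->
     L1w g /\ nb p (convol (fun xi => rc (hs k xi)) g) (kap * N)) ->
  (dnorm (pconj p) (fmult h (fmult m v)) <=
    (K%:R * (size L)%:R * kap)%:E * \sum_(l <- L) dnorm p%:E (fmult (ph_ l) v))%E.
Proof.
move=> p1 p2 k0 K0 L0 tv ch sm chs cph dec loc bd.
set c := K%:R * (size L)%:R * kap.
have c0 : 0 < c by rewrite !mulr_gt0// ltr0n.
set D := (\sum_(l <- L) _)%E.
have D0 : (0 <= D)%E by apply: sume_ge0 => l _; exact: dnorm_EFin_ge0.
have [Doo|Dfin] := eqVneq D +oo%E.
  by rewrite Doo gt0_muley ?leey// lte_fin.
have Df : D \is a fin_num by rewrite ge0_fin_numE// ltey.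
apply/lee_addgt0Pr => eps e0.
(* The infimum in [dnorm] may not be attained. [N] exceeds every block norm, and the excess costs
   [eps] in total after multiplication by [c]. *)
pose N := fine D + eps / c.
have ec : 0 < eps / c by rewrite divr_gt0.
have N0 : 0 < N by rewrite ltr_wpDl// fine_ge0.
have DN : (D < N%:E)%E by rewrite -[D]fineK// lte_fin ltrDl.
have /choice[g hg] : forall l, exists g, l \in L -> represents (fmult (ph_ l) v) g /\ (Lpn p%:E g <= N%:E)%E.
  move=> l; have [lL|lL] := boolP (l \in L); last by exists (fun=> 0).
  have dl : (dnorm p%:E (fmult (ph_ l) v) < N%:E)%E.
    apply: le_lt_trans DN; rewrite /D (big_rem l)//= leeDl//; apply: sume_ge0 => i _; exact: dnorm_EFin_ge0.
  by have [_ [g rg <-] hlt] := ereal_inf_lt dl; exists g => _; split => //; exact: ltW.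
have mg l : l \in L -> mCn (g l) by move=> /hg[[? [? _]] _]; split.
(* Zero for indices outside [L], so that measurability and the norm bound hold for every [l]. *)
pose G0 l : pt -> R[i] := if l \in L then g l else fun=> 0.
have mG0 l : mCn (G0 l) by rewrite /G0; case: ifP => [/mg//|_]; exact: mC_cst.
have LG0 l : (Lpn p%:E (G0 l) <= N%:E)%E.
  rewrite /G0; case: ifP => [/hg[]//|_].
  rewrite Lpn_int; last exact: mC_cst.
  have pp : 0 < p by lra.
  rewrite (_ : (\int[_]_t _)%E = 0%E); last first.
    by rewrite (eq_integral (cst 0%E)) ?integral0// => t _; rewrite cabs0 powR0// gt_eqF.
  by rewrite poweR0r ?invr_neq0 ?gt_eqF// lee_fin ltW.
pose G (x : pt) := \sum_(k <- enum 'I_K) \sum_(l <- L) convol (fun xi => rc (hs k xi)) (G0 l) x.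
have mc k l : mCn (convol (fun xi => rc (hs k xi)) (G0 l)) by apply: mCn_conv.
have nG : nb p G (c * N).
  rewrite /c -!mulrA -[K in K%:R](size_enum_ord K).
  apply: nb_sum => //; first by rewrite !mulr_ge0// ltW.
    by move=> k; apply: mC_sum => l; exact: mc.
  move=> k; apply: nb_sum => //; first by rewrite mulr_ge0// ltW.
  by move=> l; have [] := bd k _ N (mG0 l) N0 (LG0 l).
have mG : mCn G by apply: mC_sum => k; apply: mC_sum => l; exact: mc.
apply: (@le_trans _ _ (c * N)%:E); last first.
  rewrite -[in leRHS](fineK Df) -EFinM -EFinD lee_fin /N mulrDr lerD2l mulrCA mulfV ?mulr1// gt_eqF//.
apply: le_trans (nb_Lpn nG); apply: ereal_inf_lbound; exists G => //.
split; first by case: mG.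
split; first by case: mG.
move=> f sf; have rf := schwartz_rapid sf.
rewrite fmult_comp//.
have E1 : (fun xi => rc (m xi * h xi) * Fr 1 f xi) = (fun xi => \sum_(k <- enum 'I_K) \sum_(l <- L)
    rc (ph_ l xi) * (rc (hs k xi) * Fr 1 f xi)).
  apply/funext => xi; rewrite dec; under eq_bigr do rewrite -(loc _ xi).
  rewrite big_enum /=.
  have rcs (I : Type) (S : seq I) (F : I -> R) : rc (\sum_(i <- S) F i) = \sum_(i <- S) rc (F i).
    by elim: S => [|i S IH]; rewrite ?big_nil// !big_cons rcD IH.
  rewrite rcs mulr_suml; apply: eq_bigr => k _.
  rewrite rcM rcs mulr_sumr mulr_suml; apply: eq_bigr => l _; ring.
have cc k l : Ccs (fun xi => rc (ph_ l xi) * (rc (hs k xi) * Fr 1 f xi)).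
  have [sl _] := cph l; exact: CcsM sl (Ccs_Fr 1 (chs k) rf).
have il k l : l \in L -> iCn (fun x => convol (fun xi => rc (hs k xi)) (G0 l) x * f x) /\
   v (Fr (-1) (fun xi => rc (ph_ l xi) * (rc (hs k xi) * Fr 1 f xi))) =
   cIn (fun x => convol (fun xi => rc (hs k xi)) (G0 l) x * f x).
  move=> lL; have [rg lg] := hg l lL; rewrite /G0 lL.
  apply: repr_piece => //; have [wg _] := bd k _ N (mg l lL) N0 lg; exact: wg.
rewrite E1 tempered_sum//; last by move=> k; exact: Ccs_sum.
under eq_bigr do rewrite tempered_sum//.
have il' k l : iCn (fun x => (if l \in L then convol (fun xi => rc (hs k xi)) (G0 l) x else 0) * f x).
  have [lL|lL] := boolP (l \in L); first by have [] := il k l lL.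
  by rewrite /iCn; under eq_fun do rewrite mul0r; by split; exact: integrable0.
pose H (k : 'I_K) (l : nat) (t : tup) := (if l \in L then convol (fun xi => rc (hs k xi)) (G0 l) (rt t) else 0) * f (rt t).
have [j1 j2] := cI_sum (mu := mu R n) (enum 'I_K) (fun k => (cI_sum (mu := mu R n) L (il' k)).1).
have EG : (fun t : tup => G (rt t) * f (rt t)) = (fun t : tup => \sum_(k <- enum 'I_K) \sum_(l <- L) H k l t).
  apply/funext => t; rewrite /G mulr_suml; apply: eq_bigr => k _.
  by rewrite mulr_suml big_seq [RHS]big_seq; apply: eq_bigr => l lL; rewrite /H lL.
rewrite cintE; last by rewrite /iCn EG.
rewrite /cIn EG j2; apply: eq_bigr => k _.
have [_ ->] := cI_sum (mu := mu R n) L (il' k).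
rewrite big_seq [RHS]big_seq; apply: eq_bigr => l lL.
have [_ ->] := il k l lL; rewrite /cIn; congr cI; apply/funext => t; by rewrite lL.
Qed.
End Repr.

(** * Summation over the dyadic pieces *)

Lemma max_pow_ge1 (R : realType) (t sigma : R) : 0 < t -> 0 < sigma ->
  1 <= Num.max (t `^ sigma) (t `^ (- sigma)).
Proof.
move=> t0 s0; rewrite le_max; have [t1|t1] := leP 1 t.
  by rewrite -{1}(powRr0 t) ler_powR// ltW.
rewrite orbC powRN -[leLHS]invr1 lef_pV2 ?posrE ?powR_gt0//.
have : t `^ sigma <= 1 `^ sigma by apply: ge0_ler_powR; rewrite ?nnegrE ?ltW.
by rewrite powR1 => ->.
Qed.

(** The logarithm is absorbed through [1 + sigma ln t <= t^sigma]; for [t <= 1] the choice [K = 0]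
    suffices. *)
Lemma dyadic_count (R : realType) (sigma : R) : 0 < sigma -> exists2 C : R, 1 <= C &
  forall t : R, 0 < t -> exists2 K : nat, t <= 2 ^+ K &
    K.+1%:R <= C * Num.max (t `^ sigma) (t `^ (- sigma)).
Proof.
move=> s0; have l2 : 0 < ln 2 :> R by rewrite ln_gt0// ltr1n.
pose C : R := (sigma * ln 2)^-1 + 2.
have q0 : 0 < (sigma * ln 2)^-1 by rewrite invr_gt0 mulr_gt0.
exists C; first by rewrite /C; lra.
move=> t t0; have m1 := max_pow_ge1 t0 s0.
have [t1|t1] := leP t 1.
  exists 0%N; first by rewrite expr0.
  by apply: (le_trans m1); rewrite ler_peMl// ?(le_trans ler01 m1)// /C; lra.
have lt0 : 0 < ln t by rewrite ln_gt0.
exists (Num.truncn (ln t / ln 2)).+1.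
  have h := truncnS_gt (ln t / ln 2); move: h; set K := (Num.truncn _).+1 => h.
  rewrite -(powR_mulrn K (ler0n R 2)) -[t in t <= _]lnK ?posrE// -[leRHS]lnK ?posrE ?powR_gt0//.
  by rewrite ler_expR ln_powR -ler_pdivrMr// ltW.
have x0 : 0 <= ln t / ln 2 by rewrite divr_ge0 ?ltW.
have h : (Num.truncn (ln t / ln 2))%:R <= ln t / ln 2 by have /andP[] := truncn_itv x0.
have ts : 1 + sigma * ln t <= t `^ sigma.
  by rewrite /powR gt_eqF// expR_ge1Dx.
have lts : ln t / ln 2 <= (sigma * ln 2)^-1 * t `^ sigma.
  have -> : ln t / ln 2 = (sigma * ln 2)^-1 * (sigma * ln t) by field; rewrite !gt_eqF.
  by apply: ler_wpM2l; [exact: ltW|lra].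
apply: (@le_trans _ _ (C * t `^ sigma)); last first.
  by apply: ler_wpM2l; [rewrite /C; lra|rewrite le_max lexx].
have t1s : 1 <= t `^ sigma by have := mulr_ge0 (ltW s0) (ltW lt0); lra.
rewrite -[_.+2%:R]natr1 -[_.+1%:R]natr1 /C mulrDl; lra.
Qed.

Lemma sum_le_max (R : realType) (L : seq nat) (D : nat -> \bar R) : (forall l, 0 <= D l)%E -> (0 < size L)%N ->
  exists2 l, l \in L & (\sum_(l <- L) D l <= (size L)%:R%:E * D l)%E.
Proof.
move=> D0; elim: L => [//|a L IH] _.
case: L IH => [_|b L /(_ isT)[l lL hl]].
  by exists a; rewrite ?mem_head// big_cons big_nil adde0 mul1e.
have [h|h] := leP (D a) (D l).
  exists l; first by rewrite inE lL orbT.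
  rewrite big_cons -[(size (a :: _))%:R]nat1r EFinD ge0_muleDl ?lee_fin//.
  by rewrite mul1e leeD.
exists a; first exact: mem_head.
rewrite big_cons -[(size (a :: _))%:R]nat1r EFinD ge0_muleDl ?lee_fin//.
rewrite mul1e; apply: leeD2l; apply: (le_trans hl); apply: lee_wpmul2l; last exact: ltW.
by rewrite lee_fin ler0n.
Qed.

(** * Besov sums of blocks controlled by their neighbours *)

Section Besov.
Variables (R : realType) (sigma q c : R) (D E : nat -> \bar R).
Hypotheses (s0 : 0 < sigma) (q1 : 1 <= q) (c0 : 0 < c).
Hypotheses (D0 : forall l, (0 <= D l)%E) (E0 : forall l, (0 <= E l)%E).
Hypothesis ED : forall j, (E j <= c%:E * \sum_(l <- nbr j) D l)%E.

Let F (u : nat -> \bar R) j := ((2 `^ (j%:R * sigma * q))%:E * u j `^ q)%E.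
Let q0 : 0 < q := lt_le_trans ltr01 q1.

(** The sum over neighbours is at most 3 times its largest term, say at [l]; since [j <= l + 1],
    exchanging the weights costs [2^sigma]. *)
Lemma besov_term j : (F E j <= ((3 * c * 2 `^ sigma) `^ q)%:E * \sum_(l <- nbr j) F D l)%E.
Proof.
have F0 l : (0 <= F D l)%E by rewrite /F mule_ge0// ?lee_fin ?powR_ge0// poweR_ge0.
have sz : (0 < size (nbr j))%N by case: (j).
have [l lL hl] := sum_le_max D0 sz.
have jl : (j <= l.+1)%N.
  case: (j) lL => [//|k]; rewrite /nbr !inE => /or3P[] /eqP -> //.
  by rewrite ltnW.
have sz3 : ((size (nbr j))%:R <= 3 :> R) by case: (j) => [|k] /=; rewrite ler_nat.
have h : (E j <= (3 * c)%:E * D l)%E.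
  apply: (le_trans (ED j)).
  apply: (@le_trans _ _ (c%:E * ((size (nbr j))%:R%:E * D l))%E).
    by apply: lee_wpmul2l => //; rewrite lee_fin ltW.
  rewrite muleA -EFinM; apply: lee_wpmul2r => //; rewrite lee_fin mulrC.
  by apply: ler_wpM2r => //; exact: ltW.
have c3 : 0 <= 3 * c by rewrite mulr_ge0// ltW.
apply: (@le_trans _ _ (((3 * c * 2 `^ sigma) `^ q)%:E * F D l)%E); last first.
  apply: lee_wpmul2l; first by rewrite lee_fin powR_ge0.
  by rewrite (big_rem l)//= leeDl//; apply: sume_ge0.
rewrite /F.
apply: (@le_trans _ _ ((2 `^ (j%:R * sigma * q))%:E * (((3 * c)%:E * D l) `^ q))%E).
  apply: lee_wpmul2l; first by rewrite lee_fin powR_ge0.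
  apply: gt0_ler_poweR; rewrite ?(ltW q0)// in_itv/= leey andbT//.
  by rewrite mule_ge0// lee_fin.
rewrite poweRM ?lee_fin// poweR_EFin !muleA; apply: lee_wpmul2r; first exact: poweR_ge0.
rewrite -!EFinM lee_fin [X in _ <= X * _]powRM ?powR_ge0// [leLHS]mulrC -[leRHS]mulrA; apply: ler_wpM2l; first exact: powR_ge0.
rewrite -powRrM -powRD; last by rewrite pnatr_eq0 implybT.
apply: ler_powR; first by rewrite ler1n.
rewrite -mulrDl; apply: ler_wpM2r; first exact: ltW.
have -> : sigma + l%:R * sigma = l.+1%:R * sigma by rewrite -natr1; ring.
by apply: ler_wpM2r; [exact: ltW|rewrite ler_nat].
Qed.

(** Origin of the 4: the shift [j.-1] takes the value 0 twice and its sum is bounded by twice the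
    total, the other two shifts by the total each. As [q >= 1], [4^(1/q) <= 4]. *)
Lemma besov_sum : ((\sum_(0 <= j <oo) F E j) `^ q^-1 <=
  (4 * (3 * c * 2 `^ sigma))%:E * (\sum_(0 <= j <oo) F D j) `^ q^-1)%E.
Proof.
have F0 l : (0 <= F D l)%E by rewrite /F mule_ge0// ?lee_fin ?powR_ge0// poweR_ge0.
have FE0 l : (0 <= F E l)%E by rewrite /F mule_ge0// ?lee_fin ?powR_ge0// poweR_ge0.
set T := (\sum_(0 <= j <oo) F D j)%E.
have part N : (\sum_(0 <= j < N) F D j <= T)%E by exact: nneseries_lim_ge.
have T0 : (0 <= T)%E by have := part 0%N; rewrite big_geq.
set a := (3 * c * 2 `^ sigma) `^ q.
have a0 : 0 <= a by exact: powR_ge0.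
have bd : (\sum_(0 <= j <oo) F E j <= (4 * a)%:E * T)%E.
  apply: lime_le; first by apply: is_cvg_nneseries => *; exact: FE0.
  apply: nearW => N.
  apply: (@le_trans _ _ (\sum_(0 <= j < N) a%:E * (\sum_(l <- nbr j) F D l))%E).
    by apply: lee_sum => j _; exact: besov_term.
  rewrite -ge0_sume_distrr; last by move=> j _; exact: sume_ge0.
  rewrite (mulrC 4) EFinM -muleA; apply: lee_wpmul2l; first by rewrite lee_fin.
  apply: (@le_trans _ _ (\sum_(0 <= j < N) (F D j.-1 + (F D j + F D j.+1)))%E).
    apply: lee_sum => -[|j] _; rewrite /nbr !big_cons big_nil adde0//.
    by rewrite leeDr.
  rewrite !big_split /=.
  have sh : (\sum_(0 <= j < N) F D j.+1 <= T)%E.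
    apply: le_trans (part N.+1); rewrite big_nat_recl//= leeDr//.
  have sh' : (\sum_(0 <= j < N) F D j.-1 <= T + T)%E.
    case: N {sh} => [|N]; first by rewrite big_geq// adde_ge0.
    rewrite big_nat_recl//=; apply: leeD; last exact: part.
    by have := part 1%N; rewrite big_nat1.
  have -> : (4%:E * T = (T + T) + (T + T))%E.
    have -> : 4 = 1 + 1 + (1 + 1) :> R by ring.
    by rewrite !EFinD !ge0_muleDl ?mul1e ?adde_ge0// lee_fin.
  by apply: leeD => //; apply: leeD.
have qi : 0 <= q^-1 by rewrite invr_ge0 ltW.
apply: (@le_trans _ _ (((4 * a)%:E * T) `^ q^-1)%E).
  apply: gt0_ler_poweR => //; rewrite in_itv/= leey andbT.
  - by apply: nneseries_ge0 => *; exact: FE0.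
  - by rewrite mule_ge0// lee_fin mulr_ge0.
rewrite poweRM ?lee_fin ?mulr_ge0// poweR_EFin; apply: lee_wpmul2r; first exact: poweR_ge0.
have b0 : 0 <= 3 * c * 2 `^ sigma by rewrite !mulr_ge0 ?powR_ge0 ?(ltW c0).
rewrite lee_fin powRM// /a -powRrM mulfV ?gt_eqF// powRr1//; apply: ler_wpM2r => //.
rewrite -[leRHS]powRr1//; apply: ler_powR; first by rewrite ler1n.
by rewrite invf_le1.
Qed.
End Besov.

Lemma iint_cst_gt0 (R : realType) (m : nat) (c : \bar R) : (0 < c)%E -> (0 < iint (fun _ : m.-tuple R => c))%E.
Proof.
move=> c0; elim: m => [//|m IH] /=.
rewrite (integral_cst (@lebesgue_measure R) measurableT).
have T : (lebesgue_measure [set: R] = +oo)%E.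
  by rewrite -(set_itvNyy R) lebesgue_measure_itv.
by apply: mule_gt0 => //; move: T => /= ->.
Qed.

(** For [p = 1] the thresholds in the essential supremum range over all reals; negative ones are
    excluded because R^n has positive measure. *)
Lemma dnorm_pconj_ge0 (R : realType) (n : nat) (p : R) (w : distr R n) : (0 <= dnorm (pconj p) w)%E.
Proof.
apply: le_ereal_inf_tmp => _ [g _ <-]; rewrite /pconj; case: ifP => _ /=; last exact: poweR_ge0.
apply: le_ereal_inf_tmp => _ [M /= hM <-]; rewrite lee_fin leNgt; apply/negP => M0.
have T : [set x | M < cabs (g x)] = [set: 'rV[R]_n].
  by apply/seteqP; split => // x _ /=; rewrite (lt_le_trans M0)// sqrtr_ge0.
have := @iint_cst_gt0 R n 1%E lte01.
have <- : meas_n [set x | M < cabs (g x)] = iint (fun _ : n.-tuple R => 1%E).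
  by rewrite T /meas_n /intRn; congr iint; apply/funext => x; rewrite indicT.
by rewrite hM ltxx.
Qed.

Theorem theorem2 (R : realType) (n : nat) (p q sigma : R) (phi : 'rV[R]_n -> R) :
  (0 < n)%N ->
  (2 * n%:R + 2) / (n%:R + 3) <= p <= 2 ->
  1 <= q ->
  0 < sigma ->
  LP_admissible phi ->
  exists C : R, 0 < C /\
    forall delta t : R, 0 <= delta -> 0 < t ->
    forall v : distr R n, tempered v ->
      (besov phi sigma p%:E q v < +oo)%E ->
      (besov phi sigma (pconj p) q (Top delta t v) <=
        (C * powR t (1 - 2 * n%:R * (p^-1 - 2^-1)) *
           Num.max (powR t sigma) (powR t (- sigma)))%:E
        * besov phi sigma p%:E q v)%E.
Proof.
move=> n0 /andP[pn p2] q1 s0 adm.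
have n1 : 1 <= n%:R :> R by rewrite ler1n.
have p1 : 1 <= p.
  apply: le_trans pn; rewrite ler_pdivlMr; [lra|by rewrite ltr_wpDl].
have p0 : 0 < p by exact: lt_le_trans ltr01 p1.
(* In terms of [th] the lower bound on [p] reads [(n + 1) th <= 2], and the power of [t] in the
   claim is [1 - n th]. *)
pose th : R := 2 / p - 1.
have th0 : 0 <= th by rewrite /th subr_ge0 ler_pdivlMr// mul1r.
have pth : p * (1 + th) = 2 by rewrite /th; field; rewrite gt_eqF.
have nth1 : (n%:R + 1) * th <= 2.
  have h : 2 * n%:R + 2 <= p * (n%:R + 3) by move: pn; rewrite ler_pdivrMr// ltr_wpDl.
  have h2 : (n%:R + 1) * (1 + th) <= n%:R + 3.
    by rewrite -(ler_pM2l p0) mulrCA pth; lra.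
  lra.
have nth : n%:R * th <= 2 by lra.
have [Cp Cp0 hCp] := @convol_Lp R n p p1 p2.
have [Cg Cg0 hCg] := good_phi adm n0 th0 nth nth1.
have [Cl Cl0 hCl] := good_low th0 (smooth_phi0 adm) (bsupp_phi0 adm).
have [Ck Ck1 hCk] := dyadic_count s0.
have Ck0 : 0 < Ck by exact: lt_le_trans ltr01 Ck1.
(* 3 bounds the number of neighbours, [Ck] the count of low-frequency pieces relative to the
   maximum, [Cp] is the interpolation constant and [Cg + Cl] bounds the pieces. *)
pose C0 := 3 * Ck * (Cp * (Cg + Cl)).
have cc : 0 < Cg + Cl by rewrite addr_gt0.
have C00 : 0 < C0 by rewrite !mulr_gt0.
exists (4 * (3 * 2 `^ sigma) * C0); split; first by rewrite !mulr_gt0 ?powR_gt0.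
move=> del t d0 t0 v tv _.
have -> : 1 - 2 * n%:R * (p^-1 - 2^-1) = 1 - n%:R * th by rewrite /th; field; rewrite gt_eqF.
set tp := t `^ _; set mx := Num.max _ _.
have tp0 : 0 < tp by exact: powR_gt0.
have mx1 : 1 <= mx by exact: max_pow_ge1.
have mx0 : 0 < mx by exact: lt_le_trans ltr01 mx1.
pose kap := Cp * (Cg + Cl) * tp.
have k0 : 0 < kap by rewrite !mulr_gt0.
have cl l : Ccs (fun xi => rc (phij phi l xi)).
  split; first by apply: csmooth_rc; exact: smooth_phij.
  by have [r hr] := bsupp_phij adm l; exists r => x i hx; rewrite (hr x i hx).
pose m (xi : 'rV[R]_n) := msym del t (enorm xi).
have sm : smooth m := @smooth_msym R n del t d0.
have conv_good (Phi : 'rV[R]_n -> R) lam Cx : smooth Phi -> bsupp Phi -> 0 < lam -> Cx <= Cg + Cl -> good th Cx Phi del t lam ->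
    forall g N, mCn g -> 0 < N -> (Lpn p%:E g <= N%:E)%E ->
    L1w g /\ nb p (convol (Mp Phi del t lam) g) (kap * N).
  move=> sP bP l0 hx [A [B [A0 B0 hA hB hAB]]] g N mg N0 hN.
  have [wg ng] := hCp _ A B (Ccs_Mp t sP bP d0 l0) A0 B0 hA hB g N mg N0 hN; split => //.
  apply: nb_le ng _; apply: ler_wpM2r; first exact: ltW.
  have -> : 2 - 2 / p = 1 - th by rewrite /th; ring.
  rewrite -mulrA /kap -mulrA; apply: ler_wpM2l; first exact: ltW.
  by apply: (le_trans hAB); apply: ler_wpM2r => //; exact: ltW.
have out j : (dnorm (pconj p) (fmult (phij phi j) (Top del t v)) <=
    (C0 * tp * mx)%:E * \sum_(l <- nbr j) dnorm p%:E (fmult (phij phi l) v))%E.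
  have Dn0 : (0 <= \sum_(l <- nbr j) dnorm p%:E (fmult (phij phi l) v))%E.
    by apply: sume_ge0 => l _; exact: dnorm_EFin_ge0.
  case: j Dn0 => [|j] Dn0.
    (* The low block is cut at the scales [2^-k] with [k < K], leaving [phi0] at scale [2^-K]. As
       [t <= 2^K], [good_low] applies to this remainder. *)
    have [K tK KC] := hCk t t0.
    pose lam k : R := (2 ^+ k)^-1.
    have lam0 k : 0 < lam k by rewrite invr_gt0 exprn_gt0.
    pose hs k xi := if (k < K)%N then m xi * phi ((lam k)^-1 *: xi) else m xi * phi0 phi ((lam K)^-1 *: xi).
    have cM k : Ccs (fun xi => rc (hs k xi)).
      rewrite /hs; case: (k < K)%N.
        exact: (Ccs_Mp t (smooth_phi adm) (bsupp_phi adm) d0 (lam0 k)).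
      exact: (Ccs_Mp t (smooth_phi0 adm) (bsupp_phi0 adm) d0 (lam0 K)).
    have dec xi : m xi * phij phi 0 xi = \sum_(k < K.+1) hs k xi.
      rewrite /= (phi0_dyadic adm K) big_ord_recr/= {2}/hs ltnn /lam invrK addrC mulrDr mulr_sumr; congr (_ + _).
      by apply: eq_bigr => k _; rewrite /hs ltn_ord /lam invrK.
    have big_lam (k : nat) (xi : 'rV[R]_n) : 2 < enorm xi -> 2 <= enorm ((lam k)^-1 *: xi).
      move=> h; rewrite /lam invrK enormZ ger0_norm ?exprn_ge0// (le_trans (ltW h))// ler_peMl ?enorm_ge0//.
      by apply: exprn_ege1; rewrite ler1n.
    have loc k xi : hs k xi * (\sum_(l <- nbr 0) phij phi l xi) = hs k xi.
      have [h|h] := leP (enorm xi) 2; first by rewrite (nbr_sum0 adm h) mulr1.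
      rewrite /hs; case: ifP => _.
        by rewrite (phi_large adm (big_lam k xi h)) mulr0 mul0r.
      by rewrite (phi0_large adm (big_lam K xi h)) mulr0 mul0r.
    have bd k g N : mCn g -> 0 < N -> (Lpn p%:E g <= N%:E)%E ->
        L1w g /\ nb p (convol (fun xi => rc (hs k xi)) g) (kap * N).
      rewrite /hs; case: (k < K)%N.
        apply: (conv_good phi (lam k) Cg (smooth_phi adm) (bsupp_phi adm) (lam0 k)); first by rewrite lerDl ltW.
        exact: hCg.
      apply: (conv_good (phi0 phi) (lam K) Cl (smooth_phi0 adm) (bsupp_phi0 adm) (lam0 K)); first by rewrite lerDr ltW.
      by apply: hCl => //; rewrite /lam ler_pdivrMr ?exprn_gt0// mul1r.
    apply: (le_trans (dnorm_mult p1 p2 k0 (ltn0Sn K) (isT : (0 < size (nbr 0))%N) tv (cl 0%N) sm cM cl dec loc bd)).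
    apply: lee_wpmul2r => //; rewrite lee_fin /kap /C0.
    have -> : 3 * Ck * (Cp * (Cg + Cl)) * tp * mx = Ck * mx * 3 * (Cp * (Cg + Cl) * tp) by ring.
    apply: ler_wpM2r; first by rewrite !mulr_ge0// ltW.
    by apply: ler_pM => //; rewrite ler_nat.
  have l0 : 0 < (2 ^+ j.+1 : R) by exact: exprn_gt0.
  (* A high block is a single piece with bound [kap]; the factor [Ck * mx >= 1] is then inserted to
     share the constant of the low block. *)
  pose hs (k : nat) xi := m xi * phij phi j.+1 xi.
  have cM k : Ccs (fun xi => rc (hs k xi)).
    exact: (Ccs_Mp t (smooth_phi adm) (bsupp_phi adm) d0 l0).
  have dec xi : m xi * phij phi j.+1 xi = \sum_(k < 1) hs k xi by rewrite big_ord1.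
  have loc k xi : hs k xi * (\sum_(l <- nbr j.+1) phij phi l xi) = hs k xi.
    rewrite /hs; have [->|h] := eqVneq (phij phi j.+1 xi) 0; first by rewrite mulr0 mul0r.
    by rewrite (nbr_sum adm h) mulr1.
  have bd k g N : mCn g -> 0 < N -> (Lpn p%:E g <= N%:E)%E ->
      L1w g /\ nb p (convol (fun xi => rc (hs k xi)) g) (kap * N).
    apply: (conv_good phi (2 ^+ j.+1) Cg (smooth_phi adm) (bsupp_phi adm) l0); first by rewrite lerDl ltW.
    exact: hCg.
  apply: (le_trans (dnorm_mult p1 p2 k0 (isT : (0 < 1)%N) (isT : (0 < size (nbr j.+1))%N) tv (cl j.+1) sm cM cl dec loc bd)).
  apply: lee_wpmul2r => //; rewrite lee_fin /kap /C0 mul1r.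
  have -> : 3 * Ck * (Cp * (Cg + Cl)) * tp * mx = 3 * (Ck * mx) * (Cp * (Cg + Cl) * tp) by ring.
  apply: ler_wpM2r; first by rewrite !mulr_ge0// ltW.
  by rewrite ler_peMr//; apply: mulr_ege1.
have c0 : 0 < C0 * tp * mx by rewrite !mulr_gt0.
have dge0 l : (0 <= dnorm p%:E (fmult (phij phi l) v))%E by exact: dnorm_EFin_ge0.
have oge0 l : (0 <= dnorm (pconj p) (fmult (phij phi l) (Top del t v)))%E by exact: dnorm_pconj_ge0.
rewrite /besov; apply: (le_trans (besov_sum s0 q1 c0 dge0 oge0 out)).
apply: lee_wpmul2r; first exact: poweR_ge0.
rewrite lee_fin le_eqVlt; apply/orP; left; apply/eqP; ring.
Qed.
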